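(* Let $K$ be a stable ternary lattice. Then the class number $h(K)$ equals $$2\,\mathfrak{w}(K)+\sum_{\substack{m\mid \mathfrak{P}\mathfrak{Q},\ \delta\in\{1,2\}\\ \delta \text{ represented by } \mathrm{gen}(\lambda_m(K))}} t_{m,\delta}\cdot 2^{\nu(m)-\nu(\mathfrak{P}\mathfrak{Q})}\cdot\frac{h_E}{\mu_E}+\frac{1}{3}\big(b_{12}(K)+b_{24}(K)\big)+\frac14 b_{16}(K),$$ where the sum is over positive divisors $m$ of $\mathfrak P\mathfrak Q$ and $\delta\in\{1,2\}$ such that $\delta$ is represented by some lattice in $\mathrm{gen}(\lambda_m(K))$, $E=\mathbb{Q}(\sqrt{-\delta\, d(\lambda_m(K))})$, $h_E$ is the class number of $E$ and $\mu_E$ the number of roots of unity in $E$, and $t_{m,\delta}$ is given as follows: if $\delta=1$: $t_{m,1}=3$ if $\lambda_m(K)_2\cong\langle1,1,3\rangle$, $t_{m,1}=1$ if $\lambda_m(K)_2\cong\langle 3,3,3\rangle$, $t_{m,1}=2$ if $\lambda_m(K)_2\cong\langle 1,1,7\rangle$, $t_{m,1}=\frac12$ if $dK\equiv1\pmod 4$; if $\delta=2$: $t_{m,2}=4,1,1,2$ if $\lambda_m(K)_2\cong A\perp\langle 2\rangle, A\perp\langle 14\rangle, A\perp\langle 6\rangle, A\perp\langle 10\rangle$ respectively, where $A=\begin{pmatrix}2&1\\1&2\end{pmatrix}$, and $t_{m,2}=\frac12$ if $\lambda_m(K)_2$ is odd.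
   Context: Quadratic spaces are positive definite over $\mathbb{Q}$; lattices are $\mathbb{Z}$-lattices with quadratic map $Q$, bilinear form $B$, $Q(x)=B(x,x)$; primitive means the ideal generated by $B(L,L)$ is $\mathbb{Z}$; $L$ is even if $Q(L)\subseteq 2\mathbb{Z}$ and odd otherwise; $dL$ is the Gram determinant; $L_q=\mathbb{Z}_q\otimes L$. A primitive ternary lattice $K$ is stable if $\mathrm{ord}_q(dK)\le1$ for all primes $q$ and $\mathrm{ord}_2(dK)=1$ if and only if $K$ is even. $\mathfrak P$ (resp. $\mathfrak Q$) is the product of the odd primes $q\mid dK$ with $\mathbb{Q}_q\otimes K$ anisotropic (resp. isotropic). $\nu(a)$ is the number of distinct prime divisors of $a$. For a positive integer $m$, $\Lambda_m(K)=\{x\in K: Q(x+y)\equiv Q(y)\pmod m\ \forall y\in K\}$ and $\lambda_m(K)$ is the primitive lattice obtained from $\Lambda_m(K)$ by scaling its quadratic map by a suitable positive rational number. $b_t(K)$ is the number of isometry classes in $\mathrm{gen}(K)$ whose isometry group has order $t$. The mass is $\mathfrak{w}(K)=\sum_{[M]\in\mathrm{gen}(K)}1/|O(M)|$. A $\mathbb{Z}_2$-lattice is odd if its norm ideal is $\mathbb{Z}_2$.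
   Formalization: The lattice ⟨1,1,1⟩ is excluded, since there the printed formula gives 5/12 instead of 1; and t_{m,1}=1/2 is taken when d(λ_m(K))≡1 (mod 4) rather than dK≡1 (mod 4), since otherwise t_{m,1} is undefined, e.g. for K=⟨1,1,3⟩, m=3. *)

(* Defs.v *)
From HB Require Import structures.
From mathcomp Require Import all_boot all_order all_algebra all_field.
From mathcomp Require Import finmap.
From mathcomp Require Import boolp classical_sets functions cardinality fsbigop.

Set Implicit Arguments.
Unset Strict Implicit.
Unset Printing Implicit Defensive.

Import Order.TTheory GRing.Theory Num.Theory.

Local Open Scope classical_set_scope.
Local Open Scope ring_scope.

(* Number of elements of a finite set; 0 on an infinite set. *)
Definition ncard (T : choiceType) (A : set T) : nat := #|` fset_set A|.

Definition eq_classes (T : Type) (A : set T) (r : T -> T -> Prop) : set (set T) :=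
  [set [set y | A y /\ r x y] | x in A].

Definition ideal_gen (R : comNzRingType) (S : set R) : set R :=
  [set r | exists2 s : seq (R * R),
     (forall t, t \in s -> S t.2) & r = \sum_(t <- s) t.1 * t.2].

(* p-adic integers: the inverse limit of the rings Z/p^k, a class modulo p^k  *)
(* being represented by its least nonnegative residue.  As with 'F_p, the     *)
(* type is a domain for every p: the base is p if p is prime, else 2.         *)

Definition padic_base (p : nat) : nat := if prime p then p else 2%N.

Lemma padic_base_prime p : prime (padic_base p).
Proof. by rewrite /padic_base; case: ifP. Qed.

Lemma modz_dvdm (n e d : int) : (d %| e)%Z -> ((n %% e)%Z = n %[mod d])%Z.
Proof.
by case/dvdzP=> c ->; rewrite [in RHS](divz_eq n (c * d)) mulrA modzMDl.
Qed.

Record padic_int (p : nat) := PadicInt {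
  padic_res :> nat -> int;
  padic_resP : forall k,
    padic_res k = (padic_res k.+1 %% (padic_base p ^ k)%N%:Z)%Z
}.

Section PadicInt.
Variable p : nat.
Let P := padic_base p.
Let m k : int := (P ^ k)%N%:Z.
Implicit Types x y z : padic_int p.

HB.instance Definition _ := gen_eqMixin (padic_int p).
HB.instance Definition _ := gen_choiceMixin (padic_int p).

Lemma padic_ext x y : (forall k, x k = y k) -> x = y.
Proof.
case: x y => [x xP] [y yP] /= e.
have exy : x = y by apply/funext.
by case: y / exy yP e => yP _; congr PadicInt; apply: Prop_irrelevance.
Qed.

Lemma m_neq0 k : m k != 0.
Proof. by rewrite /m eqz_nat -lt0n expn_gt0 prime_gt0 ?padic_base_prime. Qed.

Lemma padic_resE x k : (x k %% m k)%Z = x k.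
Proof. by rewrite padic_resP modz_mod. Qed.

Lemma padic_resD x k l : (x (k + l)%N %% m k)%Z = x k.
Proof.
elim: l => [|l IHl]; first by rewrite addn0 padic_resE.
rewrite -[RHS]IHl [in RHS]padic_resP addnS.
have /modz_dvdm -> // : (m k %| m (k + l))%Z.
by apply/dvdnP; exists (P ^ l)%N; rewrite !absz_nat expnD mulnC.
Qed.

Lemma dvd_mS k : (m k %| m k.+1)%Z.
Proof. by apply/dvdnP; exists P; rewrite !absz_nat expnS. Qed.

Lemma padic_modP (f : nat -> int) :
  (forall k, (f k.+1 = f k %[mod m k])%Z) ->
  forall k, (f k %% m k)%Z = ((f k.+1 %% m k.+1)%Z %% m k)%Z.
Proof. by move=> fP k; rewrite modz_dvdm ?dvd_mS// fP. Qed.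

Definition padic_of f fP : padic_int p := PadicInt (@padic_modP f fP).

Fact padic_cst_subproof (n : int) k : (n = n %[mod m k])%Z.
Proof. by []. Qed.
Fact padic_opp_subproof x k : (- x k.+1 = - x k %[mod m k])%Z.
Proof. by rewrite [x k]padic_resP modzNm. Qed.
Fact padic_add_subproof x y k : (x k.+1 + y k.+1 = x k + y k %[mod m k])%Z.
Proof. by rewrite [x k]padic_resP [y k]padic_resP modzDm. Qed.
Fact padic_mul_subproof x y k : (x k.+1 * y k.+1 = x k * y k %[mod m k])%Z.
Proof. by rewrite [x k]padic_resP [y k]padic_resP modzMm. Qed.

Definition padic_cst n := padic_of (padic_cst_subproof n).
Definition padic_opp x := padic_of (padic_opp_subproof x).
Definition padic_add x y := padic_of (padic_add_subproof x y).
Definition padic_mul x y := padic_of (padic_mul_subproof x y).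

Fact padic_addA : associative padic_add.
Proof. by move=> x y z; apply: padic_ext => k /=; rewrite modzDml modzDmr addrA. Qed.
Fact padic_addC : commutative padic_add.
Proof. by move=> x y; apply: padic_ext => k /=; rewrite addrC. Qed.
Fact padic_add0 : left_id (padic_cst 0) padic_add.
Proof. by move=> x; apply: padic_ext => k /=; rewrite mod0z add0r padic_resE. Qed.
Fact padic_addN : left_inverse (padic_cst 0) padic_opp padic_add.
Proof. by move=> x; apply: padic_ext => k /=; rewrite modzDml addNr. Qed.

HB.instance Definition _ := GRing.isZmodule.Build (padic_int p)
  padic_addA padic_addC padic_add0 padic_addN.

Fact padic_mulA : associative padic_mul.
Proof. by move=> x y z; apply: padic_ext => k /=; rewrite modzMml modzMmr mulrA. Qed.
Fact padic_mulC : commutative padic_mul.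
Proof. by move=> x y; apply: padic_ext => k /=; rewrite mulrC. Qed.
Fact padic_mul1 : left_id (padic_cst 1) padic_mul.
Proof.
by move=> x; apply: padic_ext => k /=; rewrite modzMml mul1r padic_resE.
Qed.
Fact padic_mulDl : left_distributive padic_mul padic_add.
Proof.
by move=> x y z; apply: padic_ext => k /=; rewrite modzMml modzDm mulrDl.
Qed.
Fact padic_1neq0 : padic_cst 1 != 0.
Proof.
apply/eqP => /(congr1 (fun x : padic_int p => x 1%N)) /=.
rewrite mod0z modz_small // /m expn1.
by rewrite ltz_nat prime_gt1 // padic_base_prime.
Qed.

HB.instance Definition _ := GRing.Zmodule_isComNzRing.Build (padic_int p)
  padic_mulA padic_mulC padic_mul1 padic_mulDl padic_1neq0.

Definition padic_unit : {pred padic_int p} :=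
  fun x => `[< exists y : padic_int p, y * x = 1 >].
Definition padic_inv x : padic_int p :=
  if x \in padic_unit then xget x [set y | y * x = 1] else x.

Fact padic_mulV : {in padic_unit, left_inverse 1 padic_inv *%R}.
Proof.
move=> x xU; rewrite /padic_inv xU; case: xgetP => [y _ //|none].
by move/asboolP: xU => [y yx1]; case: (none y).
Qed.
Fact padic_unitP x y : y * x = 1 -> x \in padic_unit.
Proof. by move=> yx1; apply/asboolP; exists y. Qed.
Fact padic_inv_out : {in [predC padic_unit], padic_inv =1 id}.
Proof. by move=> x; rewrite inE /padic_inv => /negPf ->. Qed.

HB.instance Definition _ := GRing.ComNzRing_hasMulInverse.Build (padic_int p)
  padic_mulV padic_unitP padic_inv_out.

Lemma padic_neq0 x : x != 0 -> exists k, ~~ (m k %| x k)%Z.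
Proof.
move=> x0; apply: contra_neqP x0 => /forallNP xN; apply: padic_ext => k /=.
have /negP := xN k; rewrite negbK mod0z => /dvdz_mod0P.
by rewrite padic_resE.
Qed.

Lemma Ndvd_logn (k : nat) (n : int) : ~~ (m k %| n)%Z -> n != 0 /\ (logn P `|n| < k)%N.
Proof.
move=> kn; have n0 : n != 0 by apply: contraNneq kn => ->; rewrite dvdz0.
split=> //; rewrite ltnNge; apply: contra kn => le_k.
by rewrite dvdzE absz_nat pfactor_dvdn ?padic_base_prime ?absz_gt0.
Qed.

Fact padic_integral x y : x * y = 0 -> (x == 0) || (y == 0).
Proof.
move=> xy0; apply/negPn/negP; rewrite negb_or => /andP[].
move=> /padic_neq0[k xk] /padic_neq0[l yl].
have xkl : ~~ (m k %| x (k + l)%N)%Z.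
  by apply: contra xk => /dvdz_mod0P; rewrite padic_resD => ->; rewrite dvdz0.
have ykl : ~~ (m l %| y (k + l)%N)%Z.
  apply: contra yl => /dvdz_mod0P.
  by rewrite addnC padic_resD => ->; rewrite dvdz0.
have [x0 lx] := Ndvd_logn xkl; have [y0 ly] := Ndvd_logn ykl.
have := congr1 (fun z : padic_int p => z (k + l)%N) xy0.
rewrite /= mod0z => /dvdz_mod0P.
rewrite dvdzE absz_nat abszM pfactor_dvdn ?padic_base_prime//; last first.
  by rewrite muln_gt0 !absz_gt0 x0.
rewrite lognM ?absz_gt0// leqNgt => /negP; apply.
by rewrite -addSn leq_add // ltnW.
Qed.

HB.instance Definition _ :=
  GRing.ComUnitRing_isIntegral.Build (padic_int p) padic_integral.

End PadicInt.

Notation padic_num p := {fraction padic_int p}.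

(* A lattice of rank n with integral bilinear form is given by its Gram matrix *)
(* in a Z-basis, so that its elements are the row vectors 'rV[int]_n; spaces   *)
(* and local lattices are obtained by extension of scalars.                    *)

Section Forms.
Variable n : nat.

Definition bform (R : comNzRingType) (G : 'M[R]_n) (x y : 'rV[R]_n) : R :=
  (x *m G *m y^T) 0 0.
Definition qform (R : comNzRingType) (G : 'M[R]_n) (x : 'rV[R]_n) : R :=
  bform G x x.

Definition isometric (R : comUnitRingType) (G H : 'M[R]_n) : Prop :=
  exists2 U : 'M[R]_n, U \in unitmx & U *m G *m U^T = H.

Definition ext (R : comNzRingType) (G : 'M[int]_n) : 'M[R]_n := map_mx intr G.

Definition isotropic (F : fieldType) (G : 'M[F]_n) : Prop :=
  exists2 x : 'rV[F]_n, x != 0 & qform G x = 0.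
Definition anisotropic (F : fieldType) (G : 'M[F]_n) : Prop := ~ isotropic G.

Definition scale_ideal (R : comNzRingType) (G : 'M[R]_n) : set R :=
  ideal_gen [set bform G xy.1 xy.2 | xy in [set: 'rV[R]_n * 'rV[R]_n]].
Definition norm_ideal (R : comNzRingType) (G : 'M[R]_n) : set R :=
  ideal_gen (range (qform G)).

Definition lattice (G : 'M[int]_n) : Prop :=
  G^T = G /\ (forall x : 'rV[rat]_n, x != 0 -> 0 < qform (ext rat G) x).

Definition primitive (G : 'M[int]_n) : Prop := scale_ideal G = [set: int].

Definition even_lattice (G : 'M[int]_n) : Prop :=
  forall x, (2 %| qform G x)%Z.

Definition locally_isometric (q : nat) (G H : 'M[int]_n) : Prop :=
  isometric (ext (padic_int q) G) (ext (padic_int q) H).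

Definition genus (G : 'M[int]_n) : set 'M[int]_n :=
  [set H | [/\ lattice H, isometric (ext rat G) (ext rat H)
             & forall q, prime q -> locally_isometric q G H]].

Definition represented (G : 'M[int]_n) (a : int) : Prop :=
  exists x, qform G x = a.
Definition represented_by_genus (G : 'M[int]_n) (a : int) : Prop :=
  exists2 H, genus G H & represented H a.

Definition ortho (G : 'M[int]_n) : set 'M[int]_n :=
  [set U | U \in unitmx /\ U *m G *m U^T = G].

Definition genus_classes (G : 'M[int]_n) : set (set 'M[int]_n) :=
  eq_classes (genus G) (@isometric int).

Definition class_number (G : 'M[int]_n) : nat := ncard (genus_classes G).

(* |O(M)| for any lattice M in the isometry class C *)
Definition ortho_order (C : set 'M[int]_n) : nat := ncard (ortho (xget 0 C)).

Definition b_ (t : nat) (G : 'M[int]_n) : nat :=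
  ncard [set C | genus_classes G C /\ ortho_order C = t].

Definition mass (G : 'M[int]_n) : rat :=
  \sum_(C \in genus_classes G) ((ortho_order C)%:R^-1 : rat).

Definition Lambda (m : nat) (G : 'M[int]_n) : set 'rV[int]_n :=
  [set x | forall y, (qform G (x + y) = qform G y %[mod m])%Z].

(* The rows of T form a Z-basis of Lambda m G and N is the Gram matrix of that *)
(* basis after scaling.                                                        *)
Definition is_lambda (m : nat) (G N : 'M[int]_n) : Prop :=
  exists T : 'M[int]_n, exists c : rat,
    [/\ (forall x, Lambda m G x <-> exists! a : 'rV[int]_n, x = a *m T),
        0 < c, ext rat N = c *: ext rat (T *m G *m T^T) & primitive N].

(* Only the isometry class of lambda m G is meaningful. *)
Definition lambda (m : nat) (G : 'M[int]_n) : 'M[int]_n :=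
  xget 0 [set N | is_lambda m G N].

End Forms.

Definition stable (K : 'M[int]_3) : Prop :=
  [/\ lattice K, primitive K,
      forall q, prime q -> (logn q `|\det K| <= 1)%N
    & logn 2 `|\det K| = 1%N <-> even_lattice K].

Definition frakP (K : 'M[int]_3) : nat :=
  \prod_(q <- primes `|\det K| |
         odd q && `[< anisotropic (ext (padic_num q) K) >]) q.
Definition frakQ (K : 'M[int]_3) : nat :=
  \prod_(q <- primes `|\det K| |
         odd q && `[< isotropic (ext (padic_num q) K) >]) q.

Definition nu (a : nat) : nat := size (primes a).

(* The field Q(sqrt D), its ring of integers and its invariants, in algC *)

Definition quad_field (D : int) : set algC :=
  [set x | exists a b : rat, x = ratr a + ratr b * sqrtC D%:~R].

Definition integers (E : set algC) : set algC := [set x | E x /\ x \in Aint].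

Definition integral_ideal (E I : set algC) : Prop :=
  [/\ I `<=` integers E, (exists2 x, I x & x != 0),
      forall x y, I x -> I y -> I (x + y)
    & forall a x, integers E a -> I x -> I (a * x)].

Definition ideal_equiv (E I J : set algC) : Prop :=
  exists a b, [/\ integers E a /\ a != 0, integers E b /\ b != 0
    & [set a * x | x in I] = [set b * y | y in J]].

Definition field_class_number (E : set algC) : nat :=
  ncard (eq_classes (integral_ideal E) (ideal_equiv E)).

Definition roots_of_unity (E : set algC) : set algC :=
  [set x | E x /\ exists2 k : nat, (0 < k)%N & x ^+ k = 1].
Definition mu (E : set algC) : nat := ncard (roots_of_unity E).

Definition diag3 (a b c : int) : 'M[int]_3 :=
  \matrix_(i, j) (if i == j then [:: a; b; c]`_i else 0).

(* the orthogonal sum of A = (2 1; 1 2) and <c> *)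
Definition A_perp (c : int) : 'M[int]_3 :=
  block_mx (\matrix_(i < 2, j < 2) (if i == j then 2 else 1)) 0
           0 (c%:M : 'M[int]_1).

Definition odd_at2 (n : nat) (G : 'M[int]_n) : Prop :=
  norm_ideal (ext (padic_int 2) G) = [set: padic_int 2].

(* t_{m,delta} as a function of L = lambda_m(K).  The congruence in the case    *)
(* delta = 1 bears on d(L) = m * dK, not on dK: it is then exclusive of the     *)
(* three previous cases, and when delta is represented by gen(L) exactly one of *)
(* the listed cases holds, so that the default value 0 is not used.             *)
Definition tcoef (L : 'M[int]_3) (delta : nat) : rat :=
  if delta == 1%N then
    if `[< locally_isometric 2 L (diag3 1 1 3) >] then 3
    else if `[< locally_isometric 2 L (diag3 3 3 3) >] then 1
    else if `[< locally_isometric 2 L (diag3 1 1 7) >] then 2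
    else if (\det L == 1 %[mod 4])%Z then 1 / 2
    else 0
  else if delta == 2%N then
    if `[< locally_isometric 2 L (A_perp 2) >] then 4
    else if `[< locally_isometric 2 L (A_perp 14) >] then 1
    else if `[< locally_isometric 2 L (A_perp 6) >] then 1
    else if `[< locally_isometric 2 L (A_perp 10) >] then 2
    else if `[< odd_at2 L >] then 1 / 2
    else 0
  else 0.

(* Main.v *)
(** For a lattice H in gen K of squarefree determinant, a rotation of order
    greater than 2 forces H to be <n> + <1, 1>, <n> + A_2 or a trigonal lattice;
    reading off the groups, |O(H)| = #{U in O(H) | U^2 = 1} + |O(H)| c, with
    c = 1/3 if |O(H)| is 12 or 24, c = 1/4 if it is 16, and c = 0 otherwise.
    The involutions are 1, -1 and, up to sign, the reflections, and v defines a
    reflection iff Q(v) = m delta and B(v, H) <= m Z for some m | PQ and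
    delta in {1, 2}.  Summing 1 = (2 + #reflections) / |O(H)| + c over the classes
    reduces the formula to the weighted count of such v, for each (m, delta).

    The complement of v is a plane similar to the norm form of E, and H is glued
    from v and an ideal I of E with I conj(I) = (c).  Since such a determinant
    and the parity determine the genus inside a rational class, every gluing of
    every such ideal lies in gen K, so the count is the number of gluings times
    the number of ideals I with I conj(I) = (c) modulo elements of norm 1.  This
    number is h_E / 2^(t - 1), with t the number of ramified primes: if J0 is one
    such ideal, every other one is J0 a / conj(a), where a is determined up to
    ambiguous ideals. *)

(* Stability is what makes the local theory collapse: at each prime the class of the form is fixed
   by determinant, parity and isotropy, and isotropy is a rational invariant. A glued lattice is
   therefore placed in gen K by a rational isometry alone. The weighted count of vectors is a double
   count of frames, a frame being an identification of the complement of v with a subset of E in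
   which an ideal is marked. For a fixed ideal, O(H) acts freely on frames, so the sum of frames
   over |O(H)| is the number of gluings. For a fixed (H, v), elements of norm 1 and conjugation act
   simply transitively, so 2 mu_E frames land on chosen representatives of the ideals. The same
   count bounds the number of these representatives. The cubic lattice must be excluded: its group
   has order 48 with 20 elements of square 1, and the missing 28/48 is none of the corrections. The
   field Q(i) needs care as sqrt(-1) is a unit there: the nontrivial principal ambiguous ideal is
   generated by 1 + i. *)
Require Import Defs.
From mathcomp Require Import all_boot all_order all_algebra all_field.
From mathcomp Require Import finmap.
From mathcomp Require Import boolp classical_sets functions cardinality fsbigop.
From mathcomp Require Import zify ring.

Set Implicit Arguments.
Unset Strict Implicit.
Unset Printing Implicit Defensive.

Import Order.TTheory GRing.Theory Num.Theory.

Local Open Scope classical_set_scope.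
Local Open Scope ring_scope.

(** * Three by three matrices *)

Notation o0 := (@Ordinal 3 0 isT).
Notation o1 := (@Ordinal 3 1 isT).
Notation o2 := (@Ordinal 3 2 isT).

Lemma I3P (P : 'I_3 -> Prop) : P o0 -> P o1 -> P o2 -> forall i, P i.
Proof.
move=> P0 P1 P2 [[|[|[|//]]] Hi].
- by rewrite (_ : Ordinal Hi = o0) //; apply: val_inj.
- by rewrite (_ : Ordinal Hi = o1) //; apply: val_inj.
- by rewrite (_ : Ordinal Hi = o2) //; apply: val_inj.
Qed.

Lemma sum3E (V : nmodType) (F : 'I_3 -> V) : \sum_i F i = F o0 + F o1 + F o2.
Proof.
rewrite !big_ord_recl big_ord0 addr0 addrA.
by congr (_ + _ + _); congr F; apply: val_inj.
Qed.

Section Mx3.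
Variable T : Type.

(** Matrices with named entries turn identities between products into nine polynomial identities, to
    which [ring] applies; the defaults of [nth] are out of reach. *)
Definition mx3 (a b c d e f g h i : T) : 'M[T]_3 :=
  \matrix_(x, y) nth a (nth [::] [:: [:: a; b; c]; [:: d; e; f]; [:: g; h; i]] x) y.
Definition rv3 (a b c : T) : 'rV[T]_3 := \row_y nth a [:: a; b; c] y.

Lemma mx3E (A : 'M[T]_3) :
  A = mx3 (A o0 o0) (A o0 o1) (A o0 o2) (A o1 o0) (A o1 o1) (A o1 o2)
          (A o2 o0) (A o2 o1) (A o2 o2).
Proof.
by apply/matrixP; apply: I3P; apply: I3P; rewrite mxE.
Qed.

Lemma rv3E (x : 'rV[T]_3) : x = rv3 (x 0 o0) (x 0 o1) (x 0 o2).
Proof. by apply/rowP; apply: I3P; rewrite mxE. Qed.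

Lemma mx3P (A : 'M[T]_3) : exists a b c d e f g h i, A = mx3 a b c d e f g h i.
Proof. by rewrite [A]mx3E; do 9 eexists. Qed.

Lemma rv3P (x : 'rV[T]_3) : exists a b c, x = rv3 a b c.
Proof. by rewrite [x]rv3E; do 3 eexists. Qed.

Lemma mx3_inj a b c d e f g h i a' b' c' d' e' f' g' h' i' :
  mx3 a b c d e f g h i = mx3 a' b' c' d' e' f' g' h' i' ->
  [/\ a = a', b = b' & c = c'] /\ [/\ d = d', e = e' & f = f'] /\
  [/\ g = g', h = h' & i = i'].
Proof.
move=> /matrixP E.
by have := (E o0 o0, E o0 o1, E o0 o2, (E o1 o0, E o1 o1, E o1 o2),
  (E o2 o0, E o2 o1, E o2 o2)); rewrite !mxE /= => -[[[[-> ->] ->] [[-> ->] ->]] [[-> ->] ->]].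
Qed.

Lemma rv3_inj a b c a' b' c' :
  rv3 a b c = rv3 a' b' c' -> [/\ a = a', b = b' & c = c'].
Proof.
move=> /rowP E; have := (E o0, E o1, E o2); rewrite !mxE /=.
by move=> [[-> ->] ->].
Qed.

Lemma tr_mx3 a b c d e f g h i :
  (mx3 a b c d e f g h i)^T = mx3 a d g b e h c f i.
Proof. by apply/matrixP; apply: I3P; apply: I3P; rewrite !mxE. Qed.

End Mx3.

Lemma map_mx3 (T U : Type) (k : T -> U) a b c d e f g h i :
  map_mx k (mx3 a b c d e f g h i) =
  mx3 (k a) (k b) (k c) (k d) (k e) (k f) (k g) (k h) (k i).
Proof. by apply/matrixP; apply: I3P; apply: I3P; rewrite !mxE. Qed.

Section Mx3Ring.
Variable R : comNzRingType.
Implicit Types a b c d e f g h i : R.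

Lemma scale_mx3 k a b c d e f g h i :
  k *: mx3 a b c d e f g h i =
  mx3 (k * a) (k * b) (k * c) (k * d) (k * e) (k * f) (k * g) (k * h) (k * i).
Proof. by apply/matrixP; apply: I3P; apply: I3P; rewrite !mxE. Qed.

Lemma mul_mx3 a b c d e f g h i a' b' c' d' e' f' g' h' i' :
  mx3 a b c d e f g h i *m mx3 a' b' c' d' e' f' g' h' i' =
  mx3 (a * a' + b * d' + c * g') (a * b' + b * e' + c * h') (a * c' + b * f' + c * i')
      (d * a' + e * d' + f * g') (d * b' + e * e' + f * h') (d * c' + e * f' + f * i')
      (g * a' + h * d' + i * g') (g * b' + h * e' + i * h') (g * c' + h * f' + i * i').
Proof. by apply/matrixP; apply: I3P; apply: I3P; rewrite !mxE sum3E !mxE. Qed.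

Lemma mul_rv3 x y z a b c d e f g h i :
  rv3 x y z *m mx3 a b c d e f g h i =
  rv3 (x * a + y * d + z * g) (x * b + y * e + z * h) (x * c + y * f + z * i).
Proof. by apply/rowP; apply: I3P; rewrite !mxE sum3E !mxE. Qed.

Lemma opp_rv3 a b c : - rv3 a b c = rv3 (- a) (- b) (- c).
Proof. by apply/rowP; apply: I3P; rewrite !mxE. Qed.

Lemma scale_rv3 k a b c : k *: rv3 a b c = rv3 (k * a) (k * b) (k * c).
Proof. by apply/rowP; apply: I3P; rewrite !mxE. Qed.

Lemma rv3_0 : rv3 0 0 0 = 0 :> 'rV[R]_3.
Proof. by apply/rowP; apply: I3P; rewrite !mxE. Qed.

Lemma mx3_1 : 1%:M = mx3 1 0 0 0 1 0 0 0 1 :> 'M[R]_3.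
Proof. by apply/matrixP; apply: I3P; apply: I3P; rewrite !mxE. Qed.

Lemma det_mx3 a b c d e f g h i :
  \det (mx3 a b c d e f g h i) =
  a * (e * i - f * h) - b * (d * i - f * g) + c * (d * h - e * g).
Proof.
rewrite (expand_det_row _ o0) sum3E !mxE /= /cofactor.
have det2 (M : 'M[R]_2) : \det M = M 0 0 * M 1 1 - M 0 1 * M 1 0.
  rewrite (expand_det_row _ 0) !big_ord_recl big_ord0 addr0 /cofactor.
  rewrite !det_mx11 !mxE /= !addn0 expr0 mul1r expr1 mulN1r mulrN.
  by congr (_ * M _ _ - M _ _ * M _ _); apply: val_inj.
rewrite !det2 !mxE /= !add0n expr0 expr1; ring.
Qed.

Lemma bform_rv3 a b c d e f g h i x y z x' y' z' :
  bform (mx3 a b c d e f g h i) (rv3 x y z) (rv3 x' y' z') =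
  (x * a + y * d + z * g) * x' + (x * b + y * e + z * h) * y' +
  (x * c + y * f + z * i) * z'.
Proof. by rewrite /bform mul_rv3 !mxE sum3E !mxE. Qed.

Lemma qform_rv3 a b c d e f g h i x y z :
  qform (mx3 a b c d e f g h i) (rv3 x y z) =
  (x * a + y * d + z * g) * x + (x * b + y * e + z * h) * y +
  (x * c + y * f + z * i) * z.
Proof. exact: bform_rv3. Qed.

End Mx3Ring.

Lemma diag3E a b c : diag3 a b c = mx3 a 0 0 0 b 0 0 0 c.
Proof. by apply/matrixP; apply: I3P; apply: I3P; rewrite !mxE. Qed.

Lemma A_perpE c : A_perp c = mx3 2 1 0 1 2 0 0 0 c.
Proof.
apply/matrixP; apply: I3P; apply: I3P; rewrite /A_perp /block_mx /col_mx /row_mx !mxE;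
  by case: splitP => -[[|[|//]] ?] //= ; rewrite !mxE; case: splitP => -[[|[|//]] ?] //=; rewrite !mxE.
Qed.

Definition smx3 (R : Type) (a b c d e f : R) : 'M[R]_3 := mx3 a d e d b f e f c.

Lemma smx3P (R : Type) (G : 'M[R]_3) :
  G^T = G -> exists a b c d e f, G = smx3 a b c d e f.
Proof.
have [a [b [c [d [e [f [g [h [i ->]]]]]]]]] := mx3P G.
rewrite tr_mx3 => E; have [[_ Eb Ec] [[_ _ Ef] _]] := mx3_inj E.
by exists a, e, i, b, c, f; rewrite /smx3 -Eb -Ec -Ef.
Qed.

Tactic Notation "isometry3" uconstr(U) := refine (ex_intro2 _ _ U _ _);
  [by rewrite unitmxE det_mx3; first [rewrite (_ : _ + _ = 1) ?unitr1 //; ring | rewrite (_ : _ + _ = -1) ?unitrN1 //; ring]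
  |by rewrite tr_mx3 !mul_mx3; congr mx3; ring].

(** * Forms and isometries *)

Section FormTheory.
Variable n : nat.

Section Ring.
Variable R : comNzRingType.
Implicit Types (G U : 'M[R]_n) (x y z : 'rV[R]_n).

Lemma bformDl G x y z : bform G (x + y) z = bform G x z + bform G y z.
Proof. by rewrite /bform !mulmxDl mxE. Qed.
Lemma bformDr G x y z : bform G x (y + z) = bform G x y + bform G x z.
Proof. by rewrite /bform linearD /= mulmxDr mxE. Qed.
Lemma bformZl G k x y : bform G (k *: x) y = k * bform G x y.
Proof. by rewrite /bform -!scalemxAl mxE. Qed.
Lemma bformZr G k x y : bform G x (k *: y) = k * bform G x y.
Proof. by rewrite /bform linearZ /= -scalemxAr mxE. Qed.
Lemma bformNl G x y : bform G (- x) y = - bform G x y.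
Proof. by rewrite -scaleN1r bformZl mulN1r. Qed.
Lemma bformNr G x y : bform G x (- y) = - bform G x y.
Proof. by rewrite -scaleN1r bformZr mulN1r. Qed.
Lemma bform0l G y : bform G 0 y = 0.
Proof. by rewrite /bform !mul0mx mxE. Qed.
Lemma bform0r G y : bform G y 0 = 0.
Proof. by rewrite /bform trmx0 mulmx0 mxE. Qed.
Lemma qform0 G : qform G 0 = 0. Proof. exact: bform0l. Qed.

Lemma bformC G x y : G^T = G -> bform G x y = bform G y x.
Proof.
move=> sG; rewrite /bform -[in LHS](trmxK (x *m G *m y^T)).
by rewrite mxE !trmx_mul trmxK sG mulmxA.
Qed.

Lemma qformD G x y : G^T = G ->
  qform G (x + y) = qform G x + 2 * bform G x y + qform G y.
Proof.
move=> sG; rewrite /qform !bformDl !bformDr [bform G y x]bformC //; ring.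
Qed.

Lemma qformZ G k x : qform G (k *: x) = k ^+ 2 * qform G x.
Proof. by rewrite /qform bformZl bformZr mulrA. Qed.

Lemma qformN G x : qform G (- x) = qform G x.
Proof. by rewrite /qform bformNl bformNr opprK. Qed.

Lemma bform_conj G U x y : bform (U *m G *m U^T) x y = bform G (x *m U) (y *m U).
Proof. by rewrite /bform trmx_mul !mulmxA. Qed.

Lemma qform_conj G U x : qform (U *m G *m U^T) x = qform G (x *m U).
Proof. exact: bform_conj. Qed.

Lemma bform_scale k G x y : bform (k *: G) x y = k * bform G x y.
Proof. by rewrite /bform -scalemxAr -scalemxAl mxE. Qed.

Lemma qform_scale k G x : qform (k *: G) x = k * qform G x.
Proof. exact: bform_scale. Qed.

Lemma bform_delta G i j : bform G (delta_mx 0 i) (delta_mx 0 j) = G i j.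
Proof. by rewrite /bform -rowE trmx_delta -colE !mxE. Qed.

End Ring.

Lemma map_bform (R S : comNzRingType) (k : {rmorphism R -> S}) (G : 'M[R]_n) x y :
  bform (map_mx k G) (map_mx k x) (map_mx k y) = k (bform G x y).
Proof. by rewrite /bform map_trmx -!map_mxM mxE. Qed.

Lemma isometric_refl (R : comUnitRingType) (G : 'M[R]_n) : isometric G G.
Proof. by exists 1%:M; rewrite ?unitmx1 // trmx1 mul1mx mulmx1. Qed.

Lemma isometric_sym (R : comUnitRingType) (G H : 'M[R]_n) :
  isometric G H -> isometric H G.
Proof.
move=> [U uU <-]; exists (invmx U); first by rewrite unitmx_inv.
rewrite !mulmxA mulVmx // mul1mx trmx_inv -mulmxA mulmxV ?unitmx_tr //.
by rewrite mulmx1.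
Qed.

Lemma isometric_trans (R : comUnitRingType) (G H K : 'M[R]_n) :
  isometric G H -> isometric H K -> isometric G K.
Proof.
move=> [U uU <-] [V uV <-]; exists (V *m U); first by rewrite unitmx_mul uV.
by rewrite trmx_mul !mulmxA.
Qed.

Lemma isometric_sym_mx (R : comUnitRingType) (G H : 'M[R]_n) :
  isometric G H -> G^T = G -> H^T = H.
Proof. by move=> [U _ <-] sG; rewrite !trmx_mul trmxK sG mulmxA. Qed.

Lemma isometric_det (R : comUnitRingType) (G H : 'M[R]_n) :
  isometric G H -> exists2 u, u \is a GRing.unit & \det H = u ^+ 2 * \det G.
Proof.
move=> [U uU <-]; exists (\det U) => //.
by rewrite !det_mulmx det_tr; ring.
Qed.

Lemma isometric_ext (S : comUnitRingType) (G H : 'M[int]_n) :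
  isometric G H -> isometric (ext S G) (ext S H).
Proof.
move=> [U uU <-]; exists (ext S U).
  by rewrite unitmxE det_map_mx rmorph_unit // -unitmxE.
by rewrite /ext map_trmx -!map_mxM.
Qed.

End FormTheory.

Lemma intr_unit (u : int) : u \is a GRing.unit -> u ^+ 2 = 1.
Proof. by rewrite qualifE /= => /pred2P[] ->. Qed.

Lemma isometric_det_int n (G H : 'M[int]_n) : isometric G H -> \det G = \det H.
Proof. by case/isometric_det => u /intr_unit -> ->; rewrite mul1r. Qed.

Lemma smith3 (M : 'M[int]_3) : exists L R : 'M[int]_3, exists a b c : int,
  [/\ L \in unitmx, R \in unitmx, (a %| b)%Z, (b %| c)%Z
    & M = L *m mx3 a 0 0 0 b 0 0 0 c *m R].
Proof.
have [L uL [R uR [d sd ->]]] := int_Smith_normal_form M.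
exists L, R, d`_0, d`_1, d`_2; split => //.
- case: d sd => [|x [|y s]] //=; rewrite ?dvdz0 //.
  by case/andP.
- case: d sd => [|x [|y [|z s]]] //=; rewrite ?dvdz0 //.
  by case/and3P.
- congr (_ *m _ *m _); apply/matrixP; apply: I3P; apply: I3P; rewrite !mxE //=.
Qed.

Lemma unit_mx3P (U : 'M[int]_3) : (U \in unitmx) = (\det U == 1) || (\det U == -1).
Proof. by rewrite unitmxE qualifE /=; case: eqP => // ->. Qed.

(** The Smith form of a single row: [R] carries the primitive vector, and its multiplier is the
    content of [v] up to sign. *)
Lemma row_complete (v : 'rV[int]_3) : exists U : 'M[int]_3, exists k : int,
  U \in unitmx /\ v = k *: (rv3 1 0 0 *m U).
Proof.
have [L uL [R uR [d sd Ev]]] := int_Smith_normal_form v.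
exists R, (L 0 0 * d`_0); split => //.
rewrite scalemxAl [LHS]Ev; congr (_ *m R).
apply/rowP => i; rewrite !mxE big_ord1 !mxE; move: i.
by apply: I3P; rewrite /= ?mulr1n ?mulr0n ?mulr1 ?mulr0.
Qed.

(** * Arithmetic of the p-adic integers *)

Section Padic.
Variable q : nat.
Hypothesis pq : prime q.
Local Notation Zq := (padic_int q).
Implicit Types x y z u w : Zq.

Let baseE : padic_base q = q. Proof. by rewrite /padic_base pq. Qed.

Definition pmod k : int := (q ^ k)%N%:Z.

Lemma pmodE k : (padic_base q ^ k)%N%:Z = pmod k.
Proof. by rewrite baseE. Qed.

Lemma pmodS k : pmod k.+1 = q%:Z * pmod k.
Proof. by rewrite /pmod expnS PoszM. Qed.

Lemma pmod1 : pmod 1 = q%:Z. Proof. by rewrite /pmod expn1. Qed.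

Lemma padicDE x y k : (x + y) k = ((x k + y k) %% pmod k)%Z.
Proof. by rewrite -pmodE. Qed.
Lemma padicME x y k : (x * y) k = ((x k * y k) %% pmod k)%Z.
Proof. by rewrite -pmodE. Qed.
Lemma padicNE x k : (- x) k = ((- x k) %% pmod k)%Z.
Proof. by rewrite -pmodE. Qed.
Lemma padic0E k : (0 : Zq) k = 0.
Proof. by rewrite [LHS](mod0z _). Qed.
Lemma padic_modE x k : (x k %% pmod k)%Z = x k.
Proof. by rewrite -pmodE padic_resE. Qed.
Lemma padic_stepE x k : (x k.+1 %% pmod k)%Z = x k.
Proof. by rewrite -pmodE -padic_resP. Qed.

Lemma intr_padic (n : int) : n%:~R = padic_cst q n.
Proof.
have DE a b : padic_cst q (a + b) = padic_cst q a + padic_cst q b.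
  by apply: padic_ext => k; rewrite padicDE /= pmodE modzDm.
have NE a : padic_cst q (- a) = - padic_cst q a.
  by apply: padic_ext => k; rewrite padicNE /= pmodE modzNm.
have nE (a : nat) : (a%:Z)%:~R = padic_cst q a.
  elim: a => [|a IH]; first by apply: padic_ext => k; rewrite [LHS]padic0E [RHS]mod0z.
  by rewrite -addn1 PoszD rmorphD /= IH DE.
by case: (intP n) => [|a|a]; rewrite ?rmorphN /= ?nE ?NE.
Qed.

Lemma intr_padicE (n : int) k : (n%:~R : Zq) k = (n %% pmod k)%Z.
Proof. by rewrite intr_padic /= pmodE. Qed.

Lemma natr_padicE (n : nat) k : (n%:R : Zq) k = (n%:Z %% pmod k)%Z.
Proof. by rewrite -intr_padicE. Qed.

Lemma padic0res x : x 0%N = 0.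
Proof. by rewrite -padic_modE /pmod expn0 modz1. Qed.

Lemma intr_padic_eq0 (n : int) : (n%:~R == 0 :> Zq) = (n == 0).
Proof.
apply/eqP/eqP => [E|->] //.
have /(congr1 (fun x : Zq => x `|n|%N)) := E.
rewrite intr_padicE padic0E => /dvdz_mod0P; rewrite dvdzE absz_nat.
have := ltn_expl `|n| (prime_gt1 pq).
by case: (posnP `|n|) => [/eqP|n0 lt /(dvdn_leq n0)]; [rewrite absz_eq0 => /eqP|lia].
Qed.

(** Divisibility by q, read off the residue modulo q so as to be decidable; [pdivP] supplies the
    quotient. *)
Definition pdiv_pred x : bool := x 1%N == 0.
Local Notation "'pi" := (q%:R : Zq).

(** The quotient is the sequence shifted by one place: modulo q^k it is the residue of [x] modulo
    q^(k+1), divided by q. *)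
Lemma pdivP x : reflect (exists y, x = 'pi * y) (pdiv_pred x).
Proof.
apply: (iffP eqP) => [x1|[y ->]]; last first.
  by rewrite padicME natr_padicE pmod1 modzz mul0r mod0z.
have dv k : (q %| x k.+1)%Z.
  apply/dvdz_mod0P; elim: k => [|k IH]; first by rewrite x1 mod0z.
  by rewrite -IH -[x k.+1]padic_stepE modz_dvdm // pmodS dvdz_mulr.
have fP k : ((x k.+2 %/ q)%Z = (x k.+1 %/ q)%Z %[mod (padic_base q ^ k)%N%:Z])%Z.
  rewrite pmodE; apply/eqP; rewrite eqz_mod_dvd.
  have: (pmod k.+1 %| x k.+2 - x k.+1)%Z.
    by rewrite -eqz_mod_dvd padic_stepE padic_modE.
  rewrite -{1}(divzK (dv k.+1)) -{1}(divzK (dv k)) -mulrBl pmodS mulrC.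
  by rewrite dvdz_mul2l // eqz_nat -lt0n prime_gt0.
exists (padic_of fP); apply: padic_ext => k.
rewrite padicME natr_padicE /= pmodE modzMml modzMmr mulrC divzK //.
by rewrite padic_stepE.
Qed.

(** Bezout coefficients of [x k] and q^k give inverses modulo q^k; inverses being unique modulo q^k,
    they form a coherent sequence. *)
Lemma padic_unitE x : (x \is a GRing.unit) = ~~ pdiv_pred x.
Proof.
apply/idP/idP => [/unitrP[y [yx _]]|x1].
  apply/pdivP => -[z xz]; move: yx; rewrite xz => /(congr1 (fun t : Zq => t 1%N)).
  rewrite mulrCA padicME natr_padicE pmod1 modzz mul0r mod0z.
  rewrite (_ : 1 = (1%:~R : Zq)) // intr_padicE pmod1 modz_small //.
  by rewrite /= ltz_nat prime_gt1.
have cop k : coprimez (x k) (pmod k).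
  rewrite coprimezE absz_nat; case: k => [|k]; first by rewrite expn0 coprimen1.
  rewrite coprimeXr // coprime_sym prime_coprime //.
  apply: contra x1; rewrite /pdiv_pred => d.
  have: (q %| x 1%N)%Z.
    elim: k d => // k IH d; apply: IH; rewrite -[x k.+1]padic_stepE.
    have d' : (q %| x k.+2)%Z by [].
    suff : (q %| x k.+2 %% pmod k.+1)%Z by [].
    move: d'; rewrite {1}(divz_eq (x k.+2) (pmod k.+1)) rpredDl //.
    by rewrite pmodS mulrCA; apply: dvdz_mulr.
  by move=> /dvdz_mod0P; rewrite -pmod1 padic_modE => ->.
pose f k := (egcdz (x k) (pmod k)).1.
have fx k : (f k * x k = 1 %[mod pmod k])%Z.
  rewrite /f; case: egcdzP => u v E _ /=.
  have /eqP g1 := cop k; rewrite g1 in E.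
  by rewrite -E addrC modzMDl.
have fP k : (f k.+1 = f k %[mod (padic_base q ^ k)%N%:Z])%Z.
  rewrite pmodE; apply/eqP; rewrite eqz_mod_dvd.
  rewrite -(Gauss_dvdzl _ (p := x k)); last by rewrite coprimez_sym.
  rewrite mulrBl -eqz_mod_dvd fx -[x k]padic_stepE modzMmr.
  apply/eqP; have /eqP := fx k.+1; rewrite eqz_mod_dvd => d.
  apply/eqP; rewrite eqz_mod_dvd; apply: dvdz_trans d.
  by rewrite pmodS dvdz_mull.
apply/unitrP; exists (padic_of fP); rewrite mulrC; split.
  apply: padic_ext => k; rewrite padicME /= pmodE modzMmr mulrC fx.
  by rewrite -intr_padicE.
apply: padic_ext => k; rewrite padicME /= pmodE modzMmr mulrC fx.
by rewrite -intr_padicE.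
Qed.

Lemma pdivD x y : pdiv_pred x -> pdiv_pred y -> pdiv_pred (x + y).
Proof.
by move=> /pdivP[a ->] /pdivP[b ->]; apply/pdivP; exists (a + b); rewrite mulrDr.
Qed.

Lemma pdivM x y : pdiv_pred x -> pdiv_pred (x * y).
Proof. by move=> /pdivP[a ->]; apply/pdivP; exists (a * y); rewrite mulrA. Qed.

Lemma pdivMr x y : pdiv_pred x -> pdiv_pred (y * x).
Proof. by rewrite mulrC; apply: pdivM. Qed.

Lemma pdivN x : pdiv_pred (- x) = pdiv_pred x.
Proof.
by apply/pdivP/pdivP => -[y E]; exists (- y); rewrite ?mulrN -E ?opprK.
Qed.

Lemma pdiv_int (n : int) : pdiv_pred (n%:~R) = (q %| n)%Z.
Proof. by rewrite /pdiv_pred intr_padicE pmod1; apply/eqP/idP => /dvdz_mod0P. Qed.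

Lemma unit_int (n : int) : ((n%:~R : Zq) \is a GRing.unit) = ~~ (q %| n)%Z.
Proof. by rewrite padic_unitE pdiv_int. Qed.

Lemma pi_neq0 : 'pi != 0.
Proof. by rewrite -[q%:R]/((q%:Z)%:~R) intr_padic_eq0 eqz_nat -lt0n prime_gt0. Qed.

Lemma unit_Npdiv x y : x \is a GRing.unit -> pdiv_pred y -> x + y \is a GRing.unit.
Proof.
rewrite !padic_unitE => x1 dy; apply: contra x1 => d.
by rewrite -[x](addrK y); apply: pdivD => //; rewrite pdivN.
Qed.

(** Newton iteration with the fixed slope [b]: at a point divisible by q the derivative 2 a x + b
    differs from [b] by a multiple of q, so each step still gains a power of q. *)
Lemma hensel a b c : b \is a GRing.unit -> pdiv_pred c ->
  exists2 x, pdiv_pred x & a * x ^+ 2 + b * x + c = 0.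
Proof.
move=> ub dc; pose f x := a * x ^+ 2 + b * x + c.
pose s := fix s k := if k is k'.+1 then s k' - f (s k') / b else 0.
have sP k : pdiv_pred (s k) /\ exists y, f (s k) = 'pi ^+ k.+1 * y.
  elim: k => [|k [d [y E]]].
    split; first exact/pdivP/(ex_intro _ 0)/esym/mulr0.
    by have /pdivP[y E] := dc; exists y; rewrite /f /= E; ring.
  (* Taylor expansion of the quadratic; the second factor is divisible by q because [f (s k)] and
     [s k] are. *)
  have fk : f (s k.+1) = f (s k) * (a * f (s k) / b / b - 2 * a * s k / b).
    rewrite /=; set F := f (s k); rewrite /f.
    have -> : c = F - a * s k ^+ 2 - b * s k by rewrite /F /f; ring.
    transitivity (F * (a * F / b / b - 2 * a * s k / b) + F * (1 - b / b)); first by ring.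
    by rewrite divrr // subrr mulr0 addr0.
  split.
    apply: pdivD => //; rewrite pdivN E exprS; apply/pdivP.
    by exists ('pi ^+ k * y / b); ring.
  have /pdivP[z sz] := d.
  exists (y * (a * ('pi ^+ k * y) / b / b - 2 * a * z / b)).
  by rewrite fk E sz [_ ^+ k.+2]exprS [_ ^+ k.+1]exprS; ring.
have pik k y : ('pi ^+ k * y) k = 0.
  have -> : 'pi ^+ k = ((pmod k)%:~R : Zq).
    by rewrite /pmod -natrX.
  by rewrite padicME intr_padicE modzz mul0r mod0z.
have sS k : s k.+1 k = s k k.
  have [_ [y E]] := sP k.
  rewrite (_ : s k.+1 = s k - f (s k) / b) // padicDE padicNE E.
  have -> : ('pi ^+ k.+1 * y / b) k = 0.
    by rewrite exprSr -!mulrA pik.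
  by rewrite oppr0 mod0z addr0 padic_modE.
have fP k : (s k.+1 k.+1 = s k k %[mod (padic_base q ^ k)%N%:Z])%Z.
  by rewrite pmodE padic_stepE sS padic_modE.
pose x := padic_of fP.
have xk k : x k = s k k by rewrite /= pmodE padic_modE.
exists x.
  rewrite /pdiv_pred xk; have [/pdivP[y E] _] := sP 1%N.
  by rewrite E -{1}['pi]expr1 pik.
apply: padic_ext => k; rewrite padic0E.
have -> : (a * x ^+ 2 + b * x + c) k = f (s k) k.
  by rewrite /f !expr2 !(padicDE, padicME) xk.
by have [_ [y ->]] := sP k; rewrite exprSr -mulrA pik.
Qed.

(** Induction on a precision at which some coordinate is visibly nonzero; dividing all three by q
    lowers it by one. *)
Lemma padic_prim3 x y z : ~~ [&& x == 0, y == 0 & z == 0] ->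
  exists j x' y' z', [/\ x = 'pi ^+ j * x', y = 'pi ^+ j * y', z = 'pi ^+ j * z'
    & [|| x' \is a GRing.unit, y' \is a GRing.unit | z' \is a GRing.unit]].
Proof.
move=> nz.
have [k Hk] : exists k, [|| x k != 0, y k != 0 | z k != 0].
  apply: contra_notP (negP nz) => /forallNP H; apply/and3P.
  by split; apply/eqP/padic_ext => k; rewrite padic0E; apply/eqP; have /negP := H k;
    rewrite !negb_or !negbK => /and3P[].
elim: k x y z Hk {nz} => [|k IH] x y z; first by rewrite !padic0res eqxx.
move=> H; case: (boolP [&& pdiv_pred x, pdiv_pred y & pdiv_pred z]) => [|u]; last first.
  exists 0%N, x, y, z; rewrite expr0 !mul1r; split=> //.
  by move: u; rewrite !negb_and -!padic_unitE.
move=> /and3P[/pdivP[x1 E1] /pdivP[y1 E2] /pdivP[z1 E3]].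
have nzk t : ('pi * t) k.+1 != 0 -> t k != 0.
  apply: contra => /eqP tk; apply/eqP.
  rewrite padicME natr_padicE modzMml.
  have /dvdz_mod0P/dvdzP[c Ec] : (t k.+1 %% pmod k)%Z = 0 by rewrite padic_stepE.
  by rewrite Ec mulrCA -pmodS modzMl.
have [|j [x2 [y2 [z2 [F1 F2 F3 u]]]]] := IH x1 y1 z1.
  by move: H; rewrite E1 E2 E3; case/or3P => /nzk ->; rewrite ?orbT.
by exists j.+1, x2, y2, z2; rewrite E1 E2 E3 F1 F2 F3 exprS !mulrA.
Qed.

Lemma intr_dvd_padic k (n : int) y : n%:~R = 'pi ^+ k * y -> (pmod k %| n)%Z.
Proof.
have -> : 'pi ^+ k = ((pmod k)%:~R : Zq) by rewrite /pmod -natrX.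
move=> /(congr1 (fun t : Zq => t k)); rewrite intr_padicE padicME intr_padicE modzz.
by rewrite mul0r mod0z => /dvdz_mod0P.
Qed.

End Padic.

(** Looking for s = 1 + 2 t turns u + 8 w = u s^2 into t^2 + t = 2 w / u, to which Hensel applies
    since the linear coefficient is a unit. *)
Lemma unit_square8 (u w : padic_int 2) : u \is a GRing.unit ->
  exists2 s, s \is a GRing.unit & u + 8 * w = u * s ^+ 2.
Proof.
move=> uu; have p2 : prime 2 by [].
have [||t dt E] := @hensel 2 p2 1 1 (- (2 * w / u)); first by rewrite unitr1.
  by rewrite pdivN //; apply/(pdivP p2); exists (w / u); rewrite mulrA.
exists (1 + 2 * t).
  by apply: unit_Npdiv => //; rewrite ?unitr1 //; apply/(pdivP p2); exists t.
have -> : (1 + 2 * t) ^+ 2 = 1 + 4 * (1 * t ^+ 2 + 1 * t + - (2 * w / u)) + 8 * w / u by ring.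
rewrite E; transitivity (u + 8 * w * (u / u)); last by ring.
by rewrite divrr // mulr1.
Qed.

Lemma int_square8 (a b : int) : ~~ (2 %| a)%Z -> (8 %| b - a)%Z ->
  exists2 s : padic_int 2, s \is a GRing.unit & b%:~R = a%:~R * s ^+ 2.
Proof.
move=> oa /dvdzP[k Ek]; have [|s us Es] := @unit_square8 a%:~R k%:~R.
  by rewrite unit_int.
by exists s => //; rewrite -Es -[b](subrK a) Ek rmorphD rmorphM /= addrC mulrC.
Qed.

(** * Ternary lattices over the p-adic integers *)

Section Local.
Variable q : nat.
Hypothesis pq : prime q.
Local Notation Zq := (padic_int q).
Local Notation "'pi" := (q%:R : Zq).
Implicit Types (G H U : 'M[Zq]_3) (a b c d e f x y z u : Zq).

(** After clearing denominators this is isotropy over the field of q-adic numbers. *)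
Definition isoZ n (G : 'M[Zq]_n) := exists2 x : 'rV[Zq]_n, x != 0 & qform G x = 0.
Definition sqfree_at (d : Zq) := ~ exists z : Zq, d = 'pi ^+ 2 * z.
Definition evenZ n (G : 'M[Zq]_n) := forall x : 'rV[Zq]_n, exists w : Zq, qform G x = 2 * w.

Lemma rv3_neq0 x y z : (rv3 x y z != 0) = ~~ [&& x == 0, y == 0 & z == 0].
Proof.
congr negb; apply/eqP/and3P => [|[/eqP-> /eqP-> /eqP->]]; last exact: rv3_0.
by rewrite -rv3_0 => E; have [-> -> ->] := rv3_inj E.
Qed.

Lemma isometric_isoZ G H : isometric G H -> isoZ H -> isoZ G.
Proof.
move=> [U uU <-] [x x0]; rewrite qform_conj => E; exists (x *m U) => //.
by apply: contra x0 => /eqP xU; rewrite -(mulmxK uU x) xU mul0mx.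
Qed.

Lemma isometric_evenZ G H : isometric G H -> evenZ G -> evenZ H.
Proof. by move=> [U uU <-] ev x; rewrite qform_conj. Qed.

Lemma isometric_sqfree G H : isometric G H -> sqfree_at (\det G) -> sqfree_at (\det H).
Proof.
move=> /isometric_sym/isometric_det[u uu E] sG [z Ez]; apply: sG.
by exists (u ^+ 2 * z); rewrite E Ez; ring.
Qed.

Lemma unit_evenZ G : q != 2 -> evenZ G.
Proof.
move=> q2 x; exists (qform G x / 2); rewrite mulrCA mulrV ?mulr1 //.
rewrite (_ : 2 = (2%:~R : Zq)) // unit_int //.
by apply/negP => d; have : (q %| 2)%N by []; rewrite dvdn_prime2 // (negPf q2).
Qed.

Lemma unit3E x y z :
  [|| x \is a GRing.unit, y \is a GRing.unit | z \is a GRing.unit] =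
  ~~ [&& pdiv_pred x, pdiv_pred y & pdiv_pred z].
Proof. by rewrite !negb_and -!padic_unitE. Qed.

Lemma complete_prim x y z :
  [|| x \is a GRing.unit, y \is a GRing.unit | z \is a GRing.unit] ->
  exists2 U, U \in unitmx & rv3 1 0 0 *m U = rv3 x y z.
Proof.
case/or3P => u.
- exists (mx3 x y z 0 1 0 0 0 1); last by rewrite mul_rv3; congr rv3; ring.
  by rewrite unitmxE det_mx3 (_ : _ + _ = x) //; ring.
- exists (mx3 x y z 1 0 0 0 0 1); last by rewrite mul_rv3; congr rv3; ring.
  by rewrite unitmxE det_mx3 (_ : _ + _ = - y) ?unitrN //; ring.
- exists (mx3 x y z 1 0 0 0 1 0); last by rewrite mul_rv3; congr rv3; ring.
  by rewrite unitmxE det_mx3 (_ : _ + _ = z) //; ring.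
Qed.

Lemma prim_first G x y z : G^T = G ->
  [|| x \is a GRing.unit, y \is a GRing.unit | z \is a GRing.unit] ->
  exists b c d e f, isometric G (smx3 (qform G (rv3 x y z)) b c d e f).
Proof.
move=> sG /complete_prim[U uU E].
have iG : isometric G (U *m G *m U^T) by exists U.
have [a [b [c [d [e [f EG]]]]]] := smx3P (isometric_sym_mx iG sG).
exists b, c, d, e, f; rewrite -E -qform_conj EG qform_rv3.
by rewrite (_ : _ + _ = a); [rewrite -EG | ring].
Qed.

Lemma iso_prim G : isoZ G -> exists x y z, qform G (rv3 x y z) = 0 /\
  [|| x \is a GRing.unit, y \is a GRing.unit | z \is a GRing.unit].
Proof.
move=> [v]; have [x [y [z ->]]] := rv3P v; rewrite rv3_neq0.
move=> /(padic_prim3 pq)[j [x' [y' [z' [-> -> -> u]]]]].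
rewrite -scale_rv3 qformZ => /eqP; rewrite mulf_eq0 expf_eq0 /= expf_eq0.
by rewrite (negPf (pi_neq0 pq)) andbF /= => /eqP E; exists x', y', z'.
Qed.

(** With a primitive isotropic vector first, the determinant is a quadratic form in [d] and [e];
    were both divisible by q, it would be divisible by q^2. So one of them is a unit, and the plane
    it spans with the isotropic vector splits off. *)
Lemma hyp_shape G : G^T = G -> sqfree_at (\det G) -> isoZ G ->
  exists b c, isometric G (smx3 0 b c 1 0 0).
Proof.
move=> sG sq iG; have [x [y [z [Q0 u]]]] := iso_prim iG.
have [b [c [d [e [f iGG]]]]] := prim_first sG u; rewrite Q0 in iGG.
have [d' [e' [b' [c' [f' [ud iG2]]]]]] : exists d e b c f,
    d \is a GRing.unit /\ isometric G (smx3 0 b c d e f).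
  case: (boolP (d \is a GRing.unit)) => [ud|nd]; first by exists d, e, b, c, f.
  case: (boolP (e \is a GRing.unit)) => [ue|ne].
    exists e, d, c, b, f; split => //; apply: isometric_trans iGG _.
    isometry3 (mx3 1 0 0 0 0 1 0 1 0).
  case: (isometric_sqfree iGG sq).
  move: nd ne; rewrite !padic_unitE // !negbK => /(pdivP pq)[d1 ->] /(pdivP pq)[e1 ->].
  by eexists; rewrite det_mx3 /smx3; rewrite [RHS]mulrC; instantiate (1 := - (d1 * (d1 * c - f * e1) - e1 * (d1 * f - b * e1))); ring.
exists (b' / d' ^+ 2), (c' - 2 * f' * e' / d' + b' * (e' / d') ^+ 2).
apply: isometric_trans iG2 _.
exists (mx3 1 0 0 0 d'^-1 0 (b' * e' / d' / d' - f' / d') (- e' / d') 1).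
  by rewrite unitmxE det_mx3 (_ : _ + _ = d'^-1) ?unitrV //; ring.
rewrite tr_mx3 !mul_mx3; have dd := divrr ud; set w := d'^-1 in dd *.
have -> : d' ^- 2 = w ^+ 2 by rewrite /w exprVn.
by congr mx3; ring: dd.
Qed.

(** The plane with a zero corner becomes hyperbolic once [b] is divisible by 2, and the remaining
    entry is minus the determinant up to a unit square. The normal form thus depends on the
    determinant alone. *)
Lemma hyp_form G : G^T = G -> sqfree_at (\det G) -> isoZ G ->
  evenZ G \/ q = 2 /\ \det G \is a GRing.unit ->
  isometric G (smx3 0 0 (- \det G) 1 0 0).
Proof.
move=> sG sq iG ev; have [b [c iGG]] := hyp_shape sG sq iG.
suff [c' iG2] : exists c, isometric G (smx3 0 0 c 1 0 0).
  have [u uu E] := isometric_det iG2; apply: isometric_trans iG2 _.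
  exists (mx3 1 0 0 0 1 0 0 0 u^-1).
    by rewrite unitmxE det_mx3 (_ : _ + _ = u^-1) ?unitrV //; ring.
  have Ec : c' = - (u ^+ 2 * \det G) by rewrite -E det_mx3; ring.
  rewrite tr_mx3 !mul_mx3 Ec; have uu1 := divrr uu; set w := u^-1 in uu1 *.
  by congr mx3; ring: uu1.
have evb h c0 : b = 2 * h \/ True -> forall b0, b0 = 2 * h ->
    isometric (smx3 0 b0 c0 1 0 0) (smx3 0 0 c0 1 0 0).
  move=> _ b0 ->; isometry3 (mx3 1 0 0 (- h) 1 0 0 0 1).
case: ev => [ev|[q2 ud]]; last have E2 : 'pi = 2 := congr1 (fun n => n%:R : Zq) q2.
  have [h Eh] := isometric_evenZ iGG ev (rv3 0 1 0).
  exists c; apply: isometric_trans iGG _; apply: (evb h); first by right.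
  by rewrite -Eh qform_rv3; ring.
have uc : c \is a GRing.unit.
  have [u uu E] := isometric_det iGG.
  have -> : c = - (u ^+ 2 * \det G) by rewrite -E det_mx3; ring.
  by rewrite unitrN unitrMl // unitrX.
case: (boolP (pdiv_pred b)) => [/(pdivP pq)[h Eh]|ub].
  exists c; apply: isometric_trans iGG _; apply: (evb h); first by right.
  by rewrite Eh E2.
(* With [b] and [c] both odd, adding the third basis vector to the second makes the middle entry
   even; subtracting c times the first from the third restores orthogonality. *)
have /(pdivP pq)[h Eh] : pdiv_pred (b + c).
  move: uc ub (padic_modE pq b 1) (padic_modE pq c 1).
  rewrite padic_unitE // /pdiv_pred padicDE // pmod1.
  by move: (b 1%N) (c 1%N) => b1 c1; rewrite q2; lia.
exists c; apply: isometric_trans iGG _.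
apply: (@isometric_trans _ _ _ (smx3 0 (b + c) c 1 0 0)); last first.
  by apply: (evb h); [right | rewrite Eh E2].
isometry3 (mx3 1 0 0 0 1 1 (- c) 0 1).
Qed.

Lemma split_unit a b c d e f : a \is a GRing.unit -> isometric (smx3 a b c d e f)
  (mx3 a 0 0 0 (b - d ^+ 2 / a) (f - d * e / a) 0 (f - d * e / a) (c - e ^+ 2 / a)).
Proof.
move=> ua; exists (mx3 1 0 0 (- d / a) 1 0 (- e / a) 0 1).
  by rewrite unitmxE det_mx3 (_ : _ + _ = 1) ?unitr1 //; ring.
rewrite tr_mx3 !mul_mx3; have aa := divrr ua; set w := a^-1 in aa *.
by congr mx3; ring: aa.
Qed.

Lemma split_unit2 a b c f : b \is a GRing.unit ->
  isometric (mx3 a 0 0 0 b f 0 f c) (mx3 a 0 0 0 b 0 0 0 (c - f ^+ 2 / b)).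
Proof.
move=> ub; exists (mx3 1 0 0 0 1 0 0 (- f / b) 1).
  by rewrite unitmxE det_mx3 (_ : _ + _ = 1) ?unitr1 //; ring.
rewrite tr_mx3 !mul_mx3; have aa := divrr ub; set w := b^-1 in aa *.
by congr mx3; ring: aa.
Qed.

End Local.

(** ** Odd residue characteristic *)

Section FinSquares.
Variable F : finFieldType.
Hypothesis F2 : (2 : F) != 0.

(** Squaring has fibres of at most two elements and a single one over 0, so strictly more than half
    of the field are squares. *)
Lemma card_squares : (#|F| < (#|[set x ^+ 2 | x : F]%SET|).*2)%N.
Proof.
set S := [set x ^+ 2 | x : F]%SET.
have S0 : 0 \in S by apply/imsetP; exists 0; rewrite ?expr0n.
have -> : #|F| = (\sum_(y in S) #|[set x : F | x ^+ 2 == y]%SET|)%N.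
  rewrite -sum1_card (partition_big (fun x : F => x ^+ 2) (mem S)) /=; last first.
    by move=> x _; apply/imsetP; exists x.
  by apply: eq_bigr => y _; rewrite -sum1_card; apply: eq_bigl => x; rewrite !inE.
rewrite (bigD1 0) //= (cardsD1 0 S) S0 doubleD.
have -> : #|[set x : F | x ^+ 2 == 0]%SET| = 1%N.
  by rewrite -(cards1 (0 : F)); congr #|pred_of_set _|; apply/setP => x; rewrite !inE expf_eq0.
rewrite addSn add0n !ltnS -muln2 -sum_nat_const.
rewrite (eq_bigl (mem (S :\ 0)%SET)); last by move=> y; rewrite !inE andbC.
apply: leq_sum => y; rewrite !inE => /andP[_ /imsetP[x0 _ ->]].
apply: (@leq_trans #|[set x0; - x0]%SET|); last by rewrite cards2; case: (_ != _).
by apply/subset_leq_card/fintype.subsetP => x; rewrite !inE eqf_sqr.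
Qed.

(** Pigeonhole: a S and c - b S, with S the set of squares, both contain more than half of the
    field. *)
Lemma squares_meet (a b c : F) : a != 0 -> b != 0 ->
  exists x y, a * x ^+ 2 + b * y ^+ 2 = c.
Proof.
move=> a0 b0; pose S := [set x ^+ 2 | x : F]%SET.
pose A := [set a * s | s in S]%SET; pose B := [set c - b * s | s in S]%SET.
have cA : #|A| = #|S| by apply: card_imset => s t /(mulfI a0).
have cB : #|B| = #|S|.
  by apply: card_imset => s t /addrI/oppr_inj/(mulfI b0).
have : (#|(A :&: B)%SET| > 0)%N.
  have := cardsUI A B; rewrite cA cB addnn => E.
  have : (#|(A :|: B)%SET| <= #|F|)%N by apply: max_card.
  have := card_squares; rewrite -/S -E; lia.
case/card_gt0P => z; rewrite inE => /andP[/imsetP[s /imsetP[x _ ->] ->] /imsetP[t /imsetP[y _ ->] E]].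
by exists x, y; rewrite E subrK.
Qed.

(** The squares and [a] times the squares meet only in 0, so by counting they cover the field. *)
Lemma nonsquare_mul (a b : F) : a != 0 ->
  (forall x, x ^+ 2 != a) -> (forall x, x ^+ 2 != b) -> exists x, b = a * x ^+ 2.
Proof.
move=> a0 na nb; pose S := [set x ^+ 2 | x : F]%SET.
pose A := [set a * s | s in S]%SET.
have cA : #|A| = #|S| by apply: card_imset => s t /(mulfI a0).
have SA : (S :&: A)%SET \subset [set 0]%SET.
  apply/fintype.subsetP => z; rewrite !inE => /andP[/imsetP[x _ ->] /imsetP[s /imsetP[y _ ->] E]].
  have [y0|y0] := eqVneq y 0; first by rewrite E y0 expr0n mulr0.
  by case/eqP: (na (x / y)); rewrite expr_div_n E mulfK // expf_eq0.
have: (#|(S :|: A)%SET| == #|F|)%N.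
  have := cardsUI S A; rewrite cA addnn => E.
  have : (#|(S :|: A)%SET| <= #|F|)%N by apply: max_card.
  have := subset_leq_card SA; rewrite cards1.
  have := card_squares; rewrite -/S -E; lia.
rewrite -cardsT => /eqP cST.
have /eqP SAT : (S :|: A)%SET == [set: F]%SET by rewrite eqEcard finset.subsetT cST leqnn.
have : b \in (S :|: A)%SET by rewrite SAT inE.
rewrite inE => /orP[/imsetP[x _ E]|/imsetP[s /imsetP[x _ ->] ->]]; last by exists x.
by case/eqP: (nb x).
Qed.

End FinSquares.

Lemma intr_modz (R : nzRingType) (q : nat) (n : int) :
  q%:R = 0 :> R -> ((n %% q)%Z)%:~R = n%:~R :> R.
Proof.
move=> q0; have E : n%:~R = ((n %/ q)%Z * q)%:~R + ((n %% q)%Z)%:~R :> R.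
  by rewrite -rmorphD -divz_eq.
by rewrite [RHS]E intrM -[q%:~R]/(q%:R) q0 mulr0 add0r.
Qed.

Section OddLocal.
Variable q : nat.
Hypotheses (pq : prime q) (oq : q != 2).
Local Notation Zq := (padic_int q).
Implicit Types (G H U : 'M[Zq]_3) (a b c d e f x y z u : Zq).

Let res x : 'F_q := (x 1%N)%:~R.

Let intr_mod (n : int) : ((n %% q)%Z)%:~R = n%:~R :> 'F_q.
Proof.
by apply: intr_modz; apply/eqP; rewrite -(dvdn_pcharf (pchar_Fp pq)).
Qed.
Let resD x y : res (x + y) = res x + res y.
Proof. by rewrite /res padicDE // pmod1 intr_mod rmorphD. Qed.
Let resM x y : res (x * y) = res x * res y.
Proof. by rewrite /res padicME // pmod1 intr_mod rmorphM. Qed.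
Let resN x : res (- x) = - res x.
Proof. by rewrite /res padicNE // pmod1 intr_mod rmorphN. Qed.
Let resX2 x : res (x ^+ 2) = res x ^+ 2.
Proof. by rewrite !expr2 resM. Qed.
Let res0 x : (res x == 0) = pdiv_pred x.
Proof.
rewrite /pdiv_pred -[x 1%N]padic_modE // pmod1 /res.
have := modz_ge0 (x 1%N) (_ : q%:Z != 0); have := ltz_mod (x 1%N) (_ : q%:Z != 0).
have q0 : q%:Z != 0 by rewrite eqz_nat -lt0n prime_gt0.
move=> /(_ q0) lt /(_ q0); rewrite -[x 1%N]padic_modE // pmod1.
rewrite modz_mod; case: modz lt => // n lt _.
rewrite -[n%:~R]/(n%:R) -(dvdn_pcharf (pchar_Fp pq)).
apply/idP/idP => [d|/eqP[->]] //; rewrite ?dvdn0 //.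
rewrite eqz_nat -leqn0 leqNgt; apply/negP => n0.
by have := dvdn_leq n0 d; move: lt; rewrite gtr0_norm ?ltz_nat ?prime_gt0 //; lia.
Qed.
Let lift (t : 'F_q) : exists x, res x = t.
Proof.
exists ((t : nat)%:R); rewrite /res natr_padicE // pmod1 intr_mod.
by rewrite -[(_ : nat)%:~R]/((t : nat)%:R) natr_Zp.
Qed.
Let two_neq0 : (2 : 'F_q) != 0.
Proof.
rewrite -(dvdn_pcharf (pchar_Fp pq)); apply/negP.
by rewrite dvdn_prime2 // (negPf oq).
Qed.
Let unitE x : (x \is a GRing.unit) = (res x != 0).
Proof. by rewrite padic_unitE // res0. Qed.

Let unit2 : (2 : Zq) \is a GRing.unit.
Proof.
rewrite (_ : 2 = (2%:~R : Zq)) // unit_int //.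
by apply/negP => d; have : (q %| 2)%N by []; rewrite dvdn_prime2 // (negPf oq).
Qed.

Lemma square_lift x w : w \is a GRing.unit -> pdiv_pred (x ^+ 2 - w) ->
  exists2 s, s \is a GRing.unit & s ^+ 2 = w.
Proof.
move=> uw dv; have ux : x \is a GRing.unit.
  move: uw; rewrite !unitE; apply: contra => /eqP x0.
  by move: dv; rewrite -res0 resD resN resX2 x0 expr0n /= add0r oppr_eq0.
have [||t dt E] := @hensel q pq 1 (2 * x) (x ^+ 2 - w) => //.
  by rewrite unitrMl.
exists (x + t); first by apply: unit_Npdiv.
by rewrite -[w]addr0 -E; ring.
Qed.

(** A solution modulo q has a unit coordinate because [c] is a unit; Hensel lifts that coordinate
    with the other one fixed. *)
Lemma odd_repr a b c : a \is a GRing.unit -> b \is a GRing.unit ->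
  c \is a GRing.unit -> exists x y, a * x ^+ 2 + b * y ^+ 2 = c.
Proof.
move=> ua ub uc.
have a0 : res a != 0 by rewrite -unitE.
have b0 : res b != 0 by rewrite -unitE.
have [x0 [y0]] := squares_meet two_neq0 (res c) a0 b0.
have [x <-] := lift x0; have [y <-] := lift y0 => /eqP.
rewrite -subr_eq0 -!resX2 -!resM -!resD -resN -resD res0 => dv.
have [ux|nx] := boolP (x \is a GRing.unit).
  have [||t dt E] := @hensel q pq a (2 * a * x) (a * x ^+ 2 + b * y ^+ 2 - c) => //.
    by rewrite !unitrMl.
  by exists (x + t), y; rewrite -[RHS]addr0 -E; ring.
have uy : y \is a GRing.unit.
  move: uc nx; rewrite !unitE negbK => c0 /eqP x00; apply: contra c0 => /eqP y00.
  move: dv; rewrite -res0 !resD !resM resN x00 y00 !mul0r !mulr0 !add0r.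
  by rewrite oppr_eq0.
have [||t dt E] := @hensel q pq b (2 * b * y) (a * x ^+ 2 + b * y ^+ 2 - c) => //.
  by rewrite !unitrMl.
by exists x, (y + t); rewrite -[RHS]addr0 -E; ring.
Qed.

Lemma odd_nonsquare u v : u \is a GRing.unit -> v \is a GRing.unit ->
  (forall s, s ^+ 2 <> u) -> (forall s, s ^+ 2 <> v) ->
  exists2 s, s \is a GRing.unit & v = u * s ^+ 2.
Proof.
move=> uu uv nu nv.
have ns w : w \is a GRing.unit -> (forall s, s ^+ 2 <> w) -> forall t, t ^+ 2 != res w.
  move=> uw nw t; have [x <-] := lift t; apply/negP => /eqP E.
  have [||s _ /nw //] := @square_lift x w => //.
  by rewrite -res0 resD resN resX2 E subrr.
have u0 : res u != 0 by rewrite -unitE.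
have [t] := nonsquare_mul two_neq0 u0 (ns _ uu nu) (ns _ uv nv).
have [x <-] := lift t => E.
have [||s us Es] := @square_lift x (v / u).
- by rewrite unitrMl ?unitrV.
- have : res (u * (x ^+ 2 - v / u)) = 0.
    have -> : u * (x ^+ 2 - v / u) = u * x ^+ 2 - v * (u / u) by ring.
    by rewrite divrr // mulr1 resD resN resM resX2 E subrr.
  by rewrite resM => /eqP; rewrite mulf_eq0 -res0; move: uu; rewrite unitE => /negPf ->.
- by exists s => //; rewrite Es mulrCA mulrV // mulr1.
Qed.

Lemma unit_value G : G^T = G -> ~ (exists z, \det G = (q%:R) ^+ 2 * z) ->
  exists x y z, qform G (rv3 x y z) \is a GRing.unit.
Proof.
move=> /smx3P[a [b [c [d [e [f ->]]]]]] sq.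
case: (boolP (a \is a GRing.unit)) => [ua|na].
  by exists 1, 0, 0; rewrite qform_rv3 (_ : _ + _ = a) //; ring.
case: (boolP (b \is a GRing.unit)) => [ua|nb].
  by exists 0, 1, 0; rewrite qform_rv3 (_ : _ + _ = b) //; ring.
case: (boolP (c \is a GRing.unit)) => [ua|nc].
  by exists 0, 0, 1; rewrite qform_rv3 (_ : _ + _ = c) //; ring.
move: (na) (nb) (nc); rewrite !padic_unitE // !negbK => da db dc.
case: (boolP (d \is a GRing.unit)) => [ua|nd].
  exists 1, 1, 0; rewrite qform_rv3 (_ : _ + _ = 2 * d + (a + b)); last by ring.
  by apply: unit_Npdiv => //; rewrite ?unitrMl //; apply: pdivD.
case: (boolP (e \is a GRing.unit)) => [ua|ne].
  exists 1, 0, 1; rewrite qform_rv3 (_ : _ + _ = 2 * e + (a + c)); last by ring.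
  by apply: unit_Npdiv => //; rewrite ?unitrMl //; apply: pdivD.
case: (boolP (f \is a GRing.unit)) => [ua|nf].
  exists 0, 1, 1; rewrite qform_rv3 (_ : _ + _ = 2 * f + (b + c)); last by ring.
  by apply: unit_Npdiv => //; rewrite ?unitrMl //; apply: pdivD.
case: sq; move: nd ne nf; rewrite !padic_unitE // !negbK.
move=> /(pdivP pq)[d1 ->] /(pdivP pq)[e1 ->] /(pdivP pq)[f1 ->].
move: da => /(pdivP pq)[a1 ->]; move: db => /(pdivP pq)[b1 ->].
exists (a1 * (b1 * c - q%:R * f1 ^+ 2) - d1 * (d1 * c - q%:R * f1 * e1) + q%:R * e1 * (d1 * f1 - b1 * e1)).
by rewrite det_mx3; ring.
Qed.

Lemma odd_diag G : G^T = G -> ~ (exists z, \det G = (q%:R) ^+ 2 * z) ->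
  exists a b c, [/\ a \is a GRing.unit, b \is a GRing.unit
    & isometric G (mx3 a 0 0 0 b 0 0 0 c)].
Proof.
move=> sG sq; have [x [y [z uQ]]] := unit_value sG sq.
have pr : [|| x \is a GRing.unit, y \is a GRing.unit | z \is a GRing.unit].
  rewrite unit3E //; apply: contraL uQ => /and3P[dx dy dz]; rewrite padic_unitE // negbK.
  have [a [b [c [d [e [f ->]]]]]] := smx3P sG; rewrite qform_rv3.
  by do !apply: pdivD => //; apply: pdivMr.
have [b [c [d [e [f]]]]] := prim_first sG pr; move: uQ; set a := qform _ _ => ua iG.
have [b1 [c1 [f1 iG1]]] : exists b c f, isometric G (mx3 a 0 0 0 b f 0 f c).
  by do 3 eexists; exact: isometric_trans iG (split_unit _ _ _ _ _ ua).
suff [b2 [c2 [f2 [ub2 iG2]]]] : exists b c f, b \is a GRing.unit /\ isometric G (mx3 a 0 0 0 b f 0 f c).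
  exists a, b2, (c2 - f2 ^+ 2 / b2); split => //.
  exact: isometric_trans iG2 (split_unit2 _ _ _ ub2).
case: (boolP (b1 \is a GRing.unit)) => [ub|nb]; first by exists b1, c1, f1.
case: (boolP (c1 \is a GRing.unit)) => [uc|nc].
  exists c1, b1, f1; split=> //; apply: isometric_trans iG1 _.
  isometry3 (mx3 1 0 0 0 0 1 0 1 0).
case: (boolP (f1 \is a GRing.unit)) => [uf|nf].
  exists (2 * f1 + (b1 + c1)), c1, (f1 + c1); split.
    apply: unit_Npdiv => //; rewrite ?unitrMl //.
    by move: nb nc; rewrite !padic_unitE // !negbK; apply: pdivD.
  apply: isometric_trans iG1 _; isometry3 (mx3 1 0 0 0 1 1 0 0 1).
have := isometric_sqfree iG1 sq; case.
move: nb nc nf; rewrite !padic_unitE // !negbK.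
move=> /(pdivP pq)[b2 ->] /(pdivP pq)[c2 ->] /(pdivP pq)[f2 ->].
by exists (a * (b2 * c2 - f2 ^+ 2)); rewrite det_mx3; ring.
Qed.

Lemma diag_isoZ_sq a b c s : s ^+ 2 = - (a * b) -> a \is a GRing.unit ->
  isoZ (mx3 a 0 0 0 b 0 0 0 c).
Proof.
move=> Es ua; exists (rv3 s a 0).
  by rewrite rv3_neq0; apply/and3P => -[_ /eqP a0]; rewrite a0 unitr0 in ua.
rewrite qform_rv3; transitivity (a * (s ^+ 2 + a * b)); first by ring.
by rewrite Es addNr mulr0.
Qed.

(** A unimodular binary form represents 1, so <a, b, c> becomes <1, a b, c>; a square root of - a b
    would give an isotropic vector. *)
Lemma odd_aniso_form G : G^T = G -> ~ (exists z, \det G = (q%:R) ^+ 2 * z) -> ~ isoZ G ->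
  exists u c, [/\ u \is a GRing.unit, forall s, s ^+ 2 <> - u
    & isometric G (mx3 1 0 0 0 u 0 0 0 c)].
Proof.
move=> sG sq nG; have [a [b [c [ua ub iG]]]] := odd_diag sG sq.
have [x [y /(canRL (addrK _)) E]] := odd_repr ua ub (unitr1 _).
have iG2 : isometric G (mx3 1 0 0 0 (a * b) 0 0 0 c).
  apply: isometric_trans iG _; exists (mx3 x y 0 (- b * y) (a * x) 0 0 0 1).
    by rewrite unitmxE det_mx3 (_ : _ + _ = 1) ?unitr1 //; ring: E.
  by rewrite tr_mx3 !mul_mx3; congr mx3; ring: E.
exists (a * b), c; split => //; first by rewrite unitrMl.
move=> s Es; apply: nG; apply: (isometric_isoZ iG2).
by apply: (@diag_isoZ_sq _ _ _ s); rewrite ?unitr1 // mul1r.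
Qed.

(** Isotropic forms share the normal form of [hyp_form]. For anisotropic ones the negatives of the
    middle entries are nonsquare units, which agree up to a square, and the last entries are then
    compared through the determinant. *)
Lemma odd_local G H : G^T = G -> H^T = H -> \det G = \det H -> \det G != 0 ->
  ~ (exists z, \det G = (q%:R) ^+ 2 * z) -> (isoZ G <-> isoZ H) -> isometric G H.
Proof.
move=> sG sH dGH d0 sq iso.
have [iG|nG] := pselect (isoZ G).
  have iH : isoZ H by apply/iso.
  have h1 := hyp_form pq sG sq iG (or_introl (unit_evenZ pq _ oq)).
  have sq' := sq; rewrite dGH in sq'.
  have h2 := hyp_form pq sH sq' iH (or_introl (unit_evenZ pq _ oq)).
  by apply: isometric_trans h1 _; rewrite dGH; apply: isometric_sym.
have nH : ~ isoZ H by move/iso.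
have [u [c [uu nu iG]]] := odd_aniso_form sG sq nG.
have sq' := sq; rewrite dGH in sq'.
have [v [c' [uv nv iH]]] := odd_aniso_form sH sq' nH.
have [||||s us] := @odd_nonsquare (- u) (- v); rewrite ?unitrN // => /eqP.
rewrite mulNr eqr_opp => /eqP Ev.
have [g ug Eg] := isometric_det iG; have [h uh Eh] := isometric_det iH.
have {Eg} Eg : u * c = g ^+ 2 * \det G by rewrite -Eg det_mx3; ring.
have {Eh} Eh : v * c' = h ^+ 2 * \det G by rewrite dGH -Eh det_mx3; ring.
have Ec : c' = c * (h / g / s) ^+ 2.
  apply: (@mulrI _ (g ^+ 2 * v)); first by rewrite unitrMl // unitrX.
  rewrite -mulrA Eh Ev; have gg := divrr ug; have ss := divrr us.
  by set g' := g^-1 in gg *; set s' := s^-1 in ss *; ring: gg ss Eg.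
apply: isometric_trans iG _; apply: isometric_trans (isometric_sym iH).
exists (mx3 1 0 0 0 s 0 0 0 (h / g / s)).
  rewrite unitmxE det_mx3 (_ : _ + _ = s * (h / g / s)); last by ring.
  by rewrite !unitrM !unitrV us ug uh.
by rewrite tr_mx3 !mul_mx3 Ev Ec; congr mx3; ring.
Qed.

End OddLocal.

(** ** The prime two *)

Section Two.
Local Notation Z2 := (padic_int 2).
Implicit Types (G H U : 'M[Z2]_3) (a b c d e f x y z u : Z2).
Let p2 : prime 2 := isT.

Lemma pdiv_addunit a b : a \is a GRing.unit -> b \is a GRing.unit -> pdiv_pred (a + b).
Proof.
move: (padic_modE p2 a 1) (padic_modE p2 b 1).
rewrite !padic_unitE // /pdiv_pred padicDE // pmod1.
by move: (a 1%N) (b 1%N) => a1 b1; lia.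
Qed.

Lemma pdiv2M x : pdiv_pred (2 * x).
Proof. by apply/(pdivP p2); exists x. Qed.

Lemma pdiv2E x : pdiv_pred x -> exists y, x = 2 * y.
Proof. by case/(pdivP p2) => y ->; exists y. Qed.

Lemma even_entries G : G^T = G -> evenZ G ->
  exists a b c d e f, G = smx3 (2 * a) (2 * b) (2 * c) d e f.
Proof.
move=> /smx3P[a [b [c [d [e [f ->]]]]]] ev.
have [a' Ea] := ev (rv3 1 0 0); have [b' Eb] := ev (rv3 0 1 0).
have [c' Ec] := ev (rv3 0 0 1).
exists a', b', c', d, e, f; rewrite -Ea -Eb -Ec !qform_rv3.
by congr (smx3 _ _ _ _ _ _); ring.
Qed.

(** An even plane with unit off-diagonal entry is unimodular and splits off, leaving 2 c'.
    Square-freeness makes c' a unit, and Hensel finds an isotropic vector with third coordinate 1 or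
    0 according as [a] is odd or even. *)
Lemma even_isoZ_unit a b c d e f : d \is a GRing.unit ->
  sqfree_at (\det (smx3 (2 * a) (2 * b) (2 * c) d e f)) ->
  isoZ (smx3 (2 * a) (2 * b) (2 * c) d e f).
Proof.
set G := smx3 _ _ _ _ _ _ => ud sq.
pose D := 4 * a * b - d ^+ 2.
have uD : D \is a GRing.unit.
  rewrite /D addrC; apply: unit_Npdiv => //; first by rewrite unitrN unitrX.
  by rewrite (_ : 4 * a * b = 2 * (2 * a * b)) ?pdiv2M //; ring.
have DD := divrr uD; set D' := D^-1 in DD.
(* Cramer's rule for the correction that makes the third basis vector orthogonal to the plane. *)
pose s := D' * (d * f - 2 * b * e); pose t := D' * (d * e - 2 * a * f).
pose c' := c + s * e + t * f + a * s ^+ 2 + d * s * t + b * t ^+ 2.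
have iG : isometric G (smx3 (2 * a) (2 * b) (2 * c') d 0 0).
  exists (mx3 1 0 0 0 1 0 s t 1).
    by rewrite unitmxE det_mx3 (_ : _ + _ = 1) ?unitr1 //; ring.
  have E1 : e + 2 * a * s + d * t = 0.
    by transitivity (e * (1 - D * D')); [rewrite /s /t /D; ring | rewrite DD subrr mulr0].
  have E2 : f + d * s + 2 * b * t = 0.
    by transitivity (f * (1 - D * D')); [rewrite /s /t /D; ring | rewrite DD subrr mulr0].
  rewrite tr_mx3 !mul_mx3; congr mx3; try ring.
  - by rewrite -[RHS]E1; ring.
  - by rewrite -[RHS]E2; ring.
  - by rewrite -[RHS]E1; ring.
  - by rewrite -[RHS]E2; ring.
  by rewrite /c'; ring.
apply: (isometric_isoZ iG).
have [uc'|nc'] := boolP (c' \is a GRing.unit); last first.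
  case: (isometric_sqfree iG sq); move: nc'; rewrite padic_unitE // negbK.
  by move=> /pdiv2E[w ->]; exists (D * w); rewrite det_mx3 /D; ring.
have [ua|na] := boolP (a \is a GRing.unit).
  have [||y _ E] := @hensel 2 p2 b d (a + c') => //; first exact: pdiv_addunit.
  exists (rv3 1 y 1); first by rewrite rv3_neq0 oner_eq0.
  rewrite qform_rv3; transitivity (2 * (b * y ^+ 2 + d * y + (a + c'))); first by ring.
  by rewrite E mulr0.
have [||y _ E] := @hensel 2 p2 b d a => //; first by move: na; rewrite padic_unitE // negbK.
exists (rv3 1 y 0); first by rewrite rv3_neq0 oner_eq0.
rewrite qform_rv3; transitivity (2 * (b * y ^+ 2 + d * y + a)); first by ring.
by rewrite E mulr0.
Qed.

Lemma even_isoZ G : G^T = G -> evenZ G -> sqfree_at (\det G) -> isoZ G.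
Proof.
move=> sG /(even_entries sG)[a [b [c [d [e [f EG]]]]]] sq.
have iG : isometric G (smx3 (2 * a) (2 * b) (2 * c) d e f) by rewrite -EG; apply: isometric_refl.
have [ud|nd] := boolP (d \is a GRing.unit).
  by apply: (isometric_isoZ iG); apply: even_isoZ_unit => //; rewrite -EG.
have [ue|ne] := boolP (e \is a GRing.unit).
  have i2 : isometric G (smx3 (2 * a) (2 * c) (2 * b) e d f).
    apply: isometric_trans iG _; isometry3 (mx3 1 0 0 0 0 1 0 1 0).
  by apply: (isometric_isoZ i2); apply: even_isoZ_unit => //; apply: (isometric_sqfree i2).
have [uf|nf] := boolP (f \is a GRing.unit).
  have i2 : isometric G (smx3 (2 * b) (2 * c) (2 * a) f d e).
    apply: isometric_trans iG _; isometry3 (mx3 0 1 0 0 0 1 1 0 0).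
  by apply: (isometric_isoZ i2); apply: even_isoZ_unit => //; apply: (isometric_sqfree i2).
case: sq; move: nd ne nf; rewrite !padic_unitE // !negbK.
move=> /pdiv2E[d' Ed] /pdiv2E[e' Ee] /pdiv2E[f' Ef].
exists (2 * (a * (b * c - f' ^+ 2) - d' * (d' * c - f' * e') + e' * (d' * f' - b * e'))).
by rewrite EG det_mx3 Ed Ee Ef; ring.
Qed.

Lemma nonevenZ G : G^T = G -> ~ evenZ G ->
  exists b c d e f a, a \is a GRing.unit /\ isometric G (smx3 a b c d e f).
Proof.
move=> sG nev.
have [x [y [z u]]] : exists x y z, qform G (rv3 x y z) \is a GRing.unit.
  apply: contra_notP nev => /forallNP H v; have [x [y [z ->]]] := rv3P v.
  apply: pdiv2E; apply/negPn; rewrite -padic_unitE //; apply/negP => u.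
  by apply: (H x); exists y, z.
have pr : [|| x \is a GRing.unit, y \is a GRing.unit | z \is a GRing.unit].
  rewrite unit3E //; apply: contraL u => /and3P[dx dy dz]; rewrite padic_unitE // negbK.
  have [a [b [c [d [e [f ->]]]]]] := smx3P sG; rewrite qform_rv3.
  by apply: pdivD => //; [apply: pdivD => //|]; apply: pdivMr.
have [b [c [d [e [f iG]]]]] := prim_first sG pr.
by exists b, c, d, e, f; eexists; split; last exact: iG.
Qed.

Lemma odd2_form G : G^T = G -> \det G \is a GRing.unit -> ~ evenZ G ->
  exists a b c f, [/\ a \is a GRing.unit, f \is a GRing.unit
    & isometric G (mx3 a 0 0 0 (2 * b) f 0 f (2 * c))].
Proof.
move=> sG ud nev; have [b [c [d [e [f [a [ua iG]]]]]]] := nonevenZ sG nev.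
have [b1 [c1 [f1 iG1]]] : exists b c f, isometric G (mx3 a 0 0 0 b f 0 f c).
  by do 3 eexists; exact: isometric_trans iG (split_unit _ _ _ _ _ ua).
have uD : b1 * c1 - f1 ^+ 2 \is a GRing.unit.
  have [u uu E] := isometric_det iG1.
  have Ed : \det (mx3 a 0 0 0 b1 f1 0 f1 c1) = a * (b1 * c1 - f1 ^+ 2) by rewrite det_mx3; ring.
  have : \det (mx3 a 0 0 0 b1 f1 0 f1 c1) \is a GRing.unit by rewrite E unitrMl // unitrX.
  by rewrite Ed unitrM => /andP[].
have diag b2 c2 : b2 \is a GRing.unit -> c2 \is a GRing.unit ->
    isometric G (mx3 a 0 0 0 b2 0 0 0 c2) ->
    exists a b c f, [/\ a \is a GRing.unit, f \is a GRing.unit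
    & isometric G (mx3 a 0 0 0 (2 * b) f 0 f (2 * c))].
  move=> ub uc iG2; have [g Eg] := pdiv2E (pdiv_addunit ua ub).
  have [h Eh] := pdiv2E (pdiv_addunit ub uc).
  have us : a + b2 + c2 \is a GRing.unit.
    by rewrite addrC Eg; apply: unit_Npdiv => //; apply: pdiv2M.
  exists (a + b2 + c2), (a * b2 * g), (b2 * c2 * h), (- (a * b2 * c2)); split => //.
    by rewrite unitrN !unitrM ua ub.
  (* The sum of three orthogonal vectors of odd norm has odd norm, and its orthogonal complement,
     spanned by the last two rows, is even. *)
  apply: isometric_trans iG2 _; exists (mx3 1 1 1 b2 (- a) 0 0 c2 (- b2)).
    rewrite unitmxE det_mx3 (_ : _ + _ = b2 * (a + b2 + c2)) ?unitrM ?ub ?us //; ring.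
  rewrite tr_mx3 !mul_mx3; congr mx3; try ring.
    by transitivity (a * b2 * (a + b2)); [ring|rewrite Eg; ring].
  by transitivity (b2 * c2 * (b2 + c2)); [ring|rewrite Eh; ring].
have elim b2 c2 f2 : b2 \is a GRing.unit -> b2 * c2 - f2 ^+ 2 \is a GRing.unit ->
    isometric G (mx3 a 0 0 0 b2 f2 0 f2 c2) ->
    exists a b c f, [/\ a \is a GRing.unit, f \is a GRing.unit
    & isometric G (mx3 a 0 0 0 (2 * b) f 0 f (2 * c))].
  move=> ub uD2 iG2; apply: (diag b2 (c2 - f2 ^+ 2 / b2)) => //.
    rewrite (_ : _ - _ = (b2 * c2 - f2 ^+ 2) / b2) ?unitrM ?unitrV ?ub ?uD2 //.
    by rewrite mulrBl [b2 * c2]mulrC mulrK.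
  exact: isometric_trans iG2 (split_unit2 _ _ _ ub).
have [ub|nb] := boolP (b1 \is a GRing.unit); first exact: (elim b1 c1 f1).
have [uc|nc] := boolP (c1 \is a GRing.unit).
  apply: (elim c1 b1 f1) => //; first by rewrite [c1 * _]mulrC.
  apply: isometric_trans iG1 _; isometry3 (mx3 1 0 0 0 0 1 0 1 0).
move: nb nc; rewrite !padic_unitE // !negbK => /pdiv2E[b2 Eb] /pdiv2E[c2 Ec].
exists a, b2, c2, f1; split=> //; last by rewrite -Eb -Ec.
apply: contraLR uD; rewrite !padic_unitE // !negbK => df.
apply: pdivD => //; first by rewrite Eb -mulrA; apply: pdiv2M.
by rewrite pdivN // expr2; apply: pdivM.
Qed.

(** If [b] or [c] were even, Hensel would give an isotropic vector in the even plane. When both are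
    odd, b x^2 + f x + c = 1 is soluble, and the resulting vector of norm 2 starts the required
    basis of the plane. *)
Lemma odd2_aniso_form G : G^T = G -> \det G \is a GRing.unit -> ~ evenZ G -> ~ isoZ G ->
  exists2 a, a \is a GRing.unit & isometric G (mx3 a 0 0 0 2 1 0 1 2).
Proof.
move=> sG ud nev nG; have [a [b [c [f [ua uf iG]]]]] := odd2_form sG ud nev.
exists a => //; apply: (isometric_trans iG).
have ub : b \is a GRing.unit.
  apply/negPn; rewrite padic_unitE // negbK; apply/negP => db; apply: nG.
  apply: (isometric_isoZ iG); have [||y _ E] := @hensel 2 p2 c f b => //.
  exists (rv3 0 1 y); first by rewrite rv3_neq0 oner_eq0 !andbF.
  rewrite qform_rv3; transitivity (2 * (c * y ^+ 2 + f * y + b)); first by ring.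
  by rewrite E mulr0.
have uc : c \is a GRing.unit.
  apply/negPn; rewrite padic_unitE // negbK; apply/negP => db; apply: nG.
  apply: (isometric_isoZ iG); have [||y _ E] := @hensel 2 p2 b f c => //.
  exists (rv3 0 y 1); first by rewrite rv3_neq0 oner_eq0 !andbF.
  rewrite qform_rv3; transitivity (2 * (b * y ^+ 2 + f * y + c)); first by ring.
  by rewrite E mulr0.
have [||x dx E] := @hensel 2 p2 b f (c - 1) => //.
  by apply: pdiv_addunit; rewrite ?unitrN1.
pose g := 2 * b * x + f.
have ug : g \is a GRing.unit.
  by rewrite /g addrC; apply: unit_Npdiv => //; rewrite -mulrA; apply: pdiv2M.
have gg := divrr ug; pose c2 := b / g / g.
have uc2 : c2 \is a GRing.unit by rewrite !unitrM !unitrV ub ug.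
apply: (@isometric_trans _ _ _ (mx3 a 0 0 0 2 1 0 1 (2 * c2))).
  exists (mx3 1 0 0 0 x 1 0 g^-1 0).
    by rewrite unitmxE det_mx3 (_ : _ + _ = - g^-1) ?unitrN ?unitrV //; ring.
  have E' : b * x ^+ 2 = 1 - c - f * x by rewrite -[RHS]addr0 -E; ring.
  rewrite tr_mx3 !mul_mx3 /c2; set g' := g^-1 in gg *; congr mx3; try ring: E'.
  - by transitivity (g * g'); [rewrite /g; ring | exact: gg].
  - by transitivity (g * g'); [rewrite /g; ring | exact: gg].
(* The vector (y, 1 - 2 y) keeps product 1 with the first one; this quadratic asks that its norm be
   2. *)
have [||y dy E2] := @hensel 2 p2 (4 * c2 - 1) (1 - 4 * c2) (c2 - 1).
- apply: unit_Npdiv; rewrite ?unitr1 // pdivN //.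
  by rewrite (_ : 4 * c2 = 2 * (2 * c2)) ?pdiv2M //; ring.
- by apply: pdiv_addunit; rewrite ?unitrN1.
exists (mx3 1 0 0 0 1 0 0 y (1 - 2 * y)).
  rewrite unitmxE det_mx3 (_ : _ + _ = 1 - 2 * y); last by ring.
  by apply: unit_Npdiv; rewrite ?unitr1 // pdivN // pdiv2M.
rewrite tr_mx3 !mul_mx3; congr mx3; try ring.
transitivity (2 + 2 * ((4 * c2 - 1) * y ^+ 2 + (1 - 4 * c2) * y + (c2 - 1))); first by ring.
by rewrite E2 mulr0 addr0.
Qed.

(** Even forms are isotropic and fall under [hyp_form], as do isotropic odd ones; an anisotropic odd
    form is <a> plus a fixed plane, with 3 a the determinant up to a unit square. *)
Lemma two_local G H : G^T = G -> H^T = H -> \det G = \det H ->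
  sqfree_at (\det G) ->
  (evenZ G /\ evenZ H) \/ [/\ \det G \is a GRing.unit, ~ evenZ G, ~ evenZ H & (isoZ G <-> isoZ H)] ->
  isometric G H.
Proof.
move=> sG sH dGH sq; have sq' := sq; rewrite dGH in sq'.
case=> [[evG evH]|[ud nG nH iso]].
  have h1 := hyp_form p2 sG sq (even_isoZ sG evG sq) (or_introl evG).
  have h2 := hyp_form p2 sH sq' (even_isoZ sH evH sq') (or_introl evH).
  by apply: isometric_trans h1 _; rewrite dGH; apply: isometric_sym.
have [iG|niG] := pselect (isoZ G).
  have h1 := hyp_form p2 sG sq iG (or_intror (conj erefl ud)).
  rewrite dGH in ud; have h2 := hyp_form p2 sH sq' (iso.1 iG) (or_intror (conj erefl ud)).
  by apply: isometric_trans h1 _; rewrite dGH; apply: isometric_sym.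
have [a ua i1] := odd2_aniso_form sG ud nG niG.
have udH := ud; rewrite dGH in udH.
have [b ub i2] := odd2_aniso_form sH udH nH (fun i => niG (iso.2 i)).
have [u uu Eu] := isometric_det i1; have [v uv Ev] := isometric_det i2.
have {Eu} Eu : 3 * a = u ^+ 2 * \det G by rewrite -Eu det_mx3; ring.
have {Ev} Ev : 3 * b = v ^+ 2 * \det G by rewrite dGH -Ev det_mx3; ring.
have u3 : (3 : Z2) \is a GRing.unit by rewrite (_ : 3 = (3%:~R : Z2)) // unit_int.
apply: isometric_trans i1 _; apply: isometric_trans (isometric_sym i2).
exists (mx3 (v / u) 0 0 0 1 0 0 0 1).
  by rewrite unitmxE det_mx3 (_ : _ + _ = v / u) ?unitrM ?uv ?unitrV //; ring.
rewrite tr_mx3 !mul_mx3; congr mx3; try ring.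
apply: (@mulrI _ (3 * u ^+ 2)); first by rewrite unitrM u3 unitrX.
have uu1 := divrr uu; set w := u^-1 in uu1 *.
by transitivity (u ^+ 2 * (3 * b)); [rewrite Ev; ring: uu1 Eu|ring].
Qed.

End Two.

(** * Genera of stable lattices *)

Lemma ext_inj n : injective (@ext n rat).
Proof.
move=> A B /matrixP E; apply/matrixP => i j.
by have := E i j; rewrite !mxE => /intr_inj.
Qed.

Lemma det_ext n (R : comNzRingType) (G : 'M[int]_n) : \det (ext R G) = (\det G)%:~R.
Proof. exact: det_map_mx. Qed.

Lemma tr_ext n (R : comNzRingType) (G : 'M[int]_n) : (ext R G)^T = ext R G^T.
Proof. by rewrite /ext map_trmx. Qed.

Lemma ext_mul n (R : comNzRingType) (A B : 'M[int]_n) : ext R (A *m B) = ext R A *m ext R B.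
Proof. exact: map_mxM. Qed.

Lemma clear_den n (T : 'M[rat]_n) : exists2 N : int, N != 0 &
  exists T' : 'M[int]_n, ext rat T' = N%:~R *: T.
Proof.
pose N := \prod_(k : 'I_n * 'I_n) denq (T k.1 k.2).
have N0 : N != 0 by apply/prodf_neq0 => k _; rewrite denq_neq0.
have dN i j : (denq (T i j) %| N)%Z.
  by rewrite /N (bigD1 (i, j)) //= dvdz_mulr.
exists N => //; exists (\matrix_(i, j) (numq (T i j) * (N %/ denq (T i j))%Z)).
apply/matrixP => i j; rewrite !mxE.
rewrite -[N in RHS](divzK (dN i j)) !rmorphM /= numqE; ring.
Qed.

Lemma lattice_gt0 n (G : 'M[int]_n) (x : 'rV[int]_n) : lattice G -> x != 0 -> 0 < qform G x.
Proof.
move=> [_ pG] x0; have := pG (map_mx intr x).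
rewrite /qform map_bform ltr0z; apply; apply: contra x0 => /eqP/rowP E.
by apply/eqP/rowP => i; have := E i; rewrite !mxE => /eqP; rewrite intr_eq0 => /eqP.
Qed.

Lemma lattice_ge0 n (G : 'M[int]_n) (x : 'rV[int]_n) : lattice G -> 0 <= qform G x.
Proof.
by move=> lG; have [->|x0] := eqVneq x 0; [rewrite qform0|apply/ltW/lattice_gt0].
Qed.

(** Positivity is evaluated at the first basis vector, at (-d, a, 0) and at the row of cofactors,
    where the form takes the values a, a M and M det, with M the second minor. *)
Lemma lattice_minors a b c d e f : lattice (smx3 a b c d e f) ->
  [/\ 0 < a, 0 < a * b - d ^+ 2 & 0 < \det (smx3 a b c d e f)].
Proof.
move=> lG.
have nz (x y z : int) : (x != 0) || (y != 0) || (z != 0) -> rv3 x y z != 0.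
  apply: contraL => /eqP; rewrite -rv3_0 => E; have [-> -> ->] := rv3_inj E.
  by rewrite eqxx.
have a0 : 0 < a.
  have /(lattice_gt0 lG) := nz 1 0 0 isT; rewrite qform_rv3 (_ : _ + _ = a) //; ring.
have m0 : 0 < a * b - d ^+ 2.
  have /(lattice_gt0 lG) : rv3 (- d) a 0 != 0 by apply: nz; rewrite (gt_eqF a0) orbT.
  rewrite (_ : qform _ _ = a * (a * b - d ^+ 2)); last by rewrite qform_rv3; ring.
  by rewrite pmulr_rgt0.
split=> //.
have /(lattice_gt0 lG) : rv3 (d * f - b * e) (d * e - a * f) (a * b - d ^+ 2) != 0.
  by apply: nz; rewrite (gt_eqF m0) orbT.
rewrite (_ : qform _ _ = (a * b - d ^+ 2) * \det (smx3 a b c d e f)); last first.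
  by rewrite qform_rv3 det_mx3; ring.
by rewrite pmulr_rgt0.
Qed.

Lemma lattice_diag n (G : 'M[int]_n) i : lattice G -> 0 < G i i.
Proof.
rewrite -(bform_delta G) => lG; apply: (lattice_gt0 lG).
by apply/eqP => /rowP/(_ i); rewrite !mxE !eqxx.
Qed.

Lemma lattice_diag1 a b c d e f : lattice (smx3 a b c d e f) -> 0 < b.
Proof. by move=> /(lattice_diag o1); rewrite mxE. Qed.

Lemma lattice_det_gt0 (G : 'M[int]_3) : lattice G -> 0 < \det G.
Proof.
move=> lG; have [sG _] := lG; have [a [b [c [d [e [f E]]]]]] := smx3P sG.
by rewrite E in lG *; have [] := lattice_minors lG.
Qed.

Lemma lattice_isometric n (G H : 'M[int]_n) :
  lattice G -> isometric (ext rat G) (ext rat H) -> lattice H.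
Proof.
move=> [sG pG] iGH; split.
  apply: ext_inj; rewrite -tr_ext; apply: (isometric_sym_mx iGH).
  by rewrite tr_ext sG.
case: iGH => U uU <- x x0; rewrite qform_conj; apply: pG.
by apply: contra x0 => /eqP xU; rewrite -(mulmxK uU x) xU mul0mx.
Qed.

(** Cleared of denominators, the rational isometry is an integral similitude, and that acts over the
    q-adic integers. *)
Lemma rational_isoZ q (G H : 'M[int]_3) : prime q -> \det H != 0 ->
  isometric (ext rat G) (ext rat H) ->
  isoZ (ext (padic_int q) H) -> isoZ (ext (padic_int q) G).
Proof.
move=> pq dH [T uT ET] [x x0 Qx].
have [N N0 [T' ET']] := clear_den T.
have E : T' *m G *m T'^T = N ^+ 2 *: H.
  apply: ext_inj; rewrite !ext_mul -tr_ext ET' linearZ /= -!scalemxAl -scalemxAr scalerA.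
  by rewrite ET; apply/matrixP => i j; rewrite !mxE rmorphM /= expr2 rmorphM.
have dT : \det T' != 0.
  have /eqP := congr1 determinant E; apply: contraTneq => dT.
  by rewrite !det_mulmx dT !mul0r detZ eq_sym mulf_neq0 // expf_neq0 // expf_neq0.
exists (x *m ext _ T').
  apply: contra x0 => /eqP xT; have := congr1 (mulmx^~ (\adj (ext _ T'))) xT.
  rewrite -mulmxA mul_mx_adj mul0mx mul_mx_scalar det_ext => /rowP E0.
  apply/eqP/rowP => i; have := E0 i; rewrite !mxE => /eqP.
  by rewrite mulf_eq0 intr_padic_eq0 // (negPf dT) => /eqP.
rewrite -qform_conj tr_ext -!ext_mul E.
have -> : ext (padic_int q) (N ^+ 2 *: H) = (N ^+ 2)%:~R *: ext (padic_int q) H.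
  by apply/matrixP => i j; rewrite !mxE rmorphM.
by rewrite qform_scale Qx mulr0.
Qed.

Lemma map_rv_int q (x : 'rV[int]_3) (G : 'M[int]_3) :
  qform (ext (padic_int q) G) (map_mx intr x) = (qform G x)%:~R.
Proof. exact: map_bform. Qed.

Lemma evenZ_ext (G : 'M[int]_3) : G^T = G ->
  evenZ (ext (padic_int 2) G) <-> even_lattice G.
Proof.
move=> sG; split=> [ev x|ev].
  have [w E] := ev (map_mx intr x); have p2 : prime 2 by [].
  rewrite map_rv_int in E.
  by have := pdiv_int p2 (qform G x); rewrite E pdiv2M => /esym.
move: ev; have [a [b [c [d [e [f ->]]]]]] := smx3P sG => ev v.
have [x [y [z ->]]] := rv3P v.
have /dvdzP[a' Ea] := ev (rv3 1 0 0); have /dvdzP[b' Eb] := ev (rv3 0 1 0).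
have /dvdzP[c' Ec] := ev (rv3 0 0 1).
have {}Ea : a = a' * 2 by rewrite -Ea qform_rv3; ring.
have {}Eb : b = b' * 2 by rewrite -Eb qform_rv3; ring.
have {}Ec : c = c' * 2 by rewrite -Ec qform_rv3; ring.
exists (a'%:~R * x ^+ 2 + b'%:~R * y ^+ 2 + c'%:~R * z ^+ 2 +
        d%:~R * x * y + e%:~R * x * z + f%:~R * y * z).
by rewrite /ext map_mx3 qform_rv3 Ea Eb Ec !rmorphM /=; ring.
Qed.

Definition sqfreez (d : int) := forall q, prime q -> ~~ ((q ^ 2)%N %| d)%Z.

Lemma sqfreez_at d q : prime q -> sqfreez d -> sqfree_at (d%:~R : padic_int q).
Proof.
by move=> pq sd [z /(intr_dvd_padic pq)]; rewrite /pmod => h; have := sd q pq; rewrite h.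
Qed.

Lemma sqfreezP (d : int) : d != 0 ->
  (forall q, prime q -> (logn q `|d| <= 1)%N) -> sqfreez d.
Proof.
move=> d0 H q pq; apply/negP; rewrite dvdzE absz_nat pfactor_dvdn ?absz_gt0 //.
by rewrite leqNgt ltnS H.
Qed.

(** The local classifications ask only for equal determinants, equal parity at 2 and simultaneous
    isotropy; the last is inherited from the rational isometry. *)
Lemma genus_intro (K H : 'M[int]_3) : lattice K -> sqfreez (\det K) ->
  (even_lattice K \/ ~~ (2 %| \det K)%Z) ->
  isometric (ext rat K) (ext rat H) -> \det H = \det K ->
  (even_lattice K <-> even_lattice H) -> genus K H.
Proof.
move=> lK sd evK iKH dKH ev; have lH := lattice_isometric lK iKH.
split=> // q pq.
have [sK _] := lK; have [sH _] := lH.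
have dK0 : \det K != 0 by rewrite gt_eqF // lattice_det_gt0.
have sK' : (ext (padic_int q) K)^T = ext (padic_int q) K by rewrite tr_ext sK.
have sH' : (ext (padic_int q) H)^T = ext (padic_int q) H by rewrite tr_ext sH.
have dE : \det (ext (padic_int q) K) = \det (ext (padic_int q) H) by rewrite !det_ext dKH.
have iso : isoZ (ext (padic_int q) K) <-> isoZ (ext (padic_int q) H).
  split; apply: rational_isoZ => //; last by rewrite dKH.
  exact: isometric_sym.
have sq : sqfree_at (\det (ext (padic_int q) K)) by rewrite det_ext; apply: sqfreez_at.
have [q2|q2] := eqVneq q 2; last first.
  by apply: (odd_local pq) => //; rewrite det_ext intr_padic_eq0.
move: sK' sH' dE iso sq; rewrite q2 => sK' sH' dE iso sq.
apply: two_local => //; have [e|ne] := pselect (even_lattice K).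
  by left; split; apply/evenZ_ext => //; apply/ev.
right; split=> //; first by rewrite det_ext unit_int //; case: evK.
  by move/evenZ_ext => /(_ sK).
by move/evenZ_ext => /(_ sH)/ev.
Qed.

Lemma local_isometric_dvd q k (G H : 'M[int]_3) : prime q ->
  locally_isometric q G H -> (pmod q k %| \det G)%Z -> (pmod q k %| \det H)%Z.
Proof.
move=> pq /isometric_det[u uu]; rewrite !det_ext => E /dvdzP[c Ec].
apply: (@intr_dvd_padic q pq k _ (u ^+ 2 * c%:~R)).
by rewrite E Ec rmorphM /= /pmod -natrX; ring.
Qed.

Lemma genus_sym n (G H : 'M[int]_n) : lattice G -> genus G H -> genus H G.
Proof.
move=> lG [lH iQ iL]; split => //; first exact: isometric_sym.
by move=> q pq; apply/isometric_sym/iL.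
Qed.

Lemma genus_det (K H : 'M[int]_3) : lattice K -> genus K H -> \det H = \det K.
Proof.
move=> lK gH; have gK := genus_sym lK gH.
have dK := lattice_det_gt0 lK; have [lH _ iH] := gH; have dH := lattice_det_gt0 lH.
have [_ _ iK] := gK.
have: `|\det H|%N = `|\det K|%N; last by lia.
apply: eqn_from_log; rewrite ?absz_gt0 ?gt_eqF // => q.
have [pq|npq] := boolP (prime q); last by rewrite /logn (negPf npq).
have le (A B : 'M[int]_3) : 0 < \det A -> 0 < \det B -> locally_isometric q A B ->
    (logn q `|\det A| <= logn q `|\det B|)%N.
  move=> A0 B0 iAB; rewrite -pfactor_dvdn ?absz_gt0 ?gt_eqF //.
  have := @local_isometric_dvd q (logn q `|\det A|) A B pq iAB.
  by rewrite /pmod !dvdzE absz_nat; apply; apply: pfactor_dvdnn.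
by apply/eqP; rewrite eqn_leq !le //; [exact: iH | exact: iK].
Qed.

Lemma local_even (G H : 'M[int]_3) : G^T = G -> H^T = H ->
  locally_isometric 2 G H -> even_lattice G -> even_lattice H.
Proof.
by move=> sG sH iGH /(evenZ_ext sG) ev; apply/(evenZ_ext sH); apply: isometric_evenZ ev.
Qed.

Lemma genus_even (K H : 'M[int]_3) : lattice K -> genus K H ->
  (even_lattice K <-> even_lattice H).
Proof.
move=> [sK _] [[sH _] _ iH]; split; apply: local_even => //; last first.
  exact/isometric_sym/iH.
exact: iH.
Qed.

Lemma isometric_even n (G H : 'M[int]_n) : isometric G H -> even_lattice G -> even_lattice H.
Proof. by move=> [U _ <-] ev x; rewrite qform_conj. Qed.

Lemma genus_isometric n (G H H' : 'M[int]_n) : genus G H -> isometric H H' -> genus G H'.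
Proof.
move=> [lH iQ iL] iH; have iE S := isometric_ext S iH; split.
- exact: lattice_isometric lH (iE _).
- exact: isometric_trans iQ (iE _).
- by move=> q pq; apply: isometric_trans (iL q pq) (iE _).
Qed.

Lemma genus_lattice n (G H : 'M[int]_n) : genus G H -> lattice H.
Proof. by case. Qed.

Lemma stable_sqfree K : stable K -> sqfreez (\det K).
Proof.
by move=> [lK _ ord _]; apply: sqfreezP => //; rewrite gt_eqF // lattice_det_gt0.
Qed.

Lemma stable_even2 K : stable K -> (even_lattice K <-> (2 %| \det K)%Z).
Proof.
move=> [lK _ ord iff]; have d0 := lattice_det_gt0 lK; split.
  move/iff => l1; have : (2 ^ 1 %| `|\det K|)%N by rewrite pfactor_dvdn ?l1 ?absz_gt0 ?gt_eqF.
  by rewrite expn1.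
move=> d2; apply/iff/eqP; rewrite eqn_leq ord //=.
by rewrite -pfactor_dvdn ?absz_gt0 ?gt_eqF // expn1.
Qed.

(** For odd determinant equality of parity is automatic, an even ternary form having even
    determinant; so one implication is enough. *)
Lemma stable_genus (K H : 'M[int]_3) : stable K ->
  isometric (ext rat K) (ext rat H) -> \det H = \det K ->
  (even_lattice K -> even_lattice H) -> genus K H.
Proof.
move=> sK iKH dKH ev; have [lK _ _ _] := sK.
have [e|ne] := pselect (even_lattice K).
  by apply: genus_intro => //; [exact: stable_sqfree|left].
have d2 : ~~ (2 %| \det K)%Z by apply/negP => /(stable_even2 sK).
apply: genus_intro => //; [exact: stable_sqfree|by right|split=> // evH].
have [sH _] := lattice_isometric lK iKH.
case/negP: d2; rewrite -dKH; move: evH; have [a [b [c [d [e [f ->]]]]]] := smx3P sH => evH.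
have /dvdzP[a' Ea] := evH (rv3 1 0 0); have /dvdzP[b' Eb] := evH (rv3 0 1 0).
have /dvdzP[c' Ec] := evH (rv3 0 0 1).
have {}Ea : a = a' * 2 by rewrite -Ea qform_rv3; ring.
have {}Eb : b = b' * 2 by rewrite -Eb qform_rv3; ring.
have {}Ec : c = c' * 2 by rewrite -Ec qform_rv3; ring.
apply/dvdzP; exists (a' * (4 * b' * c' - f ^+ 2) - d * (d * c' - f * e) - e ^+ 2 * b').
by rewrite det_mx3 Ea Eb Ec; ring.
Qed.

(** * Representatives of equivalence classes and finite cardinals *)

Lemma ncard_seq (T : choiceType) (A : set T) (s : seq T) :
  uniq s -> (forall x, A x <-> x \in s) -> ncard A = size s.
Proof.
move=> us As; have fA : finite_set A.
  by apply/finite_seqP; exists s; apply/seteqP; split=> x /=; rewrite As.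
rewrite /ncard; apply: perm_size; apply: uniq_perm => // x.
by rewrite in_fset_set //; apply/idP/idP => [/set_mem/As|/As/mem_set].
Qed.

Lemma finite_enum (T : choiceType) (A : set T) : finite_set A ->
  exists2 s : seq T, uniq s & forall x, A x <-> x \in s.
Proof.
move=> fA; exists (enum_fset (fset_set A)); first exact: fset_uniq.
by move=> x; rewrite in_fset_set //; split=> [/mem_set|/set_mem].
Qed.

Lemma ncard_bij (T U : choiceType) (A : set T) (B : set U) (f : T -> U) (g : U -> T) :
  finite_set A -> (forall x, A x -> B (f x)) -> (forall y, B y -> A (g y)) ->
  (forall x, A x -> g (f x) = x) -> (forall y, B y -> f (g y) = y) ->
  ncard A = ncard B.
Proof.
move=> /finite_enum[s us As] fB gA fK gK.
rewrite (ncard_seq us As) (@ncard_seq _ B [seq f x | x <- s]) ?size_map //.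
  by rewrite map_inj_in_uniq // => x y /As Ax /As Ay E; rewrite -(fK x) // E fK.
move=> y; split=> [By|/mapP[x /As Ax ->]]; last exact: fB.
by apply/mapP; exists (g y); rewrite ?gK //; apply/As/gA.
Qed.

Lemma finite_box m n (M : nat) :
  finite_set [set A : 'M[int]_(m, n) | forall i j, `|A i j| <= M%:Z].
Proof.
pose F (f : {ffun 'I_m * 'I_n -> 'I_(M.*2.+1)}) : 'M[int]_(m, n) :=
  \matrix_(i, j) ((f (i, j) : nat)%:Z - M%:Z).
apply: (@sub_finite_set _ _ (F @` setT)); last exact/finite_image/finite_finset.
move=> A /= bA; exists [ffun k => inord (absz (A k.1 k.2 + M%:Z)%R)] => //.
apply/matrixP => i j; rewrite mxE ffunE /=.
by have := bA i j; rewrite ler_norml; move: (A i j) => z; case/andP => z1 z2; rewrite inordK; lia.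
Qed.

Section Reps.
Variables (T : choiceType) (A : set T) (r : T -> T -> Prop).
Hypothesis rxx : forall x, A x -> r x x.
Hypothesis rsym : forall x y, A x -> A y -> r x y -> r y x.
Hypothesis rtrans : forall x y z, A x -> A y -> A z -> r x y -> r y z -> r x z.

Definition indep (s : seq T) := [/\ uniq s, forall x, x \in s -> A x
  & forall x y, x \in s -> y \in s -> r x y -> x = y].
Definition reps (s : seq T) := indep s /\ forall x, A x -> exists2 y, y \in s & r x y.

(** A list of pairwise inequivalent elements of maximal length meets every class. *)
Lemma reps_bound B : (forall s, indep s -> (size s <= B)%N) -> exists s, reps s.
Proof.
move=> bnd; pose P n := `[< exists2 s, indep s & size s = n >].
have ex : exists n, P n by exists 0%N; apply/asboolP; exists [::].
have ub n : P n -> (n <= B)%N by move/asboolP => [s /bnd H <-].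
case: (ex_maxnP ex ub) => n /asboolP[s is_ sn] mx.
exists s; split=> // x Ax; apply: contrapT => H.
have [us As rs] := is_.
suff : P n.+1 by move/mx; rewrite ltnn.
apply/asboolP; exists (x :: s); last by rewrite /= sn.
split.
- rewrite /= us andbT; apply/negP => xs; apply: H; exists x => //; exact: rxx.
- by move=> y; rewrite inE => /predU1P[->|/As].
- move=> y z; rewrite !inE => /predU1P[->|ys] /predU1P[->|zs] //.
  + by move=> ryz; case: H; exists z.
  + by move=> ryz; case: H; exists y => //; apply: rsym => //; exact: As.
  + exact: rs.
Qed.

(** Moving each entry to an equivalent element of [B] is injective on pairwise inequivalent
    entries. *)
Lemma indep_cover (B : set T) s : finite_set B ->
  (forall x, A x -> exists2 y, B y & A y /\ r x y) -> indep s ->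
  (size s <= ncard B)%N.
Proof.
move=> /finite_enum[b ub Bb] cov [us As rs]; rewrite (ncard_seq ub Bb).
have [f fP] : exists f : T -> T, forall x, A x -> [/\ B (f x), A (f x) & r x (f x)].
  suff H x : exists y, A x -> [/\ B y, A y & r x y].
    by exists (fun x => xget x [set y | A x -> [/\ B y, A y & r x y]]) => x Ax;
       case: xgetP => [y -> /(_ Ax) //|none]; have [y /none] := H x.
  have [Ax|nAx] := pselect (A x); last by exists x.
  by have [y By [Ay ry]] := cov x Ax; exists y.
rewrite -(size_map f s); apply: uniq_leq_size.
  rewrite map_inj_in_uniq // => x y xs ys E.
  have Ax := As _ xs; have Ay := As _ ys.
  have [_ Afx rx] := fP x Ax; have [_ _ ry] := fP y Ay.
  apply: rs => //; apply: (rtrans _ Afx) => //; apply: rsym => //.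
  by rewrite E.
by move=> y /mapP[x /As Ax ->]; apply/Bb; have [] := fP x Ax.
Qed.

Definition rclass x : set T := [set y | A y /\ r x y].

Lemma rclass_inj s : indep s -> {in s &, injective rclass}.
Proof.
move=> [us As rs] x y xs ys E; apply: rs => //.
have : rclass y y by split; [exact: As | apply: rxx; exact: As].
by rewrite -E => -[].
Qed.

Lemma rclass_eq x y : A x -> A y -> r x y -> rclass x = rclass y.
Proof.
move=> Ax Ay rxy; apply/seteqP; split=> z [Az rz]; split=> //.
  by apply: (rtrans _ Ax) => //; apply: rsym.
exact: (rtrans _ Ay).
Qed.

Lemma eq_classesE s : reps s -> forall C, eq_classes A r C <-> C \in [seq rclass x | x <- s].
Proof.
move=> [is_ cov] C; have [us As rs] := is_; split.
  move=> [x Ax <-]; have [y ys rxy] := cov x Ax.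
  apply/mapP; exists y => //; apply: rclass_eq => //; exact: As.
by move=> /mapP[x xs ->]; exists x => //; exact: As.
Qed.

Lemma ncard_eq_classes s : reps s -> ncard (eq_classes A r) = size s.
Proof.
move=> rs; rewrite (@ncard_seq _ _ [seq rclass x | x <- s]) ?size_map //.
  by have [is_ _] := rs; have [us _ _] := is_; rewrite map_inj_in_uniq //; exact: rclass_inj.
exact: eq_classesE.
Qed.

Lemma fsbig_eq_classes (R : nmodType) s (F : set T -> R) : reps s ->
  \sum_(C \in eq_classes A r) F C = \sum_(x <- s) F (rclass x).
Proof.
move=> rs; have [is_ _] := rs; have [us _ _] := is_.
rewrite -(big_map rclass xpredT F).
have um : uniq [seq rclass x | x <- s] by rewrite map_inj_in_uniq //; exact: rclass_inj.
have -> : eq_classes A r = [set` [seq rclass x | x <- s]].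
  by apply/seteqP; split=> C /(eq_classesE rs).
by rewrite -fsbig_seq.
Qed.

End Reps.

(** * Reduction of positive ternary forms *)

Lemma round_ex (x n : int) : 0 < n -> exists j : int, `|2 * (x - j * n)| <= n.
Proof.
move=> n0; exists ((2 * x + n) %/ (2 * n))%Z.
have E := divz_eq (2 * x + n) (2 * n).
have := modz_ge0 (2 * x + n) (_ : 2 * n != 0).
have := ltz_mod (2 * x + n) (_ : 2 * n != 0).
have n2 : 2 * n != 0 by rewrite mulf_neq0 // gt_eqF.
move=> /(_ n2) lt /(_ n2) ge; rewrite ger0_norm in lt; last by lia.
move: E lt ge; set Q := divz _ _; set r := modz _ _ => E lt ge.
have -> : 2 * (x - Q * n) = 2 * x - Q * (2 * n) by ring.
have -> : Q * (2 * n) = 2 * x + n - r by rewrite E; ring.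
by rewrite ler_norml; lia.
Qed.

Lemma min_nat (P : nat -> Prop) : (exists n, P n) ->
  exists n, P n /\ forall m, P m -> (n <= m)%N.
Proof.
move=> [n Pn]; have ex : exists n, `[< P n >] by exists n; apply/asboolP.
case: (ex_minnP ex) => m /asboolP Pm mn; exists m; split=> // k Pk.
by apply: mn; apply/asboolP.
Qed.

Lemma isometric_lattice n (G H : 'M[int]_n) : isometric G H -> lattice G -> lattice H.
Proof. by move=> iGH lG; apply: lattice_isometric lG (isometric_ext _ iGH). Qed.

(** The first entry is minimal among equivalent forms, the minor [g2] minimal among those with that
    first entry; rounding then bounds [d], [e] and [h]. The inequalities a <= b and g2 <= g3 express
    minimality after exchanging basis vectors. *)
Lemma reduced_shape (G : 'M[int]_3) : lattice G -> exists a b c d e f,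
  let g2 := a * b - d ^+ 2 in let g3 := a * c - e ^+ 2 in let h := a * f - d * e in
  [/\ isometric G (smx3 a b c d e f), `|2 * d| <= a /\ `|2 * e| <= a, a <= b,
      g2 <= g3 & `|2 * h| <= g2].
Proof.
move=> lG; pose P n := exists b c d e f, isometric G (smx3 n%:Z b c d e f).
have latP a b c d e f : isometric G (smx3 a b c d e f) -> lattice (smx3 a b c d e f).
  by move=> iG; apply: isometric_lattice iG lG.
have [a [[b0 [c0 [d0 [e0 [f0 i0]]]]] amin]] : exists n, P n /\ forall m, P m -> (n <= m)%N.
  apply: min_nat; have [sG _] := lG; have [a [b [c [d [e [f E]]]]]] := smx3P sG.
  have iG : isometric G (smx3 a b c d e f) by rewrite -E; apply: isometric_refl.
  have [a0 _ _] := lattice_minors (latP _ _ _ _ _ _ iG).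
  by exists `|a|%N, b, c, d, e, f; rewrite gtz0_abs.
pose P2 n := exists b c d e f, isometric G (smx3 a%:Z b c d e f) /\ a%:Z * b - d ^+ 2 = n%:Z.
have [g [[b1 [c1 [d1 [e1 [f1 [i1 g1]]]]]] gmin]] : exists n, P2 n /\ forall m, P2 m -> (n <= m)%N.
  apply: min_nat; have [_ m0 _] := lattice_minors (latP _ _ _ _ _ _ i0).
  by exists (absz (a%:Z * b0 - d0 ^+ 2)%R), b0, c0, d0, e0, f0; rewrite gtz0_abs.
have [a0 m0 _] := lattice_minors (latP _ _ _ _ _ _ i1).
have [j Hj] := round_ex (a%:Z * f1 - d1 * e1) m0.
have [k Hk] := round_ex d1 a0.
have [l Hl] := round_ex (e1 - j * d1) a0.
pose A := a%:Z.
pose b := b1 - 2 * k * d1 + k ^+ 2 * A; pose d := d1 - k * A.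
pose e := e1 - j * d1 - l * A.
pose c := c1 + j ^+ 2 * b1 + l ^+ 2 * A - 2 * j * f1 - 2 * l * e1 + 2 * j * l * d1.
pose f := f1 - j * b1 - l * d1 - k * e1 + k * j * d1 + k * l * A.
have iG : isometric G (smx3 A b c d e f).
  apply: isometric_trans i1 _; exists (mx3 1 0 0 (- k) 1 0 (- l) (- j) 1).
    by rewrite unitmxE det_mx3 (_ : _ + _ = 1) ?unitr1 //; ring.
  by rewrite tr_mx3 !mul_mx3 /b /c /d /e /f; congr mx3; ring.
exists A, b, c, d, e, f; split=> //.
- have ib : isometric G (smx3 b A c d f e).
    apply: isometric_trans iG _; isometry3 (mx3 0 1 0 1 0 0 0 0 1).
  have [b0' _ _] := lattice_minors (latP _ _ _ _ _ _ ib).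
  suff : (a <= `|b|)%N by rewrite /A; lia.
  by apply: amin; exists A, c, d, f, e; rewrite gtz0_abs.
- have ib : isometric G (smx3 A c b e d f).
    apply: isometric_trans iG _; isometry3 (mx3 1 0 0 0 0 1 0 1 0).
  have [_ m3 _] := lattice_minors (latP _ _ _ _ _ _ ib).
  have -> : A * b - d ^+ 2 = g%:Z by rewrite -g1 /b /d /A; ring.
  suff : (g <= absz (A * c - e ^+ 2)%R)%N by rewrite -lez_nat gtz0_abs.
  by apply: gmin; exists c, b, e, d, f; rewrite gtz0_abs.
- have -> : A * b - d ^+ 2 = a%:Z * b1 - d1 ^+ 2 by rewrite /b /d /A; ring.
  have -> // : 2 * (A * f - d * e) = 2 * (a%:Z * f1 - d1 * e1 - j * (a%:Z * b1 - d1 ^+ 2)).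
  by rewrite /d /e /f /A; ring.
Qed.

(** As g2 g3 - h^2 = a D, the reduction inequalities give 3 a^2 <= 4 g2 and 3 g2 g3 <= 4 a D, hence
    27 a^3 <= 64 D and then a bound on every entry. The constant 15 is generous. *)
Lemma reduced_bound (a b c d e f : int) :
  let D := \det (smx3 a b c d e f) in
  let g2 := a * b - d ^+ 2 in let g3 := a * c - e ^+ 2 in let h := a * f - d * e in
  0 < a -> 0 < D -> `|2 * d| <= a -> `|2 * e| <= a -> a <= b -> g2 <= g3 -> `|2 * h| <= g2 ->
  forall i j, `|smx3 a b c d e f i j| <= 15 * D ^+ 2.
Proof.
move=> D g2 g3 h a0 D0 hd he ab g23 hh.
have sq (x y : int) : `|2 * x| <= y -> 4 * x ^+ 2 <= y ^+ 2.
  move=> H; have := ler_pM (normr_ge0 _) (normr_ge0 _) H H.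
  by rewrite -normrM ger0_norm -?expr2 ?sqr_ge0 // expr2; lia.
have d2 := sq _ _ hd; have e2 := sq _ _ he; have h2 := sq _ _ hh.
have E : g2 * g3 - h ^+ 2 = a * D by rewrite /g2 /g3 /h /D det_mx3; ring.
have g2a : 3 * a ^+ 2 <= 4 * g2.
  by rewrite /g2; have := ler_wpM2l (ltW a0) ab; lia.
have a1 : 1 <= a by lia.
have D1 : 1 <= D by lia.
have peM (x y : int) : 1 <= x -> 0 <= y -> y <= x * y by move=> x1 y0; rewrite ler_peMl.
have aa : a <= a ^+ 2 by rewrite expr2; apply: peM; lia.
have g20 : 1 <= g2 by lia.
have g22 : g2 ^+ 2 <= g2 * g3 by rewrite expr2 ler_wpM2l //; lia.
have P : 3 * (g2 * g3) <= 4 * (a * D) by lia.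
have a3 : a ^+ 3 <= 3 * D.
  have : 9 * a ^+ 4 <= 16 * g2 ^+ 2.
    have a20 : 0 <= 3 * a ^+ 2 by have := sqr_ge0 a; lia.
    have := ler_pM a20 a20 g2a g2a.
    rewrite (_ : 3 * a ^+ 2 * (3 * a ^+ 2) = 9 * a ^+ 4); last by ring.
    by rewrite (_ : 4 * g2 * (4 * g2) = 16 * g2 ^+ 2); last by ring.
  have : a ^+ 4 = a * a ^+ 3 by rewrite -exprS.
  move=> -> H; have : a * (27 * a ^+ 3) <= a * (64 * D) by lia.
  by rewrite ler_pM2l //; lia.
have a2D : a ^+ 2 <= 3 * D.
  by apply: le_trans a3; rewrite [a ^+ 3]exprS; apply: peM => //; apply: sqr_ge0.
have aD : a * D <= 3 * D ^+ 2.
  by rewrite expr2 mulrA ler_wpM2r //; lia.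
have DD : D <= D ^+ 2 by rewrite expr2; apply: peM; lia.
have g3b : g3 <= g2 * g3 by apply: peM; lia.
have g3D : g3 <= 6 * D ^+ 2 by lia.
have bnd x y : a * x <= y -> 0 <= y -> x <= y.
  move=> H y0; have [x0|x0] := lerP x 0; first exact: le_trans y0.
  by apply: le_trans H; apply: peM => //; apply: ltW.
have bb : b <= 15 * D ^+ 2.
  by apply: bnd; [rewrite /g2 in g23; lia | lia].
have cb : c <= 15 * D ^+ 2.
  by apply: bnd; [rewrite /g3 in g3D; lia | lia].
have c0 : 0 <= c.
  have : 0 <= a * c by rewrite /g3 in g23; have := sqr_ge0 e; lia.
  by rewrite pmulr_rge0.
have de : `|d * e| <= a ^+ 2.
  rewrite normrM; have := ler_pM (normr_ge0 d) (normr_ge0 e) (_ : `|d| <= a) (_ : `|e| <= a).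
  by rewrite -expr2; apply; lia.
have fb : `|f| <= 15 * D ^+ 2.
  apply: bnd; last by lia.
  rewrite -[X in X * _](gtr0_norm a0) -normrM (_ : a * f = h + d * e); last by rewrite /h; ring.
  by apply: le_trans (ler_normD _ _) _; lia.
have ha : `|a| <= 15 * D ^+ 2 by rewrite gtr0_norm //; clear -aa a2D DD D1; lia.
have hb : `|b| <= 15 * D ^+ 2 by rewrite ger0_norm // (le_trans (ltW a0)).
have hc : `|c| <= 15 * D ^+ 2 by rewrite ger0_norm.
have lea (x : int) : `|2 * x| <= a -> `|x| <= 15 * D ^+ 2.
  by move=> h2x; apply: le_trans ha; rewrite (gtr0_norm a0); clear -h2x; lia.
by apply: I3P; apply: I3P; rewrite mxE //=; apply: lea.
Qed.

Lemma lattice_bounded (G : 'M[int]_3) : lattice G -> exists2 H, isometric G H &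
  forall i j, `|H i j| <= 15 * (\det G) ^+ 2.
Proof.
move=> lG; have [a [b [c [d [e [f [iG [hd he] ab g23 hh]]]]]]] := reduced_shape lG.
exists (smx3 a b c d e f) => //; rewrite (isometric_det_int iG).
have [a0 _ D0] := lattice_minors (isometric_lattice iG lG).
exact: reduced_bound.
Qed.

Lemma genus_reps (K : 'M[int]_3) : lattice K -> exists s, reps (genus K) (@isometric 3 int) s.
Proof.
move=> lK; pose M := absz (15 * (\det K) ^+ 2)%R.
have fB := finite_box 3 3 M.
apply: (@reps_bound _ _ _ _ _ (ncard [set A : 'M[int]_3 | forall i j, `|A i j| <= M%:Z])).
- by move=> x _; apply: isometric_refl.
- by move=> x y _ _; apply: isometric_sym.
move=> s; apply: indep_cover => //.
- by move=> x y _ _; apply: isometric_sym.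
- by move=> x y z _ _ _; apply: isometric_trans.
move=> H gH; have [H' iH bH] := lattice_bounded (genus_lattice gH).
exists H'; last by split=> //; apply: genus_isometric iH.
move=> i j; have := bH i j; rewrite (genus_det lK gH) => h; apply: le_trans h _.
by rewrite /M abszE ler_norm.
Qed.

Lemma lattice_CS n (G : 'M[int]_n) x y : lattice G ->
  (bform G x y) ^+ 2 <= qform G x * qform G y.
Proof.
move=> lG; have [sG _] := lG; have [->|y0] := eqVneq y 0.
  by rewrite bform0r qform0 mulr0 expr0n.
have := lattice_ge0 (qform G y *: x - bform G x y *: y) lG.
rewrite qformD // qformZ qformN qformZ bformNr bformZl bformZr.
rewrite (_ : _ + _ = qform G y * (qform G x * qform G y - bform G x y ^+ 2)); last by ring.
by rewrite pmulr_rge0 ?lattice_gt0 // subr_ge0.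
Qed.

(** A coordinate of [x] times the determinant is the product of [x] with a row of the adjugate, so
    the Cauchy-Schwarz inequality bounds it. *)
Lemma finite_short (G : 'M[int]_3) (N : int) : lattice G ->
  finite_set [set x | qform G x <= N].
Proof.
move=> lG; have D0 := lattice_det_gt0 lG.
pose M := (\sum_(i < 3) absz (N * qform G (row i (\adj G)))%R)%N.
apply: sub_finite_set (finite_box 1 3 M) => x /= Qx i j; rewrite ord1 {i}.
have Ej : x 0 j * \det G = bform G x (row j (\adj G)).
  have [sG _] := lG; rewrite /bform tr_row trmx_adj sG colE mulmxA -[x *m G *m _]mulmxA.
  by rewrite mul_mx_adj mul_mx_scalar -scalemxAl mxE -colE mxE mulrC.
have := lattice_CS x (row j (\adj G)) lG; rewrite -Ej => H.
have Mj : N * qform G (row j (\adj G)) <= M%:Z.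
  apply: le_trans (ler_norm _) _; rewrite -abszE lez_nat /M (bigD1 j) //=.
  exact: leq_addr.
have H2 : (x 0 j * \det G) ^+ 2 <= M%:Z.
  apply: le_trans H _; apply: le_trans Mj; apply: ler_wpM2r => //.
  exact: lattice_ge0.
apply: le_trans H2; have [->|x0] := eqVneq (x 0 j) 0.
  by rewrite normr0 sqr_ge0.
rewrite -real_normK ?num_real // normrM (gtr0_norm D0).
have : 1 <= `|x 0 j| by rewrite -gtz0_ge1 normr_gt0.
have : 1 <= \det G by lia.
move: `|x 0 j| (\det G) => u v v1 u1.
have : u <= u * v by rewrite ler_peMr //; lia.
move=> uv; apply: le_trans uv _; rewrite expr2 ler_peMr //; last by lia.
by have := ler_pM (_ : 0 <= 1) (_ : 0 <= 1) u1 v1; rewrite mulr1; lia.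
Qed.

Lemma finite_vec (G : 'M[int]_3) (N : int) : lattice G -> finite_set [set x | qform G x = N].
Proof.
by move=> lG; apply: sub_finite_set (finite_short N lG) => x /= ->.
Qed.

Lemma finite_ortho (G : 'M[int]_3) : lattice G -> finite_set (Defs.ortho G).
Proof.
move=> lG.
pose F (t : 'rV[int]_3 * 'rV[int]_3 * 'rV[int]_3) : 'M[int]_3 :=
  \matrix_(i, j) nth 0 [:: t.1.1; t.1.2; t.2] i 0 j.
pose V (i : 'I_3) := [set x | qform G x = G i i].
apply: (@sub_finite_set _ _ (F @` (V o0 `*` V o1 `*` V o2))); last first.
  by apply: finite_image; apply: finite_setX; [apply: finite_setX|]; apply: finite_vec.
move=> U [_ E]; exists (row o0 U, row o1 U, row o2 U).
  by split; [split|]; rewrite /V /= !rowE -qform_conj E /qform bform_delta.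
by apply/matrixP; apply: I3P => j; rewrite !mxE.
Qed.

(** * Involutions and reflections *)

Definition invols n (G : 'M[int]_n) : set 'M[int]_n :=
  [set U | Defs.ortho G U /\ U *m U = 1%:M].

(* The reflection in a primitive vector v preserves the lattice exactly when  *)
(* 2 B(v, -) / Q(v) is integral.                                              *)
Definition symv (G : 'M[int]_3) : set 'rV[int]_3 :=
  [set v | (exists2 U : 'M[int]_3, U \in unitmx & v = row o0 U) /\
           exists c : 'rV[int]_3, 2 *: (v *m G) = qform G v *: c].

Lemma zmod_double (V : zmodType) (a p y : V) : a - p - (p - y) = a -> y = p + p.
Proof.
rewrite -addrA -[RHS]addr0 => /addrI; rewrite opprB addrCA -opprD => /eqP.
by rewrite subr_eq0 => /eqP.
Qed.

Lemma trmx11 (R : comNzRingType) (A : 'M[R]_1) : A = (A 0 0)%:M.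
Proof. by apply/matrixP => i j; rewrite !ord1 !mxE eqxx. Qed.

Lemma prim_dvd (v w : 'rV[int]_3) (U : 'M[int]_3) (k l : int) : U \in unitmx -> v = row o0 U ->
  k *: v = l *: w -> l != 0 -> exists j, k = l * j /\ w = j *: v.
Proof.
move=> uU vU E l0; have E2 := congr1 (fun x => (x *m invmx U) 0 o0) E.
move: E2; rewrite vU rowE -!scalemxAl mulmxK // !mxE eqxx mulr1.
set j := \sum_ _ _; move=> E2; exists j; split=> //.
apply/rowP => i; have := congr1 (fun x : 'rV_3 => x 0 i) E.
by rewrite -rowE -vU E2 !mxE -mulrA => /(mulfI l0) ->.
Qed.

Lemma prim_neq0 (v : 'rV[int]_3) (U : 'M[int]_3) : U \in unitmx -> v = row o0 U -> v != 0.
Proof.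
move=> uU vU; apply/eqP => v0.
have := congr1 (fun x => (x *m invmx U) 0 o0) (etrans (esym vU) v0).
by rewrite rowE mulmxK // mul0mx !mxE eqxx.
Qed.

Lemma prim_pm (v w : 'rV[int]_3) (U V : 'M[int]_3) (k l : int) :
  U \in unitmx -> v = row o0 U -> V \in unitmx -> w = row o0 V ->
  k *: v = l *: w -> l != 0 -> w = v \/ w = - v.
Proof.
move=> uU vU uV wV E l0; have [j [_ Ew]] := prim_dvd uU vU E l0.
have j0 : j != 0.
  by apply: contraTneq (prim_neq0 uV wV) => j0; rewrite negbK Ew j0 scale0r.
have E1 : 1 *: w = j *: v by rewrite scale1r.
have [i [ji _]] := prim_dvd uV wV E1 j0. have : j \is a GRing.unit by apply/unitrP; exists i; rewrite [i * j]mulrC -ji.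
rewrite qualifE /= => /pred2P[] jE.
  by left; rewrite Ew jE scale1r.
by right; rewrite Ew jE scaleN1r.
Qed.

Section Reflections.
Variable G : 'M[int]_3.
Hypothesis lG : lattice G.
Let sG : G^T = G. Proof. by case: lG. Qed.

Definition refl_co (v : 'rV[int]_3) : 'rV[int]_3 :=
  xget 0 [set c | 2 *: (v *m G) = qform G v *: c].
Definition refl v : 'M[int]_3 := 1%:M - (refl_co v)^T *m v.

Lemma symv_neq0 v : symv G v -> v != 0.
Proof. by move=> [[U uU vU] _]; apply: prim_neq0 uU vU. Qed.

Lemma refl_coP v : symv G v -> 2 *: (v *m G) = qform G v *: refl_co v.
Proof. by move=> [_ [c Hc]]; rewrite /refl_co; case: xgetP => [d _ //|/(_ c)]. Qed.

Lemma symv_gt0 v : symv G v -> 0 < qform G v.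
Proof. by move=> /symv_neq0; apply: lattice_gt0. Qed.

Lemma refl_co_mul v x : symv G v -> qform G v * (x *m (refl_co v)^T) 0 0 = 2 * bform G x v.
Proof.
move=> sv.
have -> : qform G v * (x *m (refl_co v)^T) 0 0 = (x *m (qform G v *: refl_co v)^T) 0 0.
  by rewrite linearZ /= -scalemxAr [in RHS]mxE.
rewrite -refl_coP // linearZ /= -scalemxAr [in LHS]mxE; congr (_ * _).
by rewrite /bform trmx_mul sG mulmxA.
Qed.

Lemma refl_co2 v : symv G v -> v *m (refl_co v)^T = 2%:M.
Proof.
move=> sv; rewrite [LHS]trmx11; congr (_%:M).
apply: (mulfI (lt0r_neq0 (symv_gt0 sv))).
by rewrite refl_co_mul // mulrC.
Qed.

Lemma refl_sqr v : symv G v -> refl v *m refl v = 1%:M.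
Proof.
move=> sv; rewrite /refl; set c := (refl_co v)^T.
rewrite mulmxBl mul1mx mulmxBr mulmx1 mulmxA -[c *m v *m c]mulmxA refl_co2 //.
rewrite mul_mx_scalar -scalemxAl scaler_nat mulr2n.
have -> : c *m v - (c *m v + c *m v) = - (c *m v) by rewrite opprD addrA subrr sub0r.
by rewrite opprK subrK.
Qed.

Lemma sqr1_unit (U : 'M[int]_3) : U *m U = 1%:M -> U \in unitmx.
Proof. by move=> E; have [] := mulmx1_unit E. Qed.

Lemma refl_ortho v : symv G v -> invols G (refl v).
Proof.
move=> sv; have S2 := refl_sqr sv; split=> //; split; first exact: sqr1_unit.
suff E : refl v *m G = G *m (refl v)^T by rewrite E -mulmxA -trmx_mul S2 trmx1 mulmx1.
rewrite /refl linearB /= trmx1 mulmxBl mulmxBr mul1mx mulmx1 trmx_mul trmxK.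
congr (_ - _); set c := refl_co v.
have E2 := refl_coP sv; have q0 := lt0r_neq0 (symv_gt0 sv).
have inj2 : injective (fun A : 'M[int]_3 => 2 *: A).
  by move=> A B /matrixP H; apply/matrixP => i j; have := H i j; rewrite !mxE => /(mulfI _); apply.
apply: inj2; rewrite /= -mulmxA scalemxAr E2 -scalemxAr mulmxA.
have -> : G *m v^T = (v *m G)^T by rewrite trmx_mul sG.
have -> : 2 *: ((v *m G)^T *m c) = (2 *: (v *m G))^T *m c by rewrite linearZ /= scalemxAl.
by rewrite E2 linearZ /= -scalemxAl.
Qed.

Lemma mxtrace_refl v : symv G v -> \tr (refl v) = 1.
Proof.
move=> sv; rewrite /refl linearB /= mxtrace1 mxtrace_mulC refl_co2 //.
by rewrite mxtrace_scalar.
Qed.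

Lemma refl_inj v w : symv G v -> symv G w -> refl v = refl w -> w = v \/ w = - v.
Proof.
move=> sv sw /addrI/oppr_inj E.
have /(congr1 (mulmx v)) := E; rewrite !mulmxA refl_co2 // mul_scalar_mx.
rewrite [v *m _]trmx11 mul_scalar_mx => E2.
have [[U uU vU] _] := sv; have [[V uV wV] _] := sw.
apply: (prim_pm uU vU uV wV E2); apply/eqP => l0.
have /negP := symv_neq0 sv; apply; apply/eqP/rowP => i.
have := congr1 (fun x : 'rV_3 => x 0 i) E2; rewrite l0 scale0r !mxE.
by move=> /eqP; rewrite mulf_eq0 => /orP[|/eqP].
Qed.

(** The Smith form writes 1 - U as k^T v with [v] primitive; U^2 = 1 forces v k^T = 2, and
    invariance of the form makes [k] the functional 2 B(v, -) / Q(v). *)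
Lemma rank_one_refl (U : 'M[int]_3) : invols G U ->
  (\rank (map_mx (intr : int -> rat) (1%:M - U)%R) <= 1)%N -> U != 1%:M ->
  exists2 v, symv G v & U = refl v.
Proof.
move=> [[uU oU] U2] rk nU.
have [L [R [a [b [c [uL uR dab dbc E]]]]]] := smith3 (1%:M - U).
have [b0 c0] : b = 0 /\ c = 0.
  suff b0 : b = 0 by split=> //; move: dbc; rewrite b0 dvd0z => /eqP.
  apply: contraTeq rk => b0; rewrite -ltnNge.
  have a0 : a != 0 by apply: contraNneq b0 => a0; move: dab; rewrite a0 dvd0z.
  have uir (A : 'M[int]_3) : A \in unitmx -> map_mx (intr : int -> rat) A \in unitmx.
    by move=> uA; rewrite unitmxE det_map_mx rmorph_unit // -unitmxE.
  have /uir uL' := uL; have /uir uR' := uR.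
  rewrite E !map_mxM mxrankMfree ?row_free_unit // -mxrank_tr trmx_mul mxrankMfree ?row_free_unit ?unitmx_tr //.
  rewrite mxrank_tr map_mx3.
  pose D : 'M[rat]_(2, 3) := \matrix_(i, j) (mx3 a%:~R 0 0 0 b%:~R 0 0 0 c%:~R : 'M[rat]_3) (widen_ord (isT : 2 <= 3)%N i) j.
  pose C : 'M[rat]_(3, 2) := \matrix_(i, j) (mx3 a%:~R^-1 0 0 0 b%:~R^-1 0 0 0 0 : 'M[rat]_3) i (widen_ord (isT : 2 <= 3)%N j).
  pose P : 'M[rat]_(2, 3) := \matrix_(i, j) ((i : nat) == j)%:R.
  have PD : P *m mx3 a%:~R 0 0 0 b%:~R 0 0 0 c%:~R *m C = 1%:M.
    apply/matrixP => i j; rewrite !mxE sum3E !mxE !sum3E !mxE.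
    case: i => -[|[|//]] ?; case: j => -[|[|//]] ? /=;
      rewrite ?mul0r ?mulr0 ?mul1r ?addr0 ?add0r ?mulfV ?intr_eq0 //.
  have := mxrankM_maxl (P *m mx3 a%:~R 0 0 0 b%:~R 0 0 0 c%:~R) C.
  rewrite PD mxrank1 => r1; apply: leq_trans r1 _.
  exact: mxrankM_maxr.
have [k Ek] : exists k : 'rV[int]_3, 1%:M - U = k^T *m row o0 R.
  exists (a *: (col o0 L)^T); rewrite E b0 c0 linearZ /= trmxK -scalemxAl.
  apply/matrixP => i j; rewrite !mxE sum3E !mxE !sum3E !mxE big_ord1 !mxE.
  by rewrite /= !mulr0 !addr0 !mul0r !addr0; ring.
set v := row o0 R in Ek.
have EU : U = 1%:M - k^T *m v by rewrite -Ek opprB addrC subrK.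
have kv0 : k^T *m v != 0 by rewrite -Ek subr_eq0 eq_sym.
have pv : exists2 U0 : 'M[int]_3, U0 \in unitmx & v = row o0 U0 by exists R.
have vk : v *m k^T = 2%:M.
  have := U2; rewrite EU mulmxBl mul1mx mulmxBr mulmx1 mulmxA -[k^T *m v *m _]mulmxA.
  rewrite [v *m k^T]trmx11 mul_mx_scalar -scalemxAl => /zmod_double.
  set x := (v *m k^T) 0 0 => E3.
  have : (x - 2) *: (k^T *m v) = 0 by rewrite scalerBl scaler_nat mulr2n E3 subrr.
  move=> /matrixP E4; congr (_%:M); apply/eqP; rewrite -subr_eq0; apply: contraNT kv0 => x2.
  apply/eqP/matrixP => i j; have := E4 i j; rewrite [in LHS]mxE [RHS]mxE => /eqP.
  by rewrite mulf_eq0 (negPf x2) => /eqP ->; rewrite mxE.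
have kG : 2 *: (v *m G) = qform G v *: k.
  have UG : U *m G = G *m U^T.
    by rewrite -{2}oU -!mulmxA -[X in _ *m (_ *m X)]trmx_mul U2 trmx1 mulmx1.
  move: UG; rewrite EU linearB /= trmx1 mulmxBl mulmxBr mul1mx mulmx1 trmx_mul trmxK.
  move=> /addrI/oppr_inj /(congr1 (mulmx v)); rewrite !mulmxA vk mul_scalar_mx.
  rewrite -scalemxAl => ->.
  by rewrite [X in X *m k]trmx11 mul_scalar_mx.
have sv : symv G v by split=> //; exists k.
exists v => //; rewrite EU /refl; congr (1%:M - _^T *m v).
have := refl_coP sv; rewrite kG => /rowP E5; apply/rowP => i.
by have := E5 i; rewrite !mxE => /(mulfI (lt0r_neq0 (symv_gt0 sv))).
Qed.

Definition posv (v : 'rV[int]_3) : bool :=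
  if v 0 o0 != 0 then 0 < v 0 o0 else if v 0 o1 != 0 then 0 < v 0 o1 else 0 < v 0 o2.

Lemma posvN v : v != 0 -> posv (- v) = ~~ posv v.
Proof.
rewrite [v]rv3E; move: (v 0 o0) (v 0 o1) (v 0 o2) => x y z; rewrite opp_rv3 => nz.
have : [|| x != 0, y != 0 | z != 0].
  apply: contraNT nz; rewrite !negb_or !negbK => /and3P[/eqP-> /eqP-> /eqP->].
  by rewrite rv3_0.
rewrite /posv !mxE /= !oppr_eq0; case: eqP => [->|] /=; [case: eqP => [->|] /=|]; lia.
Qed.

Lemma symvN v : symv G v -> symv G (- v).
Proof.
move=> [[U uU vU] [c Hc]]; split.
  exists (- U); first by rewrite unitmxE -scaleN1r detZ unitrMl ?unitrX ?unitrN1.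
  by apply/rowP => i; rewrite vU !mxE.
by exists (- c); rewrite qformN mulNmx !scalerN Hc.
Qed.

Lemma refl_coN v : symv G v -> refl_co (- v) = - refl_co v.
Proof.
move=> sv; have := refl_coP (symvN sv); have := refl_coP sv.
rewrite qformN mulNmx scalerN => ->; rewrite -scalerN => /rowP E; apply/rowP => i.
by have := E i; rewrite !mxE => /(mulfI (lt0r_neq0 (symv_gt0 sv))).
Qed.

Lemma reflN v : symv G v -> refl (- v) = refl v.
Proof. move=> sv; rewrite /refl refl_coN //.
have -> : (- refl_co v)^T = - (refl_co v)^T by rewrite linearN.
by rewrite mulNmx mulmxN opprK. Qed.

(** Multiplying the defining relation by the adjugate shows, [v] being primitive, that Q(v) divides
    2 det G. *)
Lemma finite_symv : finite_set (symv G).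
Proof.
pose D := \det G.
have D0 := lattice_det_gt0 lG.
apply: sub_finite_set (finite_short (2 * D) lG) => v sv /=.
have [[U uU vU] _] := sv; have E := refl_coP sv.
have E2 := congr1 (mulmx^~ (\adj G)) E.
move: E2; rewrite -scalemxAl -mulmxA mul_mx_adj mul_mx_scalar scalerA -scalemxAl => E2.
have [j [Ej _]] := prim_dvd uU vU E2 (lt0r_neq0 (symv_gt0 sv)).
have q0 := symv_gt0 sv.
have j0 : 0 < j by rewrite -(pmulr_rgt0 _ q0) -Ej mulr_gt0.
by rewrite /D Ej ler_peMr // ?ltW //; lia.
Qed.

(** Both [v] and [-v] give the same reflection; sending one of the two to its negative matches the
    vectors of [symv] one to one with the involutions other than 1 and -1. The trace tells the two
    signs apart. *)
Definition sinv v := if posv v then refl v else - refl v.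

Lemma invols1 : invols G 1%:M.
Proof. by split; [split; rewrite ?unitmx1 // trmx1 mul1mx mulmx1 | rewrite mul1mx]. Qed.

Lemma involsN U : invols G U -> invols G (- U).
Proof.
move=> [[uU oU] U2]; split; last by rewrite mulmxN mulNmx opprK.
split; last by rewrite linearN /= mulmxN !mulNmx opprK.
by rewrite unitmxE -scaleN1r detZ unitrMl ?unitrX ?unitrN1.
Qed.

(** From (1 - U)(1 + U) = 0 in dimension 3, one of the factors has rank at most 1, so [U] or [-U] is
    the identity or a reflection. *)
Lemma invols_enum (s : seq 'rV[int]_3) : uniq s -> (forall v, symv G v <-> v \in s) ->
  let t := 1%:M :: (- 1%:M) :: [seq sinv v | v <- s] in
  uniq t /\ forall U, invols G U <-> U \in t.
Proof.
move=> us Gs t.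
have trs v : symv G v -> \tr (sinv v) = if posv v then 1 else -1.
  by move=> sv; rewrite /sinv; case: ifP => _; rewrite ?linearN /= mxtrace_refl.
have nm1 (A : 'M[int]_3) : \tr A \in [:: 1; -1] -> A != 1%:M /\ A != - 1%:M.
  move=> H; split; apply: contraTneq H => ->; rewrite ?linearN /= mxtrace1 //.
have s1 v : symv G v -> sinv v != 1%:M /\ sinv v != - 1%:M.
  by move=> sv; apply: nm1; rewrite trs //; case: ifP.
split.
  rewrite /t /= !inE !negb_or -!andbA; apply/and4P; split.
  - by apply/eqP => /(congr1 mxtrace); rewrite linearN /= mxtrace1.
  - by apply/mapP => -[v /Gs sv E]; have [/eqP[]] := s1 v sv.
  - by apply/mapP => -[v /Gs sv E]; have [_ /eqP[]] := s1 v sv.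
  rewrite map_inj_in_uniq // => v w /Gs sv /Gs sw E.
  have : posv v = posv w.
    by have := congr1 mxtrace E; rewrite !trs //; do 2 case: (posv _).
  move=> pvw; have : refl v = refl w.
    by move: E; rewrite /sinv pvw; case: ifP => // _ /oppr_inj.
  case/refl_inj => // Ew; move: pvw; rewrite Ew // posvN ?(symv_neq0 sv) //.
  by case: (posv v).
move=> U; split; last first.
  rewrite /t !inE => /or3P[/eqP->|/eqP->|/mapP[v /Gs sv ->]].
  - exact: invols1.
  - exact/involsN/invols1.
  by have iS := refl_ortho sv; rewrite /sinv; case: ifP => _ //; exact: involsN.
move=> iU; have [[uU oU] U2] := iU; rewrite /t !inE.
have [//|n1] := eqVneq U 1%:M; have [//|n2 /=] := eqVneq U (- 1%:M).
have iN := involsN iU.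
have prod0 : (1%:M - U) *m (1%:M - (- U)) = 0.
  by rewrite opprK mulmxBl mul1mx mulmxDr mulmx1 U2 [U + _]addrC subrr.
have /mulmx0_rank_max rk : map_mx (intr : int -> rat) (1%:M - U)%R *m map_mx (intr : int -> rat) (1%:M - (- U))%R = 0.
  by rewrite -map_mxM prod0; apply/matrixP => i j; rewrite !mxE.
have fin v : symv G v -> U = refl v \/ - U = refl v -> U \in [seq sinv v | v <- s].
  move=> sv H; have nsv := symvN sv; have v0 := symv_neq0 sv.
  have [Ev|Ev] : U = sinv v \/ U = sinv (- v).
    rewrite /sinv posvN // reflN //.
    by case: H => <-; case: (posv v); rewrite ?opprK; auto.
  - by apply/mapP; exists v => //; apply/Gs.
  - by apply/mapP; exists (- v) => //; apply/Gs.
have [r1|r2] : (\rank (map_mx (intr : int -> rat) (1%:M - U)%R) <= 1)%N \/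
    (\rank (map_mx (intr : int -> rat) (1%:M - (- U))%R) <= 1)%N.
  move: rk; set r1 := \rank _; set r2 := \rank _ => rk.
  by have [|h] := leqP r1 1; [left | right; lia].
- by have [v sv Ev] := rank_one_refl iU r1 n1; apply: (fin v) => //; left.
- have nn : - U != 1%:M by apply: contra n2 => /eqP <-; rewrite opprK.
  by have [v sv Ev] := rank_one_refl iN r2 nn; apply: (fin v) => //; right.
Qed.

Lemma ncard_invols : ncard (invols G) = (ncard (symv G)).+2.
Proof.
have [s us Gs] := finite_enum finite_symv.
have [ut Gt] := invols_enum us Gs.
by rewrite (ncard_seq us Gs) (ncard_seq ut Gt) /= size_map.
Qed.

(** For reflections 1 - c v and 1 - d w, commuting equates multiples of the rank one matrices c w
    and d v. The multipliers vanish when the vectors are orthogonal; otherwise the vectors are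
    proportional. *)
Lemma refl_comm v w : symv G v -> symv G w -> refl v *m refl w = refl w *m refl v ->
  [\/ w = v, w = - v | bform G v w = 0].
Proof.
move=> sv sw; set c := (refl_co v)^T; set d := (refl_co w)^T.
pose x := (v *m d) 0 0; pose y := (w *m c) 0 0 => E.
have Exy : x *: (c *m w) = y *: (d *m v).
  have e1 (a b : 'cV[int]_3) (p r : 'rV[int]_3) :
      (1%:M - a *m p) *m (1%:M - b *m r) = 1%:M - a *m p - b *m r + ((p *m b) 0 0) *: (a *m r).
    rewrite mulmxBl mul1mx mulmxBr mulmx1 mulmxA -[a *m p *m b]mulmxA [p *m b]trmx11.
    by rewrite mul_mx_scalar -scalemxAl !mxE /= mulr1n; apply/matrixP => i j; rewrite !mxE; ring.
  by move: E; rewrite /refl !e1 -/c -/d -/x -/y [1%:M - d *m w - _]addrAC => /addrI.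
have [b0|b0] := eqVneq (bform G v w) 0; first by constructor 3.
have /(congr1 (mulmx v)) := Exy; rewrite -!scalemxAr !mulmxA refl_co2 // -/d.
rewrite [v *m d]trmx11 -/x !mul_scalar_mx !scalerA => E2.
have x0 : x != 0.
  have := refl_co_mul v sw; rewrite -/d -/x => H; apply: contraNneq b0 => x0.
  by move: H; rewrite x0 mulr0 => /esym/eqP; rewrite mulf_eq0.
have [[U uU vU] _] := sv; have [[V uV wV] _] := sw.
have [||] := prim_pm uU vU uV wV (esym E2); [by rewrite mulf_neq0 | by constructor 1 | by constructor 2].
Qed.

End Reflections.

Lemma orthogonal_le3 (G : 'M[int]_3) (s : seq 'rV[int]_3) : lattice G ->
  uniq s -> (forall v, v \in s -> v != 0) ->
  (forall v w, v \in s -> w \in s -> v != w -> bform G v w = 0) -> (size s <= 3)%N.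
Proof.
move=> lG us nz orth; rewrite leqNgt; apply/negP => s4.
pose A : 'M[rat]_(size s, 3) := \matrix_(i, j) (s`_i 0 j)%:~R.
have : (\rank A <= 3)%N by apply: rank_leq_col.
move=> rA; have : kermx A != 0.
  by rewrite -mxrank_eq0 mxrank_ker subn_eq0 -ltnNge (leq_ltn_trans rA).
case/rowV0Pn => k /sub_kermxP kA k0.
case/negP: k0; apply/eqP/rowP => j; rewrite mxE.
have sj : s`_j \in s by rewrite mem_nth.
have : (k *m A *m ext rat G *m (map_mx intr s`_j)^T) 0 0 = 0 by rewrite kA !mul0mx mxE.
have Eb i : (row i A *m ext rat G *m (map_mx intr s`_j)^T) 0 0 = (bform G s`_i s`_j)%:~R.
  have -> : row i A = map_mx intr s`_i by apply/rowP => l; rewrite !mxE.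
  exact: map_bform.
have -> : k *m A = \sum_i k 0 i *: row i A by rewrite mulmx_sum_row.
rewrite !mulmx_suml summxE (bigD1 j) //= big1 ?addr0; last first.
  move=> i ij; rewrite -!scalemxAl mxE Eb orth ?mem_nth ?mulr0 //.
  by rewrite nth_uniq.
rewrite -!scalemxAl mxE Eb => /eqP; rewrite mulf_eq0 => /orP[/eqP //|].
rewrite intr_eq0 => /eqP H; have := lattice_gt0 lG (nz _ sj).
by rewrite /qform H ltxx.
Qed.

(** A group of involutions is abelian, so its reflections commute and their vectors are pairwise
    orthogonal or opposite: at most three directions. *)
Lemma involutive_le8 (G : 'M[int]_3) : lattice G ->
  (forall U, Defs.ortho G U -> U *m U = 1%:M) -> (ncard (symv G) <= 6)%N.
Proof.
move=> lG allinv; have [s us Gs] := finite_enum (finite_symv lG).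
rewrite (ncard_seq us Gs).
have comm U V : Defs.ortho G U -> Defs.ortho G V -> U *m V = V *m U.
  move=> oU oV; have [uU eU] := oU; have [uV eV] := oV.
  have oUV : Defs.ortho G (U *m V).
    by split; rewrite ?unitmx_mul ?uU // trmx_mul !mulmxA -[U *m V *m G]mulmxA -[U *m (_ *m _) *m _]mulmxA eV.
  have := allinv _ oUV; rewrite mulmxA => /(congr1 (mulmx^~ V)).
  rewrite -mulmxA (allinv _ oV) mulmx1 mul1mx => /(congr1 (mulmx U)).
  by rewrite !mulmxA (allinv _ oU) mul1mx.
pose p := [seq v <- s | posv v]; pose n := [seq v <- s | ~~ posv v].
have -> : size s = (size p + size n)%N by rewrite !size_filter count_predC.
have bound (a : pred 'rV[int]_3) : (forall v, symv G v -> a v -> a (- v) = false) ->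
    (size [seq v <- s | a v] <= 3)%N.
  move=> aN; apply: (orthogonal_le3 lG); first exact: filter_uniq.
    by move=> v; rewrite mem_filter => /andP[_ /Gs]; apply: symv_neq0.
  move=> v w; rewrite !mem_filter => /andP[av /Gs sv] /andP[aw /Gs sw] vw.
  have [oS _] := refl_ortho lG sv; have [oT _] := refl_ortho lG sw.
  case: (refl_comm lG sv sw (comm _ _ oS oT)) => // E.
    by rewrite E eqxx in vw.
  by move: aw; rewrite E aN.
apply: (@leq_trans (3 + 3)) => //; apply: leq_add; apply: bound => v sv.
  by move=> pv; rewrite posvN ?(symv_neq0 sv) // pv.
by move=> /negPf pv /=; rewrite posvN ?(symv_neq0 sv) // pv.
Qed.

(** * Orders of the isometry groups *)

Lemma ortho_conj n (G H : 'M[int]_n) (V : 'M[int]_n) : V \in unitmx -> V *m G *m V^T = H ->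
  forall U, Defs.ortho G U -> Defs.ortho H (V *m U *m invmx V).
Proof.
move=> uV <- U [uU EU]; split; first by rewrite !unitmx_mul unitmx_inv uU uV.
rewrite !trmx_mul !mulmxA mulmxKV // -[in RHS]EU.
by rewrite -!mulmxA [in LHS](mulmxA V^T) -trmx_mul mulVmx // trmx1 mul1mx.
Qed.

Lemma ncard_ortho_isometric (G H : 'M[int]_3) : lattice G -> isometric G H ->
  ncard (Defs.ortho G) = ncard (Defs.ortho H) /\ ncard (invols G) = ncard (invols H).
Proof.
move=> lG [V uV E].
have uV' : invmx V \in unitmx by rewrite unitmx_inv.
have E' : invmx V *m H *m (invmx V)^T = G.
  by rewrite -E !mulmxA mulVmx // mul1mx trmx_inv mulmxK // unitmx_tr.
have K1 U : invmx V *m (V *m U *m invmx V) *m invmx (invmx V) = U.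
  by rewrite invmxK !mulmxA mulVmx // mul1mx mulmxKV.
have K2 U : V *m (invmx V *m U *m invmx (invmx V)) *m invmx V = U.
  by rewrite invmxK !mulmxA mulmxV // mul1mx mulmxK.
have sq (W U : 'M[int]_3) : W \in unitmx -> U *m U = 1%:M ->
    (W *m U *m invmx W) *m (W *m U *m invmx W) = 1%:M.
  by move=> uW UU; rewrite !mulmxA mulmxKV // -[W *m U *m U]mulmxA UU mulmx1 mulmxV.
have fO := finite_ortho lG.
split.
  apply: (@ncard_bij _ _ _ _ (fun U => V *m U *m invmx V)
          (fun U => invmx V *m U *m invmx (invmx V))) => // U.
  - exact: ortho_conj.
  - exact: ortho_conj.
apply: (@ncard_bij _ _ _ _ (fun U => V *m U *m invmx V)
          (fun U => invmx V *m U *m invmx (invmx V))) => //.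
- by apply: sub_finite_set fO => U [].
- by move=> U [oU UU]; split; [exact: ortho_conj oU | exact: sq].
- by move=> U [oU UU]; split; [exact: ortho_conj oU | exact: sq].
Qed.

(** ** Rotations of order greater than two *)

(** Gauss reduction: the least value taken by the first vector of a basis, followed by one rounding
    step. The square in the conclusion allows both determinants 1 and -1. *)
Lemma bin_reduce (b f c : int) : 0 < b -> 0 < b * c - f ^+ 2 ->
  exists p q r t : int, let b' := p ^+ 2 * b + 2 * p * q * f + q ^+ 2 * c in
    let c' := r ^+ 2 * b + 2 * r * t * f + t ^+ 2 * c in
    let f' := p * r * b + (p * t + q * r) * f + q * t * c in
    [/\ (p * t - q * r) ^+ 2 = 1, 0 < b', `|2 * f'| <= b' & b' <= c'].
Proof.
move=> b0 D0.
pose B (p q : int) := p ^+ 2 * b + 2 * p * q * f + q ^+ 2 * c.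
have Bpos p q : (p != 0) || (q != 0) -> 0 < B p q.
  move=> pq; rewrite -(pmulr_rgt0 _ b0).
  have -> : b * B p q = (p * b + q * f) ^+ 2 + q ^+ 2 * (b * c - f ^+ 2) by rewrite /B; ring.
  have [q0|q0] := eqVneq q 0.
    by move: pq; rewrite q0 eqxx orbF => p0; rewrite mul0r addr0 expr0n /= mul0r addr0 exprn_even_gt0 //= mulf_neq0 // gt_eqF.
  by apply: ltr_wpDl; rewrite ?sqr_ge0 // mulr_gt0 // exprn_even_gt0.
pose P n := exists p q r t : int, (p * t - q * r) ^+ 2 = 1 /\ B p q = n%:Z.
have [n [[p [q [r [t [dt En]]]]] mn]] : exists n, P n /\ forall m, P m -> (n <= m)%N.
  apply: min_nat; exists `|b|%N, 1, 0, 0, 1; split; first by [].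
  by rewrite gtz0_abs // /B; ring.
have pq0 (p' q' r' t' : int) : (p' * t' - q' * r') ^+ 2 = 1 -> (p' != 0) || (q' != 0).
  by apply: contra_eqT; rewrite negb_or !negbK => /andP[/eqP-> /eqP->]; rewrite !mul0r subrr expr0n.
have n0 : 0 < n%:Z by rewrite -En; apply: Bpos; apply: pq0 dt.
have [j Hj] := round_ex (p * r * b + (p * t + q * r) * f + q * t * c) n0.
have dt' : (p * (t - j * q) - q * (r - j * p)) ^+ 2 = 1 by rewrite -dt; ring.
exists p, q, (r - j * p), (t - j * q); split=> //.
- by rewrite -/(B p q) En.
- rewrite -/(B p q) En; apply: le_trans Hj; rewrite le_eqVlt; apply/orP; left.
  by apply/eqP; congr `|_|; rewrite -En /B; ring.
- rewrite -/(B p q) -/(B (r - j * p) (t - j * q)) En.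
  have dt2 : ((r - j * p) * q - (t - j * q) * p) ^+ 2 = 1 by rewrite -dt; ring.
  have B0 : 0 < B (r - j * p) (t - j * q) by apply: Bpos; apply: pq0 dt2.
  have /mn : P (absz (B (r - j * p) (t - j * q))).
    by exists (r - j * p), (t - j * q), p, q; rewrite gtz0_abs.
  by rewrite -lez_nat gtz0_abs.
Qed.

(** An isometry that preserves the span of the last two basis vectors and acts trivially modulo it.
    A rotation has this shape when those two vectors span the plane orthogonal to its axis. *)
Definition rot (a b c d e f x y i j k l : int) :=
  mx3 1 x y 0 i j 0 k l *m smx3 a b c d e f *m (mx3 1 x y 0 i j 0 k l)^T = smx3 a b c d e f.

Lemma rotE a b c d e f x y i j k l : rot a b c d e f x y i j k l ->
  [/\ i * (d + x * b + y * f) + j * (e + x * f + y * c) = d,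
      k * (d + x * b + y * f) + l * (e + x * f + y * c) = e,
      i ^+ 2 * b + 2 * i * j * f + j ^+ 2 * c = b,
      i * k * b + (i * l + j * k) * f + j * l * c = f
    & k ^+ 2 * b + 2 * k * l * f + l ^+ 2 * c = c].
Proof.
rewrite /rot tr_mx3 !mul_mx3 => E.
have [[_ E1 E2] [[_ E3 E4] [_ _ E5]]] := mx3_inj E.
by split; [rewrite -[RHS]E1|rewrite -[RHS]E2|rewrite -[RHS]E3|rewrite -[RHS]E4|rewrite -[RHS]E5]; ring.
Qed.

(** For the lower block M of determinant 1 and the Gram matrix N of the plane, M N M^T = N reads M N
    = N adj(M)^T; these are two of its entries. *)
Lemma rot_prop a b c d e f x y i j k l : i * l - j * k = 1 ->
  rot a b c d e f x y i j k l -> b * (l - i) = 2 * f * j /\ j * c = - (b * k).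
Proof.
move=> dW' /rotE[R1 R2 R3 R4 R5].
have P1 : b * (l - i) = 2 * f * j.
  have : i * b + j * f - (b * l - f * j) =
     (i ^+ 2 * b + 2 * i * j * f + j ^+ 2 * c - b) * l -
     (i * k * b + (i * l + j * k) * f + j * l * c - f) * j - (i * b + f * j) * (i * l - j * k - 1) by ring.
  by rewrite R3 R4 dW' !subrr !mul0r mulr0 !subr0 => H; rewrite -[LHS]addr0 -[X in _ + X]H; ring.
have P2 : j * c = - (b * k).
  have : f * i + j * c - (f * i - b * k) =
     (i * k * b + (i * l + j * k) * f + j * l * c - f) * i -
     (i ^+ 2 * b + 2 * i * j * f + j ^+ 2 * c - b) * k - (f * i + j * c) * (i * l - j * k - 1) by ring.
  by rewrite R3 R4 dW' !subrr !mul0r mulr0 !subr0 => H; rewrite -[RHS]addr0 -[X in _ + X]H; ring.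
by [].
Qed.

(* Base change by 1 + V with V in GL_2(Z). *)
Lemma rot_conj a b c d e f x y i j k l p q r t : (p * t - q * r) ^+ 2 = 1 ->
  i * l - j * k = 1 -> rot a b c d e f x y i j k l ->
  exists x' y' i' j' k' l' d' e',
  let b' := p ^+ 2 * b + 2 * p * q * f + q ^+ 2 * c in
  let c' := r ^+ 2 * b + 2 * r * t * f + t ^+ 2 * c in
  let f' := p * r * b + (p * t + q * r) * f + q * t * c in
  [/\ isometric (smx3 a b c d e f) (smx3 a b' c' d' e' f'),
      rot a b' c' d' e' f' x' y' i' j' k' l', i' * l' - j' * k' = 1 & i' + l' = i + l].
Proof.
move=> dt dW E; set s := p * t - q * r in dt.
pose V := mx3 1 0 0 0 p q 0 r t : 'M[int]_3.
pose V' := mx3 1 0 0 0 (s * t) (- s * q) 0 (- s * r) (s * p) : 'M[int]_3.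
have VV' : V' *m V = 1%:M.
  by rewrite /V /V' mul_mx3 mx3_1; congr mx3; rewrite ?mul0r ?mulr0 ?addr0 ?add0r ?mul1r ?mulr1 //;
     rewrite -?dt /s; ring.
pose W := mx3 1 x y 0 i j 0 k l : 'M[int]_3.
pose G := smx3 a b c d e f.
have uV : V \in unitmx by have [_] := mulmx1_unit VV'.
have EG : V *m G *m V^T = smx3 a (p ^+ 2 * b + 2 * p * q * f + q ^+ 2 * c)
   (r ^+ 2 * b + 2 * r * t * f + t ^+ 2 * c) (p * d + q * e) (r * d + t * e)
   (p * r * b + (p * t + q * r) * f + q * t * c).
  by rewrite /V /G tr_mx3 !mul_mx3; congr mx3; ring.
pose x' := s * (x * t - y * r); pose y' := s * (y * p - x * q).
pose i' := s * ((p * i + q * k) * t - (p * j + q * l) * r).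
pose j' := s * ((p * j + q * l) * p - (p * i + q * k) * q).
pose k' := s * ((r * i + t * k) * t - (r * j + t * l) * r).
pose l' := s * ((r * j + t * l) * p - (r * i + t * k) * q).
have EW : V *m W *m V' = mx3 1 x' y' 0 i' j' 0 k' l'.
  by rewrite /V /V' /W !mul_mx3; congr mx3; rewrite /x' /y' /i' /j' /k' /l'; ring.
exists x', y', i', j', k', l', (p * d + q * e), (r * d + t * e).
have ss : s * s = 1 by rewrite -expr2.
split.
- by exists V.
- rewrite /rot -EW -EG -/G !trmx_mul !mulmxA -[V *m W *m V' *m V]mulmxA VV' mulmx1.
  rewrite -[_ *m V^T *m V'^T]mulmxA -trmx_mul VV' trmx1 mulmx1.
  have E' : W *m G *m W^T = G := E.
  have -> : V *m W *m G *m W^T *m V^T = V *m (W *m G *m W^T) *m V^T by rewrite !mulmxA.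
  by rewrite E'.
- transitivity (s * s * (s * s) * (i * l - j * k)); last by rewrite ss dW.
  by rewrite /i' /j' /k' /l' /s; ring.
- transitivity (s * s * (i + l)); last by rewrite ss mul1r.
  by rewrite /i' /l' /s; ring.
Qed.

(** In odd dimension det(W - 1) det G is its own negative, so [W] fixes a column, which is completed
    to a basis. Positivity of the plane bounds the trace of the block, and j = 0 would give W^2 =
    1. *)
Lemma rot_shape (G W : 'M[int]_3) : lattice G -> Defs.ortho G W -> \det W = 1 ->
  W *m W != 1%:M -> exists a b c d e f x y i j k l,
  [/\ isometric G (smx3 a b c d e f), rot a b c d e f x y i j k l, i * l - j * k = 1,
      j != 0 & `|i + l| <= 1].
Proof.
move=> lG [uW oW] dW W2; have D0 := lattice_det_gt0 lG.
have d0 : \det (W - 1%:M) = 0.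
  have E : (W - 1%:M) *m G *m W^T = - (G *m (W - 1%:M)^T).
    by rewrite !mulmxBl mul1mx oW linearB /= trmx1 mulmxBr mulmx1 opprB.
  have dN : \det (- (G *m (W - 1%:M)^T)) = - (\det (W - 1%:M) * \det G).
    set A := G *m _; rewrite -[- A]scaleN1r detZ /A det_mulmx det_tr; ring.
  have := congr1 determinant E; rewrite dN !det_mulmx det_tr dW mulr1.
  move=> H; have /eqP : 2 * \det (W - 1%:M) * \det G = 0.
    by rewrite -mulrA; move: (_ * _) H => z; clear; lia.
  by rewrite !mulf_eq0 (gt_eqF D0) orbF /= => /eqP.
have /det0P[v v0 Ev] : \det (W - 1%:M)^T == 0 by rewrite det_tr d0.
have [U [n [uU vU]]] := row_complete v.
have n0 : n != 0 by apply: contraNneq v0 => n0; rewrite vU n0 scale0r.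
pose w := rv3 1 0 0 *m U.
have Ew : W *m w^T = w^T.
  apply/eqP; rewrite -subr_eq0 -{2}[w^T]mul1mx -mulmxBl; apply/eqP.
  apply: trmx_inj; rewrite trmx_mul trmxK trmx0.
  have Ev' : n *: (w *m (W - 1%:M)^T) = 0 by rewrite scalemxAl -vU Ev.
  apply/rowP => z; have /rowP/(_ z) := Ev'; move: (w *m _) => u.
  by rewrite !mxE => /eqP; rewrite mulf_eq0 (negPf n0) => /eqP.
pose X := invmx U^T; have uX : X \in unitmx by rewrite unitmx_inv unitmx_tr.
have Xw : X *m w^T = (rv3 1 0 0)^T by rewrite /w trmx_mul mulKmx ?unitmx_tr.
have iG : isometric G (X *m G *m X^T) by exists X.
have lG' := isometric_lattice iG lG.
have [sG' _] := lG'; have [a [b [c [d [e [f EG]]]]]] := smx3P sG'.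
rewrite EG in iG lG'.
pose W' := X *m W *m invmx X.
have oW' : Defs.ortho (smx3 a b c d e f) W'.
  by rewrite -EG; apply: (ortho_conj uX) => //; split.
have W'w : W' *m (rv3 1 0 0)^T = (rv3 1 0 0)^T.
  by rewrite /W' -Xw -mulmxA mulKmx // -mulmxA Ew.
have [w1 [x [y [w2 [i [j [w3 [k [l EW]]]]]]]]] := mx3P W'.
have [E1 E2 E3] : [/\ w1 = 1, w2 = 0 & w3 = 0].
  have := congr1 trmx W'w; rewrite trmx_mul trmxK EW tr_mx3 mul_rv3 => E.
  by have [h1 h2 h3] := rv3_inj E; split; [rewrite -[RHS]h1|rewrite -[RHS]h2|rewrite -[RHS]h3]; ring.
rewrite E1 E2 E3 {E1 E2 E3 w1 w2 w3} in EW.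
have dW' : i * l - j * k = 1.
  have : \det W' = 1.
    by rewrite /W' !det_mulmx dW mulr1 -det_mulmx mulmxV // det1.
  by rewrite EW det_mx3 => <-; ring.
have W'2 : W' *m W' != 1%:M.
  apply: contra W2 => /eqP E; apply/eqP.
  have : invmx X *m (W' *m W') *m X = 1%:M by rewrite E mulmx1 mulVmx.
  by move=> <-; rewrite /W' !mulmxA mulVmx // mul1mx !mulmxKV.
have R : rot a b c d e f x y i j k l by case: oW' => _; rewrite EW.
have [R1 R2 R3 R4 R5] := rotE R.
have [lb0 lbc] : 0 < b /\ 0 < b * c - f ^+ 2.
  have iG2 : isometric (smx3 a b c d e f) (smx3 b c a f d e).
    isometry3 (mx3 0 1 0 0 0 1 1 0 0).
  by have [] := lattice_minors (isometric_lattice iG2 lG').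
have [P1 P2] := rot_prop dW' R.
exists a, b, c, d, e, f, x, y, i, j, k, l.
have j0 : j != 0.
  apply: contraNneq W'2 => j0; rewrite EW mul_mx3 mx3_1.
  have k0 : k = 0.
    move: P2; rewrite j0 mul0r => /esym/eqP; rewrite oppr_eq0 mulf_eq0 (gt_eqF lb0).
    by move/eqP.
  have li : l = i.
    move: P1; rewrite j0 mulr0 => /eqP; rewrite mulf_eq0 (gt_eqF lb0) subr_eq0.
    by move/eqP.
  have i2 : i * i = 1 by rewrite -dW' j0 li; ring.
  have [i1|i1] : i = 1 \/ i = -1.
    have : (i - 1) * (i + 1) = i * i - 1 by ring.
    rewrite i2 subrr.
    by move=> /eqP; rewrite mulf_eq0 subr_eq0 addr_eq0 => /orP[/eqP|/eqP]; auto.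
  - have e1 : x * b + y * f = 0 by move: R1; rewrite i1 j0 => H; rewrite -[RHS](subrr d) -{1}H; ring.
    have e2 : x * f + y * c = 0 by move: R2; rewrite k0 li i1 => H; rewrite -[RHS](subrr e) -{1}H; ring.
    have y0 : y = 0.
      have /eqP : y * (b * c - f ^+ 2) = 0.
        by transitivity (b * (x * f + y * c) - f * (x * b + y * f)); [ring|rewrite e1 e2 !mulr0 subrr].
      by rewrite mulf_eq0 (gt_eqF lbc) orbF => /eqP.
    have x0 : x = 0.
      by move/eqP: e1; rewrite y0 mul0r addr0 mulf_eq0 (gt_eqF lb0) orbF => /eqP.
    by apply/eqP; rewrite x0 y0 k0 j0 li i1; congr mx3; ring.
  - by apply/eqP; rewrite k0 j0 li i1; congr mx3; ring.
split=> //.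
have H : b ^+ 2 * ((i + l) ^+ 2 - 4) = - (4 * j ^+ 2 * (b * c - f ^+ 2)).
  transitivity ((b * (l - i)) ^+ 2 + 4 * b * j * (b * k) + 4 * b ^+ 2 * (i * l - j * k - 1)); first by ring.
  rewrite P1 dW' subrr mulr0 addr0.
  have -> : b * k = - (j * c) by rewrite P2 opprK.
  by ring.
have lt4 : (i + l) ^+ 2 < 4.
  rewrite -subr_lt0 -(pmulr_rlt0 _ (_ : 0 < b ^+ 2)); last by rewrite exprn_gt0.
  rewrite H oppr_lt0; apply: mulr_gt0 => //; apply: mulr_gt0 => //; by rewrite exprn_even_gt0 ?j0.
have := lt4; move: (i + l) => z; clear; nia.
Qed.

Lemma sqfreez_sq (D p : int) : sqfreez D -> 0 < p -> (p ^+ 2 %| D)%Z -> p = 1.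
Proof.
move=> sq p0 pD; have [//|p1] := eqVneq p 1.
have pr : prime (pdiv `|p|) by apply: pdiv_prime; lia.
have /negP[] := sq _ pr; apply: dvdz_trans pD.
by rewrite dvdzE absz_nat abszX dvdn_exp2r // pdiv_dvd.
Qed.

Lemma rot_sq a b c d e f x y i j k l : rot a b c d e f x y i j k l ->
  rot a b c d e f (x + x * i + y * k) (y + x * j + y * l)
    (i * i + j * k) (i * j + j * l) (k * i + l * k) (k * j + l * l).
Proof.
move=> E; rewrite /rot; set W := mx3 1 x y 0 i j 0 k l; set W2 := mx3 _ _ _ _ _ _ _ _ _.
have -> : W2 = W *m W by rewrite /W /W2 mul_mx3; congr mx3; ring.
have E' : W *m smx3 a b c d e f *m W^T = smx3 a b c d e f := E.
have -> : W *m W *m smx3 a b c d e f *m (W *m W)^T = W *m (W *m smx3 a b c d e f *m W^T) *m W^T.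
  by rewrite trmx_mul !mulmxA.
by rewrite E' E'.
Qed.

(* The binary form fixed by a rotation of trace t is proportional to (-j, l - i, k), of determinant
   4 - t^2 up to a factor, hence reduces to a multiple of (2, t, 2). *)
Lemma rot_reduce a b c d e f x y i j k l : lattice (smx3 a b c d e f) -> rot a b c d e f x y i j k l ->
  i * l - j * k = 1 -> j != 0 -> i + l = 0 \/ i + l = -1 ->
  exists b' f' d' e' x' y' i' j' k' l', [/\ isometric (smx3 a b c d e f) (smx3 a b' b' d' e' f'),
    rot a b' b' d' e' f' x' y' i' j' k' l', i' * l' - j' * k' = 1, i' + l' = i + l & 0 < b' /\ 2 * f' = (i + l) * b'].
Proof.
move=> lG R dW j0 tau; have [P1 P2] := rot_prop dW R.
have [B [F [C [B0 BC EF EC [B2 [C2 [EB2 EC2]]]]]]] : exists B F C : int,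
    [/\ 0 < B, B * C - F ^+ 2 = 4 - (i + l) ^+ 2, f * B = b * F, c * B = b * C
      & exists B2 C2, B = 2 * B2 /\ C = 2 * C2].
  have [jn|jp] := ltrP j 0.
    exists (- 2 * j), (i - l), (2 * k); split; first by lia.
    - by transitivity (4 * (i * l - j * k) - (i + l) ^+ 2); [ring|rewrite dW].
    - by transitivity (- (2 * f * j)); [ring|rewrite -P1; ring].
    - by transitivity (- 2 * (j * c)); [ring|rewrite P2; ring].
    - by exists (- j), k; split; ring.
  exists (2 * j), (l - i), (- 2 * k); split; first by move: j0 jp; clear; lia.
  - by transitivity (4 * (i * l - j * k) - (i + l) ^+ 2); [ring|rewrite dW].
  - by transitivity (2 * f * j); [ring|rewrite -P1; ring].
  - by transitivity (2 * (j * c)); [ring|rewrite P2; ring].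
  - by exists j, (- k); split; ring.
have [|p [q [r0 [t0 [dt0 B'0 F'B0 BC'0]]]]] := @bin_reduce B F C B0; first by rewrite BC; case: tau => ->.
have [r [t [dt F'm [B'2 C'2]]]] : exists r t : int, [/\ (p * t - q * r) ^+ 2 = 1,
    p * r * B + (p * t + q * r) * F + q * t * C = i + l &
    (p ^+ 2 * B + 2 * p * q * F + q ^+ 2 * C = 2) /\
    (r ^+ 2 * B + 2 * r * t * F + t ^+ 2 * C = 2)].
  set B' := _ + _ in B'0 F'B0 BC'0; set C' := _ + _ in BC'0; set F' := _ + _ in F'B0.
  have det' : B' * C' - F' ^+ 2 = 4 - (i + l) ^+ 2.
    by transitivity ((p * t0 - q * r0) ^+ 2 * (B * C - F ^+ 2)); [rewrite /B' /C' /F'; ring|rewrite dt0 BC mul1r].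
  have [B'' EB''] : exists z, B' = 2 * z.
    by exists (p ^+ 2 * B2 + p * q * F + q ^+ 2 * C2); rewrite /B' EB2 EC2; ring.
  have [E1 E2 E3] : [/\ B' = 2, C' = 2 & F' = i + l \/ F' = - (i + l)].
    clearbody B' C' F'; move: tau det'; move: (i + l) => tt; clear -B'0 F'B0 BC'0 EB''.
    move=> [] -> det'.
      have B1 : B' = 2 by nia.
      have F1 : F' = 0 by rewrite B1 in F'B0 det'; nia.
      by split; rewrite ?F1 //; [rewrite B1 F1 in det'; lia|left].
    have B1 : B' = 2 by nia.
    have F1 : F' = 1 \/ F' = -1 by subst B'; rewrite B1 in F'B0 det'; nia.
    by split => //; case: F1 => F1; rewrite ?B1 F1 in det' *; lia.
  case: E3 => E3; first by exists r0, t0.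
  exists (- r0), (- t0); split; first by rewrite -dt0; ring.
    by transitivity (- F'); [rewrite /F'; ring | rewrite E3 opprK].
  by split=> //; rewrite -[RHS]E2 /C'; ring.
have [x' [y' [i' [j' [k' [l' [d' [e' []]]]]]]]] := rot_conj dt dW R.
set b' := _ + _; set c' := _ + _; set f' := _ + _ => iG R' dW' tau'.
have Bn : B != 0 by rewrite gt_eqF.
have Eb : B * b' = b * 2.
  rewrite -B'2; transitivity (p ^+ 2 * b * B + 2 * p * q * (f * B) + q ^+ 2 * (c * B)); first by rewrite /b'; ring.
  by rewrite EF EC; ring.
have Ec : c' = b'.
  apply: (mulfI Bn); rewrite Eb -C'2; transitivity (r ^+ 2 * b * B + 2 * r * t * (f * B) + t ^+ 2 * (c * B)); first by rewrite /c'; ring.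
  by rewrite EF EC; ring.
have Ef : 2 * f' = (i + l) * b'.
  apply: (mulfI Bn); rewrite [RHS]mulrCA Eb -F'm; transitivity (2 * (p * r * b * B + (p * t + q * r) * (f * B) + q * t * (c * B))); first by rewrite /f'; ring.
  by rewrite EF EC; ring.
clearbody b' c' f'; rewrite Ec in iG R'; exists b', f', d', e', x', y', i', j', k', l'; split=> //.
by split=> //; exact: lattice_diag1 (isometric_lattice iG lG).
Qed.

(** A quarter turn makes the plane b' times the square lattice. Invariance gives b' | d'^2 + e'^2,
    so b'^2 divides the determinant and b' = 1; the unimodular plane then splits off. *)
Lemma rot_tau0 a b c d e f x y i j k l : lattice (smx3 a b c d e f) ->
  sqfreez (\det (smx3 a b c d e f)) -> rot a b c d e f x y i j k l ->
  i * l - j * k = 1 -> j != 0 -> i + l = 0 ->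
  exists n, isometric (smx3 a b c d e f) (smx3 n 1 1 0 0 0).
Proof.
move=> lG sq R dW j0 tau.
have [b' [f' [d' [e' [x' [y' [i' [j' [k' [l' [iG R' dW' tau' [b'0 Ef]]]]]]]]]]]] := rot_reduce lG R dW j0 (or_introl tau).
have f0 : f' = 0 by move: Ef; rewrite tau mul0r; clear; lia.
rewrite f0 in iG R'; have b'n : b' != 0 by rewrite gt_eqF.
have [P1' P2'] := rot_prop dW' R'; have [R1 R2 _ _ _] := rotE R'.
have kj : k' = - j' by apply: (mulfI b'n); rewrite mulrN [b' * j']mulrC P2' opprK.
have li : l' = i' by apply/eqP; rewrite -subr_eq0; apply/eqP/(mulfI b'n); rewrite P1' !mulr0 mul0r.
have i0 : i' = 0 by move: tau'; rewrite li tau; clear; lia.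
have jj : j' * j' = 1 by rewrite -dW' li kj i0; ring.
have E1 : d' = j' * (e' + y' * b') by rewrite -[LHS]R1 i0; ring.
have E2 : e' = - j' * (d' + x' * b') by rewrite -[LHS]R2 li i0 kj; ring.
have b1 : b' = 1.
  apply: (sqfreez_sq sq) => //; rewrite (isometric_det_int iG); apply/dvdzP.
  exists (a - (j' * y' * (d' + j' * e') - e' * (j' * x' + y'))).
  have H : d' ^+ 2 + e' ^+ 2 = b' * (j' * y' * (d' + j' * e') - e' * (j' * x' + y')).
    have F1 : d' - j' * e' = j' * y' * b' by rewrite {1}E1; ring.
    have F2 : 2 * e' = - b' * (j' * x' + y').
      transitivity ((e' + j' * d') - j' * (d' - j' * e') + (1 - j' * j') * e'); first by ring.
      rewrite F1 jj subrr mul0r addr0 (_ : e' + j' * d' = - j' * x' * b' + (1 - j' * j') * 0).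
        by rewrite !mulrA jj; ring.
      by rewrite {1}E2; ring.
    transitivity ((d' - j' * e') * (d' + j' * e') + e' * (2 * e') + (j' * j' - 1) * e' ^+ 2); first by ring.
    by rewrite F1 F2 jj subrr; ring.
  by rewrite det_mx3; transitivity (a * b' ^+ 2 - b' * (d' ^+ 2 + e' ^+ 2)); [ring|rewrite H; ring].
exists (a - d' ^+ 2 - e' ^+ 2); apply: isometric_trans iG _; rewrite b1.
isometry3 (mx3 1 (- d') (- e') 0 1 0 0 0 1).
Qed.

(** The plane is s A_2, and invariance makes d' and e' multiples of s, so s^2 divides the
    determinant and s = 1. The products with A_2 matter only through a class modulo 3, its
    discriminant: class 0 splits, and 1 and -1 give the trigonal lattice. *)
Lemma rot_tau1 a b c d e f x y i j k l : lattice (smx3 a b c d e f) ->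
  sqfreez (\det (smx3 a b c d e f)) -> rot a b c d e f x y i j k l ->
  i * l - j * k = 1 -> j != 0 -> i + l = -1 ->
  exists n, isometric (smx3 a b c d e f) (smx3 n 2 2 0 0 (-1)) \/
            isometric (smx3 a b c d e f) (smx3 n 2 2 1 0 (-1)).
Proof.
move=> lG sq R dW j0 tau.
have [b' [f' [d' [e' [x' [y' [i' [j' [k' [l' [iG R' dW' tau' [b'0 Ef]]]]]]]]]]]] := rot_reduce lG R dW j0 (or_intror tau).
have [s bs fs] : exists2 s, b' = 2 * s & f' = - s by exists (- f'); move: Ef; rewrite tau; clear; lia.
rewrite bs fs in iG R'; have s0 : 0 < s by move: b'0; rewrite bs; clear; lia.
have sn : s != 0 by rewrite gt_eqF.
have [P1' P2'] := rot_prop dW' R'; have [R1 R2 _ _ _] := rotE R'.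
have kj : k' = - j'.
  by apply: (mulfI sn); apply: (mulfI (_ : 2 != 0 :> int)) => //; rewrite !mulrN mulrA -[LHS]opprK -P2'; ring.
have li : l' = i' - j'.
  have : s * (l' - i' + j') = 0.
    apply: (mulfI (_ : 2 != 0 :> int)) => //; rewrite mulr0.
    by transitivity (2 * s * (l' - i') - 2 * - s * j'); [ring|rewrite P1' subrr].
  by move=> /eqP; rewrite mulf_eq0 (negPf sn) => /eqP; clear; lia.
have jE : j' = 2 * i' + 1 by rewrite tau in tau'; clear -tau' li; lia.
have icase : i' = 0 \/ i' = -1.
  have : 3 * (i' * (i' + 1)) = i' * l' - j' * k' - 1 by rewrite kj li jE; ring.
  rewrite dW' subrr.
  by move=> /eqP; rewrite !mulf_eq0 /= addr_eq0 => /orP[/eqP|/eqP]; auto.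
have [d1 [e1 [Ed Ee]]] : exists d1 e1, d' = s * d1 /\ e' = s * e1.
  have inj3 := mulfI (_ : 3 != 0 :> int).
  case: icase => i0; rewrite jE i0 in kj li R1 R2; rewrite kj li in R2; rewrite ?kj ?li in R1.
  - have Ee : e' = s * (- y').
      apply: inj3 => //; move: R1 R2; clear; move=> R1 R2.
      have {R1}R1 : d' - e' = s * (2 * y' - x') by rewrite -{1}R1; ring.
      have {R2}R2 : d' + 2 * e' = - s * (x' + y') by transitivity (d' + e' + e'); [ring|rewrite -{2}R2; ring].
      by transitivity (d' + 2 * e' - (d' - e')); [ring|rewrite R1 R2; ring].
    exists (y' - x'), (- y'); split=> //.
    by rewrite -[LHS]R1 Ee; ring.
  - have Ed : d' = s * (- x').
      apply: inj3 => //; move: R1 R2; clear; move=> R1 R2.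
      have {R2}R2 : e' - d' = s * (2 * x' - y') by rewrite -{1}R2; ring.
      have {R1}R1 : e' + 2 * d' = - s * (x' + y') by transitivity (e' + d' + d'); [ring|rewrite -{2}R1; ring].
      by transitivity (e' + 2 * d' - (e' - d')); [ring|rewrite R1 R2; ring].
    exists (- x'), (x' - y'); split=> //.
    by rewrite -[LHS]R2 Ed; ring.
have s1 : s = 1.
  apply: (sqfreez_sq sq) => //; rewrite (isometric_det_int iG); apply/dvdzP.
  exists (3 * a - 2 * s * (d1 ^+ 2 + d1 * e1 + e1 ^+ 2)).
  by rewrite det_mx3 Ed Ee; ring.
rewrite s1 mulr1 in iG; clear -iG.
have red u v : isometric (smx3 a b c d e f) (smx3 (a + 2 * u * d' + 2 * v * e' + 2 * u ^+ 2 + 2 * v ^+ 2 - 2 * u * v)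
    2 2 (d' + 2 * u - v) (e' - u + 2 * v) (-1)).
  apply: isometric_trans iG _; isometry3 (mx3 1 u v 0 1 0 0 0 1).
have [v Hv] := round_ex (d' + 2 * e') (isT : 0 < 3 :> int).
have := red (e' + 2 * - v) (- v).
have -> : e' - (e' + 2 * - v) + 2 * - v = 0 by ring.
have -> : d' + 2 * (e' + 2 * - v) - - v = d' + 2 * e' - v * 3 by ring.
move: Hv; set z := d' + 2 * e' - v * 3 => Hz.
have [->|[->|->]] : z = 0 \/ z = 1 \/ z = -1 by clear -Hz; lia.
- by move=> i1; eexists; left; exact: i1.
- by move=> i1; eexists; right; exact: i1.
- move=> i1; eexists; right; apply: isometric_trans i1 _.
  isometry3 (mx3 (-1) 0 0 0 1 0 0 0 1).
Qed.

(** * The isometry groups of the three exceptional families, listed explicitly *)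

Definition mxt (t : (int * int * int) * (int * int * int) * (int * int * int)) : 'M[int]_3 :=
  mx3 t.1.1.1.1 t.1.1.1.2 t.1.1.2 t.1.2.1.1 t.1.2.1.2 t.1.2.2 t.2.1.1 t.2.1.2 t.2.2.

Lemma mxt_inj : injective mxt.
Proof.
move=> [[[[a b] c] [[d e] f]] [[g h] i]] [[[[a' b'] c'] [[d' e'] f']] [[g' h'] i']].
rewrite /mxt /= => E.
by have [[-> -> ->] [[-> -> ->] [-> -> ->]]] := mx3_inj E.
Qed.

Definition sqt (t : (int * int * int) * (int * int * int) * (int * int * int)) :=
  let: (((a, b), c), ((d, e), f), ((g, h), i)) := t in
  (((a * a + b * d + c * g, a * b + b * e + c * h), a * c + b * f + c * i),
   ((d * a + e * d + f * g, d * b + e * e + f * h), d * c + e * f + f * i),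
   ((g * a + h * d + i * g, g * b + h * e + i * h), g * c + h * f + i * i)).

Lemma mxt_sq t : mxt t *m mxt t = mxt (sqt t).
Proof. by case: t => [[[[a b] c] [[d e] f]] [[g h] i]]; rewrite /mxt /= mul_mx3. Qed.

Definition id9 : (int * int * int) * (int * int * int) * (int * int * int) :=
  (((1, 0), 0), ((0, 1), 0), ((0, 0), 1)).

(** On tuples of integers equality and squaring compute, so the order of the group and its number of
    elements of square 1 come from evaluating [size] and [count]. *)
Lemma ncard_ortho_list (G : 'M[int]_3) l : uniq l ->
  (forall t, t \in l -> Defs.ortho G (mxt t)) ->
  (forall U, Defs.ortho G U -> exists2 t, t \in l & U = mxt t) ->
  ncard (Defs.ortho G) = size l /\ ncard (invols G) = count (fun t => sqt t == id9) l.
Proof.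
move=> ul lO Ol; split.
  rewrite (@ncard_seq _ _ [seq mxt t | t <- l]) ?size_map //.
    by rewrite map_inj_uniq //; exact: mxt_inj.
  move=> U; split=> [/Ol[t tl ->]|/mapP[t /lO oU ->]] //; exact: map_f.
rewrite -size_filter (@ncard_seq _ _ [seq mxt t | t <- [seq t <- l | sqt t == id9]]) ?size_map //.
  by rewrite map_inj_uniq ?filter_uniq //; exact: mxt_inj.
have id9E : 1%:M = mxt id9 by rewrite mx3_1.
move=> U; split=> [[/Ol[t tl ->]]|/mapP[t]].
  rewrite mxt_sq id9E => /mxt_inj E; apply/mapP; exists t => //.
  by rewrite mem_filter E eqxx.
rewrite mem_filter => /andP[/eqP E /lO oU] ->; split=> //.
by rewrite mxt_sq E id9E.
Qed.

Lemma ortho_unit (G U : 'M[int]_3) : \det G != 0 -> U *m G *m U^T = G -> U \in unitmx.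
Proof.
move=> d0 /(congr1 determinant); rewrite !det_mulmx det_tr => E.
have /(mulfI d0) E2 : \det G * (\det U * \det U) = \det G * 1 by rewrite mulr1 -[RHS]E; ring.
by rewrite unitmxE; apply/unitrP; exists (\det U); rewrite E2.
Qed.

Lemma sq_le1 (x : int) : x * x <= 1 -> [\/ x = 0, x = 1 | x = -1].
Proof.
move=> H; have : x = 0 \/ x = 1 \/ x = -1 by nia.
by case=> [|[]] ->; [constructor 1|constructor 2|constructor 3].
Qed.

Lemma sum2sq1 (x y : int) : x * x + y * y = 1 ->
  [\/ x = 1 /\ y = 0, x = -1 /\ y = 0, x = 0 /\ y = 1 | x = 0 /\ y = -1].
Proof.
move=> H; have hx : x * x <= 1 by nia.
have hy : y * y <= 1 by nia.
case: (sq_le1 hx) H => ->; case: (sq_le1 hy) => -> // _;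
  by [constructor 1|constructor 2|constructor 3|constructor 4].
Qed.

Lemma hex1 (x y : int) : x * x - x * y + y * y = 1 -> (x, y) \in
  [:: (1, 0); (-1, 0); (0, 1); (0, -1); (1, 1); (-1, -1) : int * int].
Proof.
move=> H; have hx : x * x <= 1 by nia.
have hy : y * y <= 1 by nia.
by case: (sq_le1 hx) H => ->; case: (sq_le1 hy) => ->.
Qed.

Lemma ortho_eqs a b c d e f x1 x2 x3 y1 y2 y3 z1 z2 z3 :
  Defs.ortho (smx3 a b c d e f) (mx3 x1 x2 x3 y1 y2 y3 z1 z2 z3) ->
  let B u1 u2 u3 v1 v2 v3 : int := a * u1 * v1 + b * u2 * v2 + c * u3 * v3 +
    d * (u1 * v2 + u2 * v1) + e * (u1 * v3 + u3 * v1) + f * (u2 * v3 + u3 * v2) in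
  [/\ B x1 x2 x3 x1 x2 x3 = a, B y1 y2 y3 y1 y2 y3 = b & B z1 z2 z3 z1 z2 z3 = c] /\
  [/\ B x1 x2 x3 y1 y2 y3 = d, B x1 x2 x3 z1 z2 z3 = e & B y1 y2 y3 z1 z2 z3 = f].
Proof.
case=> _; rewrite tr_mx3 !mul_mx3 => E /=.
have [[E1 E2 E3] [[_ E5 E6] [_ _ E9]]] := mx3_inj E.
by split; split; [rewrite -[RHS]E1|rewrite -[RHS]E5|rewrite -[RHS]E9|
  rewrite -[RHS]E2|rewrite -[RHS]E3|rewrite -[RHS]E6]; ring.
Qed.

Lemma pm1_of (n x : int) : n != 0 -> n * x * x = n -> x \in [:: 1; -1 : int].
Proof.
move=> n0 H; have : n * (x * x - 1) = 0 by rewrite mulrBr mulrA H mulr1 subrr.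
move=> /eqP; rewrite mulf_eq0 (negPf n0) subr_eq0 => /= /eqP xx.
have hx : x * x <= 1 by rewrite xx.
by case: (sq_le1 hx) xx => ->.
Qed.

(** For n >= 2 the vectors of norm 1 all lie in the square plane, so the group is that of the square
    times a sign. *)
Lemma ortho_tetragonal n : 2 <= n ->
  ncard (Defs.ortho (smx3 n 1 1 0 0 0)) = 16 /\ ncard (invols (smx3 n 1 1 0 0 0)) = 12.
Proof.
move=> n2; have n0 : n != 0 by clear -n2; lia.
pose S : seq ((int * int) * (int * int)) :=
  [:: ((1, 0), (0, 1)); ((1, 0), (0, -1)); ((-1, 0), (0, 1)); ((-1, 0), (0, -1));
      ((0, 1), (1, 0)); ((0, 1), (-1, 0)); ((0, -1), (1, 0)); ((0, -1), (-1, 0))].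
pose l := [seq (((e, 0), 0), ((0, s.1.1), s.1.2), ((0, s.2.1), s.2.2)) | e <- [:: 1; -1 : int], s <- S]
  : seq ((int * int * int) * (int * int * int) * (int * int * int)).
suff [] : ncard (Defs.ortho (smx3 n 1 1 0 0 0)) = size l /\
    ncard (invols (smx3 n 1 1 0 0 0)) = count (fun t => sqt t == id9) l by [].
apply: ncard_ortho_list => //.
- move=> t; rewrite /l !inE; do ?case/orP; move=> /eqP ->;
    (have E : forall U, U *m smx3 n 1 1 0 0 0 *m U^T = smx3 n 1 1 0 0 0 -> Defs.ortho (smx3 n 1 1 0 0 0) U by
      move=> U EU; split=> //; apply: ortho_unit EU; rewrite det_mx3; clear -n2; lia);
    by apply: E; rewrite /mxt /= tr_mx3 !mul_mx3; congr mx3; ring.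
- move=> U; have [x1 [x2 [x3 [y1 [y2 [y3 [z1 [z2 [z3 ->]]]]]]]]] := mx3P U.
  move=> /ortho_eqs /= [[E00 E11 E22] [E01 E02 E12]].
  have y10 : y1 = 0 by clear -n2 E11; nia.
  have z10 : z1 = 0 by clear -n2 E22; nia.
  subst y1 z1.
  have Ey : y2 * y2 + y3 * y3 = 1 by rewrite -[RHS]E11; ring.
  have Ez : z2 * z2 + z3 * z3 = 1 by rewrite -[RHS]E22; ring.
  have {}E12 : y2 * z2 + y3 * z3 = 0 by rewrite -[RHS]E12; ring.
  have {}E01 : x2 * y2 + x3 * y3 = 0 by rewrite -[RHS]E01; ring.
  have {}E02 : x2 * z2 + x3 * z3 = 0 by rewrite -[RHS]E02; ring.
  have sy := sum2sq1 Ey; have sz := sum2sq1 Ez.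
  have [x20 x30] : x2 = 0 /\ x3 = 0.
    by clear -sy sz E12 E01 E02; case: sy => -[? ?]; case: sz => -[? ?]; subst; split; lia.
  subst x2 x3.
  have /(pm1_of n0) x1E : n * x1 * x1 = n by rewrite -[RHS]E00; ring.
  exists (((x1, 0), 0), ((0, y2), y3), ((0, z2), z3)); last by [].
  move: x1E; rewrite !inE => /orP[]/eqP ->; clear -sy sz E12;
  by case: sy E12 => -[-> ->]; case: sz => -[-> ->].
Qed.

(** The group is that of the hexagon times a sign. *)
Lemma ortho_hexagonal n : 1 <= n ->
  ncard (Defs.ortho (smx3 n 2 2 0 0 (-1))) = 24 /\ ncard (invols (smx3 n 2 2 0 0 (-1))) = 16.
Proof.
move=> n1; have n0 : n != 0 by clear -n1; lia.
pose S : seq ((int * int) * (int * int)) :=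
  [:: ((1, 0), (0, 1)); ((1, 0), (-1, -1)); ((-1, 0), (0, -1)); ((-1, 0), (1, 1));
      ((0, 1), (1, 0)); ((0, 1), (-1, -1)); ((0, -1), (-1, 0)); ((0, -1), (1, 1));
      ((1, 1), (-1, 0)); ((1, 1), (0, -1)); ((-1, -1), (1, 0)); ((-1, -1), (0, 1))].
pose l := [seq (((e, 0), 0), ((0, s.1.1), s.1.2), ((0, s.2.1), s.2.2)) | e <- [:: 1; -1 : int], s <- S]
  : seq ((int * int * int) * (int * int * int) * (int * int * int)).
suff [] : ncard (Defs.ortho (smx3 n 2 2 0 0 (-1))) = size l /\
    ncard (invols (smx3 n 2 2 0 0 (-1))) = count (fun t => sqt t == id9) l by [].
apply: ncard_ortho_list => //.
- move=> t; rewrite /l !inE; do ?case/orP; move=> /eqP ->;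
    (have E : forall U, U *m smx3 n 2 2 0 0 (-1) *m U^T = smx3 n 2 2 0 0 (-1) -> Defs.ortho (smx3 n 2 2 0 0 (-1)) U by
      move=> U EU; split=> //; apply: ortho_unit EU; rewrite det_mx3; clear -n1; lia);
    by apply: E; rewrite /mxt /= tr_mx3 !mul_mx3; congr mx3; ring.
- move=> U; have [x1 [x2 [x3 [y1 [y2 [y3 [z1 [z2 [z3 ->]]]]]]]]] := mx3P U.
  move=> /ortho_eqs /= [[E00 E11 E22] [E01 E02 E12]].
  have hex0 (u v : int) : 0 <= u * u - u * v + v * v by clear; nia.
  have hex00 (u v : int) : u * u - u * v + v * v = 0 -> u = 0 /\ v = 0 by clear; move=> H; split; nia.
  (* a vector of norm 2 off the hexagonal plane would be orthogonal to it *)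
  have first0 y1' y2' y3' z1' z2' z3' : n * y1' * y1' + 2 * (y2' * y2' - y2' * y3' + y3' * y3') = 2 ->
      n * y1' * z1' + (2 * y2' * z2' + 2 * y3' * z3' - y2' * z3' - y3' * z2') = -1 -> y1' = 0.
    move=> F1 F2; have [//|y10] := eqVneq y1' 0; exfalso.
    have h0 := hex0 y2' y3'.
    have h2 : 0 < n * y1' * y1' by clear -y10 n1; nia.
    have hz : y2' * y2' - y2' * y3' + y3' * y3' = 0 by clear -F1 h0 h2; lia.
    have [e1 e2] := hex00 _ _ hz; subst y2' y3'.
    have F3 : n * y1' * y1' = 2 by rewrite -[RHS]F1; ring.
    have F4 : n * y1' * z1' = -1 by rewrite -[RHS]F2; ring.
    have : (n * y1' * z1') * y1' = 2 * z1' by rewrite -F3; ring.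
    rewrite F4 => F5; have F6 : y1' = - 2 * z1' by clear -F5; lia.
    by subst y1'; clear -F4; lia.
  have Y1 : n * y1 * y1 + 2 * (y2 * y2 - y2 * y3 + y3 * y3) = 2 by rewrite -[RHS]E11; ring.
  have Z1 : n * z1 * z1 + 2 * (z2 * z2 - z2 * z3 + z3 * z3) = 2 by rewrite -[RHS]E22; ring.
  have y10 : y1 = 0 by apply: (first0 _ _ _ z1 z2 z3 Y1); rewrite -[RHS]E12; ring.
  have z10 : z1 = 0 by apply: (first0 _ _ _ y1 y2 y3 Z1); rewrite -[RHS]E12; ring.
  subst y1 z1.
  have Ey : y2 * y2 - y2 * y3 + y3 * y3 = 1 by clear -Y1; lia.
  have Ez : z2 * z2 - z2 * z3 + z3 * z3 = 1 by clear -Z1; lia.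
  have {}E12 : 2 * y2 * z2 + 2 * y3 * z3 - y2 * z3 - y3 * z2 = -1 by rewrite -[RHS]E12; ring.
  have {}E01 : 2 * x2 * y2 + 2 * x3 * y3 - x2 * y3 - x3 * y2 = 0 by rewrite -[RHS]E01; ring.
  have {}E02 : 2 * x2 * z2 + 2 * x3 * z3 - x2 * z3 - x3 * z2 = 0 by rewrite -[RHS]E02; ring.
  have sy := hex1 Ey; have sz := hex1 Ez; clear Ey Ez Y1 Z1 E11 E22.
  have [sS x2x3] : ((y2, y3), (z2, z3)) \in S /\ x2 = 0 /\ x3 = 0.
    clear -sy sz E12 E01 E02; move: sy sz; rewrite !inE !xpair_eqE.
    by do ?case/orP; move=> /andP[/eqP ? /eqP ?]; do ?case/orP; move=> /andP[/eqP ? /eqP ?];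
      subst; first [exfalso; clear -E12; lia | split; [by [] | clear -E01 E02; lia]].
  have [? ?] := x2x3; subst x2 x3.
  have /(pm1_of n0) x1E : n * x1 * x1 = n by rewrite -[RHS]E00; ring.
  exists (((x1, 0), 0), ((0, y2), y3), ((0, z2), z3)); last by [].
  by apply/allpairsP; exists (x1, ((y2, y3), (z2, z3))).
Qed.

(** The form is |x|^2 + y s(x)^2 with s the sum of the coordinates. Two rows of an isometry differ
    by a vector of norm 2, so for y >= 2 they have equal sums; this sum is 1 or -1, and the rows are
    basis vectors up to one common sign. *)
Lemma ortho_trigonal y : 2 <= y ->
  ncard (Defs.ortho (smx3 (y + 1) (y + 1) (y + 1) y y y)) = 12 /\
  ncard (invols (smx3 (y + 1) (y + 1) (y + 1) y y y)) = 8.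
Proof.
move=> y2; set G := smx3 _ _ _ _ _ _.
pose S : seq ((int * int * int) * (int * int * int) * (int * int * int)) :=
 [:: (((1, 0), 0), ((0, 1), 0), ((0, 0), 1)); (((1, 0), 0), ((0, 0), 1), ((0, 1), 0));
     (((0, 1), 0), ((1, 0), 0), ((0, 0), 1)); (((0, 1), 0), ((0, 0), 1), ((1, 0), 0));
     (((0, 0), 1), ((1, 0), 0), ((0, 1), 0)); (((0, 0), 1), ((0, 1), 0), ((1, 0), 0));
     (((-1, 0), 0), ((0, -1), 0), ((0, 0), -1)); (((-1, 0), 0), ((0, 0), -1), ((0, -1), 0));
     (((0, -1), 0), ((-1, 0), 0), ((0, 0), -1)); (((0, -1), 0), ((0, 0), -1), ((-1, 0), 0));
     (((0, 0), -1), ((-1, 0), 0), ((0, -1), 0)); (((0, 0), -1), ((0, -1), 0), ((-1, 0), 0))].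
suff [] : ncard (Defs.ortho G) = size S /\
    ncard (invols G) = count (fun t => sqt t == id9) S by [].
apply: ncard_ortho_list => //.
- move=> t; rewrite /S !inE; do ?case/orP; move=> /eqP ->;
    (have E : forall U, U *m G *m U^T = G -> Defs.ortho G U by
      move=> U EU; split=> //; apply: ortho_unit EU; rewrite det_mx3;
      rewrite (_ : _ + _ = 3 * y + 1); [clear -y2; lia | ring]);
    by apply: E; rewrite /mxt /= tr_mx3 !mul_mx3; congr mx3; ring.
- move=> U; have [x1 [x2 [x3 [y1 [y2' [y3 [z1 [z2 [z3 ->]]]]]]]]] := mx3P U.
  move=> oU; have [uU _] := oU; move: oU => /ortho_eqs /= [[E00 E11 E22] [E01 E02 E12]].
  have sums u1 u2 u3 v1 v2 v3 : u1 * u1 + u2 * u2 + u3 * u3 + y * (u1 + u2 + u3) * (u1 + u2 + u3) = y + 1 ->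
      v1 * v1 + v2 * v2 + v3 * v3 + y * (v1 + v2 + v3) * (v1 + v2 + v3) = y + 1 ->
      u1 * v1 + u2 * v2 + u3 * v3 + y * (u1 + u2 + u3) * (v1 + v2 + v3) = y ->
      u1 + u2 + u3 = v1 + v2 + v3.
    move=> F1 F2 F3; apply/eqP; rewrite -subr_eq0; apply/eqP.
    set s := _ - _; have [//|s0] := eqVneq s 0; exfalso.
    have F4 : (u1 - v1) ^+ 2 + (u2 - v2) ^+ 2 + (u3 - v3) ^+ 2 + y * s ^+ 2 = 2.
      transitivity (u1 * u1 + u2 * u2 + u3 * u3 + y * (u1 + u2 + u3) * (u1 + u2 + u3) -
        2 * (u1 * v1 + u2 * v2 + u3 * v3 + y * (u1 + u2 + u3) * (v1 + v2 + v3)) +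
        (v1 * v1 + v2 * v2 + v3 * v3 + y * (v1 + v2 + v3) * (v1 + v2 + v3))).
        by rewrite /s; ring.
      by rewrite F1 F2 F3; ring.
    have s2 : 1 <= s ^+ 2 by clear -s0; nia.
    have ys : 2 <= y * s ^+ 2 by clear -s2 y2; nia.
    have := sqr_ge0 (u1 - v1); have := sqr_ge0 (u2 - v2); have := sqr_ge0 (u3 - v3).
    move=> h3 h2 h1.
    have g1 : (u1 - v1) ^+ 2 = 0 by clear -h1 h2 h3 ys F4; lia.
    have g2 : (u2 - v2) ^+ 2 = 0 by clear -h1 h2 h3 ys F4; lia.
    have g3 : (u3 - v3) ^+ 2 = 0 by clear -h1 h2 h3 ys F4; lia.
    move/eqP: g1; rewrite expf_eq0 /= subr_eq0 => /eqP g1.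
    move/eqP: g2; rewrite expf_eq0 /= subr_eq0 => /eqP g2.
    move/eqP: g3; rewrite expf_eq0 /= subr_eq0 => /eqP g3.
    by case/eqP: s0; rewrite /s g1 g2 g3 subrr.
  pose s := x1 + x2 + x3.
  have X : x1 * x1 + x2 * x2 + x3 * x3 + y * s * s = y + 1 by rewrite -[RHS]E00 /s; ring.
  have sy : s = y1 + y2' + y3.
    by apply: sums => //; [rewrite -[RHS]E11; ring | rewrite -[RHS]E01; ring].
  have sz : s = z1 + z2 + z3.
    by apply: sums => //; [rewrite -[RHS]E22; ring | rewrite -[RHS]E02; ring].
  have s0 : s != 0.
    apply: contraTneq uU => s0; rewrite unitmxE det_mx3.
    have -> : x3 = - x1 - x2 by clear -s0; rewrite /s in s0; lia.
    have -> : y3 = - y1 - y2' by clear -s0 sy; lia.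
    have -> : z3 = - z1 - z2 by clear -s0 sz; lia.
    by rewrite (_ : _ + _ = 0) ?unitr0 //; ring.
  have s1 : s * s = 1.
    have n1 : 0 <= x1 * x1 by clear; nia.
    have n2 : 0 <= x2 * x2 by clear; nia.
    have n3 : 0 <= x3 * x3 by clear; nia.
    have le : y * s * s <= y + 1 by clear -n1 n2 n3 X; lia.
    by clearbody s; clear -le s0 y2; nia.
  have ysE : y * s * s = y by rewrite -mulrA s1 mulr1.
  have Ex : x1 * x1 + x2 * x2 + x3 * x3 = 1 by clear -X ysE; lia.
  have Ey : y1 * y1 + y2' * y2' + y3 * y3 = 1.
    by apply: (addIr (y * s * s)); rewrite ysE addrC [1 + y]addrC -[RHS]E11 -{1}ysE {1 2}sy; ring.
  have Ez : z1 * z1 + z2 * z2 + z3 * z3 = 1.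
    by apply: (addIr (y * s * s)); rewrite ysE addrC [1 + y]addrC -[RHS]E22 -{1}ysE {1 2}sz; ring.
  have Exy : x1 * y1 + x2 * y2' + x3 * y3 = 0.
    by apply: (addIr (y * s * s)); rewrite ysE addrC add0r -[RHS]E01 -{1}ysE {2}sy /s; ring.
  have Exz : x1 * z1 + x2 * z2 + x3 * z3 = 0.
    by apply: (addIr (y * s * s)); rewrite ysE addrC add0r -[RHS]E02 -{1}ysE {2}sz /s; ring.
  have Eyz : y1 * z1 + y2' * z2 + y3 * z3 = 0.
    by apply: (addIr (y * s * s)); rewrite ysE addrC add0r -[RHS]E12 -{1}ysE {1}sy sz; ring.
  have unitv u1 u2 u3 : u1 * u1 + u2 * u2 + u3 * u3 = 1 -> s = u1 + u2 + u3 ->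
      (u1, u2, u3) \in [:: (s, 0, 0); (0, s, 0); (0, 0, s) : int * int * int].
    clear; move=> F Es.
    have h1 : u1 * u1 <= 1 by nia.
    have h2 : u2 * u2 <= 1 by nia.
    have h3 : u3 * u3 <= 1 by nia.
    by rewrite Es; case: (sq_le1 h1) F => ->; case: (sq_le1 h2) => ->; case: (sq_le1 h3) => ->.
  have hx := unitv _ _ _ Ex erefl; have hy := unitv _ _ _ Ey sy; have hz := unitv _ _ _ Ez sz.
  have sE : s = 1 \/ s = -1.
    have hs : s * s <= 1 by rewrite s1.
    by case: (sq_le1 hs) s0 => ->; auto.
  exists (((x1, x2), x3), ((y1, y2'), y3), ((z1, z2), z3)); last by [].
  clearbody s; clear -hx hy hz sE Exy Exz Eyz.
  move: hx hy hz; rewrite !inE !xpair_eqE -!andbA.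
  by case: sE => ->; do ?case/orP; move=> /and3P[/eqP ? /eqP ? /eqP ?];
     do ?case/orP; move=> /and3P[/eqP ? /eqP ? /eqP ?];
     do ?case/orP; move=> /and3P[/eqP ? /eqP ? /eqP ?]; subst.
Qed.

Lemma ortho_cases (G : 'M[int]_3) : lattice G -> sqfreez (\det G) ->
  ~ isometric G (diag3 1 1 1) ->
  let o := ncard (Defs.ortho G) in let i := ncard (invols G) in
  [\/ o = i /\ (o <= 8)%N, o = 12 /\ i = 8, o = 24 /\ i = 16 | o = 16 /\ i = 12].
Proof.
move=> lG sq n111 o i.
have [allinv|] := pselect (forall U, Defs.ortho G U -> U *m U = 1%:M).
  constructor 1; have oi : o = i.
    rewrite /o /i; congr ncard; apply/seteqP; split=> U; last by case.
    by move=> oU; split=> //; apply: allinv.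
  by split=> //; rewrite oi /i (ncard_invols lG) !ltnS; apply: involutive_le8.
move=> /existsNP[U0 /not_implyP[oU0 /eqP U02]].
have [W [oW dW W2]] : exists W, [/\ Defs.ortho G W, \det W = 1 & W *m W != 1%:M].
  have [uU0 eU0] := oU0; have := uU0; rewrite unit_mx3P => /orP[/eqP d1|/eqP d1].
    by exists U0.
  have dN : \det (- U0) = 1 by rewrite -scaleN1r detZ d1.
  exists (- U0); split=> //; last by rewrite mulmxN mulNmx opprK.
  split; first by rewrite unitmxE dN unitr1.
  by rewrite linearN /= mulmxN !mulNmx opprK.
have [a [b [c [d [e [f [x [y [i1 [j [k [l [iG R dR j0 tau]]]]]]]]]]]]] := rot_shape lG oW dW W2.
have lG' := isometric_lattice iG lG.
have sq' : sqfreez (\det (smx3 a b c d e f)) by rewrite -(isometric_det_int iG).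
have trans n1 b1 c1 d1 e1 f1 : isometric (smx3 a b c d e f) (smx3 n1 b1 c1 d1 e1 f1) ->
    [/\ lattice (smx3 n1 b1 c1 d1 e1 f1), isometric G (smx3 n1 b1 c1 d1 e1 f1),
      o = ncard (Defs.ortho (smx3 n1 b1 c1 d1 e1 f1)) &
      i = ncard (invols (smx3 n1 b1 c1 d1 e1 f1))].
  move=> i2; have i3 := isometric_trans iG i2.
  have [h1 h2] := ncard_ortho_isometric lG i3.
  by split; [exact: isometric_lattice i3 lG|exact: i3|exact: h1|exact: h2].
have neg1 : (exists n, isometric (smx3 a b c d e f) (smx3 n 2 2 0 0 (-1)) \/
            isometric (smx3 a b c d e f) (smx3 n 2 2 1 0 (-1))) ->
  [\/ o = i /\ (o <= 8)%N, o = 12 /\ i = 8, o = 24 /\ i = 16 | o = 16 /\ i = 12].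
  move=> [n [i2|i2]].
    have [l2 _ -> ->] := trans _ _ _ _ _ _ i2; constructor 3; apply: ortho_hexagonal.
    by have [n0 _ _] := lattice_minors l2; lia.
  have i3 : isometric (smx3 a b c d e f) (smx3 n n n (n - 1) (n - 1) (n - 1)).
    apply: isometric_trans i2 _; exists (mx3 1 0 0 1 (-1) 0 1 (-1) (-1)).
      by rewrite unitmxE det_mx3.
    by rewrite tr_mx3 !mul_mx3; congr mx3; ring.
  have [l3 i4 -> ->] := trans _ _ _ _ _ _ i3; constructor 2.
  have [n0 _ _] := lattice_minors l3.
  (* The value n = 1 is the cubic lattice and n = 2 has determinant 4, so y = n - 1 is at least
     2. *)
  have n1 : n != 1.
    by apply/eqP => n1; apply: n111; rewrite n1 in i4; rewrite diag3E.
  have n2 : n != 2.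
    apply/eqP => n2; have /negP[] := sq 2 isT.
    by rewrite (isometric_det_int i4) n2 det_mx3.
  by have := @ortho_trigonal (n - 1); rewrite subrK; apply; clear -n0 n1 n2; lia.
have [t0|[t1|t2]] : i1 + l = 0 \/ i1 + l = -1 \/ i1 + l = 1 by clear -tau; lia.
- have [n i2] := rot_tau0 lG' sq' R dR j0 t0.
  have [l2 i4 -> ->] := trans _ _ _ _ _ _ i2; constructor 4; apply: ortho_tetragonal.
  have [n0 _ _] := lattice_minors l2.
  have n1 : n != 1.
    by apply/eqP => n1; apply: n111; rewrite n1 in i4; rewrite diag3E.
  by clear -n0 n1; lia.
- exact/neg1/(rot_tau1 lG' sq' R dR j0 t1).
(* A rotation of order 6 is replaced by its square, of order 3. *)
- apply/neg1/(rot_tau1 lG' sq' (rot_sq R)).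
  + by transitivity ((i1 * l - j * k) ^+ 2); [ring|rewrite dR].
  + have -> : i1 * j + j * l = j * (i1 + l) by ring.
  by rewrite t2 mulr1.
  + transitivity ((i1 + l) ^+ 2 - 2 * (i1 * l - j * k)); first by ring.
    by rewrite t2 dR.
Qed.

(** * Vectors of reflections *)

Definition PQ (K : 'M[int]_3) : nat := (frakP K * frakQ K)%N.

(** For odd m the second condition says that [v] lies in Lambda_m(H), by [LambdaP]. *)
Definition rvec (m dl : nat) (H : 'M[int]_3) : set 'rV[int]_3 :=
  [set v | qform H v = (m * dl)%N%:Z /\ exists c : 'rV[int]_3, v *m H = m%:Z *: c].

Lemma PQ_prod (K : 'M[int]_3) :
  PQ K = (\prod_(q <- primes `|\det K| | odd q) q)%N.
Proof.
rewrite /PQ /frakP /frakQ [RHS](bigID (fun q => `[< anisotropic (ext (padic_num q) K) >])) /=.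
congr (_ * _)%N; apply: eq_bigl => q; congr (_ && _).
apply/asboolP/idP => [iq|/asboolPn]; last by rewrite /anisotropic => /contrapT.
by apply/asboolPn; apply.
Qed.

Lemma sqfree_prod (d : nat) : (0 < d)%N -> (forall q, prime q -> (logn q d <= 1)%N) ->
  d = (\prod_(q <- primes d) q)%N.
Proof.
move=> d0 H; rewrite {1}(prod_prime_decomp d0) prime_decompE big_map.
apply: eq_big_seq => q /=; rewrite mem_primes => /and3P[pq _ qd].
rewrite -[RHS]expn1; congr (_ ^ _)%N; apply/eqP; rewrite eqn_leq H //.
by rewrite -pfactor_dvdn // expn1.
Qed.

Lemma PQ_odd K : odd (PQ K).
Proof.
rewrite PQ_prod; elim/big_ind: _ => // x y; by rewrite oddM => -> ->.
Qed.

Lemma PQ_det K : stable K ->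
  `|\det K|%N = (PQ K * (if `[< even_lattice K >] then 2 else 1))%N.
Proof.
move=> sK; have [lK _ ord _] := sK; have D0 := lattice_det_gt0 lK.
have d0 : (0 < `|\det K|)%N by rewrite absz_gt0 gt_eqF.
rewrite {1}(sqfree_prod d0 ord) (bigID odd) /= -PQ_prod; congr (_ * _)%N.
have [e2|ne2] := boolP `[< even_lattice K >].
  have two : (2 \in primes `|\det K|)%N.
    rewrite mem_primes /= d0; move/asboolP: e2 => /(stable_even2 sK).
    by rewrite dvdzE.
  rewrite -big_filter (bigD1_seq 2%N) ?mem_filter ?two ?filter_uniq ?primes_uniq //=.
  rewrite big1_seq ?muln1 // => q /andP[q2]; rewrite mem_filter => /andP[oq].
  by rewrite mem_primes => /and3P[pq _ _]; case/even_prime: pq oq q2 => [->|->].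
rewrite big1_seq // => q /andP[oq]; rewrite mem_primes => /and3P[pq _ dq].
have q2 : q = 2 by case/even_prime: pq oq => [//|->].
case/negP: ne2; apply/asboolP/(stable_even2 sK); rewrite dvdzE.
by rewrite q2 in dq.
Qed.

Lemma dvd_PQ_det K m : stable K -> (m %| PQ K)%N -> (m%:Z %| \det K)%Z.
Proof.
by move=> sK mP; rewrite dvdzE absz_nat (PQ_det sK); apply: dvdn_mulr.
Qed.

Lemma sqfreez_dvd (a b : int) : sqfreez b -> (a %| b)%Z -> sqfreez a.
Proof. by move=> sb ab q pq; apply: contra (sb q pq) => /dvdz_trans; apply. Qed.

Lemma rvec_sqfree K m dl : stable K -> (m %| PQ K)%N -> dl \in [:: 1; 2]%N ->
  sqfreez (m * dl)%N%:Z.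
Proof.
move=> sK mP dl12 q pq; apply/negP; rewrite dvdzE !absz_nat => q2.
have om : odd m by apply: dvdn_odd mP (PQ_odd K).
have sm : sqfreez m%:Z by apply: sqfreez_dvd (stable_sqfree sK) (dvd_PQ_det sK mP).
have /negP[] := sm q pq; rewrite dvdzE !absz_nat.
have [q2E|oq] := even_prime pq.
  have : (4 %| m * dl)%N by rewrite q2E in q2.
  move: dl12; rewrite !inE => /orP[]/eqP ->; rewrite ?muln1 => m4.
    have : (2 %| m)%N by apply: dvdn_trans m4.
    by rewrite dvdn2 om.
  have : (2 * 2 %| m * 2)%N by [].
  by rewrite dvdn_pmul2r // dvdn2 om.
move: q2; rewrite mulnC Gauss_dvdr //.
rewrite coprime_sym coprimeXr // coprime_sym.
move: dl12; rewrite !inE => /orP[]/eqP ->; rewrite ?coprimen1 //.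
by rewrite coprimen2.
Qed.

Lemma rvec_prim K H m dl v : stable K -> (m %| PQ K)%N -> dl \in [:: 1; 2]%N ->
  rvec m dl H v -> exists2 U : 'M[int]_3, U \in unitmx & v = row o0 U.
Proof.
move=> sK mP dl12 [Qv _]; have [U [k [uU vU]]] := row_complete v.
have sq := rvec_sqfree sK mP dl12.
have E1 : rv3 1 0 0 *m U = row o0 U.
  rewrite rowE; congr (_ *m U); apply/rowP; apply: I3P; by rewrite !mxE.
have Qk : (m * dl)%N%:Z = k ^+ 2 * qform H (rv3 1 0 0 *m U) by rewrite -Qv vU qformZ.
have k0 : k != 0.
  apply: contraTneq (sq 2 isT) => k0; rewrite Qk k0 expr0n mul0r dvdz0 //.
have k1 : `|k| = 1.
  apply: (sqfreez_sq sq); first by rewrite normr_gt0.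
  by rewrite Qk -normrX ger0_norm ?sqr_ge0 // dvdz_mulr.
have [kE|kE] : k = 1 \/ k = -1 by clear -k1; lia.
  by exists U => //; rewrite vU kE scale1r.
exists (- U); first by rewrite unitmxE -scaleN1r detZ unitrMl ?unitrX ?unitrN1.
by rewrite vU kE scaleN1r E1; apply/rowP => i; rewrite !mxE.
Qed.

Lemma rvec_symv K H m dl v : stable K -> (m %| PQ K)%N -> dl \in [:: 1; 2]%N ->
  rvec m dl H v -> symv H v.
Proof.
move=> sK mP dl12 rv; split; first exact: (rvec_prim sK mP dl12 rv).
have [Qv [c Hc]] := rv; rewrite Qv Hc.
move: dl12; rewrite !inE => /orP[]/eqP ->.
  by exists (2 *: c); rewrite muln1 !scalerA mulrC.
by exists c; rewrite scalerA PoszM mulrC.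
Qed.

(** Write v H = b w with [w] primitive. The reflection condition gives Q(v) = b u with u dividing 2,
    and b divides the determinant because [v] is primitive. For b odd take m = b and delta = u; for
    b even, m = b / 2 and delta = 2. *)
Lemma symv_rvec K H v : stable K -> genus K H -> symv H v ->
  exists m dl, [/\ (m %| PQ K)%N, dl \in [:: 1; 2]%N & rvec m dl H v].
Proof.
move=> sK gH sv; have [lK _ _ _] := sK; have lH := genus_lattice gH.
have dH := genus_det lK gH; have D0 := lattice_det_gt0 lK.
have [[U uU vU] [c Hc]] := sv; have Q0 := symv_gt0 lH sv.
have [V [k [uV Ev]]] := row_complete (v *m H).
set w := rv3 1 0 0 *m V in Ev.
have [b [w' [b0 Ev' [V' uV' wV']]]] : exists (b : int) (w' : 'rV[int]_3),
    [/\ 0 < b, v *m H = b *: w' & exists2 V' : 'M[int]_3, V' \in unitmx & w' = row o0 V'].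
  have wV : w = row o0 V.
    rewrite /w rowE; congr (_ *m V); apply/rowP; apply: I3P; by rewrite !mxE.
  have k0 : k != 0.
    apply: contraTneq Q0 => k0; rewrite /qform /bform Ev k0 scale0r mul0mx mxE.
    by rewrite ltxx.
  have [kp|kn] := ltrP 0 k; first by exists k, w; split=> //; exists V.
  exists (- k), (- w); split; first by rewrite oppr_gt0 lt_neqAle k0.
    by rewrite scalerN scaleNr opprK.
  exists (- V); first by rewrite unitmxE -scaleN1r detZ unitrMl ?unitrX ?unitrN1.
  by rewrite wV; apply/rowP => i; rewrite !mxE.
have bn : b != 0 by rewrite gt_eqF.
have [j [Ej _]] : exists j, 2 * b = qform H v * j /\ c = j *: w'.
  apply: (prim_dvd uV' wV'); last by rewrite gt_eqF.
  by rewrite -scalerA -Ev'.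
have [u Eu] : exists u, qform H v = b * u.
  by exists ((w' *m v^T) 0 0); rewrite /qform /bform Ev' -scalemxAl mxE.
have uj : u * j = 2.
  by apply: (mulfI bn); rewrite mulrA -Eu -Ej mulrC.
have u0 : 0 < u by rewrite -(pmulr_rgt0 _ b0) -Eu.
have u12 : u = 1 \/ u = 2.
  have j0 : 0 < j by rewrite -(pmulr_rgt0 _ u0) uj.
  by clear -u0 j0 uj; nia.
have [i [Ei _]] : exists i, \det H = b * i /\ w' *m \adj H = i *: v.
  apply: (prim_dvd uU vU) => //.
  by rewrite -mul_mx_scalar -mul_mx_adj mulmxA Ev' -scalemxAl.
have bP : (`|b| %| PQ K * (if `[< even_lattice K >] then 2 else 1))%N.
  by rewrite -(PQ_det sK) -dH Ei abszM dvdn_mulr.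
have absb : `|b|%N%:Z = b by rewrite gtz0_abs.
have ev := genus_even lK gH.
have [ob|eb] := boolP (odd `|b|).
  exists `|b|%N, `|u|%N; split.
  - by move: bP; case: ifP => _; rewrite ?muln1 // Gauss_dvdl // coprimen2.
  - by case: u12 => ->.
  - by split; [rewrite PoszM absb gtz0_abs | exists w'; rewrite absb].
have evK : even_lattice K.
  apply: contrapT => nev; move: bP; rewrite (asboolF nev) muln1 => bP.
  by have := dvdn_odd bP (PQ_odd K); rewrite (negPf eb).
have eb2 : (2 %| `|b|)%N by rewrite dvdn2.
have mE := divnK eb2; set m := (`|b| %/ 2)%N in mE.
have bm : b = 2 * m%:Z by rewrite -absb -mE PoszM mulrC.
(* Otherwise Q(v) = 4 m, and with even products with [v] and even norms the determinant would be
   divisible by 4. *)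
have u1 : u = 1.
  case: u12 => // u2; exfalso.
  have iH : isometric H (U *m H *m U^T) by exists U.
  have lH' := isometric_lattice iH lH; have [sH' _] := lH'.
  have [x1 [x2 [x3 [x4 [x5 [x6 EG]]]]]] := smx3P sH'.
  have eUv : delta_mx 0 o0 *m U = v by rewrite vU rowE.
  have x1E : x1 = 4 * m%:Z.
    transitivity (qform H v); last by rewrite Eu u2 bm; ring.
    by rewrite -eUv -qform_conj /qform bform_delta EG mxE.
  have ent (k0 : 'I_3) : (U *m H *m U^T) o0 k0 = 2 * (m%:Z * (w' *m U^T) 0 k0).
    transitivity ((v *m H *m U^T) 0 k0); last by rewrite Ev' -scalemxAl mxE bm mulrA.
    by rewrite vU -!row_mul [in RHS]mxE.
  have x4E : x4 = 2 * (m%:Z * (w' *m U^T) 0 o1) by rewrite -ent EG mxE.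
  have x5E : x5 = 2 * (m%:Z * (w' *m U^T) 0 o2) by rewrite -ent EG mxE.
  have evH' : even_lattice (smx3 x1 x2 x3 x4 x5 x6) by rewrite -EG; apply: (isometric_even iH); apply/ev.
  have /dvdzP[y2 Ey2] := evH' (rv3 0 1 0); have /dvdzP[y3 Ey3] := evH' (rv3 0 0 1).
  have {}Ey2 : x2 = y2 * 2 by rewrite -Ey2 qform_rv3; ring.
  have {}Ey3 : x3 = y3 * 2 by rewrite -Ey3 qform_rv3; ring.
  have /negP[] := stable_sqfree sK (isT : prime 2).
  rewrite -dH (isometric_det_int iH) EG det_mx3 x1E x4E x5E Ey2 Ey3.
  set z4 := m%:Z * _; set z5 := m%:Z * _; clearbody z4 z5; apply/dvdzP.
  exists (m%:Z * (4 * y2 * y3 - x6 ^+ 2) - z4 * (2 * z4 * y3 - x6 * z5) + z5 * (z4 * x6 - 2 * y2 * z5)).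
  by rewrite /smx3; ring.
exists m, 2%N; split=> //.
- move: bP; rewrite (asboolT evK) -mE dvdn_pmul2r //.
- split; first by rewrite Eu u1 mulr1 bm PoszM mulrC.
  by exists (2 *: w'); rewrite scalerA Ev' bm mulrC.
Qed.

(** As m is odd and delta is 1 or 2, the norm m delta determines both, so the sets [rvec] are
    disjoint. *)
Lemma ncard_symv K H : stable K -> genus K H ->
  ncard (symv H) = (\sum_(m <- divisors (PQ K)) \sum_(dl <- [:: 1; 2]) ncard (rvec m dl H))%N.
Proof.
move=> sK gH; have lH := genus_lattice gH.
have [s us Hs] := finite_enum (finite_symv lH); rewrite (ncard_seq us Hs).
have P0 : (0 < PQ K)%N by have := PQ_odd K; case: (PQ K).
have nE m dl : m \in divisors (PQ K) -> dl \in [:: 1; 2]%N ->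
    ncard (rvec m dl H) = (\sum_(v <- s) (qform H v == (m * dl)%N%:Z))%N.
  rewrite -dvdn_divisors // => mP dl12.
  rewrite -big_mkcond /= sum1_count -size_filter.
  apply: ncard_seq; first exact: filter_uniq.
  move=> v; rewrite mem_filter; split.
    move=> rv; have [Qv _] := rv; rewrite Qv eqxx /=; apply/Hs; exact: (rvec_symv sK mP dl12 rv).
  case/andP => /eqP Qv /Hs sv; have [m' [dl' [mP' dl12' rv]]] := symv_rvec sK gH sv.
  have [Qv' _] := rv; suff [-> ->] : m = m' /\ dl = dl' by [].
  have om : odd m by apply: dvdn_odd mP (PQ_odd K).
  have om' : odd m' by apply: dvdn_odd mP' (PQ_odd K).
  have [E] : (m * dl)%N = (m' * dl')%N by apply/eqP; rewrite -eqz_nat -Qv -Qv'.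
  have := congr1 odd E; rewrite !oddM om om' /=.
  by move: dl12 dl12' E; rewrite !inE => /orP[]/eqP -> /orP[]/eqP -> //;
     rewrite ?muln1 => E _; split=> //; move/eqP: E; rewrite eqn_pmul2r // => /eqP.
rewrite (eq_big_seq (fun m => \sum_(dl <- [:: 1; 2]) \sum_(v <- s) (qform H v == (m * dl)%N%:Z)))%N; last first.
  by move=> m mP; apply: eq_big_seq => dl dl12; apply: nE.
under eq_bigr do rewrite exchange_big /=.
rewrite exchange_big /= -sum1_size; apply: eq_big_seq => v /Hs sv.
have [m [dl [mP dl12 rv]]] := symv_rvec sK gH sv; have [Qv _] := rv.
have om : odd m by apply: dvdn_odd mP (PQ_odd K).
have mD : m \in divisors (PQ K) by rewrite -dvdn_divisors.
rewrite (bigD1_seq m) ?divisors_uniq //= [X in (_ + X)%N]big1_seq ?addn0; last first.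
  move=> m' /andP[mm']; rewrite -dvdn_divisors // => mP'.
  have om' : odd m' by apply: dvdn_odd mP' (PQ_odd K).
  rewrite big1_seq // => dl' /andP[_ dl12']; rewrite Qv eqz_nat.
  suff /negPf -> : (m * dl != m' * dl')%N by [].
  apply: contra mm' => /eqP E; have := congr1 odd E; rewrite !oddM om om' /=.
  by move: dl12 dl12' E; rewrite !inE => /orP[]/eqP -> /orP[]/eqP -> //;
     rewrite ?muln1 => E _; rewrite ?E //; move/eqP: E; rewrite eqn_pmul2r // => /eqP ->.
have m0 : (0 < m)%N by case: (m) om.
rewrite !big_cons big_nil Qv !eqz_nat !eqn_pmul2l //.
by move: dl12; rewrite !inE => /orP[]/eqP ->.
Qed.

(** * The lattices lambda_m *)

Lemma scalemxE (R : pzRingType) k n (a : R) (A : 'M[R]_(k, n)) i j : (a *: A) i j = a * A i j.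
Proof. by rewrite mxE. Qed.

Lemma scalemx_inj (R : idomainType) k n (c : R) : c != 0 -> injective (fun A : 'M[R]_(k, n) => c *: A).
Proof. by move=> c0 A B /matrixP H; apply/matrixP => i j; have := H i j; rewrite !scalemxE => /(mulfI c0). Qed.

Lemma ext_int (A : 'M[int]_3) : ext int A = A.
Proof. by apply/matrixP => i j; rewrite mxE intz. Qed.

Lemma ext_scale (R : comNzRingType) (m : nat) (A : 'M[int]_3) : ext R (m%:Z *: A) = m%:R *: ext R A.
Proof. by apply/matrixP => i j; rewrite !mxE rmorphM. Qed.

Section LamStruct.
Variables (K : 'M[int]_3) (m : nat).
Hypotheses (sq : sqfreez (\det K)) (D0 : \det K != 0) (mD : (m%:Z %| \det K)%Z).

(** Square-freeness leaves elementary divisors 1, 1, c up to sign, with m dividing c; so x K is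
    divisible by m exactly when the first two Smith coordinates of x are. The last clause is stated
    over any ring in which m is regular, so as to serve over the q-adic integers too. *)
Lemma lam_struct : exists T C : 'M[int]_3,
  [/\ T *m K = m%:Z *: C, \det T ^+ 2 = m%:Z ^+ 4
    & forall (S : comUnitRingType) k (r c : 'M[S]_(k, 3)), GRing.lreg (m%:R : S) ->
      r *m ext S K = m%:R *: c -> exists a : 'M[S]_(k, 3), r = a *m ext S T].
Proof.
have [L [R [a [b [c [uL uR dab dbc E]]]]]] := smith3 K.
have dE : \det K = \det L * (a * b * c) * \det R.
  by rewrite E !det_mulmx det_mx3; congr (_ * _ * _); ring.
have abs1 (x : int) : x != 0 -> (x ^+ 2 %| \det K)%Z -> x = 1 \/ x = -1.
  move=> x0 xD; have : `|x| = 1.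
    apply: (sqfreez_sq sq); first by rewrite normr_gt0.
    by rewrite -normrX ger0_norm ?sqr_ge0.
  by clear; lia.
have [a0 [b0 c0]] : a != 0 /\ b != 0 /\ c != 0.
  by move: D0; rewrite dE !mulf_eq0 !negb_or => /andP[/andP[_ /andP[/andP[]]]].
have b1 : b = 1 \/ b = -1.
  apply: abs1 => //; rewrite dE; have /dvdzP[c' Ec] := dbc.
  by apply/dvdzP; exists (\det L * a * c' * \det R); rewrite Ec; ring.
have a1 : a = 1 \/ a = -1.
  apply: abs1 => //; rewrite dE; have /dvdzP[b' Eb] := dab.
  by apply/dvdzP; exists (\det L * b' * c * \det R); rewrite Eb; ring.
have aa : a * a = 1 by case: a1 => ->.
have bb : b * b = 1 by case: b1 => ->.
have [c' Ec] : exists c', c = m%:Z * c'.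
  have uLR : \det L * \det R \is a GRing.unit by rewrite unitrM -!unitmxE uL.
  have : (m%:Z %| c)%Z.
    have E2 : c = \det K * (a * b) * (\det L * \det R)^-1.
      rewrite dE; transitivity (a * a * (b * b) * c * ((\det L * \det R) / (\det L * \det R))).
        by rewrite aa bb (divrr uLR) !mulr1 !mul1r.
      by ring.
    by rewrite E2 -mulrA dvdz_mulr.
  by case/dvdzP => c' ->; exists c'; rewrite mulrC.
pose M := m%:Z.
pose T := mx3 M 0 0 0 M 0 0 0 1 *m invmx L.
pose C := mx3 a 0 0 0 b 0 0 0 c' *m R.
exists T, C; split.
- rewrite /T /C -/M E !mulmxA mulmxKV // mul_mx3 scalemxAl scale_mx3 Ec.
  by congr (_ *m _); congr mx3; rewrite /M; ring.
- rewrite /T det_mulmx exprMn det_mx3.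
  have -> : \det (invmx L) ^+ 2 = 1.
    by apply: intr_unit; rewrite -unitmxE unitmx_inv.
  by rewrite /M; ring.
- move=> S k r s regm Es.
  have uLS : ext S L \in unitmx by rewrite unitmxE det_map_mx rmorph_unit // -unitmxE.
  have uRS : ext S R \in unitmx by rewrite unitmxE det_map_mx rmorph_unit // -unitmxE.
  pose x := r *m ext S L.
  pose s' := s *m invmx (ext S R).
  have Ex : x *m ext S (mx3 a 0 0 0 b 0 0 0 c) = m%:R *: s'.
    by rewrite /x /s' scalemxAl -Es E !ext_mul !mulmxA mulmxK.
  have aS : (a%:~R * a%:~R : S) = 1 by rewrite -rmorphM aa.
  have bS : (b%:~R * b%:~R : S) = 1 by rewrite -rmorphM bb.
  have Ex0 i : x i o0 = m%:R * (s' i o0 * a%:~R).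
    have := congr1 (fun A : 'M_(k, 3) => A i o0) Ex.
    rewrite !mxE sum3E !mxE /= !mulr0 !addr0 => E1.
    by rewrite mulrA -E1 -mulrA aS mulr1.
  have Ex1 i : x i o1 = m%:R * (s' i o1 * b%:~R).
    have := congr1 (fun A : 'M_(k, 3) => A i o1) Ex.
    rewrite !mxE sum3E !mxE /= !mulr0 addr0 add0r => E1.
    by rewrite mulrA -E1 -mulrA bS mulr1.
  exists (\matrix_(i, j) (if j == o0 then s' i o0 * a%:~R else if j == o1 then s' i o1 * b%:~R else x i o2)).
  rewrite /T ext_mul mulmxA -[LHS](mulmxK uLS) -/x.
  have -> : ext S (invmx L) = invmx (ext S L).
    have E1 : ext S (invmx L) *m ext S L = 1%:M by rewrite -ext_mul mulVmx // /ext map_mx1.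
    by rewrite -[LHS](mulmxK uLS) E1 mul1mx.
  clear Ex; clearbody x s'.
  congr (_ *m _); apply/matrixP => i; apply: I3P; rewrite [RHS]mxE sum3E !mxE /= ?mulr0z ?mulr1z.
  + by rewrite !mulr0 !addr0 Ex0 [LHS]mulrC.
  + by rewrite !mulr0 addr0 add0r Ex1 [LHS]mulrC.
  + by rewrite !mulr0 !add0r mulr1.
Qed.

End LamStruct.

Lemma lreg_neq0 (S : idomainType) (x : S) : x != 0 -> GRing.lreg x.
Proof. by move=> x0; apply/lregP. Qed.

Lemma odd_coprime2 (m : nat) (x : int) : odd m -> (m%:Z %| 2 * x)%Z -> (m%:Z %| x)%Z.
Proof.
by move=> om; rewrite Gauss_dvdzr // coprimezE !absz_nat coprime_sym coprime2n.
Qed.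

Lemma LambdaP (K : 'M[int]_3) m x : K^T = K -> odd m ->
  Lambda m K x <-> exists c : 'rV[int]_3, x *m K = m%:Z *: c.
Proof.
move=> sK om; split=> [H|[c Hc] y].
  have Qx : (m%:Z %| qform K x)%Z.
    by have /eqP := H 0; rewrite addr0 qform0 eqz_mod_dvd subr0.
  have dv y : (m%:Z %| bform K x y)%Z.
    apply: (odd_coprime2 om); have /eqP := H y; rewrite eqz_mod_dvd qformD //.
    have -> : qform K x + 2 * bform K x y + qform K y - qform K y = qform K x + 2 * bform K x y by ring.
    by rewrite rpredDl.
  exists (\row_j (((x *m K) 0%R j) %/ m%:Z)%Z); apply/rowP => j; rewrite !mxE mulrC divzK //.
  have := dv (delta_mx 0 j); rewrite /bform trmx_delta -colE mxE.
  by rewrite [(x *m K) 0 j]mxE.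
apply/eqP; rewrite eqz_mod_dvd qformD //.
have -> : qform K x + 2 * bform K x y + qform K y - qform K y = qform K x + 2 * bform K x y by ring.
have dv z : (m%:Z %| bform K x z)%Z by rewrite /bform Hc -scalemxAl mxE dvdz_mulr.
by rewrite rpredD //; [exact: dv | rewrite dvdz_mull].
Qed.

(** The cube of the first elementary divisor divides the determinant, so this divisor is 1 or -1;
    and it is a value of the bilinear form. *)
Lemma primitiveP (N : 'M[int]_3) : (forall q, prime q -> ~~ ((q ^ 3)%N %| \det N)%Z) -> primitive N.
Proof.
move=> cub; have [L [R [a [b [c [uL uR dab dbc E]]]]]] := smith3 N.
have a1 : a * a = 1.
  have [b' Eb] := dvdzP dab; have [c' Ec] := dvdzP dbc.
  have dE : \det N = a ^+ 3 * (\det L * b' ^+ 2 * c' * \det R).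
    by rewrite E !det_mulmx det_mx3 Ec Eb; ring.
  have [a1|a1] := eqVneq `|a|%N 1%N; first by clear -a1; have [->|->] : a = 1 \/ a = -1 by lia.
  exfalso; have [q pq qa] : exists2 q, prime q & (q %| `|a|)%N.
    have [a0|a0] := eqVneq a 0; first by exists 2; rewrite ?a0.
    by exists (pdiv `|a|); rewrite ?pdiv_dvd // pdiv_prime //; clear -a0 a1; lia.
  have /negP[] := cub q pq; rewrite dE dvdz_mulr // dvdzE absz_nat abszX dvdn_exp2r //.
pose x := row o0 (invmx L); pose y := (col o0 (invmx R))^T.
have bxy : bform N x y = a.
  rewrite /bform /x /y trmxK -!row_mul E !mulmxA mulVmx // mul1mx.
  by rewrite colE mulmxA mulmxK // -colE !mxE.
apply/seteqP; split=> // r _; exists [:: (r * a, bform N x y)] => [t|].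
  by rewrite inE => /eqP -> /=; exists (x, y).
by rewrite big_seq1 /= bxy -mulrA a1 mulr1.
Qed.

Lemma primitive_mul (N : 'M[int]_3) (p r : int) : primitive N ->
  (forall x y, (p %| r * bform N x y)%Z) -> (p %| r)%Z.
Proof.
move=> prN H; have : scale_ideal N 1 by rewrite prN.
move=> [s sP E]; rewrite -[r]mulr1 E mulr_sumr big_seq; apply: rpred_sum => t ts.
have [[x y] _ <-] := sP t ts; rewrite mulrCA; apply: dvdz_mull; exact: H.
Qed.

Lemma primitive_scale (N N' : 'M[int]_3) (k : rat) : primitive N -> primitive N' -> 0 < k ->
  ext rat N' = k *: ext rat N -> N' = N.
Proof.
move=> pN pN' k0 E.
have dn0 : (denq k)%:~R != 0 :> rat by rewrite intr_eq0 denq_neq0.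
have E2 : denq k *: N' = numq k *: N.
  apply: ext_inj; apply/matrixP => i j; have /matrixP/(_ i j) := E.
  by rewrite !mxE !rmorphM /= numqE => ->; rewrite mulrA [k * _]mulrC.
have Eb x y : denq k * bform N' x y = numq k * bform N x y.
  by rewrite -!bform_scale E2.
have d1 : (numq k %| denq k)%Z.
  by apply: (primitive_mul pN') => x y; rewrite Eb dvdz_mulr.
have d2 : (denq k %| numq k)%Z.
  by apply: (primitive_mul pN) => x y; rewrite -Eb dvdz_mulr.
have nk : numq k = denq k.
  have := numq_gt0 k; rewrite k0 => nk0; have dk0 := denq_gt0 k.
  apply/eqP; rewrite -[numq k]gtz0_abs // -[denq k]gtz0_abs // eqz_nat eqn_dvd.
  by move: d1 d2; rewrite !dvdzE => -> ->.
have k1 : k = 1 by rewrite -[k]divq_num_den nk divff.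
by apply: ext_inj; rewrite E k1 scale1r.
Qed.

Lemma scaled_gram (K T C : 'M[int]_3) (m : nat) : T *m K = m%:Z *: C ->
  T *m K *m T^T = m%:Z *: (C *m T^T).
Proof. by move=> ->; rewrite -scalemxAl. Qed.

(** [lambda] is an arbitrary choice. Two bases of Lambda_m differ by a unimodular matrix and a
    primitive scaling is unique, so the basis of [lam_struct] transfers to the chosen one. Lambda_m
    has index m^2 and is scaled by 1 / m. *)
Lemma lambdaP K m : stable K -> (m %| PQ K)%N -> exists T : 'M[int]_3,
  [/\ T *m K *m T^T = m%:Z *: lambda m K, \det T ^+ 2 = m%:Z ^+ 4, exists C, T *m K = m%:Z *: C
    & forall (S : comUnitRingType) k (r c : 'M[S]_(k, 3)), GRing.lreg (m%:R : S) ->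
      r *m ext S K = m%:R *: c -> exists a : 'M[S]_(k, 3), r = a *m ext S T].
Proof.
move=> sK mP; have [lK _ ord _] := sK; have [symK _] := lK.
have D0 := lattice_det_gt0 lK; have Dn : \det K != 0 by rewrite gt_eqF.
have om : odd m by apply: dvdn_odd mP (PQ_odd K).
have m0 : (0 < m)%N by case: (m) om.
have mn : m%:Z != 0 by rewrite eqz_nat -lt0n.
have mD := dvd_PQ_det sK mP.
have [T [C [TK dT univ]]] := lam_struct (stable_sqfree sK) Dn mD.
have dTn : \det T != 0 by rewrite -sqrf_eq0 dT expf_neq0.
have regZ : GRing.lreg (m%:R : int) by apply: lreg_neq0; rewrite pnatr_eq0 -lt0n.
have Tinj (a b : 'rV[int]_3) : a *m T = b *m T -> a = b.
  move=> /(congr1 (mulmx^~ (\adj T))); rewrite -!mulmxA mul_mx_adj !mul_mx_scalar => /rowP H.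
  by apply/rowP => i; have := H i; rewrite !mxE => /(mulfI dTn).
have rowT x : Lambda m K x <-> exists! a : 'rV[int]_3, x = a *m T.
  rewrite (LambdaP x symK om); split=> [[c Hc]|[a [-> _]]].
    have [|a Ea] := univ int 1 x c regZ; first by rewrite ext_int Hc natz.
    by exists a; split; [rewrite Ea ext_int | move=> b Eb; apply: Tinj; rewrite -Eb Ea ext_int].
  by exists (a *m C); rewrite -mulmxA TK -scalemxAr.
pose N := C *m T^T; have EN := scaled_gram TK.
have dN : \det N = m%:Z * \det K.
  have := congr1 determinant EN; rewrite detZ -/N !det_mulmx det_tr => E.
  apply: (mulfI (expf_neq0 3 mn)); rewrite -E.
  by transitivity (\det T ^+ 2 * \det K); [ring|rewrite dT; ring].
have prim (N' : 'M[int]_3) : \det N' = m%:Z * \det K -> primitive N'.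
  move=> dN'; apply: primitiveP => q pq; rewrite dN'; apply/negP; rewrite dvdzE absz_nat abszM absz_nat.
  rewrite pfactor_dvdn // ?muln_gt0 ?m0 ?absz_gt0 // lognM ?absz_gt0 // => h.
  have l1 := ord q pq.
  have : (logn q m <= logn q `|\det K|)%N by apply: dvdn_leq_log => //; rewrite absz_gt0.
  by clear -h l1; lia.
have prN := prim N dN.
have isN : is_lambda m K N.
  exists T, (m%:R)^-1; split=> //; first by rewrite invr_gt0 ltr0n.
  by rewrite EN ext_scale scalerA mulVf ?scale1r // pnatr_eq0 -lt0n.
have : is_lambda m K (lambda m K) by rewrite /lambda; case: xgetP => [y -> //|/(_ N)].
set L := lambda m K => -[T' [k [rowT' k0 EL prL]]].
have Tinj' (a b : 'rV[int]_3) : a *m T' = b *m T' -> a = b.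
  move=> E; have /rowT'[z [_ uz]] : Lambda m K 0.
    by apply/(LambdaP _ symK om); exists 0; rewrite mul0mx scaler0.
  have z0 := uz 0; rewrite mul0mx in z0.
  have := uz (a - b); rewrite mulmxBl E subrr => /(_ erefl); rewrite (z0 erefl) => /esym/eqP.
  by rewrite subr_eq0 => /eqP.
have factor (A B : 'M[int]_3) : (forall a b : 'rV[int]_3, a *m A = b *m A -> a = b) ->
    (forall x, Lambda m K x <-> exists! a : 'rV[int]_3, x = a *m A) ->
    (forall x, Lambda m K x <-> exists! a : 'rV[int]_3, x = a *m B) -> exists U, A = U *m B.
  move=> Ai rA rB; have /choice[f fP] : forall i, exists a : 'rV[int]_3, row i A = a *m B.
    move=> i; have : Lambda m K (row i A).
      apply/rA; exists (delta_mx 0 i); split; first by rewrite rowE.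
      by move=> b Eb; apply: Ai; rewrite -Eb rowE.
    by move=> /rB[a [Ea _]]; exists a.
  exists (\matrix_i f i); apply/row_matrixP => i; by rewrite row_mul rowK fP.
have [U EU] := factor T' T Tinj' rowT' rowT.
have [U' EU'] := factor T T' Tinj rowT rowT'.
have UU : U' *m U = 1%:M.
  apply/row_matrixP => i; apply: Tinj; rewrite -!row_mul mul1mx -mulmxA -EU.
  by rewrite -EU'.
have uU : U \in unitmx by have [_] := mulmx1_unit UU.
have LE : L = U *m N *m U^T.
  apply: (@primitive_scale _ _ (k * m%:R)) => //.
  - by apply: prim; rewrite -(isometric_det_int (_ : isometric N _)) //; exists U.
  - by rewrite mulr_gt0 // ltr0n.
  - rewrite EL EU trmx_mul !mulmxA -[U *m T *m K]mulmxA -[U *m (T *m K) *m T^T]mulmxA EN.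
    by rewrite -scalemxAr -scalemxAl -scalerA ext_scale /N !mulmxA.
exists T'; split.
- rewrite EU trmx_mul !mulmxA -[U *m T *m K]mulmxA -[U *m (T *m K) *m T^T]mulmxA EN.
  by rewrite -scalemxAr -scalemxAl LE.
- by rewrite EU det_mulmx exprMn dT (intr_unit (_ : \det U \is a GRing.unit)) ?mul1r // -unitmxE.
- by exists (U *m C); rewrite EU -mulmxA TK -scalemxAr.
- move=> S k' r c regm /(univ S k' r c regm)[a ->].
  exists (a *m ext S U'); rewrite -mulmxA; congr (_ *m _).
  by rewrite {1}EU' ext_mul.
Qed.

Section LambdaFacts.
Variables (K : 'M[int]_3) (m : nat).
Hypotheses (sK : stable K) (mP : (m %| PQ K)%N).
Local Notation L := (lambda m K).
Let lK : lattice K. Proof. by case: sK. Qed.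
Let om : odd m. Proof. by apply: dvdn_odd mP (PQ_odd K). Qed.
Let m0 : (0 < m)%N. Proof. by case: (m) om. Qed.
Let mn : m%:Z != 0. Proof. by rewrite eqz_nat -lt0n. Qed.

Lemma lambda_det : \det L = m%:Z * \det K.
Proof.
have [T [E dT _ _]] := lambdaP sK mP.
have := congr1 determinant E; rewrite detZ !det_mulmx det_tr => E2.
apply: (mulfI (expf_neq0 3 mn)); rewrite -E2.
by transitivity (\det T ^+ 2 * \det K); [ring|rewrite dT; ring].
Qed.

Lemma lambda_rational : exists2 T : 'M[rat]_3, T \in unitmx &
  T *m ext rat K *m T^T = m%:R *: ext rat L.
Proof.
have [T [E dT _ _]] := lambdaP sK mP; exists (ext rat T).
  by rewrite unitmxE det_ext unitfE intr_eq0 -sqrf_eq0 dT expf_neq0.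
by rewrite tr_ext -!ext_mul E ext_scale.
Qed.

Lemma lambda_sym : L^T = L.
Proof.
have [T [E _ _ _]] := lambdaP sK mP; apply: (scalemx_inj mn).
have [symK _] := lK.
by rewrite /= -linearZ /= -E !trmx_mul trmxK symK mulmxA.
Qed.

Lemma lambda_lattice : lattice L.
Proof.
split; first exact: lambda_sym.
have [T uT E] := lambda_rational; have [_ pK] := lK.
move=> x x0; have := pK (x *m T); rewrite -qform_conj E qform_scale pmulr_rgt0 ?ltr0n //.
by apply; apply: contra x0 => /eqP xT; rewrite -(mulmxK uT x) xT mul0mx.
Qed.

Lemma lambda_even : even_lattice L <-> even_lattice K.
Proof.
have [T [E dT _ _]] := lambdaP sK mP.
have odd2 n (x : int) : odd n -> (2 %| n%:Z * x)%Z -> (2 %| x)%Z.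
  move=> on; rewrite Gauss_dvdzr // coprimezE !absz_nat.
  by rewrite -[(1 + 1)%N]/2%N coprime2n.
split=> ev x; last first.
  by apply: (odd2 m) => //; rewrite -qform_scale -E qform_conj.
apply: (odd2 (m ^ 4)%N); first by rewrite oddX om orbT.
have := ev (x *m \adj T) => /(dvdz_mull m%:Z); rewrite -qform_scale -E qform_conj.
rewrite -mulmxA mul_adj_mx mul_mx_scalar qformZ dT.
by have -> : (m ^ 4)%N%:Z = m%:Z ^+ 4 by rewrite -!natz natrX.
Qed.

Lemma lambda_isoZ q : prime q -> isoZ (ext (padic_int q) L) <-> isoZ (ext (padic_int q) K).
Proof.
move=> pq; have [T [E dT _ _]] := lambdaP sK mP.
have dTn : \det T != 0 by rewrite -sqrf_eq0 dT expf_neq0.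
have EZ : ext (padic_int q) T *m ext _ K *m (ext _ T)^T = m%:R *: ext _ L.
  rewrite tr_ext -!ext_mul E; apply/matrixP => i j; by rewrite !mxE rmorphM.
have mq0 : m%:R != 0 :> padic_int q by rewrite -[m%:R]/(m%:Z%:~R) intr_padic_eq0.
have inj (x : 'rV[padic_int q]_3) A : \det A = \det T -> x != 0 -> x *m ext _ A != 0.
  move=> dA x0; apply: contra x0 => /eqP xT; have := congr1 (mulmx^~ (\adj (ext _ A))) xT.
  rewrite -mulmxA mul_mx_adj mul0mx mul_mx_scalar det_ext dA => /rowP E0.
  apply/eqP/rowP => i; have := E0 i; rewrite !mxE => /eqP.
  by rewrite mulf_eq0 intr_padic_eq0 // (negPf dTn) => /eqP.
split=> -[x x0 Qx].
  exists (x *m ext _ T); first exact: inj.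
  by rewrite -qform_conj EZ qform_scale Qx mulr0.
exists (x *m ext _ (\adj T)).
  apply: contra x0 => /eqP xT; have := congr1 (mulmx^~ (ext _ T)) xT.
  rewrite -mulmxA -ext_mul mul_adj_mx mul0mx => E0.
  have {}E0 : (\det T)%:~R *: x = 0.
    rewrite -E0 -mul_mx_scalar; congr (_ *m _).
    by apply/matrixP => i j; rewrite !mxE rmorphMn.
  apply/eqP/rowP => i; have /rowP/(_ i) := E0; rewrite !mxE => /eqP.
  by rewrite mulf_eq0 intr_padic_eq0 // (negPf dTn) => /eqP.
apply: (mulfI mq0); rewrite mulr0 -qform_scale -EZ qform_conj -mulmxA -ext_mul mul_adj_mx.
have -> : ext (padic_int q) ((\det T)%:M : 'M[int]_3) = ((\det T)%:~R)%:M.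
  by apply/matrixP => i j; rewrite !mxE rmorphMn.
by rewrite mul_mx_scalar qformZ Qx mulr0.
Qed.

End LambdaFacts.

Lemma stable_genus_stable K H : stable K -> genus K H -> stable H.
Proof.
move=> sK gH; have [lK _ ord iff] := sK; have lH := genus_lattice gH.
have dH := genus_det lK gH; have ev := genus_even lK gH.
have Dn : \det H != 0 by rewrite gt_eqF // lattice_det_gt0.
split=> //; rewrite ?dH //; last by rewrite iff.
apply: primitiveP => q pq; rewrite dH; apply/negP.
rewrite dvdzE absz_nat pfactor_dvdn ?absz_gt0 -?dH // dH => h.
by have := ord q pq; clear -h; lia.
Qed.

Lemma PQ_genus K H : stable K -> genus K H -> PQ H = PQ K.
Proof.
by move=> sK gH; rewrite !PQ_prod (genus_det _ gH) //; case: sK.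
Qed.

Lemma adj_mulmx (R : idomainType) n (A B : 'M[R]_n) : \det A != 0 -> \det B != 0 ->
  \adj (A *m B) = \adj B *m \adj A.
Proof.
move=> dA dB.
have E1 : \adj B *m \adj A *m (A *m B) = (\det A * \det B)%:M.
  rewrite mulmxA -[\adj B *m \adj A *m A]mulmxA mul_adj_mx mul_mx_scalar -scalemxAl mul_adj_mx.
  by rewrite scale_scalar_mx.
have E : (\det A * \det B) *: \adj (A *m B) = (\det A * \det B) *: (\adj B *m \adj A).
  by rewrite -mul_scalar_mx -E1 -mulmxA mul_mx_adj mul_mx_scalar det_mulmx.
by apply: scalemx_inj E; rewrite mulf_neq0.
Qed.

Lemma ext_adj (R : comNzRingType) (A : 'M[int]_3) : ext R (\adj A) = \adj (ext R A).
Proof. exact: map_mx_adj. Qed.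

Lemma sqfree_dvd (m : nat) (b : int) : (0 < m)%N -> (forall q, prime q -> (logn q m <= 1)%N) ->
  (forall q, prime q -> (q %| m)%N -> (q%:Z %| b)%Z) -> (m%:Z %| b)%Z.
Proof.
move=> m0 lm H; rewrite dvdzE absz_nat; apply/dvdn_partP => // q.
rewrite mem_primes => /and3P[pq _ qm]; rewrite p_part.
have := H q pq qm; rewrite dvdzE absz_nat => qb.
have := lm q pq; case: (logn q m) => [|[|//]] _; by rewrite ?expn0 ?expn1 // dvd1n.
Qed.

Section LambdaGenus.
Variables (K : 'M[int]_3) (m : nat).
Hypotheses (sK : stable K) (mP : (m %| PQ K)%N).
Let om : odd m. Proof. by apply: dvdn_odd mP (PQ_odd K). Qed.
Let m0 : (0 < m)%N. Proof. by case: (m) om. Qed.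
Let mn : m%:Z != 0. Proof. by rewrite eqz_nat -lt0n. Qed.
Let mr0 : m%:R != 0 :> rat. Proof. by rewrite pnatr_eq0 -lt0n. Qed.

(* Passing to lambda_m is functorial for local and rational isometries. *)
Lemma lambda_genus H : genus K H -> genus (lambda m K) (lambda m H).
Proof.
move=> gH; have sH := stable_genus_stable sK gH.
have mP' : (m %| PQ H)%N by rewrite (PQ_genus sK gH).
split; first exact: lambda_lattice.
  have [T uT ET] := lambda_rational sK mP; have [T' uT' ET'] := lambda_rational sH mP'.
  have [_ [X uX EX] _] := gH.
  exists (T' *m X *m invmx T); first by rewrite !unitmx_mul unitmx_inv uT' uX.
  apply: (scalemx_inj mr0); rewrite /= scalemxAl scalemxAr -ET !trmx_mul !mulmxA mulmxKV //.
  by rewrite -[_ *m T^T *m _]mulmxA trmx_inv mulmxV ?unitmx_tr // mulmx1 -ET' -EX !mulmxA.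
move=> q pq; have [_ _ /(_ q pq)[X uX EX]] := gH.
have [T [ET dT [C EC] univ]] := lambdaP sK mP.
have [T' [ET' dT' [C' EC'] univ']] := lambdaP sH mP'.
have mq0 : m%:R != 0 :> padic_int q by rewrite -[m%:R]/(m%:Z%:~R) intr_padic_eq0 // eqz_nat -lt0n.
have regm : GRing.lreg (m%:R : padic_int q) by apply: lreg_neq0.
have [|Y EY] := univ _ 3%N (ext _ T' *m X) (ext _ C' *m (invmx X)^T) regm.
  rewrite scalemxAl -ext_scale -EC' ext_mul -EX -!mulmxA; congr (_ *m _).
  by rewrite trmx_inv mulmxV ?unitmx_tr // mulmx1.
have [|Y' EY'] := univ' _ 3%N (ext _ T *m invmx X) (ext _ C *m X^T) regm.
  rewrite scalemxAl -ext_scale -EC ext_mul -EX -!mulmxA; congr (_ *m _).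
  by rewrite mulKmx.
have dTn : \det T != 0 by rewrite -sqrf_eq0 dT expf_neq0.
have YY : Y' *m Y = 1%:M.
  have E1 : Y' *m Y *m ext _ T = ext _ T.
    by rewrite -mulmxA -EY mulmxA -EY' mulmxKV.
  have E2 : (Y' *m Y) *m ext _ T *m \adj (ext _ T) = ext _ T *m \adj (ext _ T) by rewrite E1.
  apply: (scalemx_inj (_ : (\det T)%:~R != 0)); first by rewrite intr_padic_eq0.
  by move: E2; rewrite -mulmxA mul_mx_adj mul_mx_scalar det_ext /= => ->; rewrite scalemx1.
exists Y; first by have [_] := mulmx1_unit YY.
apply: (scalemx_inj mq0); rewrite /= scalemxAl scalemxAr -!ext_scale -ET -ET' !ext_mul -!tr_ext.
have -> : Y *m (ext _ T *m ext _ K *m (ext _ T)^T) *m Y^T =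
    (Y *m ext _ T) *m ext _ K *m (Y *m ext _ T)^T by rewrite trmx_mul !mulmxA.
by rewrite -EY trmx_mul -EX !mulmxA.
Qed.

Lemma rvec_represented H dl v : genus K H ->
  rvec m dl H v -> represented_by_genus (lambda m K) dl%:Z.
Proof.
move=> gH [Qv [c Hc]]; have sH := stable_genus_stable sK gH.
have mP' : (m %| PQ H)%N by rewrite (PQ_genus sK gH).
exists (lambda m H); first exact: lambda_genus.
have [T [ET dT _ univ]] := lambdaP sH mP'.
have [|| a Ea] := univ int 1%N v c.
- by apply: lreg_neq0; rewrite pnatr_eq0 -lt0n.
- by rewrite ext_int Hc natz.
exists a; apply: (mulfI mn).
rewrite -qform_scale -ET qform_conj (_ : a *m T = v) ?Qv ?PoszM //.
by rewrite Ea ext_int.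
Qed.

(* lambda_m(K) has rank one modulo m, which the adjugate detects. *)
Lemma lambda_adj : exists W : 'M[int]_3, \adj (lambda m K) = m%:Z *: W.
Proof.
have [lK _ ord _] := sK; have D0 := lattice_det_gt0 lK.
have [T [ET dT [C EC] univ]] := lambdaP sK mP.
have [||T2 ET2] := univ int 3%N (m%:Z *: 1%:M) K.
- by apply: lreg_neq0; rewrite pnatr_eq0 -lt0n.
- by rewrite ext_int -scalemxAl mul1mx natz.
rewrite ext_int in ET2.
have [e Ee] : exists e, \det T = m%:Z * (e * m%:Z).
  have /eqP := dT; rewrite -[m%:Z ^+ 4]/(m%:Z ^+ (2 * 2)) exprM eqf_sqr => /orP[] /eqP ->.
    by exists 1; rewrite mul1r expr2.
  by exists (-1); rewrite expr2; ring.
have dTn : \det T != 0 by rewrite -sqrf_eq0 dT expf_neq0.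
have adjT : \adj T = (e * m%:Z) *: T2.
  have E3 : \det T *: T2 = m%:Z *: \adj T.
    by rewrite -mul_mx_scalar -mul_mx_adj mulmxA -ET2 -scalemxAl mul1mx.
  by apply: (scalemx_inj mn) => /=; rewrite -E3 scalerA -Ee.
have EL : lambda m K = C *m T^T.
  by apply: (scalemx_inj mn) => /=; rewrite -ET EC -scalemxAl.
have dC : \det C != 0.
  have : \det (lambda m K) != 0 by rewrite lambda_det // mulf_neq0 // gt_eqF.
  by rewrite EL det_mulmx mulf_eq0 negb_or => /andP[].
exists (e *: T2^T *m \adj C).
rewrite EL adj_mulmx ?det_tr // -trmx_adj adjT linearZ /= -scalemxAl scalerA [m%:Z * e]mulrC.
by rewrite scalemxAl.
Qed.

(** Applying lambda_m a second time leads back to gen(K): for [N] in gen(lambda_m(K)), the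
    sublattice on which one Smith coordinate is divisible by m, scaled by 1 / m, lies in gen(K). A
    vector x of norm delta is replaced by m x, of norm m delta after scaling. *)
Lemma represented_rvec dl :
  represented_by_genus (lambda m K) dl%:Z ->
  exists H v, genus K H /\ rvec m dl H v.
Proof.
move=> [N gN [x Qx]].
have [lK _ ord _] := sK; have D0 := lattice_det_gt0 lK.
have lL := lambda_lattice sK mP; have lN := genus_lattice gN; have [sN _] := lN.
have dN : \det N = m%:Z * \det K by rewrite (genus_det lL gN) lambda_det.
have [L [R [a [b [c [uL uR dab dbc E]]]]]] := smith3 N; pose Dg : 'M[int]_3 := mx3 a 0 0 0 b 0 0 0 c.
have dNn : \det N != 0 by rewrite dN mulf_neq0 // gt_eqF.
have dLn : \det (lambda m K) != 0 by rewrite lambda_det // mulf_neq0 // gt_eqF.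
have [W EW] := lambda_adj.
(* For a prime q dividing m, the adjugate of lambda_m(K), hence that of [N], vanishes modulo q. Its
   entry a b in the Smith basis gives q | b, since a divides b. *)
have mb : (m%:Z %| b)%Z.
  apply: sqfree_dvd => // [q pq|q pq qm].
    apply: leq_trans (ord q pq); apply: dvdn_leq_log => //.
      by rewrite absz_gt0 gt_eqF.
    by have := dvd_PQ_det sK mP; rewrite dvdzE.
  have [_ _ /(_ q pq)[X uX EX]] := gN.
  have dX : \det X != 0 by apply: contraTneq uX => X0; rewrite unitmxE X0 unitr0.
  have dLq : \det (ext (padic_int q) (lambda m K)) != 0 by rewrite det_ext intr_padic_eq0.
  have qadj i j : (q%:Z %| (\adj N) i j)%Z.
    have : ext (padic_int q) (\adj N) = m%:R *: (\adj X^T *m (ext _ W *m \adj X)).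
      rewrite ext_adj -EX adj_mulmx ?det_tr ?det_mulmx ?mulf_neq0 // adj_mulmx //.
      by rewrite -ext_adj EW ext_scale -scalemxAl -scalemxAr.
    move=> /matrixP/(_ i j); rewrite scalemxE mxE => EA.
    have /dvdnP[m' Em] := qm; rewrite -[q]expn1 -[(q ^ 1)%N]/((q ^ 1)%N).
    have := @intr_dvd_padic q pq 1 (\adj N i j) (m'%:R * (\adj X^T *m (ext _ W *m \adj X)) i j).
    rewrite pmod1 //; apply; rewrite EA Em natrM; ring.
  have dLn' : \det L != 0 by apply: contraTneq uL => L0; rewrite unitmxE L0 unitr0.
  have dRn : \det R != 0 by apply: contraTneq uR => L0; rewrite unitmxE L0 unitr0.
  have qab : (q%:Z %| a * b)%Z.
    have : (q%:Z %| (R *m \adj N *m L) o2 o2)%Z.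
      rewrite mxE; apply: rpred_sum => i _; apply: dvdz_mulr; rewrite mxE.
      by apply: rpred_sum => k _; apply: dvdz_mull; apply: qadj.
    have dD : \det Dg != 0 by move: dNn; rewrite E !det_mulmx !mulf_eq0 !negb_or => /andP[/andP[]].
    have -> : R *m \adj N *m L = (\det R * \det L) *: \adj Dg.
      rewrite E -/Dg adj_mulmx ?det_mulmx ?mulf_neq0 // adj_mulmx // !mulmxA mul_mx_adj.
      by rewrite -[X in X = _]mulmxA mul_adj_mx mul_scalar_mx mul_mx_scalar scalerA mulrC.
    have -> : \adj Dg = mx3 (b * c) 0 0 0 (a * c) 0 0 0 (a * b).
      apply: (scalemx_inj dD); rewrite /= -mul_mx_scalar.
      have <- : Dg *m mx3 (b * c) 0 0 0 (a * c) 0 0 0 (a * b) = (\det Dg)%:M.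
        by rewrite mul_mx3 -scalemx1 mx3_1 scale_mx3 det_mx3; congr mx3; ring.
      by rewrite mulmxA mul_adj_mx mul_scalar_mx.
    rewrite scalemxE [mx3 _ _ _ _ _ _ _ _ _ _ _]mxE /= => H.
    have -> : a * b = (\det R * \det L) * (\det R * \det L * (a * b)).
      have uu (z : int) : z \is a GRing.unit -> z * z = 1 by move/intr_unit; rewrite expr2.
      rewrite mulrA uu ?mul1r // unitrM -!unitmxE uR uL //.
    exact: dvdz_mull.
  have := qab; rewrite !dvdzE abszM absz_nat Euclid_dvdM // => /orP[qa|//].
  by apply: dvdn_trans qa _; move: dab; rewrite dvdzE.
have mc : (m%:Z %| c)%Z := dvdz_trans mb dbc.
have [b' Eb] := dvdzP mb; have [c' Ec] := dvdzP mc.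
pose T' := mx3 m%:Z 0 0 0 1 0 0 0 1 *m invmx L.
pose C' := mx3 a 0 0 0 b' 0 0 0 c' *m R.
have TN : T' *m N = m%:Z *: C'.
  rewrite /T' /C' E !mulmxA mulmxKV // mul_mx3 scalemxAl scale_mx3 Eb Ec.
  by congr (_ *m _); congr mx3; ring.
pose H := C' *m T'^T.
have EH : T' *m N *m T'^T = m%:Z *: H by exact: scaled_gram.
have dT' : \det T' ^+ 2 = m%:Z ^+ 2.
  rewrite /T' det_mulmx exprMn det_mx3 (intr_unit (_ : \det (invmx L) \is a GRing.unit)) -?unitmxE ?unitmx_inv //.
  by ring.
have dH : \det H = \det K.
  have := congr1 determinant EH; rewrite detZ (det_mulmx (T' *m N)) (det_mulmx T') det_tr dN => E2.
  apply: (mulfI (expf_neq0 3 mn)); rewrite -E2.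
  by transitivity (\det T' ^+ 2 * m%:Z * \det K); [ring|rewrite dT'; ring].
have [T uT ET] := lambda_rational sK mP.
have [_ [X uX EX] _] := gN.
have uT' : ext rat T' \in unitmx.
  by rewrite unitmxE det_ext unitfE intr_eq0 -sqrf_eq0 dT' expf_neq0.
have gH : genus K H.
  apply: stable_genus => //.
    exists ((m%:R)^-1 *: (ext rat T' *m X *m T)).
      rewrite unitmxZ ?unitfE ?invr_eq0 // !unitmx_mul uT' uX //.
    have -> : (m%:R^-1 *: (ext rat T' *m X *m T)) *m ext rat K *m (m%:R^-1 *: (ext rat T' *m X *m T))^T
      = (m%:R^-1 * m%:R^-1) *: (ext rat T' *m (X *m (T *m ext rat K *m T^T) *m X^T) *m (ext rat T')^T).
      by rewrite linearZ /= -!scalemxAl -scalemxAr scalerA !trmx_mul !mulmxA.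
    rewrite ET -scalemxAr -scalemxAl EX -scalemxAr -scalemxAl tr_ext -!ext_mul EH ext_scale !scalerA.
    have -> : m%:R^-1 * m%:R^-1 * (m%:R * m%:R) = 1 :> rat by field.
    by rewrite scale1r.
  move=> evK y.
  have evN : even_lattice N by apply/(genus_even lL gN)/(lambda_even sK mP).
  have := evN (y *m T'); rewrite -qform_conj EH qform_scale.
  by rewrite Gauss_dvdzr // coprimezE absz_nat coprime2n.
pose v := x *m L *m mx3 1 0 0 0 m%:Z 0 0 0 m%:Z.
have vT : v *m T' = m%:Z *: x.
  rewrite /v /T' mulmxA -[_ *m _ *m mx3 m%:Z _ _ _ _ _ _ _ _]mulmxA mul_mx3.
  rewrite (_ : mx3 _ _ _ _ _ _ _ _ _ = m%:Z *: 1%:M); last by rewrite mx3_1 scale_mx3; congr mx3; ring.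
  by rewrite -scalemxAr mulmx1 -scalemxAl mulmxK.
exists H, v; split=> //; split.
  apply: (mulfI mn); rewrite -qform_scale -EH qform_conj vT qformZ Qx PoszM; ring.
exists (x *m C'^T).
apply: (scalemx_inj mn); rewrite /= [LHS]scalemxAr.
rewrite -EH (mulmxA v) (mulmxA v T') vT -!scalemxAl -mulmxA; congr (_ *: _).
have -> : N *m T'^T = (T' *m N)^T by rewrite [RHS]trmx_mul sN.
by rewrite TN linearZ /= -scalemxAr.
Qed.

End LambdaGenus.

(** * The local factor at 2 *)

(** Scaling one basis vector by [s] equalizes the determinants. *)
Lemma two_local_sq (G H : 'M[padic_int 2]_3) s : s \is a GRing.unit -> G^T = G -> H^T = H ->
  \det H = \det G * s ^+ 2 -> sqfree_at (\det G) ->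
  (evenZ G /\ evenZ H) \/ [/\ \det G \is a GRing.unit, ~ evenZ G, ~ evenZ H & (isoZ G <-> isoZ H)] ->
  isometric G H.
Proof.
move=> us sG sH dH sq alt.
pose U := mx3 s 0 0 0 1 0 0 0 1 : 'M[padic_int 2]_3; pose G' := U *m G *m U^T.
have uU : U \in unitmx by rewrite unitmxE det_mx3 (_ : _ + _ = s) //; ring.
have iG : isometric G G' by exists U.
have iG' := isometric_sym iG.
apply: (isometric_trans iG); apply: two_local.
- by rewrite /G' !trmx_mul trmxK sG mulmxA.
- by [].
- by rewrite dH /G' !det_mulmx det_tr (_ : \det U = s) ?det_mx3; ring.
- exact: (isometric_sqfree iG).
case: alt => [[evG evH]|[ud nG nH iso]]; [left|right].
  by split=> //; apply: isometric_evenZ evG.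
split=> //.
- by rewrite /G' !det_mulmx det_tr !unitrM ud -unitmxE uU.
- by move=> ev; apply: nG; apply: isometric_evenZ ev.
- by rewrite -iso; split; apply: isometric_isoZ.
Qed.

Lemma sqfree_at2 (d : int) : ~~ (4 %| d)%Z -> sqfree_at (d%:~R : padic_int 2).
Proof.
by move=> nd [z Ez]; have := @intr_dvd_padic 2 isT 2 d z Ez; apply/negP.
Qed.

Lemma dvd2M (a b : int) : (2 %| a * b)%Z = (2 %| a)%Z || (2 %| b)%Z.
Proof. by rewrite !dvdzE abszM Euclid_dvdM. Qed.

(** Odd integers congruent modulo 8 differ by a 2-adic square, so an odd unimodular form at 2 is
    known by its determinant modulo 8 and its isotropy. *)
Lemma loc2_odd (L M : 'M[int]_3) : L^T = L -> M^T = M -> ~~ (2 %| \det L)%Z ->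
  (8 %| \det M - \det L)%Z -> ~ even_lattice L -> ~ even_lattice M ->
  (isoZ (ext (padic_int 2) L) <-> isoZ (ext (padic_int 2) M)) -> locally_isometric 2 L M.
Proof.
move=> sL sM oL d8 eL eM iso; have [s us Es] := int_square8 oL d8.
apply: (two_local_sq us); rewrite ?tr_ext ?sL ?sM ?det_ext //.
  apply: sqfree_at2; apply: contra oL => h; exact: dvdz_trans h.
right; split=> //; rewrite ?evenZ_ext // ?unit_int //.
Qed.

Lemma loc2_even (L M : 'M[int]_3) a b : L^T = L -> M^T = M -> even_lattice L -> even_lattice M ->
  \det L = 2 * a -> \det M = 2 * b -> ~~ (2 %| a)%Z -> (8 %| b - a)%Z -> locally_isometric 2 L M.
Proof.
move=> sL sM eL eM dL dM oa d8; have [s us Es] := int_square8 oa d8.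
apply: (two_local_sq us); rewrite ?tr_ext ?sL ?sM ?det_ext //.
- by rewrite dL dM !rmorphM /= Es mulrA.
- by apply: sqfree_at2; rewrite dL; apply: contra oa; clear; lia.
- by left; split; apply/evenZ_ext.
Qed.

Lemma unit_sq_mod8 (a b : int) (u : padic_int 2) : u \is a GRing.unit ->
  b%:~R = a%:~R * u ^+ 2 -> (8 %| b - a)%Z.
Proof.
move=> uu E; have p2 : prime 2 by [].
have [w Ew] : exists w : int, [/\ ~~ (2 %| w)%Z & (8 %| b - a * w ^+ 2)%Z].
  exists (u 3%N); split.
    have := uu; rewrite padic_unitE // /pdiv_pred.
    have := @padic_resD 2 u 1 2; rewrite -[padic_base 2]/2%N /=.
    by rewrite addnE /= => <-; clear; lia.
  have := congr1 (fun t : padic_int 2 => t 3%N) E.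
  rewrite intr_padicE // padicME // expr2 padicME // intr_padicE // modzMmr modzMml mulrA => /eqP.
  by rewrite eqz_mod_dvd.
case: Ew => ow d8; have w8 : (8 %| w ^+ 2 - 1)%Z.
  rewrite expr2; have [c ->] : exists c, w = 2 * c + 1 by exists (w %/ 2)%Z; clear -ow; lia.
  have [t Et] : exists t, c * (c + 1) = 2 * t.
    exists (c * (c + 1) %/ 2)%Z; have : (2 %| c * (c + 1))%Z.
      by have [h|h] : (2 %| c)%Z \/ (2 %| c + 1)%Z by [clear; lia|]; [rewrite dvdz_mulr|rewrite dvdz_mull].
    by clear; lia.
  apply/dvdzP; exists t; transitivity (4 * (c * (c + 1))); [ring|rewrite Et; ring].
have -> : b - a = b - a * w ^+ 2 + a * (w ^+ 2 - 1) by ring.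
by rewrite rpredD // dvdz_mull.
Qed.

Lemma loc2_det_odd (L M : 'M[int]_3) : locally_isometric 2 L M -> (8 %| \det M - \det L)%Z.
Proof.
move=> /isometric_det[u uu]; rewrite !det_ext => E; apply: (unit_sq_mod8 uu).
by rewrite E mulrC.
Qed.

Lemma loc2_det_even (L M : 'M[int]_3) a b : \det L = 2 * a -> \det M = 2 * b ->
  locally_isometric 2 L M -> (8 %| b - a)%Z.
Proof.
move=> dL dM /isometric_det[u uu]; rewrite !det_ext dL dM !rmorphM /= => E.
apply: (unit_sq_mod8 uu).
have n2 : (2%:~R : padic_int 2) != 0 by rewrite intr_padic_eq0.
by apply: (mulfI n2); rewrite E; ring.
Qed.

Lemma diag3_sym a b c : (diag3 a b c)^T = diag3 a b c.
Proof. by rewrite diag3E tr_mx3. Qed.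

Lemma diag3_det a b c : \det (diag3 a b c) = a * b * c.
Proof. by rewrite diag3E det_mx3; ring. Qed.

Lemma diag3_odd a b c : ~~ (2 %| a)%Z -> ~ even_lattice (diag3 a b c).
Proof.
move=> oa /(_ (rv3 1 0 0)); rewrite diag3E -[mx3 _ _ _ _ _ _ _ _ _]/(smx3 a b c 0 0 0) qform_rv3.
by apply/negP; move: oa; rewrite (_ : _ + _ = a) //; ring.
Qed.

Lemma A_perp_sym c : (A_perp c)^T = A_perp c.
Proof. by rewrite A_perpE tr_mx3. Qed.

Lemma A_perp_det c : \det (A_perp c) = 3 * c.
Proof. by rewrite A_perpE det_mx3; ring. Qed.

Lemma A_perp_even c : even_lattice (A_perp (2 * c)).
Proof.
move=> x; rewrite A_perpE; have [x0 [x1 [x2 ->]]] := rv3P x.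
rewrite -[mx3 _ _ _ _ _ _ _ _ _]/(smx3 2 2 (2 * c) 1 0 0) qform_rv3.
apply/dvdzP; exists (x0 ^+ 2 + x1 ^+ 2 + c * x2 ^+ 2 + x0 * x1); ring.
Qed.

(** The number -7 is a 2-adic square s^2, and 2^2 + s^2 + 3 = 0. *)
Lemma isoZ_113 : isoZ (ext (padic_int 2) (diag3 1 1 3)).
Proof.
have [s us Es] := @int_square8 1 (-7) isT isT.
exists (rv3 2 s 1); first by rewrite rv3_neq0 oner_eq0 !andbF.
have -> : ext (padic_int 2) (diag3 1 1 3) = smx3 1 1 3%:~R 0 0 0.
  by rewrite diag3E; apply/matrixP; do 2 (apply: I3P); rewrite !mxE.
rewrite qform_rv3; transitivity (s ^+ 2 - (-7)%:~R); first by ring.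
by rewrite Es mul1r subrr.
Qed.

Lemma evenE (k : int) : (2 %| k)%Z -> exists k', k = 2 * k'.
Proof. by case/dvdzP => k' ->; exists k'; rewrite mulrC. Qed.

Lemma oddE (k : int) : ~~ (2 %| k)%Z -> exists k', k = 2 * k' + 1.
Proof. by move=> h; exists (k %/ 2)%Z; clear -h; lia. Qed.

Lemma sq_mod8 (k : int) : ~~ (2 %| k)%Z -> exists t, k ^+ 2 = 8 * t + 1.
Proof.
case/oddE => c ->; have [t Et] : exists t, c * (c + 1) = 2 * t.
  have [/evenE[c' ->]|/oddE[c' ->]] := boolP (2 %| c)%Z; first by exists (c' * (2 * c' + 1)); ring.
  by exists ((2 * c' + 1) * (c' + 1)); ring.
by exists t; transitivity (4 * (c * (c + 1)) + 1); [ring|rewrite Et; ring].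
Qed.

Lemma sq_mod4 (k : int) : exists z, k ^+ 2 = 4 * z + (k %% 2)%Z.
Proof.
exists ((k %/ 2)%Z * (k %/ 2)%Z + (k %/ 2)%Z * (k %% 2)%Z).
by have := divz_eq k 2; have : (k %% 2)%Z = 0 \/ (k %% 2)%Z = 1 by [lia|]; move=> [] -> {1}->; ring.
Qed.

Lemma ext_smx3 (R : comNzRingType) (a b c d e f : int) :
  ext R (smx3 a b c d e f) = smx3 a%:~R b%:~R c%:~R d%:~R e%:~R f%:~R.
Proof. by apply/matrixP; do 2 (apply: I3P); rewrite !mxE. Qed.

(** Here p, q, r are odd, so p y^2 + q y z + r z^2 is a unit unless y and z are both even. A
    primitive zero needs x even; then n x^2 has valuation at least 2, while the plane contributes
    valuation 1. *)
Lemma aniso_split (n p q r : int) : ~~ (2 %| n)%Z -> ((4 * p * r - q ^+ 2) %% 8)%Z = 3 ->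
  ~ isoZ (ext (padic_int 2) (smx3 n (2 * p) (2 * r) 0 0 q)).
Proof.
move=> on d3 /(@iso_prim 2 isT)[x [y [z [E u]]]].
have [oq op orr] : [/\ ~~ (2 %| q)%Z, ~~ (2 %| p)%Z & ~~ (2 %| r)%Z].
  have oq : ~~ (2 %| q)%Z.
    apply/negP => /evenE[t Et]; move: d3; rewrite Et (_ : _ - _ = 4 * (p * r - t ^+ 2)); last by ring.
    by move: (_ - _) => w; clear; lia.
  have [t Et] := sq_mod8 oq; have : ~~ (2 %| p * r)%Z by move: d3; rewrite -mulrA Et; move: (p * r); clear; lia.
  by rewrite dvd2M negb_or => /andP[].
have un k : ~~ (2 %| k)%Z -> (k%:~R : padic_int 2) \is a GRing.unit by move=> o; rewrite unit_int.
pose s : padic_int 2 := p%:~R * (y * y) + r%:~R * (z * z) + q%:~R * (y * z).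
have E2 : n%:~R * (x * x) + 2 * s = 0 by rewrite -E ext_smx3 qform_rv3 /s; ring.
have dx : pdiv_pred x.
  rewrite -[pdiv_pred x]negbK -padic_unitE //; apply/negP => ux.
  suff : n%:~R * (x * x) + 2 * s \is a GRing.unit by rewrite E2 unitr0.
  by apply: unit_Npdiv; rewrite ?unitrM ?un ?ux ?pdiv2M.
have [x' Ex] := pdiv2E dx; have : s \isn't a GRing.unit.
  rewrite padic_unitE // negbK (_ : s = 2 * - (n%:~R * (x' * x'))) ?pdiv2M //.
  apply: (mulfI (pi_neq0 (isT : prime 2))).
  by transitivity (n%:~R * (x * x) + 2 * s - n%:~R * (x * x)); [ring|rewrite E2 Ex; ring].
apply/negP; rewrite negbK; move: u; rewrite padic_unitE // dx /= /s.
have dM (a b c : padic_int 2) : ~~ (a \is a GRing.unit) -> pdiv_pred (b * (c * a)) /\ pdiv_pred (b * (a * c)).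
  by rewrite padic_unitE // negbK => h; split; apply: pdivMr => //; [apply: pdivMr|apply: pdivM].
have [uy|ny] := boolP (y \is a GRing.unit); have [uz|nz] //= := boolP (z \is a GRing.unit) => _.
- by rewrite addrC; apply: unit_Npdiv; rewrite ?pdiv_addunit // ?unitrM ?un ?uy ?uz.
- have [h1 _] := dM z q%:~R y nz; have [h2 _] := dM z r%:~R z nz.
  by rewrite -addrA; apply: unit_Npdiv; rewrite ?pdivD // ?unitrM ?un ?uy.
- have [_ h1] := dM y q%:~R z ny; have [h2 _] := dM y p%:~R y ny.
  by rewrite -addrA addrCA; apply: unit_Npdiv; rewrite ?pdivD // ?unitrM ?un ?uz.
Qed.

(* The vectors (1, 1, 1), (1, -1, 0), (0, 1, -1) span a sublattice of index 3. *)
Lemma aniso_333 : ~ isoZ (ext (padic_int 2) (diag3 3 3 3)).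
Proof.
suff i : isometric (ext (padic_int 2) (diag3 3 3 3)) (ext (padic_int 2) (smx3 9 (2 * 3) (2 * 3) 0 0 (- 3))).
  by move=> /(isometric_isoZ (isometric_sym i)); exact: aniso_split.
exists (mx3 1 1 1 1 (-1) 0 0 1 (-1)).
  by rewrite unitmxE det_mx3 (_ : _ + _ = 3%:~R) ?unit_int //; ring.
by rewrite diag3E (ext_smx3 _ 3 3 3 0 0 0) ext_smx3 tr_mx3 !mul_mx3; congr mx3; ring.
Qed.

Section Tcoef.
Variables (L : 'M[int]_3) (D : int).
Hypotheses (sL : L^T = L).
Local Notation loc := (locally_isometric 2).

Lemma tcoef1_1 : (8 %| \det L - D)%Z -> (D %% 4)%Z = 1 -> tcoef L 1 = 1 / 2.
Proof.
move=> d8 D1; rewrite /tcoef /=.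
rewrite asboolF; last by move/loc2_det_odd; rewrite diag3_det; clear -d8 D1; lia.
rewrite asboolF; last by move/loc2_det_odd; rewrite diag3_det; clear -d8 D1; lia.
rewrite asboolF; last by move/loc2_det_odd; rewrite diag3_det; clear -d8 D1; lia.
by rewrite (_ : (_ == _ %[mod 4])%Z) // eqz_mod_dvd; clear -d8 D1; lia.
Qed.

Lemma tcoef1_3i : ~ even_lattice L -> (8 %| \det L - D)%Z -> (D %% 8)%Z = 3 ->
  isoZ (ext (padic_int 2) L) -> tcoef L 1 = 3.
Proof.
move=> oL d8 D1 iso; rewrite /tcoef /= asboolT //; apply: loc2_odd => //.
- exact: diag3_sym.
- by clear -d8 D1; lia.
- by rewrite diag3_det; clear -d8 D1; lia.
- exact: diag3_odd.
- by split=> // _; exact: isoZ_113.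
Qed.

Lemma tcoef1_3a : ~ even_lattice L -> (8 %| \det L - D)%Z -> (D %% 8)%Z = 3 ->
  ~ isoZ (ext (padic_int 2) L) -> tcoef L 1 = 1.
Proof.
move=> oL d8 D1 iso; rewrite /tcoef /= asboolF; last first.
  by move=> i; apply: iso; apply: isometric_isoZ i isoZ_113.
rewrite asboolT //; apply: loc2_odd => //.
- exact: diag3_sym.
- by clear -d8 D1; lia.
- by rewrite diag3_det; clear -d8 D1; lia.
- exact: diag3_odd.
- by split=> // /aniso_333.
Qed.

Lemma tcoef1_7 : ~ even_lattice L -> (8 %| \det L - D)%Z -> (D %% 8)%Z = 7 ->
  isoZ (ext (padic_int 2) L) -> tcoef L 1 = 2.
Proof.
move=> oL d8 D1 iso; rewrite /tcoef /=.
rewrite asboolF; last by move/loc2_det_odd; rewrite diag3_det; clear -d8 D1; lia.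
rewrite asboolF; last by move/loc2_det_odd; rewrite diag3_det; clear -d8 D1; lia.
rewrite asboolT //; apply: loc2_odd => //.
- exact: diag3_sym.
- by clear -d8 D1; lia.
- by rewrite diag3_det; clear -d8 D1; lia.
- exact: diag3_odd.
split=> // _; have [s us Es] := @int_square8 1 (-7) isT isT.
exists (rv3 s 0 1); first by rewrite rv3_neq0 oner_eq0 !andbF.
have -> : ext (padic_int 2) (diag3 1 1 7) = smx3 1 1 7%:~R 0 0 0.
  by rewrite diag3E; apply/matrixP; do 2 (apply: I3P); rewrite !mxE.
rewrite qform_rv3; transitivity (s ^+ 2 - (-7)%:~R); first by ring.
by rewrite Es mul1r subrr.
Qed.

(** Parity excludes the four even models, and an odd value of the form is a 2-adic unit that
    generates the norm ideal. *)
Lemma tcoef2_odd : ~ even_lattice L -> tcoef L 2 = 1 / 2.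
Proof.
move=> oL; have nl c : ~ loc L (A_perp (2 * c)).
  move=> /isometric_sym i; apply: oL; apply: (local_even _ _ i) => //.
    exact: A_perp_sym.
  exact: A_perp_even.
rewrite /tcoef /= (asboolF (nl 1)) (asboolF (nl 7)) (asboolF (nl 3)) (asboolF (nl 5)) asboolT //.
have [x ox] : exists x, ~~ (2 %| qform L x)%Z.
  by apply: contra_notP oL => /forallNP h x; apply/negPn/negP/h.
apply/seteqP; split=> // r _.
have E : qform (ext (padic_int 2) L) (map_mx intr x) = (qform L x)%:~R by rewrite map_rv_int.
have u : ((qform L x)%:~R : padic_int 2) \is a GRing.unit by rewrite unit_int.
exists [:: (r / (qform L x)%:~R, (qform L x)%:~R)] => [t|].
  by rewrite inE => /eqP -> /=; exists (map_mx intr x).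
by rewrite big_seq1 /= divrK.
Qed.

Lemma tcoef2_even a : even_lattice L -> \det L = 2 * a -> (8 %| a - D)%Z -> ~~ (2 %| D)%Z ->
  tcoef L 2 = if (D %% 8)%Z == 3 then 4 else if (D %% 8)%Z == 7 then 2 else 1.
Proof.
move=> eL dL d8 oD.
have Y c : (8 %| 3 * c - D)%Z -> `[< loc L (A_perp (2 * c)) >] = true.
  move=> h; rewrite asboolT //; apply: (loc2_even sL (A_perp_sym _) eL (@A_perp_even c) dL (b := 3 * c)).
  - by rewrite A_perp_det; ring.
  - by clear -oD d8; lia.
  - by clear -h d8; lia.
have N c : ~~ (8 %| 3 * c - D)%Z -> `[< loc L (A_perp (2 * c)) >] = false.
  move=> /negP h; rewrite asboolF // => i; apply: h.
  have := loc2_det_even dL (b := 3 * c) _ i.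
  by rewrite A_perp_det (_ : 3 * (2 * c) = 2 * (3 * c)) => [/(_ erefl)|]; [clear -d8; lia|ring].
rewrite /tcoef /=.
(* The models have half determinants 3, 21, 9, 15 in this order, that is 3, 5, 1, 7 modulo 8. *)
have Y1 := Y 1; have Y7 := Y 7; have Y3 := Y 3; have Y5 := Y 5.
have N1 := N 1; have N7 := N 7; have N3 := N 3; have N5 := N 5.
have : [\/ (D %% 8)%Z = 1, (D %% 8)%Z = 3, (D %% 8)%Z = 5 | (D %% 8)%Z = 7].
  have : (D %% 8)%Z = 1 \/ (D %% 8)%Z = 3 \/ (D %% 8)%Z = 5 \/ (D %% 8)%Z = 7 by clear -oD; lia.
  by case=> [|[|[]]] h; [apply: Or41|apply: Or42|apply: Or43|apply: Or44].
case=> E; rewrite E /=.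
- by rewrite N1 ?N7 ?Y3 //; clear -E; lia.
- by rewrite Y1 //; clear -E; lia.
- by rewrite N1 ?Y7 //; clear -E; lia.
- by rewrite N1 ?N7 ?N3 ?Y5 //; clear -E; lia.
Qed.

End Tcoef.

(** Minus the determinant of the plane is 1 modulo 8, hence a square, so the plane itself is
    isotropic. *)
Lemma isoZ_split7 (n p q r : int) : p != 0 -> ((p * r - q ^+ 2) %% 8)%Z = 7 ->
  isoZ (ext (padic_int 2) (smx3 n p r 0 0 q)).
Proof.
move=> p0 d8; have [|s us Es] := @int_square8 1 (- (p * r - q ^+ 2)) isT; first by clear -d8; lia.
exists (rv3 0 (- q%:~R + s) p%:~R); first by rewrite rv3_neq0 intr_padic_eq0 // (negPf p0) !andbF.
rewrite ext_smx3 qform_rv3; transitivity (p%:~R * (s ^+ 2 - (- (p * r - q ^+ 2))%:~R)); first by ring.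
by rewrite Es mul1r subrr mulr0.
Qed.

(** At (2, y, 2) the form is 4 (p y^2 + q y + r + n); Hensel applies since q is odd and r + n
    even. *)
Lemma isoZ_split3 (n p q r : int) : ~~ (2 %| n)%Z -> ~~ (2 %| q)%Z -> ~~ (2 %| r)%Z ->
  isoZ (ext (padic_int 2) (smx3 n (4 * p) r 0 0 q)).
Proof.
move=> on oq orr.
have [||y _ Ey] := @hensel 2 isT p%:~R q%:~R (r + n)%:~R.
- by rewrite unit_int.
- by rewrite pdiv_int //; clear -on orr; lia.
exists (rv3 2 y 2); first by rewrite rv3_neq0 (_ : 2 = 2%:~R) // intr_padic_eq0.
rewrite ext_smx3 qform_rv3.
transitivity (4 * (p%:~R * y ^+ 2 + q%:~R * y + (r + n)%:~R)); first by ring.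
by rewrite Ey mulr0.
Qed.

(** * Ideals of imaginary quadratic fields *)

(* Stated for explicit factors: rmorphM would also split [ratr a] into its numerator and denominator. *)
Lemma conjM (x y : algC) : (x * y)^* = x^* * y^*.
Proof. exact: rmorphM. Qed.

Definition zmod (M : set algC) := M 0 /\ forall x y, M x -> M y -> M (x - y).

(* The subgroup generated by the products; the impredicative form turns every
   inclusion between products into a closure property. *)
Definition prodI (I J : set algC) : set algC :=
  [set z | forall M, zmod M -> (forall x y, I x -> J y -> M (x * y)) -> M z].

Definition conjI (I : set algC) : set algC := [set x | I x^*].
Definition scl (x : algC) (I : set algC) : set algC := [set x * y | y in I].

Lemma zmodN M x : zmod M -> M x -> M (- x).
Proof. by move=> [M0 MB] Mx; rewrite -sub0r; apply: MB. Qed.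

Lemma zmodD M x y : zmod M -> M x -> M y -> M (x + y).
Proof. by move=> zM Mx My; rewrite -[y]opprK; apply: (proj2 zM) => //; apply: zmodN. Qed.

Lemma zmodZ M (i : int) x : zmod M -> M x -> M (i%:~R * x).
Proof.
move=> zM Mx; have P (n : nat) : M (n%:R * x).
  elim: n => [|n IH]; first by rewrite mul0r; case: zM.
  by rewrite -addn1 natrD mulrDl mul1r; apply: zmodD.
by case: i => n; rewrite ?NegzE ?rmorphN ?mulNr /=; [|apply: zmodN]; rewrite //; exact: P.
Qed.

Lemma prodI_in I J x y : I x -> J y -> prodI I J (x * y).
Proof. by move=> Ix Jy M _; apply. Qed.

Lemma prodI_zmod I J : zmod (prodI I J).
Proof.
split=> [M [M0 _] _ //|x y Px Py M zM H].
by apply: (proj2 zM); [apply: Px|apply: Py].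
Qed.

Lemma prodI_sub I J M : zmod M -> (forall x y, I x -> J y -> M (x * y)) -> prodI I J `<=` M.
Proof. by move=> zM H z; apply. Qed.

Lemma prodIC I J : prodI I J = prodI J I.
Proof.
suff sub A B : prodI A B `<=` prodI B A by apply/seteqP; split; apply: sub.
apply: prodI_sub; first exact: prodI_zmod.
by move=> x y Ax By; rewrite mulrC; apply: prodI_in.
Qed.

Lemma prodIA I J L : prodI I (prodI J L) = prodI (prodI I J) L.
Proof.
suff sub A B C : prodI A (prodI B C) `<=` prodI (prodI A B) C.
  apply/seteqP; split; first exact: sub.
  by rewrite prodIC [prodI I J]prodIC [prodI I (prodI _ _)]prodIC [prodI J L]prodIC; apply: sub.
apply: prodI_sub; first exact: prodI_zmod.
move=> x z Ax; apply: (@prodI_sub _ _ [set z | prodI (prodI A B) C (x * z)]).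
  split=> [|u v /= Pu Pv]; first by rewrite /= mulr0; case: (prodI_zmod (prodI A B) C).
  by rewrite mulrBr; apply: (proj2 (prodI_zmod _ _)).
by move=> u v Bu Cv /=; rewrite mulrA; apply: prodI_in => //; apply: prodI_in.
Qed.

Lemma prodIAC I J L : prodI (prodI I J) L = prodI (prodI I L) J.
Proof. by rewrite -!prodIA [prodI J L]prodIC. Qed.

Lemma conjIK I : conjI (conjI I) = I.
Proof. by apply/seteqP; split=> x; rewrite /conjI /= conjCK. Qed.

Lemma conjI_zmod I : zmod I -> zmod (conjI I).
Proof.
by move=> [I0 IB]; split=> [|x y]; rewrite /conjI /= ?rmorph0 // rmorphB; apply: IB.
Qed.

Lemma conj_prodI I J : conjI (prodI I J) = prodI (conjI I) (conjI J).
Proof.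
have sub A B : prodI A B `<=` conjI (prodI (conjI A) (conjI B)).
  apply: prodI_sub; first exact/conjI_zmod/prodI_zmod.
  by move=> x y Ax By; rewrite /conjI /= rmorphM; apply: prodI_in; rewrite /conjI /= conjCK.
apply/seteqP; split=> z.
  by move/sub; rewrite /conjI /= conjCK.
by move/sub; rewrite !conjIK.
Qed.

Lemma scl_zmod x I : zmod I -> zmod (scl x I).
Proof.
move=> [I0 IB]; split; first by exists 0; rewrite ?mulr0.
by move=> _ _ [y Iy <-] [z Iz <-]; exists (y - z); [apply: IB|rewrite mulrBr].
Qed.

Lemma scl_prodI x I J : scl x (prodI I J) = prodI (scl x I) J.
Proof.
apply/seteqP; split.
  move=> _ [z Pz <-]; move: z Pz; apply: (@prodI_sub _ _ [set z | prodI (scl x I) J (x * z)]).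
    split=> [|u v /= Pu Pv]; first by rewrite /= mulr0; case: (prodI_zmod (scl x I) J).
    by rewrite mulrBr; apply: (proj2 (prodI_zmod _ _)).
  by move=> u v Iu Jv /=; rewrite mulrA; apply: prodI_in => //; exists u.
apply: prodI_sub; first exact/scl_zmod/prodI_zmod.
by move=> _ v [u Iu <-] Jv; exists (u * v); [apply: prodI_in|rewrite mulrA].
Qed.

Lemma scl_prodIr x I J : scl x (prodI I J) = prodI I (scl x J).
Proof. by rewrite prodIC scl_prodI prodIC. Qed.

Lemma sclM x y I : scl x (scl y I) = scl (x * y) I.
Proof.
apply/seteqP; split=> [_ [_ [z Iz <-] <-]|_ [z Iz <-]].
  by exists z; rewrite ?mulrA.
by exists (y * z); [exists z|rewrite mulrA].
Qed.

Lemma scl1 I : scl 1 I = I.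
Proof.
apply/seteqP; split=> [_ [z Iz <-]|z Iz]; first by rewrite mul1r.
by exists z; rewrite ?mul1r.
Qed.

Lemma conj_scl x I : conjI (scl x I) = scl x^* (conjI I).
Proof.
apply/seteqP; split=> z.
  move=> [y Iy E]; exists y^*; rewrite /conjI /= ?conjCK //.
  by rewrite -rmorphM /= E conjCK.
by move=> [y Iy <-]; exists y^*; rewrite // conjM conjCK.
Qed.

Lemma scl_inj x I J : x != 0 -> scl x I = scl x J -> I = J.
Proof.
by move=> x0 E; rewrite -[I]scl1 -[J]scl1 -(mulVf x0) -!sclM E.
Qed.

(** * The ring of integers of an imaginary quadratic field *)

Record sqf := SqF { sqf_val :> int; sqf_gt0 : 0 < sqf_val; sqf_free : sqfreez sqf_val }.

Section Quad.
Variable dd : sqf.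
Local Notation D := (sqf_val dd).
Let D0 : 0 < D := sqf_gt0 dd.
Let Dsq : sqfreez D := @sqf_free dd.
Local Notation E := (quad_field (- D)).
Local Notation O := (integers E).
Definition qs : algC := sqrtC (- D)%:~R.
Local Notation s := qs.

Lemma qs_sq : s ^+ 2 = - D%:~R.
Proof. by rewrite /s sqrtCK rmorphN. Qed.

Lemma qs_conj : s^* = - s.
Proof.
have : (s^*) ^+ 2 = s ^+ 2 by rewrite -rmorphXn qs_sq rmorphN /= rmorph_int.
move=> /eqP; rewrite eqf_sqr => /orP[/eqP sr|/eqP //].
have /CrealP rs := sr; have := real_exprn_even_ge0 rs (n := 2%N) isT.
by rewrite qs_sq oppr_ge0 lerz0 leNgt D0.
Qed.

Lemma qs_neq0 : s != 0.
Proof.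
apply: contraTneq D0 => s0; have := qs_sq; rewrite s0 expr0n /= => /eqP.
by rewrite eq_sym oppr_eq0 intr_eq0 => /eqP ->.
Qed.

Lemma E_intro a b : E (ratr a + ratr b * s).
Proof. by exists a, b. Qed.

Lemma conj_ratr (a : rat) : (ratr a : algC)^* = ratr a.
Proof. exact: fmorph_rat. Qed.

Lemma E_rat a : E (ratr a).
Proof. by exists a, 0; rewrite rmorph0 mul0r addr0. Qed.

Lemma E_int (i : int) : E i%:~R.
Proof. by rewrite -(@ratr_int algC i); exact: E_rat. Qed.

Lemma E_add x y : E x -> E y -> E (x + y).
Proof. by move=> [a [b ->]] [c [d ->]]; exists (a + c), (b + d); ring. Qed.

Lemma E_opp x : E x -> E (- x).
Proof. by move=> [a [b ->]]; exists (- a), (- b); ring. Qed.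

Lemma E_sub x y : E x -> E y -> E (x - y).
Proof. by move=> Ex Ey; apply: E_add => //; apply: E_opp. Qed.

Lemma E_mul x y : E x -> E y -> E (x * y).
Proof.
move=> [a [b ->]] [c [d ->]]; exists (a * c - D%:~R * b * d), (a * d + b * c).
have := qs_sq; rewrite -/s; have -> : (D%:~R : algC) = ratr D%:~R by rewrite ratr_int.
by move=> h; ring: h.
Qed.

Lemma E_qs : E s.
Proof. by exists 0, 1; rewrite rmorph0 rmorph1 add0r mul1r. Qed.

Lemma conj_el a b : (ratr a + ratr b * s)^* = ratr a - ratr b * s.
Proof. by rewrite rmorphD /= (conjM (ratr b)) !conj_ratr qs_conj mulrN. Qed.

Lemma E_conj x : E x -> E x^*.
Proof.
move=> [a [b ->]]; exists a, (- b).
by rewrite -/s conj_el; ring.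
Qed.

Lemma E_normP a b : (ratr a + ratr b * s) * (ratr a + ratr b * s)^* = ratr (a ^+ 2 + D%:~R * b ^+ 2).
Proof.
rewrite conj_el.
have := qs_sq; rewrite -/s; have -> : (D%:~R : algC) = ratr D%:~R by rewrite ratr_int.
by move=> h; ring: h.
Qed.

Lemma E_norm x : E x -> exists2 r, x * x^* = ratr r & 0 <= r.
Proof.
move=> [a [b ->]]; exists (a ^+ 2 + D%:~R * b ^+ 2); first exact: E_normP.
by rewrite addr_ge0 ?sqr_ge0 // mulr_ge0 ?sqr_ge0 // ler0z ltW.
Qed.

Lemma E_trace x : E x -> exists t, x + x^* = ratr t.
Proof.
move=> [a [b ->]]; exists (2 * a).
by rewrite -/s conj_el; ring.
Qed.

Lemma E_inv x : E x -> E x^-1.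
Proof.
move=> Ex; have [->|x0] := eqVneq x 0; first by rewrite invr0 -[0](@ratr_int algC 0); apply: E_rat.
have [r Er _] := E_norm Ex.
have r0 : (ratr r : algC) != 0 by rewrite -Er mulf_neq0 // fmorph_eq0.
have -> : x^-1 = x^* * ratr r^-1.
  by apply: (mulfI x0); rewrite divff // mulrA Er fmorphV divff.
by apply: E_mul; [apply: E_conj|apply: E_rat].
Qed.

Lemma norm_eq0 (x : algC) : x * x^* = 0 -> x = 0.
Proof. by move/eqP; rewrite mulf_eq0 fmorph_eq0 orbb => /eqP. Qed.

(** The integers are Z[w] with w = [qw], of trace [qt] and norm [qn]; [qd] is the field discriminant
    and [sd] a square root of it. Later arguments treat both shapes of the ring at once through
    these. *)
Definition qpar : bool := (D %% 4)%Z == 3.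
Definition qt : int := qpar%:Z.
Definition qn : int := if qpar then ((1 + D) %/ 4)%Z else D.
Definition qw : algC := if qpar then (1 + s) / 2 else s.
Definition qd : int := if qpar then - D else - (4 * D).

Lemma qdE : qd = qt ^+ 2 - 4 * qn.
Proof. by rewrite /qd /qt /qn /qpar; case: eqP => h /=; rewrite ?expr0n ?expr1n /=; clear -h; lia. Qed.

Lemma E_qw : E qw.
Proof.
rewrite /qw; case: ifP => _; last exact: E_qs.
apply: E_mul; first by apply: E_add; [exact: (E_int 1)|exact: E_qs].
exact: E_inv (E_int 2).
Qed.

Lemma qw_conj : qw^* = qt%:~R - qw.
Proof.
rewrite /qw /qt; case: ifP => _ /=; last by rewrite qs_conj; ring.
by rewrite rmorphM /= rmorphD /= rmorph1 qs_conj fmorphV rmorph_nat; field.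
Qed.

Lemma qw_sq : qw ^+ 2 = qt%:~R * qw - qn%:~R.
Proof.
rewrite /qw /qt /qn; case: ifP => h /=; last by rewrite qs_sq; ring.
have E4 : (((1 + D) %/ 4)%Z)%:~R * 4 = 1 + D%:~R :> algC.
  have h4 : ((1 + D) %/ 4)%Z * 4 = 1 + D by move/eqP: h; clear; lia.
  transitivity ((((1 + D) %/ 4)%Z * 4)%:~R : algC); first by ring.
  by rewrite h4; ring.
apply: (mulfI (_ : 4 != 0)); first by rewrite pnatr_eq0.
transitivity (1 + 2 * s + s ^+ 2); first by field.
rewrite qs_sq mulrBr [4 * (_ %/ _)%Z%:~R]mulrC E4; by field.
Qed.

Lemma qw_norm : qw * qw^* = qn%:~R.
Proof. by rewrite qw_conj mulrBr -expr2 qw_sq; ring. Qed.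

Definition sd : algC := 2 * qw - qt%:~R.

Lemma sd_sq : sd ^+ 2 = qd%:~R.
Proof. rewrite /sd qdE; have h := qw_sq; ring: h. Qed.

Lemma qd_lt0 : qd < 0.
Proof. by rewrite /qd; case: ifP => _; clear -D0; lia. Qed.

Lemma sd_neq0 : sd != 0.
Proof.
apply: contraTneq qd_lt0 => s0; have := sd_sq; rewrite s0 expr0n /= => /eqP.
by rewrite eq_sym intr_eq0 => /eqP ->.
Qed.

Lemma Aint2 (x : algC) (t n : int) : x ^+ 2 = t%:~R * x - n%:~R -> x \in Aint.
Proof.
move=> Ex; pose p : {poly algC} := 'X^2 - t%:~R%:P * 'X + n%:~R%:P.
have sp : (size (- (t%:~R%:P * 'X) + n%:~R%:P : {poly algC})%R < size ('X^2 : {poly algC}))%N.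
  rewrite size_polyXn -mulNr -polyCN size_MXaddC; case: ifP => // _.
  by rewrite ltnS; apply: leq_ltn_trans (size_polyC_leq1 _) _.
apply: (@root_monic_Aint p).
- by rewrite /root /p !hornerE Ex; apply/eqP; ring.
- by rewrite monicE /p -addrA lead_coefDl // lead_coefXn.
- apply/polyOverP => i; rewrite /p coefD coefB coefXn coefCM coefX coefC.
  rewrite rpredD ?rpredB ?rpredM ?rpred_nat ?rpred_int //.
  by case: ifP => _; rewrite ?rpred0 ?rpred_int.
Qed.

Lemma Aint_conj (x : algC) : x \in Aint -> x^* \in Aint.
Proof. by rewrite Aint_aut. Qed.

Lemma ratr_inj (a b : rat) : (ratr a : algC) = ratr b -> a = b.
Proof. exact: fmorph_inj. Qed.

Lemma rat_int (r : rat) : (ratr r : algC) \in Aint -> exists i : int, r = i%:~R.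
Proof.
move=> h; have : (ratr r : algC) \in Num.int by rewrite Cint_rat_Aint ?Crat_rat.
by move/intrP => [i Ei]; exists i; apply: ratr_inj; rewrite Ei ratr_int.
Qed.

Lemma O_E x : O x -> E x. Proof. by case. Qed.

Lemma O_trace_norm x : E x -> O x <-> exists t n : int, x + x^* = t%:~R /\ x * x^* = n%:~R.
Proof.
move=> Ex; split=> [[_ Ax]|[t [n [Et En]]]].
  have [r Er _] := E_norm Ex; have [u Eu] := E_trace Ex.
  have [|n En] := @rat_int r; first by rewrite -Er rpredM ?Aint_conj.
  have [|t Et] := @rat_int u; first by rewrite -Eu rpredD ?Aint_conj.
  by exists t, n; rewrite Er Eu En Et !ratr_int.
split=> //; apply: (@Aint2 _ t n); rewrite -Et -En; ring.
Qed.

Lemma sqfree_den (d : int) (b : rat) (k : int) : sqfreez d -> d%:~R * b ^+ 2 = k%:~R ->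
  exists j : int, b = j%:~R.
Proof.
move=> sq Eb; exists (numq b).
have dn0 := denq_neq0 b.
have Ez : d * numq b ^+ 2 = k * denq b ^+ 2.
  apply: (@intr_inj rat); transitivity (d%:~R * (numq b)%:~R ^+ 2 : rat); first by ring.
  rewrite numqE; transitivity (d%:~R * b ^+ 2 * (denq b)%:~R ^+ 2); first by ring.
  by rewrite Eb; ring.
have d1 : (denq b ^+ 2 %| d)%Z.
  have : (denq b ^+ 2 %| d * numq b ^+ 2)%Z by rewrite Ez dvdz_mull.
  rewrite Gauss_dvdzl // coprimezXl // coprimezXr // coprimezE coprime_sym.
  exact: coprime_num_den.
have den1 : denq b = 1 by apply: (sqfreez_sq sq) d1; exact: denq_gt0.
by rewrite -[LHS]divq_num_den den1 divr1.
Qed.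

(** Integral trace and norm make 2 a and 2 b integers t, j with t^2 + D j^2 divisible by 4; D modulo
    4 decides whether t and j may be odd. *)
Lemma OP x : O x <-> exists i j : int, x = i%:~R + j%:~R * qw.
Proof.
split=> [Ox|[i [j ->]]]; last first.
  split; first by apply: E_add; [exact: E_int|apply: E_mul; [exact: E_int|exact: E_qw]].
  by rewrite rpredD ?rpredM ?rpred_int // (Aint2 qw_sq).
have Ex := O_E Ox; have [t [n [Et En]]] := (O_trace_norm Ex).1 Ox.
have [a [b Eab]] := Ex.
have {}Et : 2 * a = t%:~R.
  by apply: ratr_inj; rewrite ratr_int -Et Eab -/s conj_el; ring.
have {}En : a ^+ 2 + D%:~R * b ^+ 2 = n%:~R.
  by apply: ratr_inj; rewrite ratr_int -En Eab -E_normP.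
have [|j Ej] := @sqfree_den D (2 * b) (4 * n - t ^+ 2) Dsq.
  transitivity (4 * (n%:~R) - t%:~R ^+ 2 : rat); last by ring.
  by rewrite -En -Et; ring.
have Ez : t ^+ 2 + D * j ^+ 2 = 4 * n.
  apply: (@intr_inj rat); transitivity (t%:~R ^+ 2 + D%:~R * j%:~R ^+ 2 : rat); first by ring.
  by rewrite -Et -Ej; transitivity (4 * n%:~R : rat); [rewrite -En; ring|ring].
have [t' Et'] := sq_mod4 t; have [j' Ej'] := sq_mod4 j.
have a2 : a = t%:~R / 2 by rewrite -Et; field.
have b2 : b = j%:~R / 2 by rewrite -Ej; field.
have half (z : int) : ratr (z%:~R / 2) = z%:~R / 2 :> algC by rewrite fmorph_div /= ratr_int rmorph_nat.
have D4 : ~~ (4 %| D)%Z by have := Dsq (isT : prime 2).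
have EM : (t %% 2)%Z + D * (j %% 2)%Z = 4 * (n - t' - D * j') :> int.
  have -> : 4 * (n - t' - D * j') = t ^+ 2 + D * j ^+ 2 - 4 * t' - D * (4 * j') by rewrite Ez; ring.
  by rewrite Et' Ej'; ring.
move: EM; move: (n - t' - D * j') => k EM.
rewrite Eab a2 b2 !half -/s /qw /qpar; case: eqP => D3.
  have tj : (2 %| t - j)%Z.
    have [h|h] : (j %% 2)%Z = 0 \/ (j %% 2)%Z = 1 by clear; lia.
      by move: EM; rewrite h mulr0; clear -h; lia.
    by move: EM; rewrite h mulr1; clear -h D3; lia.
  have [i Ei] := dvdzP tj; exists i, j.
  have -> : t = i * 2 + j by rewrite -Ei; ring.
  by field.
have [ht hj] : (t %% 2)%Z = 0 /\ (j %% 2)%Z = 0.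
  have [h|h] : (j %% 2)%Z = 0 \/ (j %% 2)%Z = 1 by clear; lia.
    by move: EM; rewrite h mulr0; clear; lia.
  by move: EM; rewrite h mulr1; clear -h D3 D4; lia.
have /dvdzP[i Ei] : (2 %| t)%Z by clear -ht; lia.
have /dvdzP[k' Ek] : (2 %| j)%Z by clear -hj; lia.
by exists i, k'; rewrite Ei Ek; field.
Qed.

Lemma O1 : O 1. Proof. by apply/OP; exists 1, 0; rewrite mul0r addr0. Qed.
Lemma O_int (i : int) : O i%:~R. Proof. by apply/OP; exists i, 0; rewrite mul0r addr0. Qed.
Lemma O_qw : O qw. Proof. by apply/OP; exists 0, 1; rewrite mul1r add0r. Qed.
Lemma O_mul x y : O x -> O y -> O (x * y).
Proof. by move=> [Ex Ax] [Ey Ay]; split; [apply: E_mul|rewrite rpredM]. Qed.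
Lemma O_sub x y : O x -> O y -> O (x - y).
Proof. by move=> [Ex Ax] [Ey Ay]; split; [apply: E_sub|rewrite rpredB]. Qed.
Lemma O_conj x : O x -> O x^*.
Proof. by move=> [Ex Ax]; split; [apply: E_conj|apply: Aint_conj]. Qed.
Lemma conjO : conjI O = O.
Proof. by apply/seteqP; split=> x /O_conj; rewrite /conjI /= ?conjCK. Qed.
Lemma zmodO : zmod O.
Proof. by split; [exact: (O_int 0)|exact: O_sub]. Qed.

(** * Fractional ideals, their norms and their norm forms *)

Definition omod (I : set algC) := [/\ zmod I, I `<=` E & forall a x, O a -> I x -> I (a * x)].

Lemma omodO : omod O.
Proof. by split; [exact: zmodO|exact: O_E|exact: O_mul]. Qed.

Lemma omod_qw I : zmod I -> I `<=` E -> (forall x, I x -> I (qw * x)) -> omod I.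
Proof.
move=> zI IE Iw; split=> // a x /OP[i [j ->]] Ix.
by rewrite mulrDl; apply: zmodD => //; rewrite -?mulrA; apply: zmodZ => //; apply: Iw.
Qed.

Lemma omod_conj I : omod I -> omod (conjI I).
Proof.
move=> [zI IE Im]; split; first exact: conjI_zmod.
  by move=> x /IE/E_conj; rewrite conjCK.
by move=> a x /O_conj Oa Ix; rewrite /conjI /= rmorphM; apply: Im.
Qed.

Lemma omod_scl x I : E x -> omod I -> omod (scl x I).
Proof.
move=> Ex [zI IE Im]; split; first exact: scl_zmod.
  by move=> _ [y Iy <-]; apply: E_mul => //; apply: IE.
by move=> a _ Oa [y Iy <-]; exists (a * y); [apply: Im|rewrite mulrCA].
Qed.

Lemma omod_prodI I J : omod I -> omod J -> omod (prodI I J).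
Proof.
move=> [zI IE Im] [zJ JE Jm]; split; first exact: prodI_zmod.
  apply: prodI_sub; first by split; [exact: (E_int 0)|exact: E_sub].
  by move=> x y /IE Ex /JE Ey; apply: E_mul.
move=> a x Oa Px; move: x Px; apply: (@prodI_sub _ _ [set x | prodI I J (a * x)]).
  split=> [|u v /= Pu Pv]; first by rewrite /= mulr0; case: (prodI_zmod I J).
  by rewrite mulrBr; apply: (proj2 (prodI_zmod _ _)).
by move=> u v Iu Jv /=; rewrite mulrA; apply: prodI_in => //; apply: Im.
Qed.

Lemma prod_O I : omod I -> prodI O I = I.
Proof.
move=> [zI IE Im]; apply/seteqP; split; first exact: prodI_sub.
by move=> x Ix; rewrite -[x]mul1r; apply: prodI_in => //; exact: O1.
Qed.

Lemma prodr_O I : omod I -> prodI I O = I.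
Proof. by rewrite prodIC; exact: prod_O. Qed.

(** Defining the norm c by I conj(I) = (c) includes invertibility, so ideals cancel without any
    appeal to prime factorization. *)
Definition fid (c : rat) (I : set algC) :=
  [/\ omod I, 0 < c & prodI I (conjI I) = scl (ratr c) O].

Lemma ratr_neq0 (c : rat) : 0 < c -> (ratr c : algC) != 0.
Proof. by move=> c0; rewrite fmorph_eq0 gt_eqF. Qed.

Lemma fid_omod c I : fid c I -> omod I. Proof. by case. Qed.

Lemma prod_scl_O x I : omod I -> prodI (scl x O) I = scl x I.
Proof. by move=> oI; rewrite -scl_prodI prod_O. Qed.

Lemma fid_mul c d I J : fid c I -> fid d J -> fid (c * d) (prodI I J).
Proof.
move=> [oI c0 EI] [oJ d0 EJ]; split; [exact: omod_prodI|exact: mulr_gt0|].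
have oS : omod (scl (ratr d) O) by apply: omod_scl; [exact: E_rat|exact: omodO].
rewrite conj_prodI prodIA [prodI (prodI I J) _]prodIAC EI -prodIA EJ -scl_prodI prod_O //.
by rewrite sclM rmorphM.
Qed.

Lemma fid_conj c I : fid c I -> fid c (conjI I).
Proof.
move=> [oI c0 EI]; split=> //; first exact: omod_conj.
by rewrite conjIK prodIC EI.
Qed.

Lemma fid_scl c r x I : E x -> 0 < r -> x * x^* = ratr r -> fid c I -> fid (r * c) (scl x I).
Proof.
move=> Ex r0 Er [oI c0 EI]; split; [exact: omod_scl|exact: mulr_gt0|].
by rewrite conj_scl -scl_prodI -scl_prodIr EI !sclM Er rmorphM.
Qed.

Lemma fid_cancel c I J L : fid c I -> omod J -> omod L -> prodI I J = prodI I L -> J = L.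
Proof.
move=> [oI c0 EI] oJ oL E; apply: (scl_inj (ratr_neq0 c0)).
by rewrite -(prod_scl_O _ oJ) -(prod_scl_O _ oL) -EI [prodI I (conjI I)]prodIC -!prodIA E.
Qed.

Lemma scl_O_eq c d : 0 < c -> 0 < d -> scl (ratr c) O = scl (ratr d) O -> c = d.
Proof.
move=> c0 d0 E.
have key (a b : rat) : 0 < a -> 0 < b -> scl (ratr a) O (ratr b) -> exists2 i : int, 0 < i & b = a * i%:~R.
  move=> a0 b0 [y Oy Ey].
  have Eb : y = ratr (b / a).
    apply: (mulfI (ratr_neq0 a0)); rewrite Ey -rmorphM; congr ratr; field; exact: lt0r_neq0.
  have [|i Ei] := @rat_int (b / a); first by rewrite -Eb; case: Oy.
  exists i; last by rewrite -Ei; field; exact: lt0r_neq0.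
  by rewrite -(ltr0z rat) -Ei divr_gt0.
have cin (a : rat) : scl (ratr a) O (ratr a) by exists 1; rewrite ?mulr1 //; exact: O1.
have [|i i0 Ei] := key c d c0 d0; first by rewrite E.
have [|j j0 Ej] := key d c d0 c0; first by rewrite -E.
have ij : i * j = 1.
  apply: (@intr_inj rat); rewrite rmorphM /=; apply: (mulfI (lt0r_neq0 c0)).
  by rewrite mulrA -Ei -Ej mulr1.
have i1 : i = 1 by clear -ij i0 j0; nia.
by rewrite Ei i1 mulr1.
Qed.

Lemma fid_uniq c d I : fid c I -> fid d I -> c = d.
Proof. by move=> [_ c0 E1] [_ d0 E2]; apply: scl_O_eq => //; rewrite -E1. Qed.

Lemma fid_stab c I u : fid c I -> scl u I = I -> O u.
Proof.
move=> [oI c0 EI] Eu.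
have : prodI (scl u I) (conjI I) = scl (ratr c) O by rewrite Eu EI.
rewrite -scl_prodI EI sclM [u * _]mulrC -sclM => /(scl_inj (ratr_neq0 c0)) <-.
by exists 1; rewrite ?mulr1 //; exact: O1.
Qed.

Definition bas (c : rat) (I : set algC) (y w : algC) (A B C : int) :=
  [/\ E y, E w, [/\ y * y^* = ratr c * A%:~R, w * w^* = ratr c * C%:~R & y * w^* + y^* * w = ratr c * B%:~R],
      B ^+ 2 - 4 * A * C = qd & I = [set z | exists i j : int, z = i%:~R * y + j%:~R * w]].

Lemma subgroupZ (P : int -> Prop) (x : int) : x != 0 -> P x -> (forall a b, P a -> P b -> P (a - b)) ->
  exists2 g, 0 < g & forall j, P j <-> (g %| j)%Z.
Proof.
move=> x0 Px PB.
have P0 : P 0 by rewrite -(subrr x); apply: PB.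
have PN a : P a -> P (- a) by move=> Pa; rewrite -sub0r; apply: PB.
have PM (k : int) a : P a -> P (k * a).
  move=> Pa; have PMn (n : nat) : P (n%:Z * a).
    elim: n => [|n IH]; first by rewrite mul0r.
    have -> : n.+1%:Z * a = n%:Z * a - (- a) by rewrite -addn1 PoszD; ring.
    by apply: PB => //; apply: PN.
  by case: k => n; rewrite ?NegzE ?mulNr; [|apply: PN]; exact: PMn.
have [|g [[g0 Pg] gmin]] := @min_nat (fun n => (0 < n)%N /\ P n%:Z).
  exists `|x|%N; split; first by rewrite absz_gt0.
  by have [->|->] : (`|x|%N : int) = x \/ (`|x|%N : int) = - x by [clear; lia|]; [|apply: PN].
exists g%:Z; first by clear -g0; lia.
move=> j; split=> [Pj|/dvdzP[k ->]]; last exact: PM.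
have Pr : P (j %% g)%Z.
  have -> : (j %% g)%Z = j - (j %/ g)%Z * g%:Z by rewrite {2}(divz_eq j g); ring.
  by apply: PB => //; apply: PM.
have gn : g%:Z != 0 by clear -g0; lia.
have r0 := modz_ge0 j gn; have rl : (j %% g)%Z < g%:Z.
  by have := ltz_mod j gn; rewrite ger0_norm.
apply/dvdz_mod0P; apply/eqP; apply/negPn/negP => rn.
have := gmin `|(j %% g)%Z|%N; move: Pr r0 rl rn; move: (j %% g)%Z => r Pr r0 rl rn.
have -> : (`|r|%N : int) = r by clear -r0; lia.
by move/(_ (conj _ Pr)) => h; have := h; clear -r0 rl rn h; lia.
Qed.

Lemma qw_indep (i j : int) : i%:~R + j%:~R * qw = 0 -> i = 0 /\ j = 0.
Proof.
move=> h; have h2 := congr1 (@Num.conj algC) h.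
move: h2; rewrite rmorphD rmorphM /= !rmorph_int qw_conj rmorph0 => h2.
have : j%:~R * sd = 0.
  rewrite -[RHS](subrr 0) -{1}h -h2 /sd; ring.
move/eqP; rewrite mulf_eq0 (negPf sd_neq0) orbF intr_eq0 => /eqP j0.
by move: h; rewrite j0 mul0r addr0 => /eqP; rewrite intr_eq0 => /eqP.
Qed.

(** Hermite normal form in the basis 1, w: [n1] is the least positive integer of the ideal, [g]
    generates the coefficients of w, and closure under w gives the divisibilities. *)
Lemma omod_basis I : omod I -> I `<=` O -> (exists2 x, I x & x != 0) ->
  exists g n b : int, [/\ 0 < g, 0 < n, (n %| b ^+ 2 + qt * b + qn)%Z
    & I = [set z | exists i j : int, z = i%:~R * (g * n)%:~R + j%:~R * (g%:~R * (b%:~R + qw))]].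
Proof.
move=> [zI IE Im] IO [x Ix x0].
have Ox := IO x Ix.
have [_ [N [_ EN]]] := (O_trace_norm (O_E Ox)).1 Ox.
have N0 : N != 0.
  apply: contra_neq x0 => N0; apply: norm_eq0; by rewrite EN N0.
have IN : I N%:~R by rewrite -EN mulrC; apply: Im => //; apply: O_conj.
have [n1 n10 n1P] : exists2 n1, 0 < n1 & forall j, I j%:~R <-> (n1 %| j)%Z.
  apply: (subgroupZ (x := N)) => // a b Ia Ib; rewrite rmorphB; exact: (proj2 zI).
have [g g0 gP] : exists2 g, 0 < g & forall j, (exists i : int, I (i%:~R + j%:~R * qw)) <-> (g %| j)%Z.
  apply: (subgroupZ (x := N)) => //.
    by exists 0; rewrite add0r mulrC; apply: Im => //; exact: O_qw.
  move=> a b [i Ii] [i' Ii']; exists (i - i').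
  have -> : (i - i')%:~R + (a - b)%:~R * qw = (i%:~R + a%:~R * qw) - (i'%:~R + b%:~R * qw) by ring.
  exact: (proj2 zI).
have [b1 Ib1] : exists i : int, I (i%:~R + g%:~R * qw) by apply/gP.
have /dvdzP[n En] : (g %| n1)%Z.
  apply/gP; exists 0; rewrite add0r mulrC; apply: Im; [exact: O_qw|exact/n1P].
have n0 : 0 < n by clear -En n10 g0; nia.
have /dvdzP[b Eb] : (g %| b1)%Z.
  have h : I (n%:~R * (b1%:~R + g%:~R * qw) - qw * n1%:~R).
    by apply: (proj2 zI); [apply: zmodZ|apply: Im; [exact: O_qw|exact/n1P]].
  have : (n1 %| n * b1)%Z by apply/n1P; rewrite (_ : _%:~R = n%:~R * (b1%:~R + g%:~R * qw) - qw * n1%:~R) // En; ring.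
  by rewrite En dvdz_mul2l; rewrite ?gt_eqF.
have Iw : I (g%:~R * (b%:~R + qw)).
  by rewrite (_ : _ * _ = b1%:~R + g%:~R * qw) // Eb; ring.
exists g, n, b; split=> //.
  have h : I ((b + qt)%:~R * (g%:~R * (b%:~R + qw)) - qw * (g%:~R * (b%:~R + qw))).
    by apply: (proj2 zI); [apply: zmodZ|apply: Im; [exact: O_qw|]].
  have : (n1 %| g * (b ^+ 2 + qt * b + qn))%Z.
    apply/n1P; rewrite (_ : _%:~R = (b + qt)%:~R * (g%:~R * (b%:~R + qw)) - qw * (g%:~R * (b%:~R + qw))) //.
    have h2 := qw_sq; ring: h2.
  by rewrite En [n * g]mulrC dvdz_mul2l // gt_eqF.
apply/seteqP; split=> z.
  move=> Iz; have /OP[i [j Ez]] := IO z Iz.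
  have /dvdzP[j' Ej] : (g %| j)%Z by apply/gP; exists i; rewrite -Ez.
  have /n1P/dvdzP[i' Ei] : I (i - j' * b1)%:~R.
    have -> : (i - j' * b1)%:~R = z - j'%:~R * (b1%:~R + g%:~R * qw) by rewrite Ez Ej; ring.
    by apply: (proj2 zI) => //; apply: zmodZ.
  exists i', j'; rewrite Ez Ej.
  have -> : i = i' * n1 + j' * b1 by rewrite -Ei; ring.
  by rewrite En Eb; ring.
move=> [i [j ->]]; apply: zmodD => //; apply: zmodZ => //.
by rewrite [g * n]mulrC -En; apply/n1P.
Qed.

Lemma basis_bas (g n b : int) I : 0 < g -> 0 < n -> (n %| b ^+ 2 + qt * b + qn)%Z ->
  I = [set z | exists i j : int, z = i%:~R * (g * n)%:~R + j%:~R * (g%:~R * (b%:~R + qw))] ->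
  exists C : int, bas (g ^+ 2 * n)%:~R I (g * n)%:~R (g%:~R * (b%:~R + qw)) n (2 * b + qt) C.
Proof.
move=> g0 n0 /dvdzP[C EC] EI; exists C.
have ECr : b%:~R ^+ 2 + qt%:~R * b%:~R + qn%:~R = C%:~R * n%:~R :> algC.
  by transitivity ((b ^+ 2 + qt * b + qn)%:~R : algC); [ring|rewrite EC; ring].
split=> //.
- exact: E_int.
- by apply: E_mul; [exact: E_int|apply: E_add; [exact: E_int|exact: E_qw]].
- split; rewrite !rmorph_int; first by ring.
    rewrite !(rmorphM, rmorphD) /= !rmorph_int.
    transitivity (g%:~R ^+ 2 * (b%:~R ^+ 2 + b%:~R * (qw + qw^*) + qw * qw^*)); first by ring.
    by rewrite qw_norm qw_conj; transitivity ((g%:~R ^+ 2 * (b%:~R ^+ 2 + qt%:~R * b%:~R + qn%:~R)) : algC); [ring|rewrite ECr; ring].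
  by rewrite !(rmorphM, rmorphD) /= !rmorph_int qw_conj; ring.
- rewrite qdE; have -> : 4 * n * C = 4 * (b ^+ 2 + qt * b + qn) by rewrite EC; ring.
  ring.
Qed.

Section Bas.
Variables (c : rat) (I : set algC) (y w : algC) (A B C : int).
Hypotheses (c0 : 0 < c) (bI : bas c I y w A B C).
Let Ey : E y. Proof. by case: bI. Qed.
Let Ew : E w. Proof. by case: bI. Qed.
Let Ny : y * y^* = ratr c * A%:~R. Proof. by case: bI => _ _ []. Qed.
Let Nw : w * w^* = ratr c * C%:~R. Proof. by case: bI => _ _ []. Qed.
Let Tyw : y * w^* + y^* * w = ratr c * B%:~R. Proof. by case: bI => _ _ []. Qed.
Let dABC : B ^+ 2 - 4 * A * C = qd. Proof. by case: bI. Qed.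
Let EI : I = [set z | exists i j : int, z = i%:~R * y + j%:~R * w]. Proof. by case: bI. Qed.
Let rc : ratr c != 0 :> algC := ratr_neq0 c0.

Lemma bas_skew : exists2 e : int, e = 1 \/ e = -1 & y * w^* - y^* * w = e%:~R * ratr c * sd.
Proof.
have : (y * w^* - y^* * w) ^+ 2 = (ratr c * sd) ^+ 2.
  transitivity ((y * w^* + y^* * w) ^+ 2 - 4 * (y * y^*) * (w * w^*)); first by ring.
  by rewrite Ny Nw Tyw [(_ * sd) ^+ 2]exprMn sd_sq -dABC; ring.
move=> /eqP; rewrite eqf_sqr => /orP[] /eqP ->; [exists 1|exists (-1)]; try ring; by [left|right].
Qed.

Lemma bas_uniq (i j : int) : i%:~R * y + j%:~R * w = 0 -> i = 0 /\ j = 0.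
Proof.
move=> h; have hc := congr1 (@Num.conj algC) h.
move: hc; rewrite rmorphD !rmorphM /= !rmorph_int rmorph0 => hc.
have [e ee Ee] := bas_skew.
have e0 : (e%:~R : algC) != 0 by case: ee => ->; rewrite intr_eq0.
have ns : e%:~R * ratr c * sd != 0 by exact: mulf_neq0 (mulf_neq0 e0 (ratr_neq0 c0)) sd_neq0.
split; apply/eqP; rewrite -(intr_eq0 algC) -(mulIr_eq0 _ (mulIf ns)) -Ee.
  have -> : i%:~R * (y * w^* - y^* * w) = (i%:~R * y + j%:~R * w) * w^* - (i%:~R * y^* + j%:~R * w^*) * w by ring.
  by rewrite h hc !mul0r subrr.
have -> : j%:~R * (y * w^* - y^* * w) = (i%:~R * y^* + j%:~R * w^*) * y - (i%:~R * y + j%:~R * w) * y^* by ring.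
by rewrite h hc !mul0r subrr.
Qed.

Lemma bas_y : I y. Proof. by rewrite EI; exists 1, 0; ring. Qed.
Lemma bas_w : I w. Proof. by rewrite EI; exists 0, 1; ring. Qed.

Lemma bas_par : exists b, B = 2 * b + qt.
Proof.
have : ((B - qt) %% 2)%Z = 0.
  have : (2 %| B ^+ 2 - qt ^+ 2)%Z.
    have -> : B ^+ 2 - qt ^+ 2 = 2 * (2 * A * C - 2 * qn).
      by move: dABC; rewrite qdE => h; have -> : B ^+ 2 = (B ^+ 2 - 4 * A * C) + 4 * A * C by [ring|]; rewrite h; ring.
    by rewrite dvdz_mulr.
  have -> : B ^+ 2 - qt ^+ 2 = (B - qt) * (B + qt) by ring.
  by rewrite dvd2M => /orP[]; clear; lia.
by move=> h; exists ((B - qt) %/ 2)%Z; clear -h; lia.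
Qed.

(* Multiplication by the different: sd y and sd w are read off the form. *)
Lemma bas_sd : exists2 e : int, e = 1 \/ e = -1 &
  sd * y = e%:~R * (B%:~R * y - (2 * A)%:~R * w) /\ sd * w = e%:~R * ((2 * C)%:~R * y - B%:~R * w).
Proof.
have [e ee Ee] := bas_skew; exists e => //.
have e2 : e%:~R * e%:~R = 1 :> algC by case: ee => ->; rewrite -rmorphM.
have Es : ratr c * sd = e%:~R * (y * w^* - y^* * w) by rewrite Ee !mulrA e2 mul1r.
split; apply: (mulfI rc); rewrite mulrA Es.
  transitivity (e%:~R * (y * (y * w^* + y^* * w) - 2 * (y * y^*) * w)); first by ring.
  by rewrite Tyw Ny; ring.
transitivity (e%:~R * (2 * (w * w^*) * y - w * (y * w^* + y^* * w))); first by ring.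
by rewrite Tyw Nw; ring.
Qed.

Lemma bas_omod : omod I.
Proof.
have zI : zmod I.
  rewrite EI; split; first by exists 0, 0; ring.
  by move=> _ _ [i [j ->]] [k [l ->]]; exists (i - k), (j - l); ring.
have [e ee [Sy Sw]] := bas_sd; have [b Eb] := bas_par.
have two : 2 != 0 :> algC by rewrite pnatr_eq0.
have Wy : I (qw * y).
  rewrite EI; case: ee => Ee; rewrite Ee in Sy.
    exists (b + qt), (- A); apply: (mulfI two).
    by transitivity (sd * y + qt%:~R * y); [rewrite /sd; ring|rewrite Sy Eb; ring].
  exists (- b), A; apply: (mulfI two).
  by transitivity (sd * y + qt%:~R * y); [rewrite /sd; ring|rewrite Sy Eb; ring].
have Ww : I (qw * w).
  rewrite EI; case: ee => Ee; rewrite Ee in Sw.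
    exists C, (- b); apply: (mulfI two).
    by transitivity (sd * w + qt%:~R * w); [rewrite /sd; ring|rewrite Sw Eb; ring].
  exists (- C), (b + qt); apply: (mulfI two).
  by transitivity (sd * w + qt%:~R * w); [rewrite /sd; ring|rewrite Sw Eb; ring].
apply: omod_qw => //.
  by rewrite EI => _ [i [j ->]]; apply: E_add; apply: E_mul => //; apply: E_int.
move=> x; rewrite {1}EI => -[i [j ->]].
rewrite mulrDr ![qw * (_ * _)]mulrCA; by apply: zmodD => //; apply: zmodZ.
Qed.

(** For a common divisor g, the discriminant divided by g^2 is again of the form B'^2 - 4 A' C'. A
    fundamental discriminant allows only g = 1; for even g this uses that - D is neither 0 nor 1
    modulo 4. *)
Lemma bas_coprime : exists u v x : int, u * A + v * B + x * C = 1.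
Proof.
have [u [v Euv]] := Bezoutz A B; have [z [x Ezx]] := Bezoutz (gcdz A B) C.
set g := gcdz (gcdz A B) C in Ezx.
suff g1 : g = 1 by exists (z * u), (z * v), x; rewrite -[RHS]g1 -Ezx -Euv; ring.
have [/dvdzP[A' EA] [/dvdzP[B' EB] /dvdzP[C' EC]]] : (g %| A)%Z /\ (g %| B)%Z /\ (g %| C)%Z.
  have h := dvdz_gcdl (gcdz A B) C.
  by split; [apply: dvdz_trans h (dvdz_gcdl _ _)|split; [apply: dvdz_trans h (dvdz_gcdr _ _)|exact: dvdz_gcdr]].
have Eg : g ^+ 2 * (B' ^+ 2 - 4 * A' * C') = qd by rewrite -dABC EA EB EC; ring.
have g0 : 0 < g.
  rewrite lt_def; apply/andP; split; last by []; apply: contraTneq qd_lt0 => g0.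
  by rewrite -Eg g0 expr0n mul0r.
move: Eg; rewrite /qd /qpar; case: eqP => D3 Eg.
  apply: (sqfreez_sq Dsq) => //; rewrite -[D]opprK -Eg -mulrN; exact: dvdz_mulr.
have [k Ek] : exists k, 4 * D = g ^+ 2 * k by exists (- (B' ^+ 2 - 4 * A' * C')); rewrite mulrN Eg opprK.
have Ek' : k = - (B' ^+ 2 - 4 * A' * C').
  by apply: (mulfI (expf_neq0 2 (lt0r_neq0 g0))); rewrite -Ek mulrN Eg opprK.
have [eg|og] : (2 %| g)%Z \/ ~~ (2 %| g)%Z by case: (2 %| g)%Z; [left|right].
  exfalso; have /dvdzP[g' Eg'] := eg.
  have EDk : D = g' ^+ 2 * k by apply: (mulfI (_ : (4 : int) != 0)) => //; rewrite Ek Eg'; ring.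
  have g'1 : g' = 1.
    by apply: (sqfreez_sq Dsq); [clear -Eg' g0; lia|rewrite EDk dvdz_mulr].
  have Dk : D = k by rewrite EDk g'1 expr1n mul1r.
  have D4 : ~~ (4 %| D)%Z by have := Dsq (isT : prime 2).
  have [q Eq] : exists q, B' ^+ 2 = 4 * q + (B' %% 2)%Z.
    exists ((B' %/ 2)%Z * (B' %/ 2)%Z + (B' %/ 2)%Z * (B' %% 2)%Z).
    by have := divz_eq B' 2; have : (B' %% 2)%Z = 0 \/ (B' %% 2)%Z = 1 by [lia|]; move=> [] -> {1}->; ring.
  move: D3 D4; rewrite Dk Ek' Eq -mulrA; move: (A' * C') => t; clear; lia.
apply: (sqfreez_sq Dsq) => //.
have : (g ^+ 2 %| 4 * D)%Z by rewrite Ek dvdz_mulr.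
rewrite Gauss_dvdzr // coprimezXl // coprimezE (_ : absz 4 = (2 ^ 2)%N) // coprimeXr // coprimen2.
by clear -og; lia.
Qed.

(** Products of basis vectors with conjugates are c A, c C and c times integers of trace B, so I
    conj(I) lies in (c); coprimality of A, B, C gives the converse. *)
Lemma bas_fid : fid c I.
Proof.
have oI := bas_omod; split=> //.
have [_ IE _] := oI.
apply/seteqP; split.
  apply: prodI_sub; first exact/scl_zmod/zmodO.
  have zS := scl_zmod (ratr c) zmodO.
  have Ecj : (y * w^* / ratr c)^* = y^* * w / ratr c.
    have -> : (ratr c)^-1 = ratr c^-1 :> algC by rewrite fmorphV.
    by rewrite (conjM (y * w^*)) (conjM y) conjCK conj_ratr.
  have Oyw : O (y * w^* / ratr c).
    apply/O_trace_norm.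
      by apply: E_mul; [apply: E_mul => //; apply: E_conj|apply: E_inv; apply: E_rat].
    exists B, (A * C); rewrite Ecj.
    split; apply: (mulfI rc).
      by rewrite -Tyw; field.
    by apply: (mulfI rc); transitivity ((y * y^*) * (w * w^*)); [field|rewrite Ny Nw rmorphM; ring].
  move=> z t; rewrite /conjI /= {1 2}EI => -[i [j ->]] [k [l Et]].
  have -> : t = k%:~R * y^* + l%:~R * w^*.
    by rewrite -[t]conjCK Et rmorphD !rmorphM /= !rmorph_int.
  exists ((i * k * A + j * l * C)%:~R + (i * l)%:~R * (y * w^* / ratr c) + (j * k)%:~R * (y * w^* / ratr c)^*).
    apply: zmodD; [exact: zmodO| |]; last by apply: zmodZ; [exact: zmodO|exact: O_conj].
    by apply: zmodD; [exact: zmodO|exact: O_int|apply: zmodZ => //; exact: zmodO].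
  rewrite Ecj.
  transitivity ((i * k)%:~R * (ratr c * A%:~R) + (j * l)%:~R * (ratr c * C%:~R) + (i * l)%:~R * (y * w^*) + (j * k)%:~R * (y^* * w)).
    by field.
  by rewrite -Ny -Nw; ring.
have oII := omod_prodI oI (omod_conj oI).
move=> _ [a Oa <-]; rewrite mulrC; have [zII _ mII] := oII; apply: mII => //.
have [u [v [x Eu]]] := bas_coprime.
have cy : conjI I y^* by rewrite /conjI /= conjCK; exact: bas_y.
have cw : conjI I w^* by rewrite /conjI /= conjCK; exact: bas_w.
have -> : ratr c = u%:~R * (y * y^*) + v%:~R * (y * w^* + w * y^*) + x%:~R * (w * w^*) :> algC.
  rewrite [w * y^*]mulrC Tyw Ny Nw.
  by transitivity (ratr c * (u * A + v * B + x * C)%:~R : algC); [rewrite Eu mulr1|ring].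
have Iy := bas_y; have Iw := bas_w.
apply: (zmodD zII); [apply: (zmodD zII)|]; apply: (zmodZ _ zII); try exact: prodI_in.
by apply: (zmodD zII); exact: prodI_in.
Qed.

End Bas.

Lemma omod_fid I : omod I -> I `<=` O -> (exists2 x, I x & x != 0) -> exists c, fid c I.
Proof.
move=> oI IO nz; have [g [n [b [g0 n0 dv EI]]]] := omod_basis oI IO nz.
have [C bI] := basis_bas g0 n0 dv EI; exists (g ^+ 2 * n)%:~R.
by apply: (bas_fid _ bI); rewrite ltr0z mulr_gt0 // exprn_gt0.
Qed.

Lemma bas_scl c r x I y w A B C : E x -> x * x^* = ratr r -> bas c I y w A B C ->
  bas (r * c) (scl x I) (x * y) (x * w) A B C.
Proof.
move=> Ex Er [Ey Ew [Ny Nw T] dABC EI]; split=> //; try exact: E_mul.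
  rewrite !rmorphM /=; split.
  - by transitivity ((x * x^*) * (y * y^*)); [ring|rewrite Er Ny; ring].
  - by transitivity ((x * x^*) * (w * w^*)); [ring|rewrite Er Nw; ring].
  - by transitivity ((x * x^*) * (y * w^* + y^* * w)); [ring|rewrite Er T; ring].
rewrite EI; apply/seteqP; split=> [_ [_ [i [j ->]] <-]|_ [i [j ->]]].
  by exists i, j; ring.
by exists (i%:~R * y + j%:~R * w); [exists i, j|ring].
Qed.

Lemma fid_nz c I : fid c I -> exists2 x, I x & x != 0.
Proof.
move=> [[zI _ _] c0 EI]; apply: contrapT => h.
have z x : I x -> x = 0 by move=> Ix; apply: contrapT => /eqP x0; apply: h; exists x.
have : prodI I (conjI I) (ratr c) by rewrite EI; exists 1; rewrite ?mulr1 //; exact: O1.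
move/(_ [set 0]) => h2; have /eqP : ratr c = 0 :> algC.
  apply: h2; first by split=> // x y -> ->; rewrite /= subrr.
  by move=> x y /z -> _; rewrite /= mul0r.
by rewrite fmorph_eq0 gt_eqF.
Qed.

Lemma E_norm_gt0 x : E x -> x != 0 -> exists2 r, 0 < r & x * x^* = ratr r.
Proof.
move=> Ex x0; have [r Er r0] := E_norm Ex; exists r => //; rewrite lt_def r0 andbT.
by apply: contra_neq x0 => rr; apply: norm_eq0; rewrite Er rr rmorph0.
Qed.

Lemma fid_integral c I : fid c I -> exists z r, [/\ E z, z != 0, 0 < r, z * z^* = ratr r & scl z I `<=` O].
Proof.
move=> fI; have [x Ix x0] := fid_nz fI; have [[zI IE _] c0 EI] := fI.
have Ez : E (x^* * ratr c^-1) by apply: E_mul; [apply/E_conj/IE|exact: E_rat].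
have z0 : x^* * ratr c^-1 != 0 by rewrite mulf_neq0 ?fmorph_eq0 // invr_eq0 gt_eqF.
have [r r0 Er] := E_norm_gt0 Ez z0.
exists (x^* * ratr c^-1), r; split=> // _ [y Iy <-].
have : prodI I (conjI I) (y * x^*) by apply: prodI_in => //; rewrite /conjI /= conjCK.
rewrite EI => -[a Oa Ea]; rewrite (_ : _ * y = a) //.
by rewrite mulrAC [x^* * y]mulrC -Ea fmorphV mulrC mulKf // ratr_neq0.
Qed.

Lemma fid_bas c I : fid c I -> exists y w A B C, bas c I y w A B C.
Proof.
move=> fI; have [z [r [Ez z0 r0 Er zI]]] := fid_integral fI.
have [x Ix x0] := fid_nz fI.
have oz : omod (scl z I) by apply: omod_scl => //; case: fI.
have [|g [n [b [g0 n0 dv EI]]]] := omod_basis oz zI.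
  by exists (z * x); [exists x|rewrite mulf_neq0].
have [C bI] := basis_bas g0 n0 dv EI.
have Er' : z^-1 * (z^-1)^* = ratr r^-1 by rewrite fmorphV -invfM Er fmorphV.
have := bas_scl (E_inv Ez) Er' bI; rewrite sclM mulVf // scl1 => bI'.
have gn0 : 0 < (g ^+ 2 * n)%:~R :> rat by rewrite ltr0z mulr_gt0 // exprn_gt0.
have fI' := bas_fid (mulr_gt0 (_ : 0 < r^-1) gn0) bI'.
rewrite (fid_uniq fI (fI' _)) ?invr_gt0 //; by do 5 eexists; exact: bI'.
Qed.

End Quad.

(** * Ideal classes and ambiguous ideals *)

Definition sumI (I J : set algC) : set algC := [set z | exists a b, [/\ I a, J b & z = a + b]].

Lemma sumIC I J : sumI I J = sumI J I.
Proof. by apply/seteqP; split=> z [a [b [Ia Jb ->]]]; exists b, a; rewrite addrC. Qed.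

Lemma sumI_zmod I J : zmod I -> zmod J -> zmod (sumI I J).
Proof.
move=> zI zJ; split; first by exists 0, 0; rewrite addr0; split=> //; [case: zI|case: zJ].
move=> _ _ [a [b [Ia Jb ->]]] [a' [b' [Ia' Jb' ->]]]; exists (a - a'), (b - b').
by split; [apply: (proj2 zI)|apply: (proj2 zJ)|ring].
Qed.

Lemma conj_sumI I J : conjI (sumI I J) = sumI (conjI I) (conjI J).
Proof.
apply/seteqP; split=> z.
  move=> [a [b [Ia Jb Ez]]]; exists a^*, b^*; rewrite /conjI /= !conjCK; split=> //.
  by rewrite -rmorphD /= -Ez conjCK.
by move=> [a [b [Ia Jb ->]]]; exists a^*, b^*; rewrite rmorphD.
Qed.

Lemma prod_sumI I A B : zmod I -> zmod A -> zmod B ->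
  prodI I (sumI A B) = sumI (prodI I A) (prodI I B).
Proof.
move=> zI zA zB; apply/seteqP; split.
  apply: prodI_sub; first by apply: sumI_zmod; exact: prodI_zmod.
  move=> x _ Ix [a [b [Aa Bb ->]]]; exists (x * a), (x * b).
  by split; [exact: prodI_in|exact: prodI_in|rewrite mulrDr].
have zP := prodI_zmod I (sumI A B).
move=> _ [a [b [Pa Pb ->]]]; apply: (zmodD zP).
  move: a Pa; apply: prodI_sub => // x y Ix Ay; apply: prodI_in => //.
  by exists y, 0; rewrite addr0; split=> //; case: zB.
move: b Pb; apply: prodI_sub => // x y Ix By; apply: prodI_in => //.
by exists 0, y; rewrite add0r; split=> //; case: zA.
Qed.

Lemma sqfree_part (n : nat) : (0 < n)%N -> exists r k : nat,
  [/\ (0 < r)%N, (0 < k)%N, sqfreez r%:Z & n = (r * k ^ 2)%N].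
Proof.
elim/ltn_ind: n => n IH n0.
have [sq|nsq] := pselect (sqfreez n%:Z); first by exists n, 1%N; rewrite muln1.
have [q pq qn] : exists2 q, prime q & (q ^ 2 %| n)%N.
  apply: contrapT => h; apply: nsq => q pq; apply/negP; rewrite dvdzE !absz_nat => qn.
  by apply: h; exists q.
have /dvdnP[n' En] := qn.
have q1 := prime_gt1 pq.
have n'0 : (0 < n')%N by move: n0; rewrite En; case: (n').
have [|r [k [r0 k0 sq Ek]]] := IH n' _ n'0.
  by rewrite En -[X in (X < _)%N]muln1 ltn_pmul2l // (ltn_trans _ (ltn_expl 2 q1)).
exists r, (k * q)%N; split=> //; first by rewrite muln_gt0 k0 prime_gt0.
by rewrite En Ek expnMn mulnA.
Qed.

Lemma rat_sqfree_part (f : rat) : 0 < f -> exists (r : nat) (q : rat),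
  [/\ (0 < r)%N, 0 < q, sqfreez r%:Z & f = r%:R * q ^+ 2].
Proof.
move=> f0; have n0 : 0 < numq f by rewrite numq_gt0.
have d0 := denq_gt0 f.
have [|r [k [r0 k0 sq Ek]]] := @sqfree_part (absz (numq f * denq f)%R).
  by rewrite absz_gt0 mulf_neq0 // gt_eqF.
exists r, (k%:R / (denq f)%:~R); split=> //.
  by rewrite divr_gt0 ?ltr0n ?ltr0z.
have dn : (denq f)%:~R != 0 :> rat by rewrite intr_eq0 gt_eqF.
have E2 : (numq f * denq f)%:~R = r%:R * k%:R ^+ 2 :> rat.
  rewrite -natrX -natrM -Ek -[RHS]/((absz (numq f * denq f)%R)%:Z%:~R); congr (_%:~R).
  by rewrite gez0_abs // mulr_ge0 // ltW.
rewrite exprMn mulrA -E2 -{1}[f]divq_num_den rmorphM /=; by field.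
Qed.

Lemma sqfree_logn (r p : nat) : (0 < r)%N -> sqfreez r%:Z -> prime p -> (logn p r <= 1)%N.
Proof.
move=> r0 sq pp; have := sq p pp; rewrite dvdzE !absz_nat pfactor_dvdn //.
by rewrite -ltnNge ltnS.
Qed.

Lemma sqfree_square (r r' z : nat) : (0 < r)%N -> (0 < r')%N -> sqfreez r%:Z -> sqfreez r'%:Z ->
  (r * r' = z ^ 2)%N -> r = r'.
Proof.
move=> r0 r'0 sr sr' E; apply: eqn_from_log => // p.
have [pp|np] := boolP (prime p); last by rewrite [LHS]lognE [RHS]lognE (negPf np).
have := congr1 (logn p) E; rewrite lognM // lognX.
have := sqfree_logn r0 sr pp; have := sqfree_logn r'0 sr' pp.
by move: (logn p r) (logn p r') (logn p z) => a b c; clear; lia.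
Qed.

Lemma sqfree1 : sqfreez 1.
Proof.
move=> q pq; have q1 := prime_gt1 pq; rewrite dvdzE absz_nat dvdn1 gtn_eqF //.
by apply: (leq_trans q1); rewrite -[X in (X <= _)%N]expn1 leq_exp2l.
Qed.

Lemma rat_sqrt_int (b : rat) (k : int) : b ^+ 2 = k%:~R -> exists j : int, b = j%:~R.
Proof. by move=> h; apply: (@sqfree_den 1 b k sqfree1); rewrite mul1r. Qed.

Section ClassNumber.
Variable dd : sqf.
Local Notation D := (sqf_val dd).
Local Notation E := (quad_field (- D)).
Local Notation O := (integers E).
Local Notation fid := (fid dd).
Local Notation omod := (omod dd).
Local Notation qw := (qw dd).
Local Notation qt := (qt dd).
Local Notation qn := (qn dd).
Local Notation qd := (qd dd).
Local Notation s := (qs dd).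
Let D0 : 0 < D := sqf_gt0 dd.
Let Dsq : sqfreez D := @sqf_free dd.

Definition E1 (u : algC) := E u /\ u * u^* = 1.
Definition eqv1 (I J : set algC) := exists2 u, E1 u & J = scl u I.

Lemma E1_neq0 u : E1 u -> u != 0.
Proof.
by move=> [_ Eu]; apply: contraTneq (oner_neq0 algC) => u0; rewrite -Eu u0 mul0r eqxx.
Qed.

Lemma E1_conj u : E1 u -> E1 u^*.
Proof. by move=> [Eu uu]; split; [exact: E_conj|rewrite conjCK mulrC]. Qed.

Lemma E1_mul u v : E1 u -> E1 v -> E1 (u * v).
Proof.
move=> [Eu uu] [Ev vv]; split; first exact: E_mul.
by rewrite conjM mulrACA uu vv mulr1.
Qed.

Lemma eqv1_refl I : eqv1 I I.
Proof. by exists 1; rewrite ?scl1 //; split; [exact: (E_int dd 1)|rewrite rmorph1 mulr1]. Qed.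

Lemma eqv1_sym I J : eqv1 I J -> eqv1 J I.
Proof.
move=> [u Eu ->]; exists u^*; first exact: E1_conj.
by rewrite sclM mulrC (proj2 Eu) scl1.
Qed.

Lemma eqv1_trans I J L : eqv1 I J -> eqv1 J L -> eqv1 I L.
Proof. by move=> [u Eu ->] [v Ev ->]; exists (v * u); [exact: E1_mul|rewrite sclM]. Qed.

(** As u conj(1 + u) = u + 1, the element 1 + u works unless it vanishes, and then sqrt(-D) does. *)
Lemma hilbert90 u : E1 u -> exists x, [/\ E x, x != 0 & u * x^* = x].
Proof.
move=> [Eu uu]; have [u1|u1] := eqVneq u (-1).
  by exists s; split; [exact: E_qs|exact: qs_neq0|rewrite qs_conj u1; ring].
exists (1 + u); split.
- by apply: E_add => //; exact: (E_int dd 1).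
- by rewrite addrC addr_eq0.
- by rewrite rmorphD rmorph1 mulrDr mulr1 uu addrC.
Qed.

Lemma E_denom x : E x -> exists2 k : int, k != 0 & O (k%:~R * x).
Proof.
move=> [a [b ->]]; exists (denq a * denq b); first by rewrite mulf_neq0 ?denq_neq0.
have -> : (denq a * denq b)%:~R * (ratr a + ratr b * sqrtC (- D)%:~R) =
   (numq a * denq b)%:~R + (denq a * numq b)%:~R * s :> algC.
  have Ea : (denq a)%:~R * ratr a = (numq a)%:~R :> algC.
    by rewrite -ratr_int -rmorphM /= mulrC -numqE ratr_int.
  have Eb : (denq b)%:~R * ratr b = (numq b)%:~R :> algC.
    by rewrite -ratr_int -rmorphM /= mulrC -numqE ratr_int.
  by rewrite !rmorphM /= -Ea -Eb -/s; ring.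
apply: (zmodD (zmodO dd)); first exact: O_int.
apply: (zmodZ _ (zmodO dd)); split; first exact: E_qs.
by apply: (@Aint2 _ 0 D); rewrite qs_sq; ring.
Qed.

Lemma omod_fid_scl I z : omod I -> (exists2 x, I x & x != 0) -> E z -> z != 0 -> scl z I `<=` O ->
  exists c, fid c I.
Proof.
move=> oI [x Ix x0] Ez z0 zI.
have [|n fn] := omod_fid (omod_scl Ez oI) zI; first by exists (z * x); [exists x|rewrite mulf_neq0].
have zi : z^-1 != 0 by rewrite invr_eq0.
have [r r0 Er] := E_norm_gt0 (E_inv Ez) zi; exists (r * n).
by rewrite -[I]scl1 -(mulVf z0) -sclM; apply: fid_scl => //; exact: E_inv.
Qed.

(** The norm and the trace of [x] are rationals with integral squares, hence integers. *)
Lemma prod_sq_O x : E x -> O (x * x) -> O x.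
Proof.
move=> Ex Oxx; have [r Er _] := E_norm Ex; have [t Et] := E_trace Ex.
have [T [N [ET EN]]] := (O_trace_norm (E_mul Ex Ex)).1 Oxx.
have [n En] : exists n : int, r = n%:~R.
  apply: (@rat_sqrt_int r N); apply: ratr_inj; rewrite rmorphXn /= ratr_int -EN (conjM x) -Er; ring.
have [t' Et'] : exists t' : int, t = t'%:~R.
  apply: (@rat_sqrt_int t (T + 2 * n)); apply: ratr_inj.
  rewrite rmorphXn /= -Et ratr_int; transitivity (T%:~R + 2 * n%:~R : algC); last by ring.
  by rewrite -ET -[n%:~R]ratr_int -En -Er (conjM x); ring.
by apply/(O_trace_norm Ex); exists t', n; rewrite Et Er En Et' !ratr_int.
Qed.

(** Ambiguous ideals. The norm r determines the ideal ([amb_uniq]), and when square-free it divides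
    [ram]. *)
Definition amb (r : nat) (F : set algC) := fid r%:R F /\ conjI F = F.

Lemma amb_integral r F : (0 < r)%N -> amb r F -> F `<=` O.
Proof.
move=> r0 [[[zF FE _] _ EF] cF] x Fx; apply: prod_sq_O; first exact: FE.
have : prodI F (conjI F) (x * x) by rewrite cF; exact: prodI_in.
rewrite EF => -[a Oa <-]; apply: O_mul => //.
by rewrite ratr_nat; exact: (O_int dd r).
Qed.

Lemma amb_basis r F : (0 < r)%N -> sqfreez r%:Z -> amb r F -> exists b : int,
  [/\ (r%:Z %| b ^+ 2 + qt * b + qn)%Z, (r%:Z %| 2 * b + qt)%Z
    & F = [set z | exists i j : int, z = i%:~R * r%:~R + j%:~R * (b%:~R + qw)]].
Proof.
move=> r0 sr aF; have FO := amb_integral r0 aF; have [fF cF] := aF.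
have [g [n [b [g0 n0 dv EF]]]] := omod_basis (fid_omod fF) FO (fid_nz fF).
have [C bF] := basis_bas g0 n0 dv EF.
have fF' := bas_fid (_ : 0 < (g ^+ 2 * n)%:~R) bF.
have Er : r%:Z = g ^+ 2 * n.
  apply: (@intr_inj rat); apply: (fid_uniq fF); apply: fF'.
  by rewrite ltr0z mulr_gt0 // exprn_gt0.
have g1 : g = 1 by apply: (sqfreez_sq sr) => //; rewrite Er dvdz_mulr.
have nr : n = r by rewrite Er g1 expr1n mul1r.
exists b; rewrite -nr; split=> //; last by rewrite EF g1 mul1r; apply/seteqP; split=> z [i [j ->]]; exists i, j; ring.
have : conjI F (b%:~R + qw).
  by rewrite cF EF; exists 0, 1; rewrite g1; ring.
rewrite /conjI /= EF => -[i [j]]; rewrite rmorphD /= rmorph_int qw_conj g1 => h.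
have h0 : (b + qt - i * n - j * b)%:~R + (- 1 - j)%:~R * qw = 0.
  transitivity (b%:~R + (qt%:~R - qw) - (i%:~R * (1 * n)%:~R + j%:~R * (1%:~R * (b%:~R + qw)))); first by ring.
  by rewrite h subrr.
have [h1 h2] := qw_indep h0.
by apply/dvdzP; exists i; clear -h1 h2; nia.
Qed.

(** The product of the ramified primes: 2 ramifies unless D is 3 modulo 4, and for even D it is
    already a factor of D. *)
Definition ram : nat := if (D %% 4)%Z == 1 then (2 * `|D|)%N else `|D|%N.

Lemma ram_gt0 : (0 < ram)%N.
Proof. by rewrite /ram; case: ifP => _; clear -D0; lia. Qed.

Lemma qd_ram (r : nat) : sqfreez r%:Z -> (r%:Z %| qd)%Z -> (r %| ram)%N.
Proof.
move=> sr; rewrite /qd /qpar /ram.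
have aD : `|D|%N%:Z = D by clear -D0; lia.
case: eqP => D3; first by rewrite dvdzE abszN absz_nat; case: eqP => // D1; clear -D3 D1; lia.
rewrite dvdzE absz_nat abszN abszM => r4.
have r0 : (0 < r)%N.
  by case: (r) r4 => //; rewrite dvd0n muln_eq0 /=; clear -D0; lia.
have D4 : ~~ (4 %| D)%Z by have := Dsq (isT : prime 2).
have r2D : (r %| 2 * `|D|)%N.
  apply/dvdn_partP => // p; rewrite mem_primes => /and3P[pp _ pr].
  rewrite p_part; have := sqfree_logn r0 sr pp; have : (0 < logn p r)%N by rewrite logn_gt0 mem_primes pp r0.
  case: (logn p r) => [//|[_ _|//]]; rewrite expn1.
  have : (p %| 4 * `|D|)%N by apply: dvdn_trans pr r4.
  rewrite Euclid_dvdM // => /orP[|h]; last by rewrite dvdn_mull.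
  by rewrite -[4%N]/((2 ^ 2)%N) Euclid_dvdX // => /andP[h _]; rewrite dvdn_mulr.
case: eqP => D1 //.
have e : (2 %| `|D|)%N by clear -D1 D3 D4; lia.
apply/dvdn_partP => // p; rewrite mem_primes => /and3P[pp _ pr].
rewrite p_part; have := sqfree_logn r0 sr pp; have : (0 < logn p r)%N by rewrite logn_gt0 mem_primes pp r0.
case: (logn p r) => [//|[_ _|//]]; rewrite expn1.
have : (p %| 2 * `|D|)%N by apply: dvdn_trans pr r2D.
by rewrite Euclid_dvdM // => /orP[h|//]; apply: dvdn_trans h e.
Qed.

Lemma amb_ram r F : (0 < r)%N -> sqfreez r%:Z -> amb r F -> (r %| ram)%N.
Proof.
move=> r0 sr aF; have [b [d1 d2 _]] := amb_basis r0 sr aF.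
apply: qd_ram => //; rewrite qdE.
have -> : qt ^+ 2 - 4 * qn = (2 * b + qt) * (2 * b + qt) - 4 * (b ^+ 2 + qt * b + qn) by ring.
by rewrite rpredB // dvdz_mull.
Qed.

Lemma amb_scl F q : 0 < q -> conjI F = F -> conjI (scl (ratr q) F) = scl (ratr q) F.
Proof. by move=> q0 cF; rewrite conj_scl conj_ratr cF. Qed.

Lemma fid_sclr c q I : 0 < q -> fid c I -> fid (q ^+ 2 * c) (scl (ratr q) I).
Proof.
move=> q0; apply: fid_scl; [exact: E_rat|exact: exprn_gt0|].
by rewrite conj_ratr -rmorphM -expr2.
Qed.

(** The ideal F F' / r is ambiguous of norm 1, hence O; since F F = (r) as well, F cancels. *)
Lemma amb_uniq r F F' : (0 < r)%N -> amb r F -> amb r F' -> F = F'.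
Proof.
move=> r0 [fF cF] [fF' cF'].
have rr0 : 0 < r%:R :> rat by rewrite ltr0n.
have q0 : 0 < (r%:R)^-1 :> rat by rewrite invr_gt0.
pose C := scl (ratr (r%:R)^-1) (prodI F F').
have aC : amb 1 C.
  split; last by apply: amb_scl => //; rewrite conj_prodI cF cF'.
  have := fid_sclr q0 (fid_mul fF fF').
  by rewrite (_ : _ * (_ * _) = 1%:R) // expr2; field; rewrite gt_eqF.
have CO : C = O.
  have [b [_ _ EC]] := amb_basis (isT : (0 < 1)%N) sqfree1 aC.
  apply/seteqP; split; first exact: amb_integral aC.
  move=> x Ox; have C1 : C 1 by rewrite EC; exists 1, 0; ring.
  have [[[_ _ mC] _ _] _] := aC; by rewrite -[x]mulr1; apply: mC.
have rn : ratr (r%:R)^-1 != 0 :> algC by apply: ratr_neq0.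
have EFF : prodI F F = prodI F F'.
  apply: (scl_inj rn); rewrite -/C CO; have [_ _ EF] := fF; rewrite cF in EF.
  by rewrite EF sclM -rmorphM mulVf ?gt_eqF // rmorph1 scl1.
exact: (fid_cancel fF (fid_omod fF) (fid_omod fF') EFF).
Qed.

Lemma amb_of_b (r : nat) (b : int) : (0 < r)%N -> (r%:Z %| b ^+ 2 + qt * b + qn)%Z ->
  (r%:Z %| 2 * b + qt)%Z -> exists F, amb r F.
Proof.
move=> r0 d1 /dvdzP[k Ek].
pose F := [set z : algC | exists i j : int, z = i%:~R * (1 * r%:Z)%:~R + j%:~R * (1%:~R * (b%:~R + qw))].
have rz : 0 < r%:Z by [].
have [C bF] := basis_bas (ltr01 : 0 < (1 : int)) rz d1 (erefl F).
have fF : fid r%:R F.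
  have := bas_fid (_ : 0 < (1 ^+ 2 * r%:Z)%:~R) bF.
  by rewrite expr1n mul1r; apply; rewrite ltr0z.
exists F; split=> //.
have sub : F `<=` conjI F.
  move=> z [i [j ->]]; exists (i + j * k), (- j).
  rewrite rmorphD !(rmorphM, rmorphD) /= !rmorph_int qw_conj.
  have Ekr : 2 * b%:~R + qt%:~R = k%:~R * r%:~R :> algC.
    by transitivity ((2 * b + qt)%:~R : algC); [ring|rewrite Ek; ring].
  transitivity (i%:~R * r%:~R + j%:~R * (2 * b%:~R + qt%:~R) - j%:~R * (b%:~R + qw)); first by ring.
  by rewrite Ekr; ring.
apply/seteqP; split=> [z /sub|]; last exact: sub.
by rewrite /conjI /= conjCK.
Qed.

(** Z r + Z (b + w) is ambiguous when r divides the norm of b + w and 2 b + t, with t the trace of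
    w. If t = 1 take r = 2 b + 1; if t = 0 take b = 0 when r divides D, and b = r / 2 when r has the
    additional factor 2. *)
Lemma amb_ex r : (r %| ram)%N -> exists F, amb r F.
Proof.
move=> rR; have r0 : (0 < r)%N := dvdn_gt0 ram_gt0 rR.
have aD : `|D|%N%:Z = D by clear -D0; lia.
have D4 : ~~ (4 %| D)%Z by have := Dsq (isT : prime 2).
have dvdD : (r %| `|D|)%N -> (r%:Z %| D)%Z by rewrite dvdzE absz_nat.
have [par|npar] := boolP (qpar dd).
  have D3 : (D %% 4)%Z = 3 by apply/eqP.
  have rD : (r%:Z %| D)%Z by apply: dvdD; move: rR; rewrite /ram; case: eqP => //; clear -D3; lia.
  have or_ : odd r.
    apply/negPn/negP => er; have /dvdzP[k Ek] := rD.
    have : (2 %| D)%Z by rewrite Ek dvdz_mull // dvdzE absz_nat dvdn2.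
    by clear -D3; lia.
  have [b Eb] : exists b, r%:Z = 2 * b + 1 by exists (r./2)%:Z; clear -or_; lia.
  apply: (@amb_of_b r b) => //; last first.
    by rewrite /qt par -Eb.
  have -> : b ^+ 2 + qt * b + qn = b ^+ 2 + b + ((1 + D) %/ 4)%Z by rewrite /qt /qn par mul1r.
  have E4 : 4 * (b ^+ 2 + b + ((1 + D) %/ 4)%Z) = r%:Z * r%:Z + D.
    have h : 4 * ((1 + D) %/ 4)%Z = 1 + D by clear -D3; lia.
    by rewrite !mulrDr h Eb; ring.
  have : (r%:Z %| 4 * (b ^+ 2 + b + ((1 + D) %/ 4)%Z))%Z by rewrite E4 rpredD // dvdz_mull.
  rewrite Gauss_dvdzr // coprimezE absz_nat (_ : absz 4 = (2 ^ 2)%N) // coprimeXr //.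
  by rewrite coprimen2.
have qt0 : qt = 0 by rewrite /qt (negPf npar).
have qnD : qn = D by rewrite /qn (negPf npar).
have [rD|nrD] := boolP (r %| `|D|)%N.
  apply: (@amb_of_b r 0) => //; rewrite qt0 ?qnD ?mulr0 ?expr0n ?add0r ?addr0 ?dvdz0 //.
have D1 : (D %% 4)%Z = 1 by apply/eqP; move: rR nrD; rewrite /ram; case: ifP => // _ ->.
have r2D : (r %| 2 * `|D|)%N by move: rR; rewrite /ram D1 eqxx.
have er : ~~ odd r.
  by apply: contra nrD => or_; move: r2D; rewrite Gauss_dvdr // coprimen2.
have [r' Er] : exists r', r = (2 * r')%N by exists r./2; clear -er; lia.
have r'D : (r'%:Z %| D)%Z by rewrite dvdzE absz_nat -(@dvdn_pmul2l 2) // -Er.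
apply: (@amb_of_b r r'%:Z) => //; rewrite qt0 ?qnD ?mul0r ?addr0; last by rewrite Er PoszM dvdzz.
have [k Ek] := dvdzP r'D.
have ok : ~~ (2 %| k + r'%:Z)%Z -> False.
  move=> h; have : (D %% 2)%Z = 1 by clear -D1; lia.
  have : (2 %| D)%Z by rewrite Ek dvd2M; clear -h; lia.
  by clear; lia.
rewrite Er PoszM Ek (_ : _ + _ = (k + r'%:Z) * r'%:Z); last by ring.
have /dvdzP[x ->] : (2 %| k + r'%:Z)%Z by apply/negPn/negP.
by rewrite -mulrA dvdz_mull.
Qed.

(** The norm of a generator of a nontrivial principal ambiguous ideal: sqrt(-D) in general, and 1 +
    i for D = 1, where sqrt(-D) is a unit. *)
Definition gen_ram : nat := if D == 1 then 2%N else `|D|%N.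

Lemma gen_ram_elt : exists x, [/\ E x, x != 0, x * x^* = ratr gen_ram%:R & conjI (scl x O) = scl x O].
Proof.
rewrite /gen_ram; case: eqP => D1; last first.
  exists s; split; [exact: E_qs|exact: qs_neq0| |].
    rewrite qs_conj mulrN -expr2 qs_sq opprK ratr_nat -[LHS]/(_%:~R) -[RHS]/((absz D)%:Z%:~R).
    by congr (_%:~R); clear -D0; lia.
  have ON y : O y -> O (- y) by exact: (zmodN (zmodO dd)).
  by rewrite conj_scl qs_conj conjO; apply/seteqP; split=> _ [y Oy <-]; exists (- y);
    rewrite ?mulrNN ?mulrN ?mulNr //; exact: ON.
have s2 : s ^+ 2 = -1 by rewrite qs_sq D1.
have Os : O s by split; [exact: E_qs|apply: (@Aint2 _ 0 1); rewrite s2; ring].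
exists (1 + s); split.
- by apply: E_add; [exact: (E_int dd 1)|exact: E_qs].
- apply/eqP => h; have s1 : s = -1 by apply/eqP; rewrite -addr_eq0 addrC h.
  have := qs_conj dd; rewrite s1 rmorphN rmorph1 opprK => h1.
  have /eqP : 2 = 0 :> algC by rewrite -[2]/(1 + 1) -{1}h1 addNr.
  by rewrite pnatr_eq0.
- have cj1 : (1 + s)^* = 1 - s by rewrite [LHS]rmorphD rmorph1 /= qs_conj.
  by rewrite cj1 ratr_nat; ring: s2.
- have cj : (1 + s)^* = (1 + s) * - s by rewrite [LHS]rmorphD rmorph1 /= qs_conj; ring: s2.
  rewrite conj_scl conjO cj -sclM; congr (scl _ _).
  apply/seteqP; split=> [_ [y Oy <-]|y Oy].
    by apply: O_mul => //; exact: (zmodN (zmodO dd)).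
  exists (s * y); first exact: O_mul.
  by rewrite mulrA mulNr -expr2 s2 opprK mul1r.
Qed.

Lemma gen_ram_gt1 : (1 < gen_ram)%N.
Proof. by rewrite /gen_ram; case: eqP => // D1; clear -D0 D1; lia. Qed.

Lemma gen_ram_dvd : (gen_ram %| ram)%N.
Proof.
rewrite /gen_ram /ram; case: eqP => [->|_] //.
by case: ifP => _ //; rewrite dvdn_mull.
Qed.

Lemma ram_sqfree : sqfreez ram%:Z.
Proof.
move=> q pq; rewrite dvdzE !absz_nat /ram.
have := Dsq pq; rewrite dvdzE absz_nat => h.
case: eqP => // D1; apply: contra h.
have D2 : ~~ (2 %| `|D|)%N by clear -D1; lia.
have [->|q2] := eqVneq q 2; first by rewrite expnS expn1 dvdn_pmul2l // (negPf D2).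
by rewrite Gauss_dvdr // coprime_sym coprimeXr // prime_coprime // dvdn_prime2 // eq_sym.
Qed.

(* The element x generates an ambiguous ideal, hence x / x^* is a root of unity. *)
Lemma norm_unit_ratio x : E x -> x != 0 -> O (x / x^*) ->
  exists2 q : rat, q != 0 & x * x^* = ratr (q ^+ 2) \/ x * x^* = ratr (gen_ram%:R * q ^+ 2).
Proof.
move=> Ex x0 Ou; set u := x / x^* in Ou.
have xc0 : x^* != 0 by rewrite fmorph_eq0.
have Eu : E u by case: Ou.
have uu : u * u^* = 1 by rewrite /u (conjM x) fmorphV /= conjCK; field; rewrite x0 xc0.
have ux : u * x^* = x by rewrite /u divfK.
have [t [n [Et _]]] := (O_trace_norm Eu).1 Ou.
have t2 : -2 <= t <= 2.
  have [r1 E1' h1] := E_norm (E_add (E_int dd 1) Eu).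
  have [r2 E2' h2] := E_norm (E_sub (E_int dd 1) Eu).
  have F1 : r1 = (2 + t)%:~R.
    apply: ratr_inj; rewrite -E1' ratr_int rmorphD rmorph_int.
    transitivity (1 + (u + u^*) + u * u^*); first by ring.
    by rewrite Et uu; ring.
  have F2 : r2 = (2 - t)%:~R.
    apply: ratr_inj; rewrite -E2' ratr_int rmorphB rmorph_int.
    transitivity (1 - (u + u^*) + u * u^*); first by ring.
    by rewrite Et uu; ring.
  move: h1 h2; rewrite F1 F2 !ler0z; clear; lia.
have [T ET] := E_trace Ex.
have ETN : (2 + t)%:~R * (x * x^*) = ratr T ^+ 2.
  rewrite -ET; transitivity (x * x^* + x * x^* + (u + u^*) * (x * x^*)).
    by rewrite Et; ring.
  have ux2 : u * (x * x^*) = x * x by rewrite mulrCA ux.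
  have ux3 : u^* * (x * x^*) = x^* * x^*.
    have ucx : u^* * x = x^* by rewrite -[RHS](congr1 (@Num.conj algC) ux) (conjM u) conjCK.
    by rewrite mulrA ucx.
  by rewrite mulrDl ux2 ux3; ring.
have [a [b Eab]] := Eu.
have Ea : 2 * a = t%:~R by apply: ratr_inj; rewrite ratr_int -Et Eab -/s conj_el; ring.
have En : a ^+ 2 + D%:~R * b ^+ 2 = 1 by apply: ratr_inj; rewrite rmorph1 -uu Eab -E_normP.
have [r r0 Er] := E_norm_gt0 Ex x0.
have ETN' : (2 + t)%:~R * r = T ^+ 2.
  apply: ratr_inj; transitivity ((2 + t)%:~R * ratr r : algC); first by rewrite [LHS]rmorphM /= ratr_int.
  by rewrite -Er ETN rmorphXn.
have T0 : 2 + t != 0 -> T != 0.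
  by move=> h; apply: contraTneq r0 => TT; move/eqP: ETN'; rewrite TT expr0n mulf_eq0 intr_eq0 (negPf h) /= => /eqP ->.
have jE (k : int) : 4 - t ^+ 2 = k -> exists j : int, D * j ^+ 2 = k.
  move=> Ek; have [|j Ej] := @sqfree_den D (2 * b) k Dsq.
    transitivity (4 * (a ^+ 2 + D%:~R * b ^+ 2) - (2 * a) ^+ 2); first by ring.
    by rewrite En Ea -Ek; ring.
  exists j; apply: (@intr_inj rat); transitivity (D%:~R * j%:~R ^+ 2 : rat); first by ring.
  rewrite -Ej; transitivity (4 * (a ^+ 2 + D%:~R * b ^+ 2) - (2 * a) ^+ 2); first by ring.
  by rewrite En Ea -Ek; ring.
(* These are the traces of roots of unity of order 2, 3, 4, 6, 1. The square of the trace of [x] is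
   (2 + t) N(x), which yields N(x) unless t = -2; in that case [x] is a rational multiple of
   sqrt(-D). *)
have : [\/ t = -2, t = -1, t = 0 | t = 1 \/ t = 2].
  have : t = -2 \/ t = -1 \/ t = 0 \/ t = 1 \/ t = 2 by clear -t2; lia.
  by case=> [|[|[]]] h; [apply: Or41|apply: Or42|apply: Or43|apply: Or44].
case=> [t_|t_|t_|[t_|t_]].
- have TT : T = 0 by apply/eqP; move/eqP: ETN'; rewrite t_ mul0r eq_sym expf_eq0.
  have [a' [b' Ex']] := Ex.
  have a'0 : a' = 0.
    apply: (mulfI (_ : (2 : rat) != 0)) => //; rewrite mulr0; apply: ratr_inj.
    by rewrite -[in RHS]TT -ET Ex' -/s conj_el; ring.
  have Er' : r = D%:~R * b' ^+ 2.
    by apply: ratr_inj; rewrite -Er Ex' E_normP a'0; congr ratr; ring.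
  have b'0 : b' != 0 by apply: contraTneq r0 => bb; rewrite Er' bb expr0n mulr0.
  have [D1|D1] := eqVneq D 1.
    by exists b' => //; left; rewrite Er Er' D1 mul1r.
  exists b' => //; right; rewrite Er Er' /gen_ram (negPf D1).
  by rewrite -[(absz D)%:R]/((absz D)%:Z%:~R) gez0_abs // ltW.
- exists T; first by apply: T0; rewrite t_.
  by left; rewrite Er -ETN' t_ mul1r.
- have D1 : D = 1.
    have [//|j Ej] := jE 4; first by rewrite t_.
    have D4 : ~~ (4 %| D)%Z by have := Dsq (isT : prime 2).
    have jb : -2 <= j <= 2 by clear -Ej D0; nia.
    have : j = -2 \/ j = -1 \/ j = 0 \/ j = 1 \/ j = 2 by clear -jb; lia.
    by case=> [h|[h|[h|[h|h]]]]; move: Ej; rewrite h expr2; clear -D4; lia.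
  exists (T / 2); first by rewrite mulf_neq0 // T0 // t_.
  right; rewrite Er /gen_ram D1 /=; congr ratr.
  apply: (mulfI (_ : (2 : rat) != 0)) => //.
  by move: ETN'; rewrite t_ => ->; field.
- have D3 : D = 3.
    have [//|j Ej] := jE 3; first by rewrite t_.
    have jb : -1 <= j <= 1 by clear -Ej D0; nia.
    have : j = -1 \/ j = 0 \/ j = 1 by clear -jb; lia.
    by case=> [h|[h|h]]; move: Ej; rewrite h expr2; clear; lia.
  exists (T / 3); first by rewrite mulf_neq0 // T0 // t_.
  right; rewrite Er /gen_ram D3 /=; congr ratr.
  apply: (mulfI (_ : (3 : rat) != 0)) => //.
  by move: ETN'; rewrite t_ => ->; field.
- exists (T / 2); first by rewrite mulf_neq0 // T0 // t_.
  left; rewrite Er; congr ratr.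
  apply: (mulfI (_ : (4 : rat) != 0)) => //.
  by move: ETN'; rewrite t_ => ->; field.
Qed.

End ClassNumber.

Lemma prodIACA A B C F : prodI (prodI A B) (prodI C F) = prodI (prodI A C) (prodI B F).
Proof. by rewrite -!prodIA [prodI B (prodI C F)]prodIA [prodI B C]prodIC -[prodI (prodI C B) F]prodIA. Qed.

Lemma nuM a b : (0 < a)%N -> (0 < b)%N -> coprime a b -> nu (a * b) = (nu a + nu b)%N.
Proof.
move=> a0 b0 cop; rewrite /nu -size_cat; apply: perm_size; apply: uniq_perm; first exact: primes_uniq.
  by rewrite cat_uniq !primes_uniq andbT /= -coprime_has_primes.
by move=> x; rewrite mem_cat primesM.
Qed.

Lemma size_divisors_sqfree (n : nat) : (0 < n)%N -> sqfreez n%:Z -> size (divisors n) = (2 ^ nu n)%N.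
Proof.
elim/ltn_ind: n => n IH n0 sq; have [n1|n1] := eqVneq n 1%N; first by rewrite n1.
have n2 : (1 < n)%N by clear -n0 n1; lia.
have pp := pdiv_prime n2; set p := pdiv n in pp.
have /dvdnP[n' En] := pdiv_dvd n; rewrite -/p mulnC in En.
have n'0 : (0 < n')%N by move: n0; rewrite En muln_gt0 => /andP[].
have cop : coprime p n'.
  rewrite prime_coprime //; apply/negP => /dvdnP[k Ek]; have := sq p pp.
  by rewrite dvdzE !absz_nat En Ek mulnCA mulnn dvdn_mull.
have sq' : sqfreez n'%:Z.
  by apply: (sqfreez_dvd sq); rewrite dvdzE !absz_nat En dvdn_mull.
have lt : (n' < n)%N by rewrite En ltn_Pmull // prime_gt1.
have IH' := IH n' lt n'0 sq'.
have p0 := prime_gt0 pp.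
have pd : perm_eq (divisors n) (divisors n' ++ [seq (p * d)%N | d <- divisors n']).
  apply: uniq_perm; first exact: divisors_uniq.
    rewrite cat_uniq divisors_uniq map_inj_uniq ?divisors_uniq ?andbT; last first.
      by move=> a b /eqP; rewrite eqn_pmul2l // => /eqP.
    apply/hasPn => _ /mapP[d _ ->]; rewrite -dvdn_divisors //; apply/negP => h.
    have : (p %| n')%N by apply: dvdn_trans h; rewrite dvdn_mulr.
    by move: cop; rewrite prime_coprime // => /negP.
  move=> d; rewrite mem_cat -!dvdn_divisors //; apply/idP/orP.
    move=> dn; have [pd|npd] := boolP (p %| d)%N; [right|left].
      have /dvdnP[d' Ed] := pd; rewrite mulnC in Ed; apply/mapP; exists d' => //.
      by rewrite -dvdn_divisors //; move: dn; rewrite En Ed dvdn_pmul2l.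
    by move: dn; rewrite En Gauss_dvdr // coprime_sym prime_coprime.
  case=> [h|/mapP[d' h ->]]; first by rewrite En dvdn_mull.
  by rewrite En dvdn_pmul2l // dvdn_divisors.
rewrite (perm_size pd) size_cat size_map IH' En nuM // (_ : nu p = 1%N); last by rewrite /nu primes_prime.
by rewrite expnS mul2n addnn.
Qed.

(** * Ideals of a fixed norm and the class number *)

Section ClassCount.
Variable dd : sqf.
Local Notation D := (sqf_val dd).
Local Notation E := (quad_field (- D)).
Local Notation O := (integers E).
Local Notation fid := (fid dd).
Local Notation omod := (omod dd).
Local Notation amb := (amb dd).
Local Notation ram := (ram dd).
Local Notation gen_ram := (gen_ram dd).

(** The ambiguous ideals of norm dividing [ram] fall into pairs equivalent through the principal one
    of norm [gen_ram]. In each pair one norm is prime to the chosen prime factor of [gen_ram]; these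
    norms index the classes. *)
Definition half_ram : seq nat := divisors (ram %/ pdiv gen_ram).
Local Notation p0 := (pdiv gen_ram).

Lemma p0_prime : prime p0. Proof. by apply: pdiv_prime; exact: gen_ram_gt1. Qed.
Lemma p0_ram : (p0 %| ram)%N. Proof. exact: dvdn_trans (pdiv_dvd _) (gen_ram_dvd dd). Qed.
Lemma ramE : ram = (p0 * (ram %/ p0))%N. Proof. by rewrite mulnC divnK // p0_ram. Qed.
Lemma ram_div_gt0 : (0 < ram %/ p0)%N.
Proof. by have := ram_gt0 dd; rewrite {1}ramE muln_gt0 => /andP[]. Qed.

Lemma p0_ndvd : ~~ (p0 %| ram %/ p0)%N.
Proof.
apply/negP => /dvdnP[k Ek]; have := @ram_sqfree dd _ p0_prime; rewrite dvdzE !absz_nat.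
by rewrite ramE Ek mulnCA mulnn dvdn_mull.
Qed.

Lemma half_ramP r : r \in half_ram <-> (r %| ram)%N /\ ~~ (p0 %| r)%N.
Proof.
rewrite /half_ram -dvdn_divisors; last exact: ram_div_gt0.
split=> [h|[h np]].
  split; first by rewrite ramE dvdn_mull.
  by apply: contra p0_ndvd => h2; apply: dvdn_trans h2 h.
by move: h; rewrite {1}ramE Gauss_dvdr // coprime_sym prime_coprime // p0_prime.
Qed.

Lemma size_half_ram : size half_ram = (2 ^ (nu ram).-1)%N.
Proof.
have sq : sqfreez (ram %/ p0)%N%:Z.
  by apply: (sqfreez_dvd (@ram_sqfree dd)); rewrite dvdzE !absz_nat {2}ramE dvdn_mull.
rewrite /half_ram size_divisors_sqfree ?ram_div_gt0 //; congr (_ ^ _)%N.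
rewrite [in RHS]ramE nuM ?ram_div_gt0 ?prime_gt0 ?p0_prime ?prime_coprime ?p0_ndvd ?p0_prime //.
by rewrite (_ : nu p0 = 1%N) // /nu primes_prime ?p0_prime.
Qed.

Lemma ram_dvd_gt0 r : (r %| ram)%N -> (0 < r)%N. Proof. exact: dvdn_gt0 (ram_gt0 dd). Qed.

Lemma ram_dvd_sqfree r : (r %| ram)%N -> sqfreez r%:Z.
Proof. by move=> h; apply: (sqfreez_dvd (@ram_sqfree dd)); rewrite dvdzE. Qed.

Lemma logn_gen_ram : logn p0 gen_ram = 1%N.
Proof.
have g0 : (0 < gen_ram)%N := ltnW (gen_ram_gt1 dd).
apply/eqP; rewrite eqn_leq sqfree_logn ?p0_prime //=; last exact/ram_dvd_sqfree/gen_ram_dvd.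
by rewrite logn_gt0 mem_primes p0_prime g0 pdiv_dvd.
Qed.

Definition dI (r : nat) : set algC := xget O [set F | amb r F].

Lemma dIP r : (r %| ram)%N -> amb r (dI r).
Proof. by move=> h; rewrite /dI; case: xgetP => [F -> //|no]; have [F aF] := amb_ex h; case: (no F). Qed.

Lemma amb_scaled r k F : (0 < r)%N -> (0 < k)%N -> fid (r * k ^ 2)%N%:R F -> conjI F = F ->
  amb r (scl (ratr (k%:R)^-1) F).
Proof.
move=> r0 k0 fF cF; have ki : 0 < (k%:R)^-1 :> rat by rewrite invr_gt0 ltr0n.
split; last exact: amb_scl.
have := fid_sclr ki fF; rewrite (_ : _ * _ = r%:R) // natrM natrX; field.
by rewrite pnatr_eq0 -lt0n.
Qed.

(** A rational factor reduces the norm to its square-free part r. If the chosen prime divides r,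
    multiplying by the generator of norm [gen_ram] makes its exponent even, so it drops out of the
    new square-free part. *)
Lemma amb_class f F : fid f F -> conjI F = F ->
  exists r x, [/\ r \in half_ram, E x, x != 0 & F = scl x (dI r)].
Proof.
move=> fF cF; have f0 : 0 < f by case: fF.
have [r [q [r0 q0 sr Ef]]] := rat_sqfree_part f0.
have qi : 0 < q^-1 by rewrite invr_gt0.
pose F1 := scl (ratr q^-1) F.
have a1 : amb r F1.
  split; last exact: amb_scl.
  by have := fid_sclr qi fF; rewrite (_ : _ * _ = r%:R) // Ef; field; rewrite gt_eqF.
have FE : F = scl (ratr q) F1 by rewrite /F1 sclM -rmorphM divff ?gt_eqF // rmorph1 scl1.
have rR := amb_ram r0 sr a1.
have qn0 := ratr_neq0 q0.
have [p0r|np0r] := boolP (p0 %| r)%N; last first.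
  exists r, (ratr q); split=> //; [exact/half_ramP|exact: E_rat|].
  by rewrite FE (amb_uniq r0 a1 (dIP rR)).
have [x [Ex x0 Nx cx]] := gen_ram_elt dd.
have g0 : (0 < gen_ram)%N := ltnW (gen_ram_gt1 dd).
have f2 : fid (gen_ram * r)%N%:R (scl x F1).
  by rewrite natrM; apply: fid_scl => //; [rewrite ltr0n|case: a1].
have c2 : conjI (scl x F1) = scl x F1.
  have [[oF _ _] cF1] := a1.
  by rewrite -(prod_scl_O _ oF) conj_prodI cx cF1.
have [|r' [k [r'0 k0 sr' Ek]]] := @sqfree_part (gen_ram * r)%N; first by rewrite muln_gt0 g0.
rewrite Ek in f2; have a2 := amb_scaled r'0 k0 f2 c2.
have rR' := amb_ram r'0 sr' a2.
have np : ~~ (p0 %| r')%N.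
  have := congr1 (logn p0) Ek; rewrite (lognM _ g0 r0) (lognM _ r'0) ?expn_gt0 ?k0 // lognX.
  have l1 : logn p0 r = 1%N.
    apply/eqP; rewrite eqn_leq sqfree_logn ?p0_prime //= logn_gt0 mem_primes p0_prime r0 //.
  have l3 := sqfree_logn r'0 sr' p0_prime.
  rewrite l1 logn_gen_ram => h; apply/negP => h2.
  have : (0 < logn p0 r')%N by rewrite logn_gt0 mem_primes p0_prime r'0.
  by clear -h l3; lia.
have kn : ratr (k%:R)^-1 != 0 :> algC by apply: ratr_neq0; rewrite invr_gt0 ltr0n.
have zn : ratr (k%:R)^-1 * x != 0 by exact: mulf_neq0.
have Ez : E (ratr (k%:R)^-1 * x) by apply: E_mul => //; exact: E_rat.
exists r', (ratr q * (ratr (k%:R)^-1 * x)^-1); split.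
- exact/half_ramP.
- by apply: E_mul; [exact: E_rat|exact: E_inv].
- by rewrite mulf_neq0 // invr_eq0.
- by rewrite FE -(amb_uniq r'0 a2 (dIP rR')) (sclM (ratr (k%:R)^-1)) sclM divfK.
Qed.

(** Here x / conj(x) is a unit, so N(x) is a square or [gen_ram] times a square. The first gives
    equal square-free norms; the second fails by parity at the chosen prime. *)
Lemma amb_equiv r r' x : r \in half_ram -> r' \in half_ram -> E x -> x != 0 ->
  dI r' = scl x (dI r) -> r = r'.
Proof.
move=> /half_ramP[rR np] /half_ramP[rR' np'] Ex x0 Ed.
have r0 := ram_dvd_gt0 rR; have r'0 := ram_dvd_gt0 rR'.
have [fr cr] := dIP rR; have [fr' cr'] := dIP rR'.
have xc0 : x^* != 0 by rewrite fmorph_eq0.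
have Ou : O (x / x^*).
  apply: (fid_stab fr); have := cr'; rewrite Ed conj_scl cr => h.
  by apply: (scl_inj xc0); rewrite sclM mulrC divfK.
have [n n0 En] := E_norm_gt0 Ex x0.
have := fid_scl Ex n0 En fr; rewrite -Ed => /(fid_uniq fr') En'.
have [q q0 Nq] := norm_unit_ratio Ex x0 Ou.
have sq_nat (z : rat) (a : nat) : a%:R = z ^+ 2 -> exists k : nat, a = (k ^ 2)%N.
  move=> h; have [|j Ej] := @rat_sqrt_int z a%:Z; first by rewrite -h.
  exists `|j|%N; apply/eqP; rewrite -(eqr_nat rat) h Ej natrX; apply/eqP.
  rewrite -[(absz j)%:R]/((absz j)%:Z%:~R).
  by have [->|->] : (absz j)%:Z = j \/ (absz j)%:Z = - j by [clear; lia|]; [|ring].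
case: Nq => Nq.
  have {}Nq : n = q ^+ 2 by apply: ratr_inj; rewrite -En.
  have [|k Ek] := sq_nat (q * r%:R) (r' * r)%N.
    by rewrite natrM En' Nq exprMn; ring.
  exact/esym/(sqfree_square r'0 r0 (ram_dvd_sqfree rR') (ram_dvd_sqfree rR) Ek).
have {}Nq : n = gen_ram%:R * q ^+ 2 by apply: ratr_inj; rewrite -En.
exfalso; have [|k Ek] := sq_nat (gen_ram%:R * q * r%:R) (gen_ram * (r' * r))%N.
  by rewrite !natrM En' Nq; ring.
have g0 : (0 < gen_ram)%N := ltnW (gen_ram_gt1 dd).
have := congr1 (logn p0) Ek; rewrite (lognM _ g0) ?muln_gt0 ?r0 ?r'0 // (lognM _ r'0 r0) lognX logn_gen_ram.
have -> : logn p0 r = 0%N by apply/eqP; rewrite -leqn0 leqNgt logn_gt0 mem_primes (negPf np) !andbF.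
have -> : logn p0 r' = 0%N by apply/eqP; rewrite -leqn0 leqNgt logn_gt0 mem_primes (negPf np') !andbF.
by clear; lia.
Qed.

Lemma ideal_equivP I J : ideal_equiv E I J <-> exists x, [/\ E x, x != 0 & I = scl x J].
Proof.
split=> [[a [b [[Oa a0] [Ob b0] Eab]]]|[x [Ex x0 ->]]].
  exists (a^-1 * b); split.
  - by apply: E_mul; [apply: E_inv; case: Oa|case: Ob].
  - by rewrite mulf_neq0 // invr_eq0.
  - have {}Eab : scl a I = scl b J := Eab.
    by rewrite -sclM -Eab sclM mulVf // scl1.
have [k k0 Ok] := E_denom Ex.
exists k%:~R, (k%:~R * x); split.
- by split; [exact: O_int|rewrite intr_eq0].
- by split; [|rewrite mulf_neq0 // intr_eq0].
- by rewrite -[LHS]/(scl k%:~R (scl x J)) sclM.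
Qed.

Section Count.
Variables (c : rat) (J0 : set algC).
Hypothesis f0 : fid c J0.
Let c0 : 0 < c. Proof. by case: f0. Qed.

(** Hilbert 90 for ideals: a = J conj(J0) + (c) satisfies J conj(a) = J0 a, both sides being c J0 +
    c J. *)
Definition alphaI (J : set algC) := sumI (prodI J (conjI J0)) (scl (ratr c) O).

Lemma alphaI_fid J : fid c J -> exists n, fid n (alphaI J).
Proof.
move=> fJ; have fP := fid_mul fJ (fid_conj f0).
have [zP PE mP] := fid_omod fP.
have [zS SE mS] : omod (scl (ratr c) O) by apply: omod_scl; [exact: E_rat|exact: omodO].
have oA : omod (alphaI J).
  split; first exact: sumI_zmod.
    by move=> _ [a [b [Pa Sb ->]]]; apply: E_add; [exact: PE|exact: SE].
  move=> x _ Ox [a [b [Pa Sb ->]]]; exists (x * a), (x * b).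
  by split; [exact: mP|exact: mS|rewrite mulrDr].
have [z [r [Ez z0 r0 Er zO]]] := fid_integral fP.
have [k k0 Ok] := E_denom (E_mul Ez (E_rat dd c)).
have kn : (k%:~R : algC) != 0 by rewrite intr_eq0.
apply: (omod_fid_scl (z := k%:~R * z)) => //.
- exists (ratr c); last exact: ratr_neq0.
  exists 0, (ratr c); split; [by case: zP| |by rewrite add0r].
  by exists 1; rewrite ?mulr1 //; exact: O1.
- by apply: E_mul => //; exact: E_int.
- by rewrite mulf_neq0.
move=> _ [_ [a [b [Pa [y Oy <-] ->]]] <-]; rewrite mulrDr.
apply: (zmodD (zmodO dd)).
  by rewrite -mulrA; apply: (zmodZ _ (zmodO dd)); apply: zO; exists a.
have -> : k%:~R * z * (ratr c * y) = (k%:~R * (z * ratr c)) * y by ring.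
exact: O_mul.
Qed.

Lemma alphaI_eq J : fid c J -> prodI J (conjI (alphaI J)) = prodI J0 (alphaI J).
Proof.
move=> fJ; have [oJ _ EJ] := fJ; have [o0 _ E0] := f0.
have [zJ _ _] := oJ; have [z0 _ _] := o0.
have zS := scl_zmod (ratr c) (zmodO dd).
rewrite /alphaI conj_sumI conj_scl conj_ratr conjO conj_prodI conjIK.
rewrite !prod_sumI //; try exact: prodI_zmod.
rewrite prodIA EJ prod_scl_O // [prodI J (scl _ _)]prodIC prod_scl_O //.
rewrite [prodI J (conjI J0)]prodIC prodIA E0 prod_scl_O // [prodI J0 (scl _ _)]prodIC prod_scl_O //.
exact: sumIC.
Qed.

Definition itg (I : set algC) : set algC :=
  scl (xget 1 [set z | [/\ E z, z != 0 & scl z I `<=` O]]) I.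

Lemma itgP n I : fid n I -> integral_ideal E (itg I) /\ exists z, [/\ E z, z != 0 & itg I = scl z I].
Proof.
move=> fI; rewrite /itg; set P := [set z | _]; set z := xget 1 P.
have [Ez z0 zO] : P z.
  have [y [r [Ey y0 _ _ yO]]] := fid_integral fI.
  by rewrite /z; case: xgetP => [y' -> //|no]; case: (no y).
split; last by exists z.
have [zs _ ms] := omod_scl Ez (fid_omod fI).
split=> //; last by move=> x y; exact: (zmodD zs).
by have [x Ix x0] := fid_nz fI; exists (z * x); [exists x|rewrite mulf_neq0].
Qed.

(** The ideals [T J r] represent every class exactly once: the relation J conj(T) = J0 T recovers J
    from the class up to norm 1 elements, and the remaining freedom is that of ambiguous ideals. *)
Theorem class_count Js : reps (fid c) (eqv1 dd) Js ->
  field_class_number E = (size Js * 2 ^ (nu ram).-1)%N.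
Proof.
move=> [[uJ JP Jeq] Jcov].
pose T J r := prodI (alphaI J) (dI r).
have fT J r : J \in Js -> r \in half_ram -> exists n, fid n (T J r).
  move=> /JP fJ /half_ramP[rR _]; have [n fn] := alphaI_fid fJ; have [fr _] := dIP rR.
  by exists (n * r%:R); exact: fid_mul.
have Teq J r : J \in Js -> r \in half_ram -> prodI J (conjI (T J r)) = prodI J0 (T J r).
  move=> /JP fJ /half_ramP[rR _]; have [_ cr] := dIP rR.
  by rewrite /T conj_prodI cr !prodIA alphaI_eq.
have key J r J' r' x : J \in Js -> r \in half_ram -> J' \in Js -> r' \in half_ram -> E x -> x != 0 ->
    T J r = scl x (T J' r') -> J = J' /\ r = r'.
  move=> JJ rr JJ' rr' Ex x0 ET.
  have xc0 : x^* != 0 by rewrite fmorph_eq0.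
  have [n' fn'] := fT J' r' JJ' rr'.
  have EJ : J = J'.
    apply/esym/Jeq => //; exists (x / x^*).
      split; first by apply: E_mul => //; apply/E_inv/E_conj.
      by rewrite (conjM x) fmorphV /= conjCK; field; rewrite x0 xc0.
    have h : prodI (conjI (T J' r')) (scl x^* J) = prodI (conjI (T J' r')) (scl x J').
      have := Teq J r JJ rr; rewrite ET conj_scl -scl_prodIr => h.
      rewrite -[LHS]scl_prodIr [prodI _ J]prodIC h -scl_prodIr -(Teq J' r' JJ' rr').
      by rewrite -[RHS]scl_prodIr [prodI J' _]prodIC.
    have oJ := fid_omod (JP _ JJ); have oJ' := fid_omod (JP _ JJ').
    have {}h := fid_cancel (fid_conj fn') (omod_scl (E_conj Ex) oJ) (omod_scl Ex oJ') h.
    by apply: (scl_inj xc0); rewrite h sclM mulrC divfK.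
  split=> //; have [n fn] := alphaI_fid (JP _ JJ).
  move/half_ramP: (rr) => [rR _]; move/half_ramP: (rr') => [rR' _].
  have [fr _] := dIP rR; have [fr' _] := dIP rR'.
  apply: esym; apply: (@amb_equiv r' r x) => //.
  apply: (fid_cancel fn); [exact: fid_omod fr|exact: omod_scl Ex (fid_omod fr')|].
  by rewrite -scl_prodIr {2}EJ -/(T J' r') -ET.
pose L := [seq itg (T J r) | J <- Js, r <- half_ram].
have refl I : ideal_equiv E I I.
  by apply/ideal_equivP; exists 1; rewrite oner_neq0 scl1; split=> //; exact: (E_int dd 1).
have sym I J : ideal_equiv E I J -> ideal_equiv E J I.
  move=> /ideal_equivP[x [Ex x0 ->]]; apply/ideal_equivP; exists x^-1.
  by rewrite sclM mulVf // scl1 invr_eq0; split=> //; exact: E_inv.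
have trans I J H : ideal_equiv E I J -> ideal_equiv E J H -> ideal_equiv E I H.
  move=> /ideal_equivP[x [Ex x0 ->]] /ideal_equivP[y [Ey y0 ->]]; apply/ideal_equivP; exists (x * y).
  by rewrite sclM mulf_neq0 //; split=> //; exact: E_mul.
have key' J r J' r' : J \in Js -> r \in half_ram -> J' \in Js -> r' \in half_ram ->
    ideal_equiv E (itg (T J r)) (itg (T J' r')) -> J = J' /\ r = r'.
  move=> JJ rr JJ' rr' /ideal_equivP[x [Ex x0 Ei]].
  have [n fn] := fT J r JJ rr; have [n' fn'] := fT J' r' JJ' rr'.
  have [_ [z [Ez z0 Iz]]] := itgP fn; have [_ [z' [Ez' z0' Iz']]] := itgP fn'.
  apply: (key J r J' r' (z^-1 * (x * z'))) => //.
  - by apply: E_mul; [exact: E_inv|exact: E_mul].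
  - by rewrite !mulf_neq0 // invr_eq0.
  - by rewrite -sclM -(sclM x) -Iz' -Ei Iz sclM mulVf // scl1.
have rL : reps (integral_ideal E) (ideal_equiv E) L.
  split; first split.
  - apply: allpairs_uniq => //; first exact: divisors_uniq.
    move=> [J r] [J' r'] /allpairsP[[a b] /= [aJ br [-> ->]]] /allpairsP[[a' b'] /= [aJ' br' [-> ->]]] /= h.
    by have [|-> ->] := key' a b a' b' aJ br aJ' br'; first by rewrite h.
  - move=> _ /allpairsP[[J r] /= [JJ rr ->]]; have [n fn] := fT J r JJ rr.
    by have [] := itgP fn.
  - move=> _ _ /allpairsP[[J r] /= [JJ rr ->]] /allpairsP[[J' r'] /= [JJ' rr' ->]] h.
    by have [-> ->] := key' J r J' r' JJ rr JJ' rr' h.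
  move=> A [AO [x Ax x0] AD AM].
  have zA : zmod A.
    split; first by rewrite -(mul0r x); apply: AM => //; exact: (O_int dd 0).
    move=> a b Aa Ab; apply: AD => //; rewrite -mulN1r; apply: AM => //; exact: (O_int dd (-1)).
  have oA : omod A by split=> //; move=> a /AO[].
  have [|N fA] := omod_fid oA AO; first by exists x.
  have N0 : 0 < N by case: fA.
  have Ni : 0 < N^-1 by rewrite invr_gt0.
  (* This is J0 A / conj(A), as conj(A) is N times the inverse of [A]. *)
  pose J := scl (ratr N^-1) (prodI J0 (prodI A A)).
  have fJ : fid c J.
    have := fid_sclr Ni (fid_mul f0 (fid_mul fA fA)).
    have -> : N^-1 ^+ 2 * (c * (N * N)) = c by field; rewrite gt_eqF.
    by [].
  have o0 := fid_omod f0.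
  have eq1 : prodI J (conjI A) = prodI J0 A.
    rewrite /J -scl_prodI -!prodIA; have [_ _ ->] := fA.
    rewrite -scl_prodIr prodr_O // -scl_prodIr sclM -rmorphM mulVf ?gt_eqF //.
    by rewrite rmorph1 scl1.
  have [J1 JJ1 [u Eu EJ1]] := Jcov J fJ.
  have [n1 fn1] := alphaI_fid (JP _ JJ1); set a1 := alphaI J1 in fn1.
  have eq2 : scl u (prodI J (conjI a1)) = prodI J0 a1.
    by rewrite scl_prodI -EJ1 alphaI_eq //; exact: JP.
  (* The quotient of [A] by [a1] equals its conjugate up to [u]; multiplied by y it becomes
     ambiguous. *)
  have [y [Ey y0 uy]] := hilbert90 Eu.
  pose F := scl y (prodI A (conjI a1)).
  have E1u : E u by case: Eu.
  have fAa := fid_mul fA (fid_conj fn1).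
  have oAa := fid_omod fAa.
  have eqF : prodI (conjI A) a1 = scl u (prodI A (conjI a1)).
    have oa := omod_prodI (omod_conj oA) (fid_omod fn1).
    apply: (fid_cancel (fid_mul f0 fJ) oa (omod_scl E1u oAa)).
    rewrite [prodI J0 J]prodIC prodIACA eq1 -eq2 -scl_prodIr -scl_prodIr; congr (scl _ _).
    by rewrite prodIACA [prodI J0 J]prodIC.
  have cF : conjI F = F.
    by rewrite /F conj_scl conj_prodI conjIK eqF sclM mulrC uy.
  have [ny ny0 Eny] := E_norm_gt0 Ey y0.
  have fF : fid (ny * (N * n1)) F by apply: fid_scl.
  have [r [x1 [rr Ex1 x10 EF]]] := amb_class fF cF.
  exists (itg (T J1 r)); first by apply/allpairsP; exists (J1, r).
  have [n fn] := fT J1 r JJ1 rr.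
  have [_ [z [Ez z0 Iz]]] := itgP fn.
  apply/ideal_equivP; rewrite Iz.
  have n10 : 0 < n1 by case: fn1.
  have nr0 := ratr_neq0 n10.
  have EFa : prodI F a1 = scl (y * ratr n1) A.
    rewrite /F -scl_prodI -prodIA [prodI (conjI a1) a1]prodIC; have [_ _ ->] := fn1.
    by rewrite -scl_prodIr prodr_O // sclM.
  have EFa2 : prodI F a1 = scl x1 (T J1 r) by rewrite EF -scl_prodI /T prodIC.
  have yn0 : y * ratr n1 != 0 by rewrite mulf_neq0.
  have Eyn : E (y * ratr n1) by apply: E_mul => //; exact: E_rat.
  exists ((y * ratr n1)^-1 * x1 * z^-1); split.
  - by apply: E_mul; [apply: E_mul => //; exact: E_inv|exact: E_inv].
  - by rewrite !mulf_neq0 // invr_eq0.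
  - by rewrite sclM mulfVK // -sclM -EFa2 EFa sclM mulVf // scl1.
rewrite /field_class_number (ncard_eq_classes _ _ _ rL) ?size_allpairs ?size_half_ram //.
- by move=> I H _ _; exact: sym.
- by move=> I H G _ _ _; exact: trans.
Qed.

End Count.

(** The trace lies between -2 and 2, which leaves the orders 1, 2, 3, 4 and 6. *)
Lemma unit_root12 u : O u -> u * u^* = 1 -> u ^+ 12 = 1.
Proof.
move=> Ou uu; have Eu := O_E Ou.
have [t [n [Et _]]] := (O_trace_norm Eu).1 Ou.
have u2 : u ^+ 2 = t%:~R * u - 1 by rewrite -Et -uu; ring.
have t2 : -2 <= t <= 2.
  have [r1 E1' h1] := E_norm (E_add (E_int dd 1) Eu).
  have [r2 E2' h2] := E_norm (E_sub (E_int dd 1) Eu).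
  have F1 : r1 = (2 + t)%:~R.
    apply: ratr_inj; rewrite -E1' ratr_int rmorphD rmorph_int.
    transitivity (1 + (u + u^*) + u * u^*); first by ring.
    by rewrite Et uu; ring.
  have F2 : r2 = (2 - t)%:~R.
    apply: ratr_inj; rewrite -E2' ratr_int rmorphB rmorph_int.
    transitivity (1 - (u + u^*) + u * u^*); first by ring.
    by rewrite Et uu; ring.
  move: h1 h2; rewrite F1 F2 !ler0z; clear; lia.
have : t = -2 \/ t = -1 \/ t = 0 \/ t = 1 \/ t = 2 by clear -t2; lia.
have two (e : algC) : u ^+ 2 = 2 * e * u - 1 -> e * e = 1 -> u = e.
  move=> h ee; apply/eqP; rewrite -subr_eq0 -sqrf_eq0; apply/eqP.
  by transitivity (u ^+ 2 - 2 * e * u + e * e); [ring|rewrite ee h; ring].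
case=> [t_|[t_|[t_|[t_|t_]]]]; rewrite t_ in u2.
- rewrite (two (-1)); [by rewrite -signr_odd expr0|by rewrite u2; ring|by ring].
- by rewrite (_ : 12 = 3 * 4)%N // exprM (_ : u ^+ 3 = 1) ?expr1n // exprS u2; ring: u2.
- by rewrite (_ : 12 = 2 * 6)%N // exprM u2; ring.
- by rewrite (_ : 12 = 3 * 4)%N // exprM (_ : u ^+ 3 = -1); [ring|rewrite exprS u2; ring: u2].
- rewrite (two 1); [by rewrite expr1n|by rewrite u2; ring|by ring].
Qed.

Lemma root_unit u : roots_of_unity E u -> O u /\ u * u^* = 1.
Proof.
move=> [Eu [k k0 uk]]; split.
  split=> //; apply: (@Aint_unity_root k) => //; by apply/unity_rootP.
rewrite -normCK; have : `|u| ^+ k = 1 by rewrite -normrX uk normr1.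
by move/eqP; rewrite (pexpr_eq1 k0 (normr_ge0 u)) => /eqP ->; rewrite expr1n.
Qed.

Lemma rootsP u : roots_of_unity E u <-> O u /\ u * u^* = 1.
Proof.
split; first exact: root_unit.
by move=> [Ou uu]; split; [exact: O_E|exists 12%N => //; exact: unit_root12].
Qed.

Lemma finite_roots : finite_set (roots_of_unity E).
Proof.
have [r Er] := closed_field_poly_normal ('X^12 - 1 : {poly algC}).
apply: (sub_finite_set _ (finite_seq r)) => u /rootsP[Ou uu].
have mon : ('X^12 - 1 : {poly algC}) \is monic by rewrite -[1]/(1%:P) monicXnsubC.
have : root ('X^12 - 1 : {poly algC}) u by rewrite /root !hornerE unit_root12 // subrr.
by rewrite Er (monicP mon) scale1r root_prod_XsubC.
Qed.

End ClassCount.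

(** * Counting vectors by ideal classes *)

Definition cv3 (x y z : algC) : 'cV[algC]_3 := \col_i [:: x; y; z]`_i.

Lemma mul_cv3 (a b c d e f g h i x y z : algC) :
  mx3 a b c d e f g h i *m cv3 x y z =
  cv3 (a * x + b * y + c * z) (d * x + e * y + f * z) (g * x + h * y + i * z).
Proof. by apply/colP; apply: I3P; rewrite !mxE sum3E !mxE. Qed.

Lemma cv3_inj x y z x' y' z' : cv3 x y z = cv3 x' y' z' -> [/\ x = x', y = y' & z = z'].
Proof.
move=> /colP E; split; [have := E o0|have := E o1|have := E o2]; by rewrite !mxE.
Qed.

Lemma ext_mx3 (R : comNzRingType) (a b c d e f g h i : int) :
  ext R (mx3 a b c d e f g h i) =
  mx3 a%:~R b%:~R c%:~R d%:~R e%:~R f%:~R g%:~R h%:~R i%:~R.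
Proof. by apply/matrixP; do 2 (apply: I3P); rewrite !mxE. Qed.

Lemma ncard_fiber (T U : choiceType) (A : set (T * U)) (s : seq T) : uniq s ->
  (forall p, A p -> p.1 \in s) -> (forall x, x \in s -> finite_set [set z | A (x, z)]) ->
  finite_set A /\ ncard A = (\sum_(x <- s) ncard [set z | A (x, z)])%N.
Proof.
move=> us As fin.
have /choice[l lP] : forall x, exists l : seq U, x \in s -> uniq l /\ forall z, A (x, z) <-> z \in l.
  move=> x; have [xs|nx] := boolP (x \in s); last by exists [::].
  by have [l ul lP] := finite_enum (fin x xs); exists l.
pose L := flatten [seq [seq (x, z) | z <- l x] | x <- s].
have LP p : A p <-> p \in L.
  split=> [Ap|/flattenP[_ /mapP[x xs ->] /mapP[z zl ->]]]; last by have [_ h] := lP x xs; apply/h.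
  case: p Ap => x z Ap; have xs := As _ Ap; have [_ h] := lP x xs.
  apply/flattenP; exists [seq (x, z') | z' <- l x]; first exact: map_f.
  by apply: map_f; apply/h.
have uL : uniq L.
  rewrite /L; elim: s us lP {As fin LP L} => //= x s IH /andP[xs us] lP.
  rewrite cat_uniq; apply/and3P; split.
  - rewrite map_inj_uniq; last by move=> z z' [].
    by have [] := lP x (mem_head _ _).
  - apply/hasPn => p /flattenP[_ /mapP[x' xs' ->] /mapP[z _ ->]].
    by apply/negP => /mapP[z' _ [E _]]; rewrite -E xs' in xs.
  - by apply: IH => // x' xs'; apply: lP; rewrite inE xs' orbT.
split; first by apply: (sub_finite_set _ (finite_seq L)) => p /LP.
rewrite (ncard_seq uL LP) /L size_flatten /shape -map_comp sumnE big_map big_seq [RHS]big_seq.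
apply: eq_bigr => x xs /=; rewrite size_map; have [ul h] := lP x xs.
by rewrite (ncard_seq ul h).
Qed.

Lemma ncard0 (T : choiceType) (A : set T) : (forall x, ~ A x) -> ncard A = 0%N.
Proof. by move=> h; apply: (@ncard_seq _ _ [::]) => // x; split=> // /h. Qed.

(** Witt's theorem in the definite case: the reflection along x - y exchanges two vectors of equal
    norm. *)
Lemma positive_reflection (G : 'M[rat]_3) (x y : 'rV[rat]_3) : G^T = G ->
  (forall z : 'rV[rat]_3, z != 0 -> 0 < qform G z) -> qform G x = qform G y ->
  exists Q : 'M[rat]_3, Q *m G *m Q^T = G /\ x *m Q = y.
Proof.
move=> sG pG Exy; have [->|xy] := eqVneq x y.
  by exists 1%:M; rewrite mul1mx trmx1 !mulmx1.
pose u := x - y; have u0 : u != 0 by rewrite subr_eq0.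
pose t := G *m u^T; pose d := qform G u; have d0 : 0 < d := pG u u0.
have tT : t^T = u *m G by rewrite /t trmx_mul trmxK sG.
have ut : u *m t = d%:M.
  by rewrite [LHS]mx11_scalar /d /qform /bform /t mulmxA.
pose Q := 1%:M - (2 / d) *: (t *m u); exists Q.
have QT : Q^T = 1%:M - (2 / d) *: (u^T *m t^T) by rewrite /Q linearB linearZ /= trmx1 trmx_mul.
have QG : Q *m G = G - (2 / d) *: (t *m t^T).
  by rewrite /Q mulmxBl mul1mx -scalemxAl -mulmxA -tT.
have tQ : t^T *m Q^T = - t^T.
  rewrite QT mulmxBr mulmx1 -scalemxAr mulmxA tT.
  have -> : u *m G *m u^T = d%:M by rewrite -mulmxA.
  rewrite mul_scalar_mx scalerA (_ : 2 / d * d = 2) ?divfK ?gt_eqF // scaler_nat mulr2n.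
  by rewrite opprD addrA subrr add0r.
have GQ : G *m Q^T = G - (2 / d) *: (t *m t^T).
  by rewrite -[LHS]trmxK trmx_mul trmxK sG QG linearB linearZ /= sG trmx_mul trmxK.
split.
  have ttQ : t *m t^T *m Q^T = - (t *m t^T) by rewrite -(mulmxA t) tQ mulmxN.
  by rewrite QG mulmxBl GQ -scalemxAl ttQ scalerN opprK subrK.
rewrite /Q mulmxBr mulmx1 -scalemxAr mulmxA.
have -> : x *m t = (d / 2)%:M.
  rewrite [LHS]mx11_scalar; congr (_%:M); rewrite /t mulmxA -/(bform G x u).
  have b_lin : bform G x u = qform G x - bform G x y.
    by rewrite /u /bform /qform /bform linearB /= mulmxBr !mxE.
  have E : d = qform G x + qform G y - 2 * bform G x y.
    rewrite /d /u qformD //.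
    have -> : bform G x (- y) = - bform G x y by rewrite /bform linearN mulmxN mxE.
    have -> : qform G (- y) = qform G y by rewrite /qform /bform linearN mulmxN !mulNmx opprK.
    by ring.
  by rewrite b_lin E -Exy; field.
rewrite mul_scalar_mx scalerA (_ : 2 / d * (d / 2) = 1); last by field; rewrite gt_eqF.
by rewrite scale1r /u opprB addrCA subrr addr0.
Qed.

Definition unim (i j k l : int) := i * l - j * k = 1 \/ i * l - j * k = -1.
(** [fA] and [fB] are the coefficients of the form (A, B, C) after the change of basis with rows (i,
    j) and (k, l). *)
Definition fA (A B C i j : int) : int := A * i ^+ 2 + B * i * j + C * j ^+ 2.
Definition fB (A B C i j k l : int) : int := 2 * A * i * k + B * (i * l + j * k) + 2 * C * j * l.

Lemma unim_sq i j k l : unim i j k l -> (i * l - j * k) * (i * l - j * k) = 1.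
Proof. by case=> ->. Qed.

Section Bases.
Variable dd : sqf.
Local Notation D := (sqf_val dd).
Local Notation E := (quad_field (- D)).
Local Notation O := (integers E).
Local Notation fid := (fid dd).
Local Notation bas := (bas dd).
Local Notation qd := (qd dd).
Local Notation E1 := (E1 dd).
Local Notation eqv1 := (eqv1 dd).

Lemma bas_change c I y w A B C i j k l : bas c I y w A B C -> unim i j k l ->
  bas c I (i%:~R * y + j%:~R * w) (k%:~R * y + l%:~R * w)
    (fA A B C i j) (fB A B C i j k l) (fA A B C k l).
Proof.
move=> [Ey Ew [Ny Nw T] dABC EI] u; have u2 := unim_sq u.
have EL (i' j' : int) : E (i'%:~R * y + j'%:~R * w).
  by apply: E_add; apply: E_mul => //; exact: E_int.
have cj (i' j' : int) : (i'%:~R * y + j'%:~R * w)^* = i'%:~R * y^* + j'%:~R * w^*.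
  by rewrite rmorphD !rmorphM /= !rmorph_int.
split=> //.
- rewrite !cj /fA /fB; split.
  + transitivity (i%:~R ^+ 2 * (y * y^*) + i%:~R * j%:~R * (y * w^* + y^* * w) + j%:~R ^+ 2 * (w * w^*)); first by ring.
    by rewrite Ny Nw T; ring.
  + transitivity (k%:~R ^+ 2 * (y * y^*) + k%:~R * l%:~R * (y * w^* + y^* * w) + l%:~R ^+ 2 * (w * w^*)); first by ring.
    by rewrite Ny Nw T; ring.
  + transitivity (2 * i%:~R * k%:~R * (y * y^*) + (i%:~R * l%:~R + j%:~R * k%:~R) * (y * w^* + y^* * w) + 2 * j%:~R * l%:~R * (w * w^*)); first by ring.
    by rewrite Ny Nw T; ring.
- rewrite -dABC /fA /fB; transitivity (((i * l - j * k) * (i * l - j * k)) * (B ^+ 2 - 4 * A * C)); first by ring.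
  by rewrite u2 mul1r.
rewrite EI; apply/seteqP; split=> z [p [q ->]].
  have [e [ee E0]] : exists e : int, e * e = 1 /\ i * l - j * k = e.
    by exists (i * l - j * k).
  exists (e * (p * l - q * k)), (e * (q * i - p * j)).
  transitivity ((e * (i * l - j * k))%:~R * (p%:~R * y + q%:~R * w)); last by ring.
  by rewrite E0 ee mul1r.
by exists (p * i + q * k), (p * j + q * l); ring.
Qed.

Lemma bas_form c I y w A B C y' w' A' B' C' : 0 < c -> bas c I y w A B C -> bas c I y' w' A' B' C' ->
  y = y' -> w = w' -> [/\ A = A', B = B' & C = C'].
Proof.
move=> c0 [_ _ [Ny Nw T] _ _] [_ _ [Ny' Nw' T'] _ _] Ey Ew; subst y' w'.
have rc := ratr_neq0 c0.
have inj (a b : int) : ratr c * a%:~R = ratr c * b%:~R :> algC -> a = b.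
  by move/(mulfI rc)/eqP; rewrite eqr_int => /eqP.
by split; apply: inj; [rewrite -Ny Ny'|rewrite -T T'|rewrite -Nw Nw'].
Qed.

Lemma bas_two c I y w A B C y' w' A' B' C' : 0 < c -> bas c I y w A B C -> bas c I y' w' A' B' C' ->
  exists i j k l, [/\ unim i j k l, y' = i%:~R * y + j%:~R * w, w' = k%:~R * y + l%:~R * w
   & [/\ A' = fA A B C i j, B' = fB A B C i j k l & C' = fA A B C k l]].
Proof.
move=> c0 b b'; have [_ _ _ _ EI] := b; have [_ _ _ _ EI'] := b'.
have := bas_y b'; rewrite EI => -[i [j Ey]].
have := bas_w b'; rewrite EI => -[k [l Ew]].
have := bas_y b; rewrite EI' => -[i' [j' Ey']].
have := bas_w b; rewrite EI' => -[k' [l' Ew']].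
have h1 : (i' * i + j' * k - 1)%:~R * y + (i' * j + j' * l)%:~R * w = 0.
  transitivity (i'%:~R * (i%:~R * y + j%:~R * w) + j'%:~R * (k%:~R * y + l%:~R * w) - y); first by ring.
  by rewrite -Ey -Ew -Ey' subrr.
have h2 : (k' * i + l' * k)%:~R * y + (k' * j + l' * l - 1)%:~R * w = 0.
  transitivity (k'%:~R * (i%:~R * y + j%:~R * w) + l'%:~R * (k%:~R * y + l%:~R * w) - w); first by ring.
  by rewrite -Ey -Ew -Ew' subrr.
have [e1 e2] := bas_uniq c0 b h1; have [e3 e4] := bas_uniq c0 b h2.
have u : unim i j k l.
  have dd1 : (i' * l' - j' * k') * (i * l - j * k) = 1.
    transitivity ((i' * i + j' * k) * (k' * j + l' * l) - (i' * j + j' * l) * (k' * i + l' * k)); first by ring.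
    have -> : i' * i + j' * k = 1 by apply/eqP; rewrite -subr_eq0 e1.
    have -> : k' * j + l' * l = 1 by apply/eqP; rewrite -subr_eq0 e4.
    by rewrite e2 e3.
  have : i * l - j * k \is a GRing.unit by apply/unitrP; exists (i' * l' - j' * k'); rewrite dd1 mulrC dd1.
  move=> /intr_unit; rewrite /unim; move: (i * l - j * k) => e /eqP.
  by rewrite sqrf_eq1 => /orP[]/eqP ->; [left|right].
exists i, j, k, l; split=> //.
have b2 := bas_change b u; rewrite -Ey -Ew in b2.
exact: (bas_form c0 b' b2 erefl erefl).
Qed.

(** Sum and product of y conj(w) and its conjugate are fixed by the form, so y' conj(w') is one of
    the two: the choice between a rotation and a reflection of the plane. *)
Lemma pair_orbit c I I' y w y' w' A B C : 0 < c -> bas c I y w A B C -> bas c I' y' w' A B C ->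
  (exists2 u, E1 u & y' = u * y /\ w' = u * w) \/ (exists2 u, E1 u & y' = u * y^* /\ w' = u * w^*).
Proof.
move=> c0 b b'; have [Ey Ew [Ny Nw T] _ _] := b; have [Ey' Ew' [Ny' Nw' T'] _ _] := b'.
have nz I1 y1 w1 : bas c I1 y1 w1 A B C -> y1 != 0.
  move=> b1; apply/eqP => y0.
  by have [] : (1 : int) = 0 /\ (0 : int) = 0 by apply: (bas_uniq c0 b1); rewrite y0; ring.
have y0 := nz _ _ _ b; have y'0 := nz _ _ _ b'.
have yc0 : y^* != 0 by rewrite fmorph_eq0.
have y'c0 : y'^* != 0 by rewrite fmorph_eq0.
have NN : y * y^* = y' * y'^* by rewrite Ny Ny'.
have TT : y * w^* + y^* * w = y' * w'^* + y'^* * w' by rewrite T T'.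
have WW : w * w^* = w' * w'^* by rewrite Nw Nw'.
have : (y' * w'^* - y * w^*) * (y' * w'^* - y^* * w) = 0.
  transitivity ((y' * w'^*) ^+ 2 - (y * w^* + y^* * w) * (y' * w'^*) + (y * y^*) * (w * w^*)); first by ring.
  by rewrite TT NN WW; ring.
move/eqP; rewrite mulf_eq0 !subr_eq0 => /orP[]/eqP h; [left|right].
  have h2 : y'^* * w' = y^* * w.
    by have := congr1 (@Num.conj algC) h; rewrite !conjM !conjCK.
  exists (y' / y).
    split; first by apply: E_mul => //; exact: E_inv.
    by rewrite (conjM y') fmorphV /=; transitivity ((y' * y'^*) / (y * y^*)); [field; rewrite y0 yc0|rewrite NN divff // -NN mulf_neq0].
  split; first by rewrite divfK.
  apply: (mulfI y'c0); rewrite h2; transitivity ((y' * y'^*) * w / y); last by field.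
  by rewrite -NN; field.
have h2 : y'^* * w' = y * w^*.
  by have := congr1 (@Num.conj algC) h; rewrite !conjM !conjCK.
exists (y' / y^*).
  split; first by apply: E_mul => //; apply/E_inv/E_conj.
  by rewrite (conjM y') fmorphV /= conjCK; transitivity ((y' * y'^*) / (y * y^*)); [field; rewrite y0 yc0|rewrite NN divff // -NN mulf_neq0].
split; first by rewrite divfK.
apply: (mulfI y'c0); rewrite h2; transitivity ((y' * y'^*) * w^* / y^*); last by field.
by rewrite -NN; field.
Qed.

Lemma bas_conj c I y w A B C : bas c I y w A B C -> bas c (conjI I) y^* w^* A B C.
Proof.
move=> [Ey Ew [Ny Nw T] dABC EI]; split; try exact: E_conj; rewrite ?conjCK //.
  by split; rewrite 1?mulrC //; rewrite -T addrC [y^* * w]mulrC; congr (_ + _); rewrite mulrC.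
rewrite EI; apply/seteqP; split=> z.
  move=> [i [j Ez]]; exists i, j; by rewrite -[z]conjCK Ez rmorphD !rmorphM /= !rmorph_int.
by move=> [i [j ->]]; exists i, j; rewrite rmorphD !rmorphM /= !rmorph_int !conjCK.
Qed.

(** The norm 1 elements carrying [I] to [J] form a coset of the stabilizer of [I], which consists of
    the roots of unity. *)
Lemma torsor c I J : fid c I ->
  [/\ finite_set [set u | E1 u /\ scl u I = J],
      eqv1 I J -> ncard [set u | E1 u /\ scl u I = J] = mu E
    & ~ eqv1 I J -> ncard [set u | E1 u /\ scl u I = J] = 0%N].
Proof.
move=> fI; have fr := finite_roots dd.
have no : ~ eqv1 I J -> forall u, ~ (E1 u /\ scl u I = J).
  by move=> h u [Eu EJ]; apply: h; exists u.
have [[u0 Eu0 EJ]|h] := pselect (eqv1 I J); last first.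
  split; [|by []|by move=> _; exact/ncard0/no].
  by apply: sub_finite_set (finite_set0 algC) => u /(no h).
have [s us sP] := finite_enum fr.
have u00 := E1_neq0 Eu0.
have LP u : (E1 u /\ scl u I = J) <-> u \in [seq e * u0 | e <- s].
  split=> [[Eu EuJ]|/mapP[e /sP/rootsP[Oe ee] ->]].
    apply/mapP; exists (u / u0); last by rewrite divfK.
    apply/sP/rootsP; split.
      apply: (fid_stab fI); rewrite mulrC -sclM EuJ EJ sclM mulVf // scl1 //.
    rewrite (conjM u) fmorphV /=; have [_ h1] := Eu; have [_ h2] := Eu0.
    transitivity ((u * u^*) / (u0 * u0^*)); first by field; rewrite u00 fmorph_eq0 u00.
    by rewrite h1 h2 divr1.
  have E1e : E1 e by split; [exact: O_E|].
  split; first exact: E1_mul.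
  rewrite mulrC -sclM (_ : scl e I = I) -?EJ //.
  apply/seteqP; have [_ _ mI] := fid_omod fI; split=> [_ [x Ix <-]|x Ix]; first exact: mI.
  exists (e^* * x); last by rewrite mulrA ee mul1r.
  by apply: mI => //; exact: O_conj.
have ul : uniq [seq e * u0 | e <- s] by rewrite map_inj_uniq //; exact: mulIf.
split; first by apply: (sub_finite_set _ (finite_seq [seq e * u0 | e <- s])) => u /LP.
  by move=> _; rewrite (ncard_seq ul LP) size_map /mu (ncard_seq us sP).
by case; exists u0.
Qed.

Lemma torsor_sum c I Js : fid c I -> indep (fid c) eqv1 Js ->
  (\sum_(J <- Js) ncard [set u | E1 u /\ scl u I = J] <= mu E)%N /\
  ((exists2 J, J \in Js & eqv1 I J) -> (\sum_(J <- Js) ncard [set u | E1 u /\ scl u I = J])%N = mu E).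
Proof.
move=> fI [uJ JP Jeq].
have H : (exists2 J, J \in Js & eqv1 I J) -> (\sum_(J <- Js) ncard [set u | E1 u /\ scl u I = J])%N = mu E.
  move=> [J1 JJ1 e1]; rewrite (bigD1_seq J1) //=; have [_ -> // _] := torsor J1 fI.
  rewrite big_seq_cond big1 ?addn0 // => J /andP[JJ JJ1'].
  have [_ _ ->] := torsor J fI => //; apply: contra_neq_not JJ1' => e.
  by apply: Jeq => //; apply: eqv1_trans (eqv1_sym e) e1.
split=> //; have [h|h] := pselect (exists2 J, J \in Js & eqv1 I J); first by rewrite H.
rewrite big_seq big1 // => J JJ; have [_ _ ->] := torsor J fI => // e.
by apply: h; exists J.
Qed.

End Bases.

(* A family of pairs (H, v): in a basis starting with v, H is the Gram matrix of
   v, y, al v + w / be, where y and w span an ideal of norm ga / a with norm form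
   (A, B, C) subject to a congruence condition. *)
Section Family.
Variables (K : 'M[int]_3) (dd : sqf) (n be : nat) (al ga a : rat).
Variables (cond : int -> int -> int -> Prop) (kk : nat).
Local Notation D := (sqf_val dd).
Local Notation E := (quad_field (- D)).
Local Notation O := (integers E).
Local Notation fid := (fid dd).
Local Notation bas := (bas dd).
Local Notation qd := (qd dd).
Local Notation E1 := (E1 dd).
Local Notation eqv1 := (eqv1 dd).
Local Notation e0 := (rv3 1 0 0 : 'rV[int]_3).

Definition shape (A B C : int) : 'M[rat]_3 :=
  smx3 n%:R (ga * A%:~R) (n%:R * al ^+ 2 + ga * C%:~R / be%:R ^+ 2) 0 (n%:R * al)
    (ga * B%:~R / (2 * be%:R)).
Definition good (A B C : int) := cond A B C /\ B ^+ 2 - 4 * A * C = qd.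

Definition famX (H : 'M[int]_3) (v : 'rV[int]_3) := exists U A B C,
  [/\ U \in unitmx, v = e0 *m U, ext rat (U *m H *m U^T) = shape A B C & good A B C].

Hypotheses (sK : stable K) (n0 : (0 < n)%N) (be0 : (0 < be)%N) (ga0 : 0 < ga) (a0 : 0 < a).
Hypothesis hdiag : isometric (ext rat K) (smx3 n%:R a (a * D%:~R) 0 0 0).
Hypothesis h1 : forall A B C, good A B C -> exists H : 'M[int]_3,
  [/\ ext rat H = shape A B C, \det H = \det K & even_lattice K -> even_lattice H].
(** Ensures that the ideal depends only on (H, v) and the frame: between two adapted bases, w / be
    enters the new y with a multiple of [be], so y stays in the ideal. *)
Hypothesis h2 : forall A B C A' B' C' i j, good A B C -> good A' B' C' ->
  A'%:~R = A%:~R * i%:~R ^+ 2 + B%:~R * i%:~R * j%:~R / be%:R + C%:~R * j%:~R ^+ 2 / be%:R ^+ 2 :> rat ->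
  (exists t : int, al * j%:~R = t%:~R) -> (be%:Z %| j)%Z.
Hypothesis hal : (exists t : int, al * be%:R = t%:~R) /\
  forall l : int, (be == 1)%N \/ ~~ (2 %| l)%Z -> exists t : int, al * (1 - l%:~R) = t%:~R.
Hypothesis hbe : (be == 1)%N \/ (2 %| be)%N.
(** For a given ideal the glued lattice depends on the basis only through its second row (k : l)
    modulo [be]; [gs] holds one basis for each point of the projective line over Z / be at which the
    gluing is good. *)
Hypothesis h3 : forall A B C, (exists J y w, bas (ga / a) J y w A B C) -> exists gs : seq (int * int * int * int),
  [/\ uniq gs, size gs = kk,
   forall i j k l, (i, j, k, l) \in gs ->
     unim i j k l /\ good (fA A B C i j) (fB A B C i j k l) (fA A B C k l),
   forall i j k l i' j' k' l', (i, j, k, l) \in gs -> (i', j', k', l') \in gs ->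
     (be%:Z %| k * l' - l * k')%Z -> (i, j, k, l) = (i', j', k', l')
 & forall i j k l, unim i j k l -> good (fA A B C i j) (fB A B C i j k l) (fA A B C k l) ->
     exists i' j' k' l', (i', j', k', l') \in gs /\ (be%:Z %| k' * l - l' * k)%Z].

Let c : rat := ga / a.
Let c0 : 0 < c. Proof. exact: divr_gt0. Qed.
Let bn : be%:R != 0 :> rat. Proof. by rewrite pnatr_eq0 -lt0n. Qed.
Let bnC : be%:R != 0 :> algC. Proof. by rewrite pnatr_eq0 -lt0n. Qed.
Let nn : n%:R != 0 :> rat. Proof. by rewrite pnatr_eq0 -lt0n. Qed.
Let gn : ga != 0. Proof. exact: lt0r_neq0. Qed.

Definition T3 (y w : algC) := cv3 0 y (w / be%:R).

(** A frame: [z] gives each basis vector of [H], projected orthogonally to [v], as an element of E;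
    in an adapted basis these are 0, y and w / be, and y and w span [I]. *)
Definition fr (H : 'M[int]_3) (v : 'rV[int]_3) (z : 'cV[algC]_3) (I : set algC) :=
  exists U A B C y w,
  [/\ U \in unitmx, v = e0 *m U, ext rat (U *m H *m U^T) = shape A B C & good A B C] /\
  (bas c I y w A B C /\ ext algC U *m z = T3 y w).

Lemma T3_inj y w y' w' : T3 y w = T3 y' w' -> y = y' /\ w = w'.
Proof. by move=> /cv3_inj[_ -> h]; split=> //; apply: (mulIf (_ : be%:R^-1 != 0)) h; rewrite invr_eq0. Qed.

Lemma ext_mulc (A : 'M[int]_3) (B : 'M[int]_3) (z : 'cV[algC]_3) :
  ext algC A *m (ext algC B *m z) = ext algC (A *m B) *m z.
Proof. by rewrite mulmxA ext_mul. Qed.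

(** The products with v determine x and z, and [h2] supplies the factor [be] in the upper corner;
    what remains is a unimodular change of y and w. *)
Lemma relW (W : 'M[int]_3) A B C A' B' C' : W \in unitmx -> e0 *m W = e0 ->
  ext rat W *m shape A B C *m (ext rat W)^T = shape A' B' C' -> good A B C -> good A' B' C' ->
  exists x i j z k l, [/\ W = mx3 1 0 0 x i (be%:Z * j) z k l,
    x%:~R = - al * (be%:Z * j)%:~R :> rat, z%:~R = al * (1 - l%:~R) :> rat, unim i j (be%:Z * k) l
    & [/\ A' = fA A B C i j, B' = fB A B C i j (be%:Z * k) l & C' = fA A B C (be%:Z * k) l]].
Proof.
move=> uW e0W EW gA gA'; have [w1 [w2 [w3 [x [i [j0 [z [k [l EWm]]]]]]]]] := mx3P W.
have e0W' := e0W; rewrite EWm mul_rv3 in e0W'; have [f1 f2 f3] := rv3_inj e0W'.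
have {}f1 : w1 = 1 by rewrite -[RHS]f1; ring.
have {}f2 : w2 = 0 by rewrite -[RHS]f2; ring.
have {}f3 : w3 = 0 by rewrite -[RHS]f3; ring.
subst w1 w2 w3; clear e0W'.
rewrite EWm ext_mx3 /shape tr_mx3 !mul_mx3 in EW.
have [[_ q01 q02] [[_ q11 q12] [_ _ q22]]] := mx3_inj EW.
have Ex : x%:~R = - al * j0%:~R :> rat.
  by apply: (mulfI nn); apply/eqP; rewrite -subr_eq0 -[X in _ == X]q01; apply/eqP; ring.
have Ez : z%:~R = al * (1 - l%:~R) :> rat.
  apply: (mulfI nn); apply/eqP; rewrite -subr_eq0.
  rewrite (_ : _ - _ = n%:R * z%:~R + n%:R * al * l%:~R - n%:R * al); last by ring.
  by rewrite -[X in _ - X]q02 subr_eq0; apply/eqP; ring.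
have EA : A'%:~R = A%:~R * i%:~R ^+ 2 + B%:~R * i%:~R * j0%:~R / be%:R + C%:~R * j0%:~R ^+ 2 / be%:R ^+ 2 :> rat.
  by apply: (mulfI gn); rewrite -q11 Ex; field; rewrite ?bn.
have [|j Ej] := dvdzP (h2 gA gA' EA _).
  by exists (- x); rewrite rmorphN /= Ex; ring.
rewrite mulrC in Ej.
have jr : j0%:~R = be%:R * j%:~R :> rat by rewrite Ej rmorphM.
exists x, i, j, z, k, l; split; rewrite -?Ej //.
- have : \det W \is a GRing.unit by rewrite -unitmxE.
  rewrite EWm det_mx3 => /intr_unit; rewrite /unim.
  have -> : i * l - j * (be%:Z * k) = i * l - j0 * k by rewrite Ej; ring.
  rewrite (_ : _ + _ = i * l - j0 * k); last by ring.
  by move=> /eqP; rewrite sqrf_eq1 => /orP[]/eqP ->; [left|right].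
- have inj (p q : int) : p%:~R = q%:~R :> rat -> p = q by exact: intr_inj.
  split; apply: inj.
  + by rewrite EA jr /fA; field; rewrite ?bn.
  + apply: (mulfI gn); apply: (mulfI (_ : (2 * be%:R)^-1 != 0 :> rat)); first by rewrite invr_eq0 mulf_neq0.
    transitivity (ga * B'%:~R / (2 * be%:R)); first by field; rewrite ?bn.
    by rewrite -q12 Ex Ez jr /fB; field; rewrite ?bn.
  + apply: (mulfI gn); apply: (mulfI (_ : (be%:R ^+ 2)^-1 != 0 :> rat)); first by rewrite invr_eq0 expf_neq0.
    transitivity (n%:R * al ^+ 2 + ga * C'%:~R / be%:R ^+ 2 - n%:R * al ^+ 2); first by field; rewrite ?bn.
    by rewrite -q22 Ez /fA; field; rewrite ?bn.
Qed.

Lemma relW_T3 x i j z k l y w : ext algC (mx3 1 0 0 x i (be%:Z * j) z k l) *m T3 y w =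
  T3 (i%:~R * y + j%:~R * w) ((be%:Z * k)%:~R * y + l%:~R * w).
Proof. by rewrite ext_mx3 /T3 mul_cv3; congr cv3; rewrite ?rmorphM /=; field. Qed.

Lemma fr_U H v z I U A B C : fr H v z I -> U \in unitmx -> v = e0 *m U ->
  ext rat (U *m H *m U^T) = shape A B C -> good A B C ->
  exists y w, bas c I y w A B C /\ ext algC U *m z = T3 y w.
Proof.
move=> [U' [A' [B' [C' [y [w [[uU' vU' EU' g'] [b Uz]]]]]]]] uU vU EU g.
pose W := U *m invmx U'.
have uW : W \in unitmx by rewrite unitmx_mul uU unitmx_inv.
have e0W : e0 *m W = e0 by rewrite mulmxA -vU vU' mulmxK.
have WU : W *m U' = U by rewrite mulmxKV.
clearbody W.
have EW : ext rat W *m shape A' B' C' *m (ext rat W)^T = shape A B C.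
  rewrite -EU' -EU tr_ext -!ext_mul; congr (ext rat _).
  by rewrite -[in RHS]WU trmx_mul !mulmxA.
have [x [i [j [z' [k [l [EWm _ _ un [-> -> ->]]]]]]]] := relW uW e0W EW g' g.
exists (i%:~R * y + j%:~R * w), ((be%:Z * k)%:~R * y + l%:~R * w).
split; first exact: bas_change.
by rewrite -WU -ext_mulc Uz EWm relW_T3.
Qed.

Lemma fr_fid H v z I : fr H v z I -> fid c I.
Proof. by move=> [U [A [B [C [y [w [_ [b _]]]]]]]]; exact: bas_fid b. Qed.

Lemma fr_X H v z I : fr H v z I -> famX H v.
Proof. by move=> [U [A [B [C [y [w [[uU vU EU g] _]]]]]]]; exists U, A, B, C. Qed.

Lemma fr_uniq H v z I I' : fr H v z I -> fr H v z I' -> I = I'.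
Proof.
move=> f; case=> U [A [B [C [y [w [[uU vU EU g] [b Uz]]]]]]].
have [y' [w' [b' Uz']]] := fr_U f uU vU EU g.
have [Ey Ew] : y = y' /\ w = w' by apply: T3_inj; rewrite -Uz.
by have [_ _ _ _ ->] := b; have [_ _ _ _ ->] := b'; rewrite Ey Ew.
Qed.

Lemma fr_scl H v z I u : E1 u -> fr H v z I -> fr H v (u *: z) (scl u I).
Proof.
move=> [Eu uu] [U [A [B [C [y [w [hU [b Uz]]]]]]]]; exists U, A, B, C, (u * y), (u * w).
split=> //; split; first by rewrite -[c]mul1r; apply: bas_scl => //; rewrite uu rmorph1.
rewrite -scalemxAr Uz; apply/colP; apply: I3P; rewrite !mxE /= ?mulr0 ?mulrA //.
Qed.

Lemma ext_conj (U : 'M[int]_3) (z : 'cV[algC]_3) :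
  ext algC U *m map_mx (@Num.conj algC) z = map_mx (@Num.conj algC) (ext algC U *m z).
Proof.
apply/colP => i; rewrite !mxE rmorph_sum; apply: eq_bigr => j _.
by rewrite !mxE rmorphM /= rmorph_int.
Qed.

Lemma fr_conj H v z I : fr H v z I -> fr H v (map_mx (@Num.conj algC) z) (conjI I).
Proof.
move=> [U [A [B [C [y [w [hU [b Uz]]]]]]]]; exists U, A, B, C, y^*, w^*.
split=> //; split; first exact: bas_conj.
rewrite ext_conj Uz; apply/colP; apply: I3P; rewrite !mxE /= ?rmorph0 //.
by rewrite (conjM w) fmorphV rmorph_nat.
Qed.

Lemma fr_orbit H v z I z' I' : fr H v z I -> fr H v z' I' ->
  (exists2 u, E1 u & z' = u *: z) \/ (exists2 u, E1 u & z' = u *: map_mx (@Num.conj algC) z).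
Proof.
move=> [U [A [B [C [y [w [[uU vU EU g] [b Uz]]]]]]]] f'.
have [y' [w' [b' Uz']]] := fr_U f' uU vU EU g.
have uUC : ext algC U \in unitmx by rewrite unitmxE det_ext rmorph_unit // -unitmxE.
have inj (p q : 'cV[algC]_3) : ext algC U *m p = ext algC U *m q -> p = q.
  by move=> h; rewrite -[p](mulKmx uUC) h mulKmx.
have [[u Eu [Ey Ew]]|[u Eu [Ey Ew]]] := pair_orbit c0 b b'; [left|right]; exists u => //; apply: inj.
  rewrite -scalemxAr Uz Uz' Ey Ew; apply/colP; apply: I3P; rewrite !mxE /= ?mulr0 ?mulrA //.
rewrite -scalemxAr ext_conj Uz Uz' Ey Ew; apply/colP; apply: I3P; rewrite !mxE /= ?rmorph0 ?mulr0 //.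
by rewrite (conjM w) fmorphV rmorph_nat mulrA.
Qed.

(** Otherwise y conj(w) would be real, against [bas_skew]; hence the two families of [fr_orbit] are
    disjoint. *)
Lemma fr_skew H v z I u u' : fr H v z I -> E1 u -> E1 u' -> u *: z <> u' *: map_mx (@Num.conj algC) z.
Proof.
move=> [U [A [B [C [y [w [_ [b Uz]]]]]]]] [_ uu] [_ uu'] h.
have := congr1 (fun t => ext algC U *m t) h; rewrite -!scalemxAr ext_conj Uz => /colP h'.
have hy := h' o1; have hw := h' o2; move: hy hw; rewrite !mxE /= => hy hw.
have {}hw : u * w = u' * w^*.
  apply: (mulIf (_ : be%:R^-1 != 0)); first by rewrite invr_eq0.
  by rewrite -mulrA hw (conjM w) fmorphV rmorph_nat mulrA.
have [e ee Ee] := bas_skew b.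
have sk : y * w^* - y^* * w = 0.
  have e1 : y * w^* = (u * y) * (u * w)^* by rewrite (conjM u) mulrACA uu mul1r.
  have e2 : y^* * w = (u' * y^*) * (u' * w^*)^* by rewrite (conjM u') conjCK mulrACA uu' mul1r.
  by rewrite e1 e2 hy hw subrr.
move/eqP: Ee; rewrite sk eq_sym; apply/negP; apply: mulf_neq0; last exact: sd_neq0.
by apply: mulf_neq0; [case: ee => ->; rewrite intr_eq0|exact: ratr_neq0].
Qed.

Lemma diag_pos (x : 'rV[rat]_3) : x != 0 -> 0 < qform (smx3 n%:R a (a * D%:~R) 0 0 0) x.
Proof.
have [x0 [x1 [x2 ->]]] := rv3P x; rewrite qform_rv3 => nz.
have {}nz : [|| x0 != 0, x1 != 0 | x2 != 0].
  apply: contraNT nz; rewrite !negb_or !negbK => /and3P[/eqP -> /eqP -> /eqP ->].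
  by apply/eqP/rowP; apply: I3P; rewrite !mxE.
have D0 : 0 < D%:~R :> rat by rewrite ltr0z sqf_gt0.
have nr0 : 0 < n%:R :> rat by rewrite ltr0n.
rewrite (_ : _ + _ = n%:R * x0 ^+ 2 + a * (x1 ^+ 2 + D%:~R * x2 ^+ 2)); last by ring.
have p0 := sqr_ge0 x0; have p1 := sqr_ge0 x1; have p2 := sqr_ge0 x2.
have q2 : 0 <= D%:~R * x2 ^+ 2 by rewrite mulr_ge0 // ltW.
move: nz => /or3P[] h.
- apply: ltr_pwDl; first by rewrite mulr_gt0 // exprn_even_gt0.
  by rewrite mulr_ge0 ?addr_ge0 // ltW.
- apply: ltr_wpDl; first by rewrite mulr_ge0 // ltW.
  by rewrite mulr_gt0 // ltr_pwDl // exprn_even_gt0.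
- apply: ltr_wpDl; first by rewrite mulr_ge0 // ltW.
  by rewrite mulr_gt0 // ltr_wpDl // mulr_gt0 // exprn_even_gt0.
Qed.

(** A reflection corrects the rational isometry of [H] with <n> + a <1, D> so that v becomes the
    first vector; its complement then goes to the plane a (X^2 + D Y^2), which is E with a scaled
    norm. *)
Lemma fr_ex H v : genus K H -> famX H v -> exists z I, fr H v z I.
Proof.
move=> gH [U [A [B [C [uU vU EU g]]]]].
pose G := smx3 n%:R a (a * D%:~R) 0 0 0 : 'M[rat]_3.
have sG : G^T = G by rewrite /G tr_mx3.
have : isometric G (shape A B C).
  apply: isometric_trans (isometric_sym hdiag) _.
  have [_ iH _] := gH; apply: (isometric_trans iH).
  exists (ext rat U); last by rewrite tr_ext -!ext_mul.
  by rewrite unitmxE det_ext rmorph_unit // -unitmxE.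
move=> [R0 uR0 ER0].
have [|Q [EQ xQ]] := @positive_reflection G (rv3 1 0 0 *m R0) (rv3 1 0 0) sG diag_pos.
  by rewrite -qform_conj ER0 /shape /G !qform_rv3; ring.
pose R := R0 *m Q.
have ER : R *m G *m R^T = shape A B C.
  by rewrite /R trmx_mul -ER0 -[in RHS]EQ !mulmxA.
have e0R : rv3 1 0 0 *m R = rv3 1 0 0 by rewrite /R mulmxA.
have [w1 [w2 [w3 [x [y1 [y2 [x' [t1 [t2 ERm]]]]]]]]] := mx3P R.
move: e0R; rewrite ERm mul_rv3 => e0R; have [f1 f2 f3] := rv3_inj e0R.
have {}f1 : w1 = 1 by rewrite -[RHS]f1; ring.
have {}f2 : w2 = 0 by rewrite -[RHS]f2; ring.
have {}f3 : w3 = 0 by rewrite -[RHS]f3; ring.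
rewrite f1 f2 f3 {e0R f1 f2 f3 w1 w2 w3} in ERm.
move: ER; rewrite ERm /G /shape tr_mx3 !mul_mx3 => ER.
have [[_ q01 q02] [[_ q11 q12] [_ _ q22]]] := mx3_inj ER.
have Ex : x = 0 by apply: (mulfI nn); rewrite mulr0 -[RHS]q01; ring.
have Ex' : x' = al by apply: (mulfI nn); rewrite -[RHS]q02; ring.
pose y := ratr y1 + ratr y2 * qs dd; pose w := ratr (be%:R * t1) + ratr (be%:R * t2) * qs dd.
have an : a != 0 by exact: lt0r_neq0.
have ci (p : rat) (r : int) : a * p = ga * r%:~R -> ratr p = ratr c * r%:~R :> algC.
  move=> h; rewrite -[r%:~R]ratr_int -rmorphM; congr ratr.
  by apply: (mulfI an); rewrite h /c; field.
pose I := [set z : algC | exists i j : int, z = i%:~R * y + j%:~R * w].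
have b : bas c I y w A B C.
  split; [exact: E_intro|exact: E_intro| |by case: g|by []].
  split.
  - by rewrite /y E_normP; apply: ci; rewrite -q11 Ex; ring.
  - rewrite /w E_normP; apply: ci.
    apply: (mulfI (_ : (be%:R ^+ 2)^-1 != 0 :> rat)); first by rewrite invr_eq0 expf_neq0.
    transitivity (n%:R * al ^+ 2 + ga * C%:~R / be%:R ^+ 2 - n%:R * al ^+ 2); last by field; rewrite ?bn.
    by rewrite -q22 Ex'; field; rewrite ?bn.
  - rewrite /y /w !conj_el.
    transitivity (ratr (2 * (y1 * (be%:R * t1) + D%:~R * y2 * (be%:R * t2))) : algC).
      have := qs_sq dd; have -> : (D%:~R : algC) = ratr D%:~R by rewrite ratr_int.
      by move=> h; ring: h.
    apply: ci; apply: (mulfI (_ : (2 * be%:R)^-1 != 0 :> rat)); first by rewrite invr_eq0 mulf_neq0.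
    transitivity (ga * B%:~R / (2 * be%:R)); last by field; rewrite ?bn.
    by rewrite -q12 Ex; field; rewrite ?bn.
have uUC : ext algC U \in unitmx by rewrite unitmxE det_ext rmorph_unit // -unitmxE.
exists (invmx (ext algC U) *m T3 y w), I, U, A, B, C, y, w; split=> //; split=> //.
by rewrite mulKVmx.
Qed.

Lemma fr_fiber H v z1 I1 J : fr H v z1 I1 ->
  finite_set [set z | fr H v z J] /\ ncard [set z | fr H v z J] =
  (ncard [set u | E1 u /\ scl u I1 = J] + ncard [set u | E1 u /\ scl u (conjI I1) = J])%N.
Proof.
move=> f1; have fI := fr_fid f1; have f2 := fr_conj f1; have fI2 := fr_fid f2.
set z2 := map_mx _ z1 in f2.
have [fin1 _ _] := torsor J fI; have [fin2 _ _] := torsor J fI2.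
have [l1 u1 l1P] := finite_enum fin1; have [l2 u2 l2P] := finite_enum fin2.
pose L := [seq u *: z1 | u <- l1] ++ [seq u *: z2 | u <- l2].
have nz z I : fr H v z I -> z != 0.
  move=> [U [A [B [C [y [w [_ [b Uz]]]]]]]]; apply/eqP => z0.
  move: Uz; rewrite z0 mulmx0 => /colP/(_ o1); rewrite !mxE /= => y0.
  by have [] : (1 : int) = 0 /\ (0 : int) = 0 by apply: (bas_uniq c0 b); rewrite -y0; ring.
have LP z : fr H v z J <-> z \in L.
  rewrite mem_cat; split.
    move=> f; have [[u Eu Ez]|[u Eu Ez]] := fr_orbit f1 f; apply/orP; [left|right];
      apply/mapP; exists u => //.
      by apply/l1P; split=> //; apply: (fr_uniq _ f); rewrite Ez; exact: fr_scl.
    by apply/l2P; split=> //; apply: (fr_uniq _ f); rewrite Ez; exact: fr_scl.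
  by move=> /orP[]/mapP[u]; [move=> /l1P|move=> /l2P]; move=> [Eu <-] ->; exact: fr_scl.
have uL : uniq L.
  rewrite cat_uniq !map_inj_uniq ?u1 ?u2 ?andbT /=.
  - apply/hasPn => _ /mapP[u /l2P[Eu _] ->]; apply/negP => /mapP[u' /l1P[Eu' _]] h.
    by apply: (fr_skew f1 Eu' Eu); rewrite h.
  - by move=> p q /eqP; rewrite -subr_eq0 -scalerBl scaler_eq0 (negPf (nz _ _ f2)) orbF subr_eq0 => /eqP.
  - by move=> p q /eqP; rewrite -subr_eq0 -scalerBl scaler_eq0 (negPf (nz _ _ f1)) orbF subr_eq0 => /eqP.
split; first by apply: (sub_finite_set _ (finite_seq L)) => z /LP.
by rewrite (ncard_seq uL LP) size_cat !size_map (ncard_seq u1 l1P) (ncard_seq u2 l2P).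
Qed.

Definition frP H J : set ('rV[int]_3 * 'cV[algC]_3) := [set p | fr H p.1 p.2 J].

Lemma famX_vec H v : famX H v -> qform H v = n%:Z.
Proof.
move=> [U [A [B [C [_ -> EU _]]]]]; rewrite -qform_conj.
have EM : ((U *m H *m U^T) o0 o0)%:~R = n%:R :> rat.
  by have /matrixP/(_ o0 o0) := EU; rewrite !mxE.
apply: (@intr_inj rat); rewrite -[RHS]EM; congr (_%:~R); move: (U *m H *m U^T) => M.
have -> : e0 = delta_mx 0 o0 by apply/rowP; apply: I3P; rewrite !mxE.
by rewrite /qform /bform -rowE trmx_delta -colE !mxE.
Qed.

Lemma finite_famX H : lattice H -> finite_set (famX H).
Proof. by move=> lH; apply: sub_finite_set (finite_vec n%:Z lH) => v /famX_vec. Qed.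

(** Among the multiples of one frame by norm 1 elements, [mu E] have their ideal in a full list of
    representatives, and conjugation doubles this. For a list that is only independent the
    inequality serves to bound its length. *)
Lemma frP_sum H Js : genus K H -> indep (fid c) eqv1 Js ->
  (\sum_(J <- Js) ncard (frP H J) <= 2 * mu E * ncard (famX H))%N /\
  (reps (fid c) eqv1 Js -> (\sum_(J <- Js) ncard (frP H J))%N = (2 * mu E * ncard (famX H))%N).
Proof.
move=> gH iJ; have lH := genus_lattice gH.
have [Xs uX XP] := finite_enum (finite_famX lH).
have ex v : v \in Xs -> exists z I, fr H v z I by move/XP; exact: fr_ex.
have E2 J : ncard (frP H J) = (\sum_(v <- Xs) ncard [set z | fr H v z J])%N.
  have [] := @ncard_fiber _ _ (frP H J) Xs uX.
  - by move=> [v z] /fr_X /XP.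
  - by move=> v /ex[z [I f]]; have [] := fr_fiber J f.
  - by [].
under eq_bigr do rewrite E2.
rewrite exchange_big /= (ncard_seq uX XP).
have key v : v \in Xs -> (\sum_(J <- Js) ncard [set z | fr H v z J] <= 2 * mu E)%N /\
   (reps (fid c) eqv1 Js -> (\sum_(J <- Js) ncard [set z | fr H v z J])%N = (2 * mu E)%N).
  move=> /ex[z [I f]]; have fI := fr_fid f; have fI2 := fid_conj fI.
  have -> : (\sum_(J <- Js) ncard [set z | fr H v z J] = \sum_(J <- Js) ncard [set u | E1 u /\ scl u I = J] +
      \sum_(J <- Js) ncard [set u | E1 u /\ scl u (conjI I) = J])%N.
    by rewrite -big_split /=; apply: eq_bigr => J _; have [_ ->] := fr_fiber J f.
  have [b1 t1] := torsor_sum fI iJ; have [b2 t2] := torsor_sum fI2 iJ.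
  split; first by rewrite mul2n -addnn leq_add.
  move=> [_ cov]; rewrite t1 ?t2 ?mul2n ?addnn //; exact: cov.
split.
  rewrite (_ : (2 * mu E * size Xs = \sum_(v <- Xs) 2 * mu E)%N); last by rewrite big_const_seq count_predT iter_addn_0.
  by rewrite big_seq [leqRHS]big_seq; apply: leq_sum => v /key[].
move=> rJ; rewrite big_seq; under eq_bigr => v vX do rewrite (proj2 (key v vX) rJ).
by rewrite -big_seq big_const_seq count_predT iter_addn_0.
Qed.

Definition econj (W : 'M[int]_3) (S : 'M[rat]_3) := ext rat W *m S *m (ext rat W)^T.

Lemma econjM W W' S : econj (W *m W') S = econj W (econj W' S).
Proof. by rewrite /econj ext_mul trmx_mul !mulmxA. Qed.

Lemma econj_ext W H : econj W (ext rat H) = ext rat (W *m H *m W^T).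
Proof. by rewrite /econj tr_ext -!ext_mul. Qed.

Lemma econjK W : W \in unitmx -> cancel (econj W) (econj (invmx W)).
Proof. by move=> uW S; rewrite -econjM mulVmx // /econj /ext map_mx1 trmx1 mul1mx mulmx1. Qed.

(** O(H) acts freely on the frames with ideal [J], and the orbits over all classes correspond to the
    gluings in [gs]. *)
Lemma frP_class J (Hs : seq 'M[int]_3) : fid c J -> reps (genus K) (@isometric 3 int) Hs ->
  \sum_(H <- Hs) ((ncard (frP H J))%:R / (ncard (Defs.ortho H))%:R : rat) = kk%:R.
Proof.
move=> fJ [[uH HP Heq] Hcov].
have [y0 [w0 [A [B [C b]]]]] := fid_bas fJ.
have [|gs [ugs sgs gsP gsU gsC]] := @h3 A B C; first by exists J, y0, w0.
pose yg (g : int * int * int * int) : algC := let: (i, j, k, l) := g in i%:~R * y0 + j%:~R * w0.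
pose wg (g : int * int * int * int) : algC := let: (i, j, k, l) := g in k%:~R * y0 + l%:~R * w0.
pose Ag (g : int * int * int * int) := let: (i, j, k, l) := g in fA A B C i j.
pose Bg g := let: (i, j, k, l) := g in fB A B C i j k l.
pose Cg (g : int * int * int * int) := let: (i, j, k, l) := g in fA A B C k l.
pose Sg g := shape (Ag g) (Bg g) (Cg g).
have bg g : g \in gs -> bas c J (yg g) (wg g) (Ag g) (Bg g) (Cg g) /\ good (Ag g) (Bg g) (Cg g).
  by case: g => [[[i j] k] l] /gsP[un gg]; split=> //; exact: bas_change.
have Hg g : g \in gs -> exists W H', [/\ W \in unitmx, H' \in Hs & ext rat H' = econj W (Sg g)].
  move=> /bg[bb gg]; have [H0 [EH0 dH0 ev0]] := h1 gg.
  have gH0 : genus K H0.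
    apply: stable_genus => //; apply: isometric_trans hdiag _.
    have [[y1 [y2 Ey]] [w1 [w2 Ew]] [Ny Nw T] _ _] := bb.
    have an : a != 0 by exact: lt0r_neq0.
    have ci (p : rat) (r : int) : ratr p = ratr c * r%:~R :> algC -> a * p = ga * r%:~R.
      rewrite -[r%:~R]ratr_int -rmorphM => /ratr_inj ->; rewrite /c; field; exact: an.
    have qy : a * (y1 ^+ 2 + D%:~R * y2 ^+ 2) = ga * (Ag g)%:~R by apply: ci; rewrite -Ny Ey E_normP.
    have qw : a * (w1 ^+ 2 + D%:~R * w2 ^+ 2) = ga * (Cg g)%:~R by apply: ci; rewrite -Nw Ew E_normP.
    have qyw : a * (2 * (y1 * w1 + D%:~R * y2 * w2)) = ga * (Bg g)%:~R.
      apply: ci; rewrite -T Ey Ew -/(qs dd) !conj_el.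
      have := qs_sq dd; have -> : (D%:~R : algC) = ratr D%:~R by rewrite ratr_int.
      by move=> h; ring: h.
    pose S : 'M[rat]_3 := mx3 1 0 0 0 y1 y2 al (w1 / be%:R) (w2 / be%:R).
    have ES : S *m smx3 n%:R a (a * D%:~R) 0 0 0 *m S^T = ext rat H0.
      rewrite EH0 /S /shape tr_mx3 !mul_mx3 -qy -qw -qyw.
      by congr mx3; field; rewrite ?bn.
    exists S => //; rewrite unitmxE unitfE.
    have := congr1 determinant ES; rewrite !det_mulmx det_tr det_ext dH0 => hd.
    have : (\det K)%:~R != 0 :> rat by rewrite intr_eq0 gt_eqF // lattice_det_gt0 //; case: sK.
    by rewrite -hd !mulf_eq0 !negb_or => /andP[/andP[]].
  have [H' HH' [W uW EW]] := Hcov H0 gH0; exists W, H'; split=> //.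
  by rewrite /Sg -EH0 econj_ext EW.
have /choice[Vh VhP] : forall g, exists p, g \in gs ->
    [/\ p.1 \in unitmx, p.2 \in Hs & ext rat p.2 = econj p.1 (Sg g)].
  move=> g; have [gg|ng] := boolP (g \in gs); last by exists (0, 0).
  by have [W [H' hh]] := Hg g gg; exists (W, H').
pose Vg g := (Vh g).1; pose hH g := (Vh g).2.
pose ph g (V : 'M[int]_3) : 'rV[int]_3 * 'cV[algC]_3 :=
  (e0 *m invmx (V *m Vg g), ext algC (V *m Vg g) *m T3 (yg g) (wg g)).
have main H : H \in Hs -> ncard (frP H J) = (count (fun g => hH g == H) gs * ncard (Defs.ortho H))%N.
  move=> HH; have lH := genus_lattice (HP H HH).
  have [os uo oP] := finite_enum (finite_ortho lH).
  pose gs' := [seq g <- gs | hH g == H].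
  have WP g V : g \in gs' -> V \in os -> V *m Vg g \in unitmx /\ ext rat H = econj (V *m Vg g) (Sg g).
    rewrite mem_filter => /andP[/eqP EH gg] /oP[uV EV]; have [uVg _ EVg] := VhP g gg.
    by rewrite unitmx_mul uV econjM -EVg -/(hH g) EH econj_ext EV.
  have LP p : frP H J p <-> p \in [seq ph g V | g <- gs', V <- os].
    split; last first.
      move=> /allpairsP[[g V] /= [gg VV ->]]; have [uW EW] := WP g V gg VV.
      move: gg; rewrite mem_filter => /andP[_ gg]; have [bb go] := bg g gg.
      exists (invmx (V *m Vg g)), (Ag g), (Bg g), (Cg g), (yg g), (wg g); split.
        split=> //; first by rewrite unitmx_inv.
        by rewrite -econj_ext EW econjK.
      by split=> //; rewrite /ph /= ext_mulc mulVmx // /ext map_mx1 mul1mx.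
    case: p => v z [U [A' [B' [C' [y [w [[uU /= vU EU go] [b' /= Uz]]]]]]]].
    have [i [j [k [l [un Ey Ew [EA EB EC]]]]]] := bas_two c0 b b'.
    have := gsC i j k l un; rewrite -EA -EB -EC => /(_ go)[i' [j' [k' [l' [gg dv]]]]].
    pose g := (i', j', k', l'); have [bb go'] := bg g gg; have [un' _] := gsP _ _ _ _ gg.
    have [r1 [r2 [r3 [r4 [unr Eyr Ewr [EAr EBr ECr]]]]]] := bas_two c0 bb b'.
    (* the transition matrix from g to (i, j, k, l) has lower left entry +-(k l' - l k') *)
    have dr3 : (be%:Z %| r3)%Z.
      have h : (k - (r3 * i' + r4 * k'))%:~R * y0 + (l - (r3 * j' + r4 * l'))%:~R * w0 = 0.
        transitivity ((k%:~R * y0 + l%:~R * w0) - (r3%:~R * (i'%:~R * y0 + j'%:~R * w0) + r4%:~R * (k'%:~R * y0 + l'%:~R * w0))); first by ring.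
        by rewrite -Ew Ewr subrr.
      have [s1 s2] := bas_uniq c0 b h.
      have Ek : k = r3 * i' + r4 * k' by apply/eqP; rewrite -subr_eq0 s1.
      have El : l = r3 * j' + r4 * l' by apply/eqP; rewrite -subr_eq0 s2.
      have : (be%:Z %| (i' * l' - j' * k') * r3)%Z.
        have -> : (i' * l' - j' * k') * r3 = - (k' * l - l' * k) by rewrite Ek El; ring.
        by rewrite rpredN.
      by case: un' => ->; rewrite ?mul1r ?mulN1r ?rpredN.
    have [q Eq] := dvdzP dr3; rewrite mulrC in Eq.
    have [[t1 Et1] hl] := hal.
    have [|t2 Et2] := hl r4.
      case: hbe => [->|be2]; [by left|right].
      apply/negP => r42; have r32 : (2 %| r3)%Z by apply: dvdz_trans dr3; rewrite dvdzE.
      have : (2 %| r1 * r4 - r2 * r3)%Z by rewrite rpredB // dvdz_mull.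
      by case: unr => ->.
    pose W : 'M[int]_3 := mx3 1 0 0 (- (t1 * r2)) r1 (be%:Z * r2) t2 q r4.
    have uW : W \in unitmx.
      rewrite unitmxE det_mx3 (_ : _ + _ = r1 * r4 - r2 * r3); last by rewrite Eq; ring.
      by case: unr => ->.
    have EW : econj W (Sg g) = shape A' B' C'.
      rewrite EAr EBr ECr /econj /Sg /W ext_mx3 /shape tr_mx3 !mul_mx3 -Et2 !rmorphN !rmorphM /= -Et1 /fA /fB Eq.
      by congr mx3; field; rewrite ?bn.
    have WT : ext algC W *m T3 (yg g) (wg g) = T3 y w by rewrite relW_T3 Eyr Ewr Eq.
    have e0W : e0 *m W = e0 by rewrite /W mul_rv3; congr rv3; ring.
    have [uVg HHg EVg] := VhP g gg.
    pose V := invmx U *m W *m invmx (Vg g).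
    have VV : V *m Vg g = invmx U *m W by rewrite mulmxKV.
    have uV : V \in unitmx by rewrite !unitmx_mul !unitmx_inv uU uW.
    have EV : V *m hH g *m V^T = H.
      by apply: ext_inj; rewrite -econj_ext EVg -econjM VV econjM EW -EU -econj_ext econjK.
    have EHg : hH g = H by apply: Heq => //; exists V.
    have oV : Defs.ortho H V by split; rewrite // -{1}EHg.
    apply/allpairsP; exists (g, V); split=> /=; first by rewrite mem_filter EHg eqxx.
      exact/oP.
    rewrite /ph VV; congr pair.
      have -> : invmx (invmx U *m W) = invmx W *m U.
        apply: (can_inj (mulmxK (_ : invmx U *m W \in unitmx))).
          by rewrite unitmx_mul unitmx_inv uU.
        by rewrite mulVmx ?unitmx_mul ?unitmx_inv ?uU // mulmxA mulmxK // mulVmx.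
      by rewrite mulmxA -{1}e0W mulmxK.
    rewrite -ext_mulc WT -Uz ext_mulc mulVmx // /ext map_mx1 mul1mx //.
  have injph : {in [seq (g, V) | g <- gs', V <- os] &, injective (fun p => ph p.1 p.2)}.
    move=> _ _ /allpairsP[[g V] /= [gg VV ->]] /allpairsP[[g' V'] /= [gg' VV' ->]] /= [Ev Ez].
    have [uW EW] := WP g V gg VV; have [uW' EW'] := WP g' V' gg' VV'.
    move: (gg) (gg'); rewrite !mem_filter => /andP[/eqP EHg gin] /andP[/eqP EHg' gin'].
    set W := V *m Vg g in uW EW Ev Ez; set W' := V' *m Vg g' in uW' EW' Ev Ez.
    pose Z := invmx W' *m W.
    have uZ : Z \in unitmx by rewrite unitmx_mul unitmx_inv uW'.
    have e0Z : e0 *m Z = e0 by rewrite mulmxA -Ev mulmxKV.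
    have WZ : W' *m Z = W by rewrite mulKVmx.
    have [bb go] := bg g gin; have [bb' go'] := bg g' gin'.
    have EZ : econj Z (Sg g) = Sg g' by rewrite econjM -EW EW' econjK.
    have [x [i [j [t [k [l [EZm Ex Et un _]]]]]]] := relW uZ e0Z EZ go go'.
    have ZT : ext algC Z *m T3 (yg g) (wg g) = T3 (yg g') (wg g').
      have := congr1 (fun M => ext algC (invmx W') *m M) Ez.
      by rewrite !ext_mulc mulVmx // -/Z /ext map_mx1 mul1mx.
    move: ZT; rewrite EZm relW_T3 => /T3_inj[Ey Ew].
    have Egg : g = g'.
      case: g gin Ey Ew bb {gg EHg W uW EW Ev Ez Z uZ e0Z WZ EZ EZm go} => [[[gi gj] gk] gl] gin Ey Ew bb.
      case: g' gin' Ey Ew bb' {gg' EHg' W' uW' EW' go'} => [[[gi' gj'] gk'] gl'] gin' Ey Ew bb'.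
      apply: gsU => //.
      have h : (be%:Z * k * gi + l * gk - gk')%:~R * y0 + (be%:Z * k * gj + l * gl - gl')%:~R * w0 = 0.
        transitivity ((be%:Z * k)%:~R * (gi%:~R * y0 + gj%:~R * w0) + l%:~R * (gk%:~R * y0 + gl%:~R * w0) - (gk'%:~R * y0 + gl'%:~R * w0)); first by ring.
        by rewrite Ew subrr.
      have [s1 s2] := bas_uniq c0 b h.
      have -> : gk' = be%:Z * k * gi + l * gk by apply/esym/eqP; rewrite -subr_eq0 s1.
      have -> : gl' = be%:Z * k * gj + l * gl by apply/esym/eqP; rewrite -subr_eq0 s2.
      by apply/dvdzP; exists (k * (gk * gj - gl * gi)); ring.
    subst g'.
    have [i1 j0] : i - 1 = 0 /\ j = 0.
      by apply: (bas_uniq c0 bb); rewrite rmorphB /= mulrBl mul1r addrAC Ey subrr.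
    have [k0 l1] : be%:Z * k = 0 /\ l - 1 = 0.
      by apply: (bas_uniq c0 bb); rewrite rmorphB /= mulrBl mul1r addrA Ew subrr.
    have {}i1 : i = 1 by apply/eqP; rewrite -subr_eq0 i1.
    have {}l1 : l = 1 by apply/eqP; rewrite -subr_eq0 l1.
    have {}k0 : k = 0 by apply/eqP; move/eqP: k0; rewrite mulf_eq0 eqz_nat gtn_eqF.
    have x0 : x = 0 by apply: (@intr_inj rat); rewrite Ex j0 !mulr0.
    have t0 : t = 0 by apply: (@intr_inj rat); rewrite Et l1 subrr mulr0.
    have Z1 : Z = 1%:M by rewrite EZm i1 j0 k0 l1 x0 t0 mulr0 mx3_1.
    have WW : W = W' by rewrite -WZ Z1 mulmx1.
    have [uVg _ _] := VhP g gin.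
    by rewrite (_ : V = V') // -(mulmxK uVg V) -/W WW /W' mulmxK.
  have uL : uniq [seq ph g V | g <- gs', V <- os].
    rewrite (allpairs_uniq (f := fun g V => ph g V)) //; first exact: filter_uniq.
    by move=> [g V] [g' V'] h h' e; exact: (injph (g, V) (g', V') h h' e).
  by rewrite (ncard_seq uL LP) size_allpairs size_filter (ncard_seq uo oP).
rewrite -sgs -sum1_size natr_sum.
rewrite [RHS]big_seq (eq_bigr (fun g => \sum_(H <- Hs) (hH g == H)%:R)); last first.
  move=> g gg; have [_ HHg _] := VhP g gg.
  rewrite (bigD1_seq (hH g)) //= eqxx big1 ?addr0 // => H; by rewrite eq_sym => /negPf ->.
rewrite -big_seq exchange_big /= big_seq [RHS]big_seq; apply: eq_bigr => H HH.
have oo : (ncard (Defs.ortho H))%:R != 0 :> rat.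
  have lH := genus_lattice (HP H HH); have [os uo oP] := finite_enum (finite_ortho lH).
  rewrite (ncard_seq uo oP) pnatr_eq0 size_eq0; apply/eqP => o0.
  have : 1%:M \in os by apply/oP; split; rewrite ?unitmx1 // mul1mx trmx1 mulmx1.
  by rewrite o0.
rewrite main // natrM mulfK //.
by elim: (gs) => [|g s IH]; rewrite ?big_nil // big_cons /= natrD IH.
Qed.

Theorem family_sum (Hs : seq 'M[int]_3) : (0 < kk)%N -> (exists J, fid c J) ->
  reps (genus K) (@isometric 3 int) Hs ->
  \sum_(H <- Hs) ((ncard (famX H))%:R / (ncard (Defs.ortho H))%:R : rat) =
  kk%:R * (field_class_number E)%:R / (2 ^+ nu (ram dd) * (mu E)%:R).
Proof.
move=> k0 [J0 fJ0] rH; have [[_ HP _] _] := rH.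
pose Bd := (\sum_(H <- Hs) 2 * mu E * ncard (famX H))%N.
have dbl Js : indep (fid c) eqv1 Js ->
    \sum_(H <- Hs) ((\sum_(J <- Js) ncard (frP H J))%N%:R / (ncard (Defs.ortho H))%:R : rat) = (kk * size Js)%:R.
  move=> [uJ JP _]; under eq_bigr do rewrite natr_sum mulr_suml.
  rewrite exchange_big /=; transitivity (\sum_(J <- Js) (kk%:R : rat)).
    by apply: eq_big_seq => J JJ; apply: frP_class => //; exact: JP.
  by rewrite big_const_seq count_predT iter_addr_0 natrM mulr_natr.
(* By [dbl] an independent list is bounded by the weighted number of frames, so finiteness of the
   ideals of norm c modulo norm 1 elements comes out of the count itself. *)
have [Js rJ] : exists Js, reps (fid c) eqv1 Js.
  apply: (@reps_bound _ _ _ _ _ Bd); rewrite //.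
  - by move=> I _; exact: eqv1_refl.
  - by move=> I J _ _; exact: eqv1_sym.
  move=> Js iJ; apply: (@leq_trans (kk * size Js)%N); first by rewrite leq_pmull.
  rewrite -(ler_nat rat) -(dbl Js iJ) /Bd natr_sum big_seq [leRHS]big_seq.
  apply: ler_sum => H HH; have [b1 _] := frP_sum (HP H HH) iJ.
  apply: (@le_trans _ _ ((\sum_(J <- Js) ncard (frP H J))%N%:R)); last by rewrite ler_nat.
  have [->|o0] := eqVneq (ncard (Defs.ortho H)) 0%N; first by rewrite invr0 mulr0.
  by rewrite ler_pdivrMr ?ltr0n ?lt0n // ler_peMr // ler1n lt0n.
have iJ := rJ.1.
have [fm um] : finite_set (roots_of_unity E) /\ (0 < mu E)%N.
  have fm := finite_roots dd; split=> //; have [s us sP] := finite_enum fm.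
  rewrite /mu (ncard_seq us sP) lt0n size_eq0; apply/eqP => s0.
  have : 1 \in s by apply/sP; split; [exact: (E_int dd 1)|exists 1%N].
  by rewrite s0.
have m0 : (mu E)%:R != 0 :> rat by rewrite pnatr_eq0 -lt0n.
have key : 2 * (mu E)%:R * (\sum_(H <- Hs) ((ncard (famX H))%:R / (ncard (Defs.ortho H))%:R)) = (kk * size Js)%:R :> rat.
  rewrite -(dbl Js iJ) mulr_sumr big_seq [RHS]big_seq; apply: eq_bigr => H HH.
  have [_ ->] := frP_sum (HP H HH) iJ => //.
  by rewrite !natrM !mulrA.
have nu0 : (0 < nu (ram dd))%N.
  by rewrite /nu -has_predT; apply/hasP; exists (pdiv (gen_ram dd)) => //; rewrite mem_primes p0_prime ram_gt0 p0_ram.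
rewrite (class_count fJ0 rJ); apply: (mulfI (_ : 2 * (mu E)%:R != 0 :> rat)); first by rewrite mulf_neq0.
rewrite key !natrM natrX -[nu _]prednK // exprS; field.
by rewrite m0 expf_neq0.
Qed.

End Family.

(** * The families of vectors of norm m and 2m *)

Section Glue.
Variables (be : int) (q : int -> Prop) (A B C : int).

(** For a class [cl] of rows (k, l) modulo 2: [Some t] says that its good rows all agree modulo [be]
    with the good row [vt t], [None] that it has no good row. [cr] is the determinant of [vt t] and
    (k, l). *)
Definition glue_class (cl : int -> int -> Prop) (cr : int -> int -> int -> int) (vt : int -> int * int) (o : option int) :=
  if o is Some t then q (fA A B C (vt t).1 (vt t).2) /\
    forall k l, cl k l -> q (fA A B C k l) -> (be %| cr t k l)%Z
  else forall k l, cl k l -> ~ q (fA A B C k l).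

Definition glue0 := glue_class (fun k l => (2 %| k)%Z /\ ~~ (2 %| l)%Z) (fun t k l => 2 * t * l - k) (fun t => (2 * t, 1)).
Definition glue1 := glue_class (fun k l => ~~ (2 %| k)%Z /\ (2 %| l)%Z) (fun t k l => l - 2 * t * k) (fun t => (1, 2 * t)).
Definition glue2 := glue_class (fun k l => ~~ (2 %| k)%Z /\ ~~ (2 %| l)%Z)
  (fun t k l => (1 + 2 * t) * l - k) (fun t => (1 + 2 * t, 1)).

Definition gluing (dd : sqf) (sz : nat) := exists gs : seq (int * int * int * int),
  [/\ uniq gs, size gs = sz,
   forall i j k l, (i, j, k, l) \in gs ->
     unim i j k l /\ good dd (fun _ _ C => q C) (fA A B C i j) (fB A B C i j k l) (fA A B C k l),
   forall i j k l i' j' k' l', (i, j, k, l) \in gs -> (i', j', k', l') \in gs ->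
     (be %| k * l' - l * k')%Z -> (i, j, k, l) = (i', j', k', l')
 & forall i j k l, unim i j k l -> good dd (fun _ _ C => q C) (fA A B C i j) (fB A B C i j k l) (fA A B C k l) ->
     exists i' j' k' l', (i', j', k', l') \in gs /\ (be %| k' * l - l' * k)%Z].

(** Primitive rows are (0, 1), (1, 0) or (1, 1) modulo 2; as [be] is even, gluings from different
    classes stay different. *)
Lemma glue3 (dd : sqf) (o0' o1' o2' : option int) : (2 %| be)%Z ->
  B ^+ 2 - 4 * A * C = qd dd -> glue0 o0' -> glue1 o1' -> glue2 o2' ->
  gluing dd (isSome o0' + isSome o1' + isSome o2')%N.
Proof.
move=> be2 dABC c0 c1 c2.
pose g0 t : int * int * int * int := (1, 0, 2 * t, 1).
pose g1 t : int * int * int * int := (0, 1, 1, 2 * t).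
pose g2 t : int * int * int * int := (1, 0, 1 + 2 * t, 1).
pose gl (g : int -> int * int * int * int) o : seq (int * int * int * int) := if o is Some t then [:: g t] else [::].
have b2 z : (be %| z)%Z -> (2 %| z)%Z by exact: dvdz_trans.
have disc i j k l : unim i j k l -> fB A B C i j k l ^+ 2 - 4 * fA A B C i j * fA A B C k l = qd dd.
  move=> /unim_sq u; rewrite -dABC /fA /fB.
  by transitivity (((i * l - j * k) * (i * l - j * k)) * (B ^+ 2 - 4 * A * C)); [ring|rewrite u mul1r].
exists (gl g0 o0' ++ gl g1 o1' ++ gl g2 o2'); split.
- by rewrite /gl; case: (o0') => [t0|]; case: (o1') => [t1|]; case: (o2') => [t2|]; rewrite /= ?inE ?andbT //;
    rewrite /g0 /g1 /g2 !xpair_eqE /= ?andbF //; clear; lia.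
- by rewrite !size_cat addnA; case: (o0'); case: (o1'); case: (o2').
- move=> i j k l; rewrite !mem_cat => /or3P[].
  + case: (o0') c0 => [t [qt _]|//]; rewrite inE => /eqP[-> -> -> ->].
    have u : unim 1 0 (2 * t) 1 by left; ring.
    by split=> //; split=> //; exact: disc.
  + case: (o1') c1 => [t [qt _]|//]; rewrite inE => /eqP[-> -> -> ->].
    have u : unim 0 1 1 (2 * t) by right; ring.
    by split=> //; split=> //; exact: disc.
  + case: (o2') c2 => [t [qt _]|//]; rewrite inE => /eqP[-> -> -> ->].
    have u : unim 1 0 (1 + 2 * t) 1 by left; ring.
    by split=> //; split=> //; exact: disc.
- move=> i j k l i' j' k' l'; rewrite !mem_cat => h h' /b2.
  by case/or3P: h => h; case/or3P: h' => h'; move: h h';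
    case: (o0') => [t0|]; case: (o1') => [t1|]; case: (o2') => [t2|] //; rewrite !inE => /eqP[-> -> -> ->] /eqP[-> -> -> ->] //;
    clear; nia.
- move=> i j k l u [qk _].
  have un2 : ~~ ((2 %| k)%Z && (2 %| l)%Z).
    apply/negP => /andP[k2 l2]; have : (2 %| i * l - j * k)%Z by rewrite rpredB // dvdz_mull.
    by case: u => ->.
  have inL (g : int -> int * int * int * int) o t : o = Some t -> g t \in gl g o by move=> ->; rewrite inE.
  have [k2|k2] := boolP (2 %| k)%Z.
    have l2 : ~~ (2 %| l)%Z by move: un2; rewrite k2.
    have : glue0 o0' := c0; case Eo : {1}o0' => [t|] /= c0'; last by case: (c0' k l).
    exists 1, 0, (2 * t), 1; rewrite mem_cat (inL g0 _ _ Eo) mul1r; split=> //.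
    by apply: (proj2 c0').
  have [l2|l2] := boolP (2 %| l)%Z.
    have : glue1 o1' := c1; case Eo : {1}o1' => [t|] /= c1'; last by case: (c1' k l).
    exists 0, 1, 1, (2 * t); rewrite !mem_cat (inL g1 _ _ Eo) orbT mul1r; split=> //.
    by apply: (proj2 c1').
  have : glue2 o2' := c2; case Eo : {1}o2' => [t|] /= c2'; last by case: (c2' k l).
  exists 1, 0, (1 + 2 * t), 1; rewrite !mem_cat (inL g2 _ _ Eo) !orbT mul1r; split=> //.
  by apply: (proj2 c2').
Qed.

End Glue.

Section Classes.
Variables A B C : int.

Lemma fA_class0 k l : (2 %| k)%Z -> ~~ (2 %| l)%Z -> exists z, fA A B C k l = C + 2 * z.
Proof.
move=> /evenE[k' ->] /oddE[l' ->]; rewrite /fA.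
by exists (2 * A * k' ^+ 2 + B * k' * (2 * l' + 1) + C * (2 * l' ^+ 2 + 2 * l')); ring.
Qed.

Lemma fA_class1 k l : ~~ (2 %| k)%Z -> (2 %| l)%Z -> exists z, fA A B C k l = A + 2 * z.
Proof.
move=> /oddE[k' ->] /evenE[l' ->]; rewrite /fA.
by exists (2 * C * l' ^+ 2 + B * l' * (2 * k' + 1) + A * (2 * k' ^+ 2 + 2 * k')); ring.
Qed.

Lemma fA_class2 k l : ~~ (2 %| k)%Z -> ~~ (2 %| l)%Z -> exists z, fA A B C k l = A + B + C + 2 * z.
Proof.
move=> /oddE[k' ->] /oddE[l' ->]; rewrite /fA.
by exists (A * (2 * k' ^+ 2 + 2 * k') + C * (2 * l' ^+ 2 + 2 * l') + B * (2 * k' * l' + k' + l')); ring.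
Qed.

End Classes.

Lemma even_smx3 a b c d e f : (2 %| a)%Z -> (2 %| b)%Z -> (2 %| c)%Z -> even_lattice (smx3 a b c d e f).
Proof.
move=> /evenE[a' ->] /evenE[b' ->] /evenE[c' ->] x; have [x1 [x2 [x3 ->]]] := rv3P x; rewrite qform_rv3.
by apply/dvdzP; exists (a' * x1 ^+ 2 + b' * x2 ^+ 2 + c' * x3 ^+ 2 + (d * x1 * x2 + e * x1 * x3 + f * x2 * x3)); ring.
Qed.

(** On the three classes the form is C, A and A + B + C modulo 2, so a parity condition selects
    whole classes. *)
Lemma glue_parity q (A B C : int) dd (s : bool) : (forall z, q z -> (2 %| z)%Z = s) ->
  (forall i j k l, unim i j k l -> (2 %| fA A B C k l)%Z = s -> q (fA A B C k l)) -> B ^+ 2 - 4 * A * C = qd dd ->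
  gluing 2 q A B C dd (((2 %| C)%Z == s) + ((2 %| A)%Z == s) + ((2 %| A + B + C)%Z == s)).
Proof.
move=> qs sq d; pose o b : option int := if b then Some 0 else None.
have ob b : isSome (o b) = b by case: b.
rewrite -(ob (_ == s)) -(ob ((2 %| A)%Z == s)) -(ob ((2 %| A + B + C)%Z == s)); apply: glue3 => //; rewrite /glue0 /glue1 /glue2 /o; case: eqP => h.
- split=> /=; last by move=> k l [hk _] _; rewrite mulr0 mul0r sub0r rpredN.
  by apply: (@sq 1 0); [left; ring|rewrite (_ : fA _ _ _ _ _ = C) // /fA; ring].
- by move=> k l [hk hl]; have [u ->] := fA_class0 A B C hk hl => /qs h'; apply: h; rewrite -h'; clear; lia.
- split=> /=; last by move=> k l [_ hl] _; rewrite mulr0 mul0r subr0.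
  by apply: (@sq 0 1); [right; ring|rewrite (_ : fA _ _ _ _ _ = A) // /fA; ring].
- by move=> k l [hk hl]; have [u ->] := fA_class1 A B C hk hl => /qs h'; apply: h; rewrite -h'; clear; lia.
- split=> /=; last by move=> k l [hk hl] _; rewrite mulr0 addr0 mul1r; clear -hk hl; lia.
  by apply: (@sq 1 0); [left; ring|rewrite (_ : fA _ _ _ _ _ = A + B + C) // /fA; ring].
- by move=> k l [hk hl]; have [u ->] := fA_class2 A B C hk hl => /qs h'; apply: h; rewrite -h'; clear; lia.
Qed.

(* When the middle coefficient is odd the three classes modulo 2 split modulo 4. *)
Section ClassesOdd.
Variables A b C : int.
Local Notation B := (2 * b + 1).

Lemma fA_odd0 k l : ~~ (2 %| l)%Z -> exists z, fA A B C (2 * k) l = C + 2 * k + 4 * z.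
Proof.
move=> /oddE[l' ->]; exists (A * k ^+ 2 + k * (2 * b * l' + b + l') + C * (l' ^+ 2 + l')).
by rewrite /fA; ring.
Qed.

Lemma fA_odd1 k l : ~~ (2 %| k)%Z -> exists z, fA A B C k (2 * l) = A + 2 * l + 4 * z.
Proof.
move=> /oddE[k' ->]; exists (C * l ^+ 2 + l * (2 * b * k' + b + k') + A * (k' ^+ 2 + k')).
by rewrite /fA; ring.
Qed.

Lemma fA_odd2 k l : exists z, fA A B C (2 * k + 1) (2 * l + 1) = A + B + C + 2 * (k + l) + 4 * z.
Proof.
exists (A * (k ^+ 2 + k) + C * (l ^+ 2 + l) + B * k * l + b * (k + l)).
by rewrite /fA; ring.
Qed.

End ClassesOdd.

Section Instances.
Variables (K : 'M[int]_3) (dd : sqf) (n : nat) (a : rat) (Hs : seq 'M[int]_3).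
Local Notation D := (sqf_val dd).
Local Notation E := (quad_field (- D)).
Local Notation famS ga := (famX dd n 1 0 ga (fun _ _ _ => True)).
Local Notation famO := (famX dd n 2 0 4 (fun _ _ C => ~~ (2 %| C)%Z)).
Local Notation fam2o := (famX dd n 2 (1 / 2) 1 (fun _ _ C => (2 %| C)%Z)).
Local Notation fam2n be ga m := (famX dd n be (1 / 2) ga (fun _ _ C => ((C + m) %% 4)%Z = 0)).
Local Notation total F := (\sum_(H <- Hs) ((ncard (F H))%:R / (ncard (Defs.ortho H))%:R : rat)).
Local Notation value kk := (kk%:R * (field_class_number E)%:R / (2 ^+ nu (ram dd) * (mu E)%:R) : rat).
Hypotheses (sK : stable K) (n0 : (0 < n)%N) (a0 : 0 < a).
Hypothesis hdiag : isometric (ext rat K) (smx3 n%:R a (a * D%:~R) 0 0 0).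
Hypothesis rH : reps (genus K) (@isometric 3 int) Hs.

Lemma qd_odd : (D %% 4)%Z = 3 -> qd dd = - D.
Proof. by rewrite /qd /qpar => ->. Qed.

Lemma qd_even : (D %% 4)%Z <> 3 -> qd dd = - (4 * D).
Proof. by rewrite /qd /qpar => /eqP/negPf ->. Qed.

Lemma even_disc (A B C : int) : (D %% 4)%Z <> 3 -> B ^+ 2 - 4 * A * C = qd dd ->
  exists b, B = 2 * b /\ b ^+ 2 - A * C = - D.
Proof.
move=> D3; rewrite qd_even // => d; have /evenE[b Eb] : (2 %| B)%Z.
  have : (2 %| B * B)%Z; last by rewrite dvd2M orbb.
  rewrite (_ : B * B = 2 * (2 * (A * C) - 2 * D)) ?dvdz_mulr //.
  by transitivity (B ^+ 2 - 4 * A * C + 4 * A * C); [ring|rewrite d; ring].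
exists b; split=> //; apply: (mulfI (_ : (4 : int) != 0)) => //.
by transitivity (B ^+ 2 - 4 * A * C); [rewrite Eb; ring|rewrite d; ring].
Qed.

(** Orthogonal sums: with [be] = 1 all bases of the ideal give the same lattice, so a single basis
    represents them. *)
Lemma split_total (ga : rat) : 0 < ga -> (exists J, fid dd (ga / a) J) ->
  (forall A B C, B ^+ 2 - 4 * A * C = qd dd -> exists H : 'M[int]_3,
     [/\ ext rat H = shape n 1 0 ga A B C, \det H = \det K & even_lattice K -> even_lattice H]) ->
  total (famS ga) = value 1%N.
Proof.
move=> ga0 exJ h1; apply: (family_sum (a := a) (K := K)) => //.
- by move=> A B C [_ d]; exact: h1.
- by split; [exists 0; rewrite mul0r|move=> l _; exists 0; rewrite mul0r].
- by left.
move=> A B C [J [y [w [_ _ _ d _]]]]; exists [:: (1, 0, 0, 1)]; split=> //.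
- move=> i j k l; rewrite inE => /eqP[-> -> -> ->]; split; first by left; ring.
  by split=> //; rewrite /fA /fB -d; ring.
- by move=> i j k l i' j' k' l'; rewrite !inE => /eqP -> /eqP ->.
- by move=> i j k l _ _; exists 1, 0, 0, 1; rewrite inE eqxx; split=> //; rewrite dvd1z.
Qed.

Lemma half_odd (l : int) : ~~ (2 %| l)%Z -> exists t : int, 1 / 2 * (1 - l%:~R) = t%:~R :> rat.
Proof. by case/oddE => c ->; exists (- c); field. Qed.

Lemma half_int (j : int) : (exists t : int, 1 / 2 * j%:~R = t%:~R :> rat) -> (2 %| j)%Z.
Proof.
move=> [t Et]; apply/dvdzP; exists t; apply: (@intr_inj rat); rewrite rmorphM /= -Et.
by field.
Qed.

Lemma glue_quarter (A B C A' i j : int) : ~~ (2 %| C)%Z ->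
  A'%:~R = A%:~R * i%:~R ^+ 2 + B%:~R * i%:~R * j%:~R / 2 + C%:~R * j%:~R ^+ 2 / 4 :> rat -> (2 %| j)%Z.
Proof.
move=> oC E1; have Ez : 4 * A' = 4 * A * i ^+ 2 + 2 * B * i * j + C * j ^+ 2.
  apply: (@intr_inj rat); transitivity (4 * A'%:~R : rat); first by ring.
  by rewrite E1; field.
have : (2 %| C * (j * j))%Z.
  have -> : C * (j * j) = 2 * (2 * A' - 2 * A * i ^+ 2 - B * i * j).
    transitivity (C * j ^+ 2); first by ring.
    by rewrite (_ : C * j ^+ 2 = 4 * A' - (4 * A * i ^+ 2 + 2 * B * i * j)); [ring|rewrite Ez; ring].
  by rewrite dvdz_mulr.
by rewrite !dvd2M (negPf oC) orbb.
Qed.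

Lemma odd_disc (A B C : int) : (D %% 4)%Z = 3 -> B ^+ 2 - 4 * A * C = qd dd ->
  ~~ (2 %| B)%Z /\ ((2 %| A * C)%Z = ((D %% 8)%Z == 7)).
Proof.
move=> D3; rewrite qd_odd // => d.
have oB : ~~ (2 %| B)%Z.
  apply/negP => /evenE[b Eb]; move: d; rewrite Eb.
  have -> : (2 * b) ^+ 2 - 4 * A * C = 4 * (b ^+ 2 - A * C) by ring.
  by move: (b ^+ 2 - A * C) => z; clear -D3; lia.
split=> //; have [t Et] := sq_mod8 oB; move: d; rewrite Et -mulrA; move: (A * C) => z d.
by apply/idP/eqP; clear -d D3; lia.
Qed.

(** The complement of v has the odd Gram entries 4 A, B, C and belongs to the order of index 2; it
    arises from an ideal of the full ring by adjoining half a vector. Half vectors with C odd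
    qualify: all three if A C is odd, one otherwise. *)
Lemma glueO_total (m : int) : n%:R = m%:~R :> rat -> (D %% 4)%Z = 3 -> ~ even_lattice K ->
  \det K = m * D -> (exists J, fid dd (4 / a) J) ->
  total famO = value (if (D %% 8)%Z == 7 then 1%N else 3%N).
Proof.
move=> nm D3 oK dK exJ; apply: (family_sum (a := a) (K := K)) => //; last by case: ifP.
- move=> A B C [oC]; rewrite qd_odd // => d; exists (smx3 m (4 * A) C 0 0 B); split=> //.
  + by rewrite ext_smx3 /shape nm; congr mx3; rewrite ?rmorphM /=; field.
  + rewrite dK; have -> : D = 4 * A * C - B ^+ 2 by rewrite -[D]opprK -d; ring.
    by rewrite det_mx3; ring.
- move=> A B C A' B' C' i j [oC _] _ EA _; apply: (glue_quarter oC (A' := A') (A := A) (B := B) (i := i)).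
  by rewrite EA; field.
- by split; [exists 0; rewrite mul0r|move=> l _; exists 0; rewrite mul0r].
- by right.
move=> A B C [J [y [w [_ _ _ d _]]]]; have [oB AC] := odd_disc D3 d.
have [//|//|gs [u sz g1 g2 g3]] := @glue_parity (fun C => ~~ (2 %| C)%Z) A B C dd false _ _ d; first by move=> z /negPf.
  by move=> i j k l _ ->.
exists gs; split=> //; rewrite sz -AC dvd2M.
have S2 : (2 %| A + B + C)%Z = ((2 %| A)%Z != (2 %| C)%Z) by clear -oB; lia.
by rewrite S2; case: (2 %| A)%Z; case: (2 %| C)%Z.
Qed.

(** The glued vector (v + w) / 2 has norm (2 m + C) / 4. An even C is 2 modulo 4 here, so parity is
    the whole condition, and exactly one of A, C, A + B + C is even. *)
Lemma glue2o_total (m : int) : n%:R = (2 * m)%:~R :> rat -> ~~ (2 %| m)%Z -> (D %% 4)%Z = 2 -> ~ even_lattice K ->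
  2 * \det K = m * D -> (exists J, fid dd (1 / a) J) -> total fam2o = value 1%N.
Proof.
move=> nm om D2 oK dK exJ; have D3 : (D %% 4)%Z <> 3 by rewrite D2.
apply: (family_sum (a := a) (K := K)) => //.
- move=> A B C [C2 d]; have [b [Eb db]] := even_disc D3 d; have [c Ec] := evenE C2.
  have [z Ez] := sq_mod4 b.
  have [oc eb] : ~~ (2 %| c)%Z /\ (2 %| b)%Z.
    move: db; rewrite Ez Ec mulrCA; have [/evenE[c' Ec']|/oddE[c' Ec']] := boolP (2 %| c)%Z.
      by rewrite Ec' mulrCA mulrA; move: (A * c') => t; clear -D2; lia.
    by rewrite Ec' mulrDr mulr1 mulrCA; move: (A * c') => t; clear -D2; lia.
  have [b' Eb'] := evenE eb.
  have [r Er] : exists r, 4 * r = C + 2 * m by exists ((C + 2 * m) %/ 4)%Z; rewrite Ec; clear -oc om; lia.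
  have Ebb : B = 4 * b' by rewrite Eb Eb'; ring.
  have EC : C = 4 * r - 2 * m by rewrite Er; ring.
  exists (smx3 (2 * m) A r 0 m b'); split=> //.
  + by rewrite ext_smx3 /shape nm Ebb EC; congr mx3; rewrite ?(rmorphM, rmorphB) /=; field.
  + apply: (mulfI (_ : (2 : int) != 0)) => //; rewrite dK.
    have -> : D = A * C - b ^+ 2 by rewrite -[D]opprK -db; ring.
    by rewrite EC Eb' det_mx3; ring.
- by move=> A B C A' B' C' i j _ _ _; exact: half_int.
- split; first by exists 1; field.
  by move=> l [//|]; exact: half_odd.
- by right.
move=> A B C [J [y [w [_ _ _ d _]]]]; have [b [Eb db]] := even_disc D3 d; rewrite Eb in d *.
have [z Ez] := sq_mod4 b.
pose q C : Prop := (2 %| C)%Z.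
have AC : ~~ ((2 %| A)%Z && (2 %| C)%Z).
  apply/negP => /andP[/evenE[A' EA] /evenE[C' EC]]; move: db; rewrite Ez EA EC mulrACA.
  by move: (A' * C') => t; clear -D2; lia.
have [//|//|gs [u sz g1 g2 g3]] := @glue_parity q A (2 * b) C dd true _ _ d.
exists gs; split=> //; rewrite sz.
have S2 : (2 %| A + 2 * b + C)%Z = ((2 %| A)%Z == (2 %| C)%Z) by clear; lia.
by rewrite S2; move: AC; case: (2 %| A)%Z; case: (2 %| C)%Z.
Qed.

(* The ratio of the two values is a rational value of X^2 + D Y^2; descend on the 2-part of its denominator. *)
Lemma odd_values_mod4 c J y w A B C J' y' w' A' B' C' : 0 < c -> (D %% 4)%Z = 1 ->
  bas dd c J y w A B C -> bas dd c J' y' w' A' B' C' -> ~~ (2 %| C)%Z -> ~~ (2 %| C')%Z -> (4 %| C - C')%Z.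
Proof.
move=> c0 D1 b b' oC oC'; have [_ Ew [_ Nw _] _ _] := b; have [_ Ew' [_ Nw' _] _ _] := b'.
have rc := ratr_neq0 c0.
have w'0 : w' != 0.
  apply/eqP => h; have := Nw'; rewrite h mul0r => /esym/eqP; rewrite mulf_eq0 (negPf rc) /= intr_eq0 => /eqP h2.
  by move: oC'; rewrite h2.
have Et : quad_field (- D) (w / w') by apply: E_mul => //; exact: E_inv.
have [p [r Epr]] := Et.
have Ez : p ^+ 2 + D%:~R * r ^+ 2 = C%:~R / C'%:~R.
  apply: ratr_inj; rewrite -E_normP -/(qs dd) -Epr (conjM w) fmorphV /= fmorph_div /= !ratr_int.
  transitivity ((w * w^*) / (w' * w'^*)); first by field; rewrite fmorph_eq0 w'0.
  rewrite Nw Nw'; field; rewrite rc /= intr_eq0 ?andbT.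
  by apply: contraNneq oC' => ->.
have C'0 : C'%:~R != 0 :> rat by rewrite intr_eq0; apply: contraNneq oC' => ->.
have [N N0 [X [Y [EX EY]]]] : exists2 N : nat, (0 < N)%N & exists X Y : int, p * N%:R = X%:~R /\ r * N%:R = Y%:~R.
  exists (absz (denq p * denq r)); first by rewrite absz_gt0 mulf_neq0 ?denq_neq0.
  have -> : (absz (denq p * denq r))%:R = (denq p)%:~R * (denq r)%:~R :> rat.
    by rewrite natr_absz ger0_norm ?rmorphM // mulr_ge0 // ltW // denq_gt0.
  exists (numq p * denq r), (numq r * denq p); rewrite !rmorphM /= !numqE; split; ring.
have EQ : (X ^+ 2 + D * Y ^+ 2) * C' = C * N%:Z ^+ 2.
  apply: (@intr_inj rat); transitivity ((X%:~R ^+ 2 + D%:~R * Y%:~R ^+ 2) * C'%:~R : rat); first by ring.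
  rewrite -EX -EY; transitivity ((p ^+ 2 + D%:~R * r ^+ 2) * C'%:~R * N%:R ^+ 2); first by ring.
  by rewrite Ez divfK // rmorphM rmorphXn.
have [D' ED] : exists D', D = 4 * D' + 1 by exists (D %/ 4)%Z; clear -D1; lia.
elim/ltn_ind: N X Y N0 EQ {EX EY} => N IH X Y N0 EQ.
have [x Ex] := sq_mod4 X; have [y0 Ey] := sq_mod4 Y; have [z0 En] := sq_mod4 N%:Z.
have [/evenE[N' EN]|oN] := boolP (2 %| N%:Z)%Z; last first.
  have nm : (N%:Z %% 2)%Z = 1 by clear -oN; lia.
  move: EQ; rewrite Ex Ey En nm ED.
  move=> EQ; have EC : C = 4 * (x * C' + (D' * (4 * y0 + (Y %% 2)%Z) + y0) * C' - C * z0) + ((X %% 2)%Z + (Y %% 2)%Z) * C'.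
    by transitivity (C * (4 * z0 + 1) - 4 * C * z0); [ring|rewrite -EQ; ring].
  move: EC; move: (_ + _ - _) => s; have [->|->] : (X %% 2)%Z = 0 \/ (X %% 2)%Z = 1 by clear; lia.
    by have [->|->] : (Y %% 2)%Z = 0 \/ (Y %% 2)%Z = 1 by [clear; lia|]; clear -oC; lia.
  by have [->|->] : (Y %% 2)%Z = 0 \/ (Y %% 2)%Z = 1 by [clear; lia|]; clear -oC; lia.
have [hX hY] : (2 %| X)%Z /\ (2 %| Y)%Z.
  have : (4 %| (X ^+ 2 + D * Y ^+ 2) * C')%Z by rewrite EQ EN; apply/dvdzP; exists (C * N' ^+ 2); ring.
  rewrite Gauss_dvdzl; last by rewrite coprimezE (_ : absz 4 = (2 ^ 2)%N) // coprimeXl // coprime2n; clear -oC'; lia.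
  rewrite Ex Ey ED.
  have -> : 4 * x + (X %% 2)%Z + (4 * D' + 1) * (4 * y0 + (Y %% 2)%Z) =
     4 * (x + D' * (4 * y0 + (Y %% 2)%Z) + y0) + ((X %% 2)%Z + (Y %% 2)%Z) by ring.
  by move: (x + _ + _) => u; clear; lia.
have [X' EX] := evenE hX; have [Y' EY] := evenE hY.
have N'0 : 0 <= N' by clear -EN; lia.
apply: (IH `|N'|%N _ X' Y').
- by clear -EN N0 N'0; lia.
- by clear -EN N0 N'0; lia.
- rewrite gez0_abs //; apply: (mulfI (_ : (4 : int) != 0)) => //.
  by transitivity ((X ^+ 2 + D * Y ^+ 2) * C'); [rewrite EX EY; ring|rewrite EQ EN; ring].
Qed.

(** The norm (m + C) / 2 of the glued vector must be even. Odd values of the norm forms are all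
    congruent modulo 4, so the single good value [C0] makes every odd one good, and two of the three
    classes are odd. *)
Lemma glue2n1_total (m : int) J0 y0 w0 A0 B0 C0 : n%:R = (2 * m)%:~R :> rat -> ~~ (2 %| m)%Z -> (D %% 4)%Z = 1 ->
  \det K = 2 * m * D -> bas dd (2 / a) J0 y0 w0 A0 B0 C0 -> ((C0 + m) %% 4)%Z = 0 -> total (fam2n 2 2 m) = value 2%N.
Proof.
move=> nm om D1 dK b0 C0m; have D3 : (D %% 4)%Z <> 3 by rewrite D1.
have ca : 0 < 2 / a by exact: divr_gt0.
have oC0 : ~~ (2 %| C0)%Z by clear -C0m om; lia.
apply: (family_sum (a := a) (K := K)) => //; last by exists J0; exact: bas_fid b0.
- move=> A B C [Cm d]; have [b [Eb db]] := even_disc D3 d.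
  have [r Er] : exists r, 4 * r = C + m by exists ((C + m) %/ 4)%Z; clear -Cm; lia.
  have EC : C = 4 * r - m by rewrite Er; ring.
  exists (smx3 (2 * m) (2 * A) (2 * r) 0 m b); split=> //.
  + by rewrite ext_smx3 /shape nm Eb EC; congr mx3; rewrite ?(rmorphM, rmorphB) /=; field.
  + rewrite dK; have -> : D = A * C - b ^+ 2 by rewrite -[D]opprK -db; ring.
    by rewrite EC det_mx3; ring.
  + by move=> _; apply: even_smx3; rewrite dvdz_mulr.
- by move=> A B C A' B' C' i j _ _ _; exact: half_int.
- split; first by exists 1; field.
  by move=> l [//|]; exact: half_odd.
- by right.
move=> A B C [J [y [w bJ]]]; have [_ _ _ d _] := bJ; have [b [Eb db]] := even_disc D3 d; rewrite Eb in d bJ *.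
have AC : ~~ ((2 %| A)%Z && (2 %| C)%Z).
  apply/negP => /andP[/evenE[A' EA] /evenE[C' EC]]; move: db; rewrite EA EC mulrACA.
  have [/evenE[b' ->]|/sq_mod8[t ->]] := boolP (2 %| b)%Z; last by move: (A' * C') => t'; clear -D1; lia.
  by rewrite exprMn; move: (A' * C') (b' ^+ 2) => t' s'; clear -D1; lia.
pose q C : Prop := ((C + m) %% 4)%Z = 0.
have oddq i j k l : unim i j k l -> ~~ (2 %| fA A (2 * b) C k l)%Z -> q (fA A (2 * b) C k l).
  move=> u o; have := odd_values_mod4 ca D1 (bas_change bJ u) b0 o oC0.
  by rewrite /q; move: (fA _ _ _ _ _) => z; clear -C0m; lia.
have [||gs [u sz g1 g2 g3]] := @glue_parity q A (2 * b) C dd false _ _ d.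
- by move=> z; rewrite /q; clear -om; lia.
- by move=> i j k l un /negbT; exact: oddq un.
exists gs; split=> //; rewrite sz.
have S2 : (2 %| A + 2 * b + C)%Z = ((2 %| A)%Z == (2 %| C)%Z) by clear; lia.
by rewrite S2; move: AC; case: (2 %| A)%Z; case: (2 %| C)%Z.
Qed.

(** Each class modulo 2 on which the form is odd splits into two modulo 4, and exactly one of them
    has C congruent to - m modulo 4; [tt] picks it. *)
Lemma glue2n3_total (m : int) : n%:R = (2 * m)%:~R :> rat -> ~~ (2 %| m)%Z -> (D %% 4)%Z = 3 ->
  \det K = 2 * m * D -> (exists J, fid dd (8 / a) J) ->
  total (fam2n 4 8 m) = value (if (D %% 8)%Z == 7 then 1%N else 3%N).
Proof.
move=> nm om D3 dK exJ; apply: (family_sum (a := a) (K := K)) => //; last by case: ifP.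
- move=> A B C [Cm]; rewrite qd_odd // => d.
  have [r Er] : exists r, 4 * r = C + m by exists ((C + m) %/ 4)%Z; clear -Cm; lia.
  have EC : C = 4 * r - m by rewrite Er; ring.
  exists (smx3 (2 * m) (8 * A) (2 * r) 0 m B); split=> //.
  + by rewrite ext_smx3 /shape nm EC; congr mx3; rewrite ?(rmorphM, rmorphB) /=; field.
  + rewrite dK; have -> : D = 4 * A * C - B ^+ 2 by rewrite -[D]opprK -d; ring.
    by rewrite EC det_mx3; ring.
  + by move=> _; apply: even_smx3; rewrite ?dvdz_mulr //; apply: dvdz_mulr.
- move=> A B C A' B' C' i j [Cm _] _ EA /half_int/evenE[j' Ej].
  have oC : ~~ (2 %| C)%Z by clear -Cm om; lia.
  have /evenE[j2 Ej2] : (2 %| j')%Z.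
    by apply: (glue_quarter oC (A' := A') (A := A) (B := B) (i := i)); rewrite EA Ej rmorphM /=; field.
  by apply/dvdzP; exists j2; rewrite Ej Ej2; ring.
- split; first by exists 2; field.
  by move=> l [//|]; exact: half_odd.
- by right.
move=> A B C [J [y [w [_ _ _ d _]]]]; have [oB AC] := odd_disc D3 d; have [b Eb] := oddE oB; rewrite Eb in d *.
pose q C : Prop := ((C + m) %% 4)%Z = 0.
pose tt C : int := if ((C + m) %% 4)%Z == 0 then 0 else 1.
pose op C := if (2 %| C)%Z then None else Some (tt C).
have ttP z : ~~ (2 %| z)%Z -> ((z + 2 * tt z + m) %% 4)%Z = 0.
  by rewrite /tt; case: eqP => h o; clear -h om o; lia.
have ttq z k : ~~ (2 %| z)%Z -> ((z + 2 * k + m) %% 4)%Z = 0 -> (2 %| tt z - k)%Z.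
  by move=> /ttP; move: (tt z) => t; clear; lia.
have qodd z : q z -> ~~ (2 %| z)%Z by rewrite /q; clear -om; lia.
have c0 : glue0 4 q A (2 * b + 1) C (op C).
  rewrite /op; case: ifP => C2.
    by move=> k l [/evenE[k' ->] hl]; have [u ->] := fA_odd0 A b C k' hl => /qodd; clear -C2; lia.
  have oC : ~~ (2 %| C)%Z by rewrite C2.
  split=> /=; first by have [//|z ->] := fA_odd0 A b C (tt C) (l := 1); have := ttP C oC; rewrite /q; move: (tt C); clear; lia.
  move=> k l [/evenE[k' ->] hl]; have [u ->] := fA_odd0 A b C k' hl; have [l' El] := oddE hl => Q.
  have /evenE[s Es] : (2 %| tt C - k')%Z by apply: ttq => //; move: Q; rewrite /q; clear; lia.
  by apply/dvdzP; exists (s + l' * tt C); rewrite El (_ : k' = tt C - 2 * s); [ring|rewrite -Es; ring].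
have c1 : glue1 4 q A (2 * b + 1) C (op A).
  rewrite /op; case: ifP => A2.
    by move=> k l [hk /evenE[l' ->]]; have [u ->] := fA_odd1 A b C l' hk => /qodd; clear -A2; lia.
  have oA : ~~ (2 %| A)%Z by rewrite A2.
  split=> /=; first by have [//|z ->] := fA_odd1 A b C (tt A) (k := 1); have := ttP A oA; rewrite /q; move: (tt A); clear; lia.
  move=> k l [hk /evenE[l' ->]]; have [u ->] := fA_odd1 A b C l' hk; have [k' Ek] := oddE hk => Q.
  have /evenE[s Es] : (2 %| tt A - l')%Z by apply: ttq => //; move: Q; rewrite /q; clear; lia.
  by apply/dvdzP; exists (- s - k' * tt A); rewrite Ek (_ : l' = tt A - 2 * s); [ring|rewrite -Es; ring].
have c2 : glue2 4 q A (2 * b + 1) C (op (A + (2 * b + 1) + C)).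
  rewrite /op; set S := A + (2 * b + 1) + C; case: ifP => S2.
    move=> k l [/oddE[k' ->] /oddE[l' ->]]; have [u ->] := fA_odd2 A b C k' l' => /qodd.
    by rewrite -/S; clear -S2; clearbody S; lia.
  have oS : ~~ (2 %| S)%Z by rewrite S2.
  split=> /=.
    have [z] := fA_odd2 A b C (tt S) 0; rewrite mulr0 add0r addr0 [2 * tt S + 1]addrC => ->.
    by have := ttP S oS; rewrite /q -/S; clear; clearbody S; move: (tt S); lia.
  move=> k l [/oddE[k' ->] /oddE[l' ->]]; have [u ->] := fA_odd2 A b C k' l'; rewrite -/S => Q.
  have /evenE[s Es] : (2 %| tt S - (k' + l'))%Z by apply: ttq => //; move: Q; rewrite /q; clear; clearbody S; lia.
  apply/dvdzP; exists (s + l' + l' * tt S); rewrite (_ : k' = tt S - 2 * s - l'); [ring|].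
  by rewrite -Es; ring.
have [gs [u sz g1 g2 g3]] := glue3 (isT : (2 %| 4)%Z) d c0 c1 c2.
exists gs; split=> //; rewrite sz -AC dvd2M /op.
have S2 : (2 %| A + (2 * b + 1) + C)%Z = ((2 %| A)%Z != (2 %| C)%Z) by clear; lia.
by rewrite S2; case: (2 %| A)%Z; case: (2 %| C)%Z.
Qed.

End Instances.

(** * Counting the vectors of norm m and 2m over a genus *)

Local Notation e0 := (rv3 1 0 0 : 'rV[int]_3).

Definition gram (H : 'M[int]_3) (v : 'rV[int]_3) (M : 'M[int]_3) :=
  exists U, [/\ U \in unitmx, v = e0 *m U & U *m H *m U^T = M].

Lemma gram_isometric H v M : gram H v M -> isometric H M.
Proof. by move=> [U [uU _ EU]]; exists U. Qed.

Lemma gram_change H v M W : W \in unitmx -> e0 *m W = e0 -> gram H v M -> gram H v (W *m M *m W^T).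
Proof.
move=> uW eW [U [uU -> <-]]; exists (W *m U); split; first by rewrite unitmx_mul uW.
  by rewrite mulmxA eW.
by rewrite trmx_mul !mulmxA.
Qed.

Lemma gram_change3 H v n p r d e q e' i j x k l z :
  (i * l - j * k = 1 \/ i * l - j * k = -1) -> x * n + i * d + j * e = 0 -> z * n + k * d + l * e = e' ->
  gram H v (smx3 n p r d e q) ->
  gram H v (smx3 n (n * x ^+ 2 + p * i ^+ 2 + r * j ^+ 2 + 2 * (d * x * i + e * x * j + q * i * j))
    (n * z ^+ 2 + p * k ^+ 2 + r * l ^+ 2 + 2 * (d * z * k + e * z * l + q * k * l)) 0 e'
    (n * x * z + p * i * k + r * j * l + d * (x * k + z * i) + e * (x * l + z * j) + q * (i * l + j * k))).
Proof.
move=> u hx hz g; set M := smx3 _ _ _ _ _ _.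
have -> : M = mx3 1 0 0 x i j z k l *m smx3 n p r d e q *m (mx3 1 0 0 x i j z k l)^T.
  by rewrite tr_mx3 !mul_mx3 /M /smx3; congr mx3; rewrite -?hz; try ring; rewrite -[LHS]hx; ring.
apply: gram_change g.
- by rewrite unit_mx3P det_mx3; case: u => u; apply/orP; [left|right]; apply/eqP; rewrite -[RHS]u; ring.
- by rewrite mul_rv3; congr rv3; ring.
Qed.

Lemma gram_rel H v n p r e q p' r' e' q' : gram H v (smx3 n p r 0 e q) -> gram H v (smx3 n p' r' 0 e' q') ->
  exists z k l, z * n + l * e = e' /\ r' = n * z ^+ 2 + p * k ^+ 2 + r * l ^+ 2 + 2 * (e * z * l + q * k * l).
Proof.
move=> [U [uU vU EU]] [U' [uU' vU' EU']]; pose W := U' *m invmx U.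
have eW : e0 *m W = e0 by rewrite mulmxA -vU' vU mulmxK.
have EW : W *m smx3 n p r 0 e q *m W^T = smx3 n p' r' 0 e' q'.
  have EW : U' = W *m U by rewrite /W mulmxKV.
  by clearbody W; rewrite -EU -EU' EW trmx_mul !mulmxA.
move: eW EW; have [w1 [w2 [w3 [x [i [j [z [k [l ->]]]]]]]]] := mx3P W.
rewrite mul_rv3 => h; have [f1 f2 f3] := rv3_inj h; clear h.
have {}f1 : w1 = 1 by rewrite -[RHS]f1; ring.
have {}f2 : w2 = 0 by rewrite -[RHS]f2; ring.
have {}f3 : w3 = 0 by rewrite -[RHS]f3; ring.
subst w1 w2 w3; rewrite tr_mx3 !mul_mx3 => h; have [[_ _ q02] [_ [_ _ q22]]] := mx3_inj h.
by exists z, k, l; split; rewrite -?q02 -?q22; ring.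
Qed.

Lemma gram_rvec (m dl : nat) H v p r e q : (m%:Z %| e)%Z -> gram H v (smx3 (m * dl)%N%:Z p r 0 e q) -> rvec m dl H v.
Proof.
move=> /dvdzP[e' Ee] [U [uU -> EU]]; split.
  by rewrite -qform_conj EU qform_rv3; ring.
exists (rv3 dl%:Z 0 e' *m invmx U^T); have uT : U^T \in unitmx by rewrite unitmx_tr.
rewrite scalemxAl; apply: (canRL (mulmxK uT)).
transitivity (e0 *m (U *m H *m U^T)); first by rewrite !mulmxA.
rewrite EU mul_rv3; apply/rowP; apply: I3P; rewrite !mxE /= ?Ee ?PoszM; ring.
Qed.

(** Products with v are multiples of m and Q(v) is m or 2 m, so adding multiples of v makes them 0
    or m; a change of the other two vectors then concentrates a nonzero product on the last one. *)
Lemma rvec_gram K H (m dl : nat) v : stable K -> (m %| PQ K)%N -> genus K H -> dl \in [:: 1; 2]%N -> rvec m dl H v ->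
  exists p r e q, gram H v (smx3 (m * dl)%N%:Z p r 0 e q) /\ (e = 0 \/ dl = 2%N /\ e = m%:Z).
Proof.
move=> sK mP gH dl12 rv; have [sH _] := genus_lattice gH.
have [U uU vU] := rvec_prim sK mP dl12 rv; have [Qv [c Hc]] := rv.
have vU' : v = e0 *m U.
  by rewrite vU rowE; congr (_ *m U); apply/rowP; apply: I3P; rewrite !mxE.
have sM : (U *m H *m U^T)^T = U *m H *m U^T by rewrite !trmx_mul trmxK sH mulmxA.
have [n [p [r [d [e [q EM]]]]]] := smx3P sM.
have nE : n = (m * dl)%N%:Z.
  by rewrite -Qv vU' -qform_conj EM qform_rv3; ring.
have [d' [e' [Ed Ee]]] : exists d' e', d = m%:Z * d' /\ e = m%:Z * e'.
  have /matrixP h : e0 *m (U *m H *m U^T) = m%:Z *: (c *m U^T) by rewrite scalemxAl -Hc vU' !mulmxA.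
  have := h 0 o1; have := h 0 o2; rewrite EM mul_rv3 !mxE /= => h2 h1.
  by exists ((c *m U^T) 0 o1), ((c *m U^T) 0 o2); rewrite !mxE -h1 -h2; split; ring.
have gM : gram H v (smx3 n p r d e q) by exists U.
have chg i j x k l z : (i * l - j * k = 1 \/ i * l - j * k = -1) -> x * n + i * d + j * e = 0 ->
    exists p r q, gram H v (smx3 n p r 0 (z * n + k * d + l * e) q).
  by move=> u hx; do 3 eexists; exact: (gram_change3 u hx erefl gM).
move: dl12; rewrite !inE => /orP[] /eqP Edl.
  have nm : n = m%:Z by rewrite nE Edl muln1.
  have [||p' [r' [q' g]]] := chg 1 0 (- d') 0 1 (- e'); [by left|by rewrite nm Ed; ring|].
  exists p', r', 0, q'; rewrite -nE; split; last by left.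
  by move: g; rewrite (_ : - e' * n + _ + _ = 0) // nm Ee; ring.
have nm : n = 2 * m%:Z by rewrite nE Edl PoszM; ring.
have dv (z : int) : exists t, z = 2 * t \/ z = 2 * t + 1.
  by have [/evenE[t ->]|/oddE[t ->]] := boolP (2 %| z)%Z; exists t; [left|right].
have fin z e1 : z = 0 \/ z = m%:Z -> e1 = z -> (exists p r q, gram H v (smx3 n p r 0 e1 q)) ->
    exists p r e q, gram H v (smx3 (m * dl)%N%:Z p r 0 e q) /\ (e = 0 \/ dl = 2%N /\ e = m%:Z).
  move=> hz -> [p' [r' [q' g]]]; exists p', r', z, q'; rewrite -nE; split=> //.
  by case: hz; [left|right].
have [td [hd|hd]] := dv d'; have [te [he|he]] := dv e'.
- apply: (fin 0 (- te * n + 0 * d + 1 * e)); [by left|by rewrite nm Ee he; ring|].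
  by apply: (chg 1 0 (- td)); [left; ring|rewrite nm Ed hd; ring].
- apply: (fin m%:Z (- te * n + 0 * d + 1 * e)); [by right|by rewrite nm Ee he; ring|].
  by apply: (chg 1 0 (- td)); [left; ring|rewrite nm Ed hd; ring].
- apply: (fin m%:Z (- td * n + 1 * d + 0 * e)); [by right|by rewrite nm Ed hd; ring|].
  by apply: (chg 0 1 (- te)); [right; ring|rewrite nm Ee he; ring].
- apply: (fin m%:Z (- te * n + 0 * d + 1 * e)); [by right|by rewrite nm Ee he; ring|].
  by apply: (chg 1 (-1) (te - td)); [left; ring|rewrite nm Ed Ee hd he; ring].
Qed.

Lemma famX_gram dd n be al ga cond H v (e : int) : H^T = H -> n%:R * al = e%:~R ->
  famX dd n be al ga cond H v -> exists p r q A B C,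
  [/\ gram H v (smx3 n%:Z p r 0 e q), ext rat (smx3 n%:Z p r 0 e q) = shape n be al ga A B C & good dd cond A B C].
Proof.
move=> sH Ee [U [A [B [C [uU vU EU g]]]]].
have sM : (U *m H *m U^T)^T = U *m H *m U^T by rewrite !trmx_mul trmxK sH mulmxA.
have [n' [p [r [d [e' [q EM]]]]]] := smx3P sM.
rewrite EM in EU; have EU' := EU; rewrite ext_smx3 /shape in EU'.
have [[h1 h2 h3] _] := mx3_inj EU'.
have En : n' = n%:Z by apply: (@intr_inj rat); rewrite h1.
have Ed : d = 0 by apply: (@intr_inj rat); rewrite h2.
have Ee' : e' = e by apply: (@intr_inj rat); rewrite h3.
by subst n' d e'; exists p, r, q, A, B, C; split=> //; exists U.
Qed.

Lemma gram_famX dd n be al ga cond H v M A B C : gram H v M -> ext rat M = shape n be al ga A B C ->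
  good dd cond A B C -> famX dd n be al ga cond H v.
Proof. by move=> [U [uU vU EU]] EM g; exists U, A, B, C; rewrite EU. Qed.

(** One member of the family yields both the diagonal form, with a = ga A, and an ideal of norm ga /
    a: the span of 1 and (B + f sqrt(-D)) / (2 A), where f^2 D = - [qd]. *)
Lemma famX_base K H v dd n be al ga cond : genus K H -> (0 < n)%N -> (0 < be)%N -> 0 < ga ->
  famX dd n be al ga cond H v -> exists a : rat, [/\ 0 < a,
    isometric (ext rat K) (smx3 n%:R a (a * (sqf_val dd)%:~R) 0 0 0)
    & exists J, fid dd (ga / a) J /\ exists y w A B C, bas dd (ga / a) J y w A B C /\ cond A B C].
Proof.
move=> gH n0 b0 ga0 [U [A [B [C [uU vU EU [hc d]]]]]].
have [lH iKH _] := gH.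
have lM : lattice (U *m H *m U^T) by apply: isometric_lattice lH; exists U.
have A0 : 0 < ga * A%:~R.
  by have /matrixP/(_ o1 o1) := EU; rewrite [LHS]mxE [RHS]mxE /= => <-; rewrite ltr0z lattice_diag.
have Ap : 0 < A%:~R :> rat by rewrite pmulr_rgt0 in A0.
have An : A%:~R != 0 :> rat by rewrite gt_eqF.
have gn : ga != 0 by rewrite gt_eqF.
have bn : be%:R != 0 :> rat by rewrite pnatr_eq0 -lt0n.
have [f f0 Ef] : exists2 f : rat, f != 0 & f ^+ 2 * (sqf_val dd)%:~R = - (qd dd)%:~R.
  by rewrite /qd; case: ifP => _; [exists 1|exists 2] => //; rewrite ?rmorphN ?rmorphM /=; ring.
have dr : B%:~R ^+ 2 + f ^+ 2 * (sqf_val dd)%:~R = 4 * A%:~R * C%:~R :> rat.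
  by rewrite Ef -d; ring.
pose w1 : rat := B%:~R / (2 * A%:~R); pose w2 : rat := f / (2 * A%:~R).
have w12 : w1 ^+ 2 + (sqf_val dd)%:~R * w2 ^+ 2 = C%:~R / A%:~R.
  transitivity ((B%:~R ^+ 2 + f ^+ 2 * (sqf_val dd)%:~R) / (4 * A%:~R ^+ 2)); first by rewrite /w1 /w2; field.
  by rewrite dr; field.
have w1E : A%:~R * w1 = B%:~R / 2 by rewrite /w1; field.
exists (ga * A%:~R); split=> //.
  apply: isometric_trans iKH _; apply: (isometric_trans (isometric_ext rat (_ : isometric H _))); first by exists U; last reflexivity.
  rewrite EU; apply: isometric_sym; exists (mx3 1 0 0 0 1 0 al (w1 / be%:R) (w2 / be%:R)).
    rewrite unitmxE unitfE det_mx3 (_ : _ + _ = w2 / be%:R); last by ring.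
    by rewrite mulf_neq0 ?invr_eq0 // /w2 mulf_neq0 // invr_eq0 mulf_neq0.
  rewrite tr_mx3 !mul_mx3 /shape /smx3; congr mx3; try ring.
  - by transitivity (ga * (A%:~R * w1) / be%:R); [ring|rewrite w1E; field].
  - by transitivity (ga * (A%:~R * w1) / be%:R); [ring|rewrite w1E; field].
  - transitivity (n%:R * al ^+ 2 + ga * A%:~R * (w1 ^+ 2 + (sqf_val dd)%:~R * w2 ^+ 2) / be%:R ^+ 2); first by field.
    by rewrite w12; field; rewrite bn.
set w := ratr w1 + ratr w2 * qs dd; set J := [set z | exists i j : int, z = i%:~R * 1 + j%:~R * w].
suff b : bas dd (ga / (ga * A%:~R)) J 1 w A B C.
  by exists J; split; [exact: bas_fid (divr_gt0 ga0 A0) b|exists 1, w, A, B, C].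
have -> : ga / (ga * A%:~R) = A%:~R^-1 by rewrite invfM mulVKf.
have AC : ratr A%:~R^-1 * A%:~R = 1 :> algC by rewrite -[A%:~R in X in _ * X](ratr_int algC) -rmorphM /= mulVf ?rmorph1.
rewrite /J /w; split=> //; [exact: (E_int dd 1)|exact: E_intro|split].
- by rewrite rmorph1 mulr1 AC.
- by rewrite E_normP w12 mulrC rmorphM /= ratr_int mulrC.
- rewrite rmorph1 !mul1r conj_el; transitivity (ratr (w1 + w1) : algC); first by rewrite (raddfD (@ratr algC)) /=; ring.
  by rewrite -[B%:~R](ratr_int algC) -rmorphM; congr ratr; rewrite /w1; field.
Qed.

Lemma ncard_disjoint (T : choiceType) (A B C : set T) : finite_set A -> finite_set B ->
  (forall x, C x <-> A x \/ B x) -> (forall x, A x -> ~ B x) -> ncard C = (ncard A + ncard B)%N.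
Proof.
move=> /finite_enum[s us sP] /finite_enum[t ut tP] CP dis.
rewrite (ncard_seq us sP) (ncard_seq ut tP) -size_cat; apply: ncard_seq.
  rewrite cat_uniq us ut andbT; apply/hasPn => x /tP Bx; apply/negP => /sP Ax; exact: (dis x).
by move=> x; rewrite mem_cat CP sP tP; split=> [[]->|/orP[]]; rewrite ?orbT; auto.
Qed.

(** * Vectors of norm m and 2 m counted according to D modulo 8 *)

Section Totals.
Variables (K : 'M[int]_3) (m : nat) (dd : sqf) (Hs : seq 'M[int]_3).
Local Notation D := (sqf_val dd).
Local Notation E := (quad_field (- D)).
Local Notation total F := (\sum_(H <- Hs) ((ncard (F H))%:R / (ncard (Defs.ortho H))%:R : rat)).
Local Notation value kk := (kk%:R * (field_class_number E)%:R / (2 ^+ nu (ram dd) * (mu E)%:R) : rat).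
Local Notation isoK := (isoZ (ext (padic_int 2) K)).
Hypotheses (sK : stable K) (mP : (m %| PQ K)%N) (rH : reps (genus K) (@isometric 3 int) Hs).

Let om : ~~ (2 %| m%:Z)%Z.
Proof. by have := dvdn_odd mP (PQ_odd K); rewrite dvdzE /= dvdn2 => ->. Qed.
Let m0 : (0 < m)%N. Proof. by have := om; case: (m). Qed.
Let mn : m%:Z != 0. Proof. by rewrite eqz_nat -lt0n. Qed.

Lemma total_ext (F G : 'M[int]_3 -> set 'rV[int]_3) : (forall H, genus K H -> forall v, F H v <-> G H v) -> total F = total G.
Proof.
move=> h; have [[_ HP _] _] := rH; apply: eq_big_seq => H /HP gH; do 2 f_equal.
by congr ncard; apply/seteqP; split=> v /(h H gH).
Qed.

Lemma total_disjoint (F F1 F2 : 'M[int]_3 -> set 'rV[int]_3) :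
  (forall H, genus K H -> finite_set (F1 H) /\ finite_set (F2 H)) ->
  (forall H, genus K H -> forall v, F H v <-> F1 H v \/ F2 H v) ->
  (forall H, genus K H -> forall v, F1 H v -> ~ F2 H v) -> total F = total F1 + total F2.
Proof.
move=> fin h dis; have [[_ HP _] _] := rH; rewrite -big_split; apply: eq_big_seq => H /HP gH.
by have [f1 f2] := fin H gH; rewrite /= -mulrDl -natrD (ncard_disjoint f1 f2 (h H gH) (dis H gH)).
Qed.

Lemma gram_data H v n p r e q : genus K H -> gram H v (smx3 n p r 0 e q) ->
  [/\ \det K = n * (p * r - q ^+ 2) - e ^+ 2 * p, 0 < p & even_lattice K -> (2 %| p)%Z /\ (2 %| r)%Z].
Proof.
move=> gH g; have lK : lattice K by case: sK.
have i := gram_isometric g; have lM := isometric_lattice i (genus_lattice gH); split.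
- by rewrite -(genus_det lK gH) (isometric_det_int i) det_mx3; ring.
- exact: lattice_diag1 lM.
move=> ev; have eM : even_lattice (smx3 n p r 0 e q) by apply: (isometric_even i); apply/(genus_even lK gH).
have := eM (rv3 0 1 0); have := eM (rv3 0 0 1); rewrite !qform_rv3 => h2 h1.
by split; [move: h1|move: h2]; congr (is_true (_ %| _)%Z); ring.
Qed.

Lemma gram_iso H v M : genus K H -> gram H v M -> isometric (ext (padic_int 2) K) (ext (padic_int 2) M).
Proof. by move=> [_ _ /(_ 2 isT) l] /gram_isometric/(isometric_ext (padic_int 2)); exact: isometric_trans. Qed.

Let nmE : m%:R = m%:Z%:~R :> rat. Proof. by []. Qed.
Let nm2 : (m * 2)%N%:R = (2 * m%:Z)%:~R :> rat. Proof. by rewrite natrM rmorphM /= mulrC. Qed.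
Let nz2 : (m * 2)%N%:Z = 2 * m%:Z. Proof. by rewrite PoszM mulrC. Qed.

Lemma total_1_1 : (D %% 4)%Z = 1 -> \det K = m%:Z * D -> (exists H v, genus K H /\ rvec m 1 H v) ->
  total (rvec m 1) = value 1%N.
Proof.
move=> D1 dK ex; have qdE : qd dd = - (4 * D) by apply: qd_even; rewrite D1.
have eq H : genus K H -> forall v, rvec m 1 H v <-> famX dd m 1 0 1 (fun _ _ _ => True) H v.
  move=> gH v; have [sH _] := genus_lattice gH; split.
    move=> /(rvec_gram sK mP gH (isT : 1%N \in [:: 1; 2]%N))[p [r [e [q []]]]]; rewrite muln1 => g [e0|[]//]; subst e.
    have [dM _ _] := gram_data gH g.
    have DE : D = p * r - q ^+ 2 by apply: (mulfI mn); rewrite -dK dM; ring.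
    apply: (gram_famX g (A := p) (B := 2 * q) (C := r)).
      by rewrite ext_smx3 /shape nmE; congr mx3; rewrite ?rmorphM /=; field.
    by split=> //; rewrite qdE DE; ring.
  move=> /(famX_gram sH (e := 0))[|p [r [q [A [B [C [g _ _]]]]]]]; first by rewrite mulr0.
  by apply: gram_rvec; last by rewrite muln1; exact: g.
rewrite (total_ext eq); have [H [v [gH /(eq H gH) X]]] := ex.
have [a [a0 hd [J [fJ _]]]] := famX_base gH m0 (isT : (0 < 1)%N) ltr01 X.
apply: (split_total sK m0 a0 hd rH) => //; first by exists J.
move=> A B C; rewrite qdE => d; have [B' EB] : exists B', B = 2 * B'.
  apply: evenE; have : (2 %| B * B)%Z; last by rewrite dvd2M orbb.
  by apply/dvdzP; exists (2 * (A * C - D)); transitivity (B ^+ 2 - 4 * A * C + 4 * A * C); [ring|rewrite d; ring].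
exists (smx3 m%:Z A C 0 0 B'); split.
- by rewrite ext_smx3 /shape nmE EB; congr mx3; rewrite ?rmorphM /=; field.
- rewrite dK; apply: (mulfI (_ : (4 : int) != 0)) => //.
  transitivity (m%:Z * - - (4 * D)); last by ring.
  by rewrite -d EB det_mx3; ring.
- move=> /(stable_even2 sK); rewrite dK dvd2M (negPf om) /= => h.
  by have := dvdz_mod0P h; clear -D1; lia.
Qed.

(** The norm of w is then even, so Z 2 + Z w is an ideal of norm 2. *)
Lemma prime2_ideal : (D %% 8)%Z = 7 -> exists P, fid dd 2 P.
Proof.
move=> D7; set P := [set z | exists i j : int, z = i%:~R * (1 * 2)%:~R + j%:~R * (1%:~R * (0%:~R + qw dd))].
have [|C b] := @basis_bas dd 1 2 0 P isT isT _ erefl; last by exists P; exact: bas_fid b.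
by rewrite expr0n mulr0 !add0r /qn /qpar; case: ifP => [_|/eqP h]; [clear -D7|clear -D7 h]; lia.
Qed.

Lemma split2_total n a ga : stable K -> (0 < n)%N -> 0 < a -> isometric (ext rat K) (smx3 n%:R a (a * D%:~R) 0 0 0) ->
  (D %% 4)%Z = 3 -> \det K = n%:Z * D -> (even_lattice K -> (2 %| n%:Z)%Z) -> fid dd (2 / a) ga ->
  total (famX dd n 1 0 2 (fun _ _ _ => True)) = value 1%N.
Proof.
move=> _ n0 a0 hd D3 dK ev fJ; apply: (split_total sK n0 a0 hd rH) => //; first by exists ga.
move=> A B C; rewrite qd_odd // => d; exists (smx3 n%:Z (2 * A) (2 * C) 0 0 B); split.
- by rewrite ext_smx3 /shape; congr mx3; rewrite ?rmorphM /=; field.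
- by rewrite dK -[D]opprK -d det_mx3; ring.
- by move=> /ev n2; apply: even_smx3 => //; exact: dvdz_mulr.
Qed.

(** The complement of v is even ([Fe]) or odd ([Fo]). For D = 7 modulo 8 both occur, an ideal of
    norm 2 turning one kind into the other, and each contributes 1. For D = 3 modulo 8 isotropy at 2
    decides: anisotropic genera have only even planes, contributing 1, isotropic ones only odd
    planes, contributing 3. *)
Lemma total_1_3 : (D %% 4)%Z = 3 -> \det K = m%:Z * D -> (exists H v, genus K H /\ rvec m 1 H v) ->
  total (rvec m 1) = value (if (D %% 8)%Z == 7 then 2%N else if `[< isoK >] then 3%N else 1%N).
Proof.
move=> D3 dK ex; have qdE := qd_odd D3; have oD : ~~ (2 %| D)%Z by clear -D3; lia.
have oK : ~ even_lattice K by move=> /(stable_even2 sK); rewrite dK dvd2M (negPf om) (negPf oD).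
pose Fe := famX dd m 1 0 2 (fun _ _ _ => True); pose Fo := famX dd m 2 0 4 (fun _ _ C => ~~ (2 %| C)%Z).
have DE H v p r q : genus K H -> gram H v (smx3 m%:Z p r 0 0 q) -> D = p * r - q ^+ 2.
  by move=> gH g; have [dM _ _] := gram_data gH g; apply: (mulfI mn); rewrite -dK dM; ring.
have FeP H v : genus K H -> Fe H v -> exists A C q, gram H v (smx3 m%:Z (2 * A) (2 * C) 0 0 q).
  move=> gH /(famX_gram (genus_lattice gH).1 (e := 0))[|p [r [q [A [B [C [g EM _]]]]]]]; first by rewrite mulr0.
  move: EM; rewrite ext_smx3 /shape => EM; have [_ [[_ h1 _] [_ _ h2]]] := mx3_inj EM.
  exists A, C, q; suff [<- <-] : p = 2 * A /\ r = 2 * C by [].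
  by split; apply: (@intr_inj rat); rewrite ?h1 ?h2 rmorphM /=; field.
have FoP H v : genus K H -> Fo H v -> exists A r q, gram H v (smx3 m%:Z (4 * A) r 0 0 q) /\ ~~ (2 %| r)%Z.
  move=> gH /(famX_gram (genus_lattice gH).1 (e := 0))[|p [r [q [A [B [C [g EM [oC _]]]]]]]]; first by rewrite mulr0.
  move: EM; rewrite ext_smx3 /shape => EM; have [_ [[_ h1 _] [_ _ h2]]] := mx3_inj EM.
  exists A, r, q; suff [<- rC] : p = 4 * A /\ r = C by split=> //; rewrite rC.
  by split; apply: (@intr_inj rat); rewrite ?h1 ?h2 ?rmorphM /=; field.
have eq H : genus K H -> forall v, rvec m 1 H v <-> Fe H v \/ Fo H v.
  move=> gH v; have [sH _] := genus_lattice gH; split; last first.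
    by case=> [/(FeP _ _ gH)[A [C [q g]]]|/(FoP _ _ gH)[A [r [q [g _]]]]]; apply: gram_rvec; rewrite ?muln1; try exact: g.
  move=> /(rvec_gram sK mP gH (isT : 1%N \in [:: 1; 2]%N))[p [r [e [q []]]]]; rewrite muln1 => g [e0|[]//]; subst e.
  have d := DE _ _ _ _ _ gH g.
  have fin p' r' q' : gram H v (smx3 m%:Z p' r' 0 0 q') -> (4 %| p')%Z -> ~~ (2 %| r')%Z -> Fo H v.
    move=> g' /dvdzP[A EA] o; rewrite mulrC in EA; have d' := DE _ _ _ _ _ gH g'.
    apply: (gram_famX g' (A := A) (B := q') (C := r')).
      by rewrite ext_smx3 /shape nmE EA; congr mx3; rewrite ?rmorphM /=; field.
    by split=> //; rewrite qdE d' EA; ring.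
  have [/andP[/evenE[p' Ep] /evenE[r' Er]]|npr] := boolP ((2 %| p)%Z && (2 %| r)%Z).
    left; apply: (gram_famX g (A := p') (B := q) (C := r')); last by split=> //; rewrite qdE d Ep Er; ring.
    by rewrite ext_smx3 /shape nmE Ep Er; congr mx3; rewrite ?rmorphM /=; field.
  right; have [q2|/sq_mod8[t Et]] := boolP (2 %| q)%Z.
    have [q' Eq] := evenE q2.
    have pr3 : ((p * r) %% 4)%Z = 3.
      by rewrite (_ : p * r = D + 4 * q' ^+ 2); [move: (q' ^+ 2) => s; clear -D3; lia|rewrite d Eq; ring].
    have [op orr] : ~~ (2 %| p)%Z /\ ~~ (2 %| r)%Z.
      by split; apply/negP => /evenE[z Ez]; move: pr3; rewrite Ez 1?mulrCA -?mulrA; [move: (z * r)|move: (p * z)] => s; clear; lia.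
    have [p' Ep] := oddE op; have [r' Er] := oddE orr.
    have h := @gram_change3 H v m%:Z p r 0 0 q 0 1 1 0 0 1 0 (or_introl erefl).
    apply: (fin _ _ _ (h ltac:(ring) ltac:(ring) g)).
      apply/dvdzP; exists ((p + r + 2 * q) %/ 4)%Z; move: pr3; rewrite (_ : p * r = 4 * (p' * r') + 2 * (p' + r') + 1); last by rewrite Ep Er; ring.
      rewrite (_ : m%:Z * _ + _ + _ + _ = p + r + 2 * q); last by ring.
      by rewrite Eq Ep Er; move: (p' * r') => s; clear; lia.
    by rewrite (_ : m%:Z * _ + _ + _ + _ = r) //; ring.
  have pr4 : (4 %| p * r)%Z.
    by rewrite (_ : p * r = D + q ^+ 2); [rewrite Et; clear -D3; lia|rewrite d; ring].
  have cop z : ~~ (2 %| z)%Z -> coprimez 4 z.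
    by move=> o; rewrite coprimezE (_ : absz 4 = (2 ^ 2)%N) // coprimeXl // coprime2n; clear -o; lia.
  have [r2|orr] := boolP (2 %| r)%Z; last by apply: (fin _ _ _ g) => //; rewrite -(Gauss_dvdzl _ (cop _ orr)).
  have op : ~~ (2 %| p)%Z by move: npr; rewrite r2 andbT.
  have h := @gram_change3 H v m%:Z p r 0 0 q 0 0 1 0 1 0 0 (or_intror erefl).
  apply: (fin _ _ _ (h ltac:(ring) ltac:(ring) g)).
    by rewrite (_ : m%:Z * _ + _ + _ + _ = r); [rewrite -(Gauss_dvdzr _ (cop _ op))|ring].
  by rewrite (_ : m%:Z * _ + _ + _ + _ = p) //; ring.
have dis H : genus K H -> forall v, Fe H v -> ~ Fo H v.
  move=> gH v /(FeP _ _ gH)[A [C [q g]]] /(FoP _ _ gH)[A' [r' [q' [g' o]]]].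
  have [z [k [l [hz Er]]]] := gram_rel g g'.
  have z0 : z = 0 by apply: (mulIf mn); rewrite mul0r -[RHS]hz; ring.
  move: o; rewrite Er z0 (_ : _ + _ = 2 * (A * k ^+ 2 + C * l ^+ 2 + q * k * l)); last by ring.
  by rewrite dvdz_mulr.
have isoFo H v : genus K H -> Fo H v -> isoK.
  move=> gH /(FoP _ _ gH)[A [r [q [g o]]]]; apply: (isometric_isoZ (gram_iso gH g)); apply: isoZ_split3 => //.
  apply/negP => q2; move: oD; rewrite (DE _ _ _ _ _ gH g) (_ : 4 * A * r = 2 * (2 * A * r)); last by ring.
  by rewrite rpredB ?dvdz_mulr // dvd2M q2.
have isoFe H v : (D %% 8)%Z <> 7 -> genus K H -> Fe H v -> ~ isoK.
  move=> D7 gH /(FeP _ _ gH)[A [C [q g]]] i; have d := DE _ _ _ _ _ gH g.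
  apply: (@aniso_split m%:Z A q C om); last exact: (isometric_isoZ (isometric_sym (gram_iso gH g)) i).
  by rewrite (_ : _ - _ = D); [clear -D3 D7; lia|rewrite d; ring].
have base : exists a : rat, [/\ 0 < a, isometric (ext rat K) (smx3 m%:R a (a * D%:~R) 0 0 0)
   & (exists2 J, fid dd (2 / a) J & exists H v, genus K H /\ Fe H v) \/
     (exists2 J, fid dd (4 / a) J & exists H v, genus K H /\ Fo H v)].
  have [H [v [gH /(eq H gH)[X|X]]]] := ex.
    have [a [a0 hd [J [fJ _]]]] := famX_base gH m0 (isT : (0 < 1)%N) (isT : 0 < 2 :> rat) X.
    by exists a; split=> //; left; exists J => //; exists H, v.
  have [a [a0 hd [J [fJ _]]]] := famX_base gH m0 (isT : (0 < 2)%N) (isT : 0 < 4 :> rat) X.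
  by exists a; split=> //; right; exists J => //; exists H, v.
have fin H : genus K H -> finite_set (Fe H) /\ finite_set (Fo H).
  by move=> /genus_lattice lH; split; exact: finite_famX.
rewrite (total_disjoint fin eq dis); have [a [a0 hd fJ]] := base.
have tFe J : fid dd (2 / a) J -> total Fe = value 1%N.
  by move=> f; apply: (split2_total sK m0 a0 hd D3 dK _ f) => /oK.
have tFo J : fid dd (4 / a) J -> total Fo = value (if (D %% 8)%Z == 7 then 1%N else 3%N).
  by move=> f; apply: (glueO_total sK m0 a0 hd rH nmE D3 oK dK); exists J.
have [/eqP D7|/eqP D7] := boolP ((D %% 8)%Z == 7).
  have [P fP] := prime2_ideal D7.
  have [[J1 f1] [J2 f2]] : (exists J, fid dd (2 / a) J) /\ (exists J, fid dd (4 / a) J).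
    case: fJ => [[J f _]|[J f _]]; split; try by exists J.
      by exists (prodI P J); have := fid_mul fP f; congr (fid dd _); field; rewrite gt_eqF.
    exists (scl (ratr (1 / 2)) (prodI P J)); have := fid_sclr (isT : 0 < 1 / 2 :> rat) (fid_mul fP f).
    by congr (fid dd _); field; rewrite gt_eqF.
  by rewrite (tFe _ f1) (tFo _ f2) D7 /= -mulrDl -mulrDl -natrD.
case: asboolP => i.
  have e0 : total Fe = 0.
    have [[_ HP _] _] := rH; rewrite big_seq big1 // => H /HP gH.
    by have -> : ncard (Fe H) = 0%N; [apply: ncard0 => v /(isoFe _ _ D7 gH)|rewrite mul0r].
  case: fJ => [[J f [H [v [gH /(isoFe _ _ D7 gH)]]]]|[J f _]] //.
  by rewrite e0 add0r (tFo _ f); case: eqP D7.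
have e0 : total Fo = 0.
  have [[_ HP _] _] := rH; rewrite big_seq big1 // => H /HP gH.
  by have -> : ncard (Fo H) = 0%N; [apply: ncard0 => v /(isoFo _ _ gH)|rewrite mul0r].
by case: fJ => [[J f _]|[J f [H [v [gH /(isoFo _ _ gH)]]]]] //; rewrite e0 addr0 (tFe _ f).
Qed.

Lemma iso_mod8 : (D %% 8)%Z = 7 -> \det K = m%:Z * D -> (exists H v, genus K H /\ rvec m 1 H v) -> isoK.
Proof.
move=> D7 dK [H [v [gH]]] /(rvec_gram sK mP gH (isT : 1%N \in [:: 1; 2]%N))[p [r [e [q []]]]]; rewrite muln1 => g [e0|[]//]; subst e.
have [dM p0 _] := gram_data gH g; apply: (isometric_isoZ (gram_iso gH g)); apply: isoZ_split7; first by rewrite gt_eqF.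
by rewrite (_ : _ - _ = D) //; apply: (mulfI mn); rewrite -dK dM; ring.
Qed.

Lemma total_2_odd : (D %% 4)%Z = 2 -> ~ even_lattice K -> 2 * \det K = m%:Z * D ->
  (exists H v, genus K H /\ rvec m 2 H v) -> total (rvec m 2) = value 1%N.
Proof.
move=> D2 oK dK ex; have qdE : qd dd = - (4 * D) by apply: qd_even; rewrite D2.
have m20 : (0 < m * 2)%N by rewrite muln_gt0 m0.
have eq H : genus K H -> forall v, rvec m 2 H v <-> famX dd (m * 2) 2 (1 / 2) 1 (fun _ _ C => (2 %| C)%Z) H v.
  move=> gH v; have [sH _] := genus_lattice gH; split.
    move=> /(rvec_gram sK mP gH (isT : 2%N \in [:: 1; 2]%N))[p [r [e [q []]]]]; rewrite nz2 => g h.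
    have [dM _ _] := gram_data gH g; case: h => [e0|[_ em]]; subst e.
      suff h : D = 4 * (p * r - q ^+ 2) by move: D2; rewrite h; move: (p * r - _) => s; clear; lia.
      by apply: (mulfI mn); rewrite -dK dM; ring.
    have DE : D = 4 * (p * r - q ^+ 2) - 2 * m%:Z * p by apply: (mulfI mn); rewrite -dK dM; ring.
    apply: (gram_famX g (A := p) (B := 4 * q) (C := 4 * r - 2 * m%:Z)).
      by rewrite ext_smx3 /shape nm2; congr mx3; rewrite ?(rmorphM, rmorphB) /=; field.
    split; last by rewrite qdE DE; ring.
    by rewrite (_ : _ - _ = 2 * (2 * r - m%:Z)); [rewrite dvdz_mulr|ring].
  move=> /(famX_gram sH (e := m%:Z))[|p [r [q [A [B [C [g _ _]]]]]]]; last by apply: gram_rvec g.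
  by rewrite nm2 rmorphM /=; field.
rewrite (total_ext eq); have [H [v [gH /(eq H gH) X]]] := ex.
have [a [a0 hd [J [fJ _]]]] := famX_base gH m20 (isT : (0 < 2)%N) ltr01 X.
by apply: (glue2o_total sK m20 a0 hd rH nm2 om D2 oK dK); exists J.
Qed.

(** No such v splits off orthogonally: D would be 4 p' r' - q^2, which is 0 or 3 modulo 4. Only the
    glued family contributes. *)
Lemma total_2_1 : (D %% 4)%Z = 1 -> \det K = 2 * m%:Z * D ->
  (exists H v, genus K H /\ rvec m 2 H v) -> total (rvec m 2) = value 2%N.
Proof.
move=> D1 dK ex; have qdE : qd dd = - (4 * D) by apply: qd_even; rewrite D1.
have eK : even_lattice K by apply/(stable_even2 sK); rewrite dK -mulrA dvdz_mulr.
have m20 : (0 < m * 2)%N by rewrite muln_gt0 m0.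
have eq H : genus K H -> forall v, rvec m 2 H v <-> famX dd (m * 2) 2 (1 / 2) 2 (fun _ _ C => ((C + m%:Z) %% 4)%Z = 0) H v.
  move=> gH v; have [sH _] := genus_lattice gH; split.
    move=> /(rvec_gram sK mP gH (isT : 2%N \in [:: 1; 2]%N))[p [r [e [q []]]]]; rewrite nz2 => g h.
    have [dM _ /(_ eK)[/evenE[p' Ep] /evenE[r' Er]]] := gram_data gH g.
    have m2n : 2 * m%:Z != 0 by rewrite mulf_neq0.
    case: h => [e0|[_ em]]; subst e.
      have DE : D = 4 * (p' * r') - q ^+ 2 by apply: (mulfI m2n); rewrite -dK dM Ep Er; ring.
      exfalso; move: D1; rewrite DE; move: (p' * r') => s; have [/evenE[q' ->]|/sq_mod8[t ->]] := boolP (2 %| q)%Z; last by clear; lia.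
      by rewrite exprMn; move: (q' ^+ 2) => t; clear; lia.
    have DE : D = 4 * p' * r' - q ^+ 2 - m%:Z * p' by apply: (mulfI m2n); rewrite -dK dM Ep Er; ring.
    apply: (gram_famX g (A := p') (B := 2 * q) (C := 2 * r - m%:Z)).
      by rewrite ext_smx3 /shape nm2 Ep; congr mx3; rewrite ?(rmorphM, rmorphB) /=; field.
    split; last by rewrite qdE DE Er; ring.
    by rewrite Er; clear; lia.
  move=> /(famX_gram sH (e := m%:Z))[|p [r [q [A [B [C [g _ _]]]]]]]; last by apply: gram_rvec g.
  by rewrite nm2 rmorphM /=; field.
rewrite (total_ext eq); have [H [v [gH /(eq H gH) X]]] := ex.
have [a [a0 hd [J [fJ [y [w [A [B [C [b Cm]]]]]]]]]] := famX_base gH m20 (isT : (0 < 2)%N) (isT : 0 < 2 :> rat) X.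
exact: (glue2n1_total sK m20 a0 hd rH nm2 om D1 dK b Cm).
Qed.

(** Split and glued vectors both occur, contributing 1 + 1 or 1 + 3. Doubling an ideal of norm 2 / a
    gives one of norm 8 / a, so one kind entails the other. *)
Lemma total_2_3 : (D %% 4)%Z = 3 -> \det K = 2 * m%:Z * D ->
  (exists H v, genus K H /\ rvec m 2 H v) -> total (rvec m 2) = value (if (D %% 8)%Z == 7 then 2%N else 4%N).
Proof.
move=> D3 dK ex; have qdE := qd_odd D3.
have eK : even_lattice K by apply/(stable_even2 sK); rewrite dK -mulrA dvdz_mulr.
have m20 : (0 < m * 2)%N by rewrite muln_gt0 m0.
have m2n : 2 * m%:Z != 0 by rewrite mulf_neq0.
pose Fs := famX dd (m * 2) 1 0 2 (fun _ _ _ => True).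
pose Fn := famX dd (m * 2) 4 (1 / 2) 8 (fun _ _ C => ((C + m%:Z) %% 4)%Z = 0).
have FsP H v : genus K H -> Fs H v -> exists p r q, gram H v (smx3 (m * 2)%N%:Z p r 0 0 q).
  move=> gH /(famX_gram (genus_lattice gH).1 (e := 0))[|p [r [q [A [B [C [g _ _]]]]]]]; first by rewrite mulr0.
  by exists p, r, q.
have FnP H v : genus K H -> Fn H v -> exists p r q, gram H v (smx3 (m * 2)%N%:Z p r 0 m%:Z q).
  move=> gH /(famX_gram (genus_lattice gH).1 (e := m%:Z))[|p [r [q [A [B [C [g _ _]]]]]]]; last by exists p, r, q.
  by rewrite nm2 rmorphM /=; field.
have eq H : genus K H -> forall v, rvec m 2 H v <-> Fs H v \/ Fn H v.
  move=> gH v; split; last first.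
    by case=> [/(FsP _ _ gH)[p [r [q g]]]|/(FnP _ _ gH)[p [r [q g]]]]; apply: gram_rvec g; rewrite ?dvdz0.
  move=> /(rvec_gram sK mP gH (isT : 2%N \in [:: 1; 2]%N))[p [r [e [q []]]]]; rewrite nz2 => g h.
  case: h => [e0|[_ em]]; subst e.
    have [dM _ /(_ eK)[/evenE[p' Ep] /evenE[r' Er]]] := gram_data gH g.
    left; apply: (gram_famX g (A := p') (B := q) (C := r')).
      by rewrite ext_smx3 /shape nm2 Ep Er; congr mx3; rewrite ?rmorphM /=; field.
    by split=> //; rewrite qdE; apply: (mulfI m2n); rewrite mulrN -dK dM Ep Er; ring.
  right; have fin p' r' q' : gram H v (smx3 (2 * m%:Z) p' r' 0 m%:Z q') -> ~~ (2 %| q')%Z -> Fn H v.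
    move=> g' o; have [dM _ /(_ eK)[/evenE[p1 Ep] /evenE[r1 Er]]] := gram_data gH g'.
    have DE : D = 4 * (p1 * r1) - q' ^+ 2 - m%:Z * p1 by apply: (mulfI m2n); rewrite -dK dM Ep Er; ring.
    have : (4 %| m%:Z * p1)%Z.
      have [t Et] := sq_mod8 o; move: D3; rewrite DE Et; move: (p1 * r1) (m%:Z * p1) => s s'; clear; lia.
    rewrite Gauss_dvdzr; last by rewrite coprimezE (_ : absz 4 = (2 ^ 2)%N) // coprimeXl // coprime2n; clear -om; lia.
    move=> /dvdzP[A EA]; apply: (gram_famX g' (A := A) (B := q') (C := 2 * r' - m%:Z)).
      by rewrite ext_smx3 /shape nm2 Ep EA; congr mx3; rewrite ?(rmorphM, rmorphB) /=; field.
    by split; [rewrite Er; clear; lia|rewrite qdE DE EA Er; ring].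
  have [q2|oq] := boolP (2 %| q)%Z; last exact: (fin _ _ _ g).
  have h := @gram_change3 H v (2 * m%:Z) p r 0 m%:Z q m%:Z 1 2 (-1) 0 1 0 (or_introl erefl).
  apply: (fin _ _ _ (h ltac:(ring) ltac:(ring) g)).
  rewrite (_ : 2 * m%:Z * _ * _ + _ + _ + _ + _ + _ = q + 2 * r - m%:Z); last by ring.
  by clear -q2 om; lia.
have dis H : genus K H -> forall v, Fs H v -> ~ Fn H v.
  move=> gH v /(FsP _ _ gH)[p [r [q g]]] /(FnP _ _ gH)[p' [r' [q' g']]].
  have [z [k [l [hz _]]]] := gram_rel g g'; move: om; rewrite -hz nz2 mulr0 addr0.
  by rewrite mulrCA dvdz_mulr.
have fin H : genus K H -> finite_set (Fs H) /\ finite_set (Fn H).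
  by move=> /genus_lattice lH; split; exact: finite_famX.
rewrite (total_disjoint fin eq dis).
have [a [a0 hd [[J1 f1] [J2 f2]]]] : exists a : rat, [/\ 0 < a, isometric (ext rat K) (smx3 (m * 2)%N%:R a (a * D%:~R) 0 0 0)
   & (exists J, fid dd (2 / a) J) /\ (exists J, fid dd (8 / a) J)].
  have [H [v [gH /(eq H gH)[X|X]]]] := ex.
    have [a [a0 hd [J [fJ _]]]] := famX_base gH m20 (isT : (0 < 1)%N) (isT : 0 < 2 :> rat) X.
    exists a; split=> //; split; first by exists J.
    exists (scl (ratr 2) J); have := fid_sclr (isT : 0 < 2 :> rat) fJ.
    by congr (fid dd _); field; rewrite gt_eqF.
  have [a [a0 hd [J [fJ _]]]] := famX_base gH m20 (isT : (0 < 4)%N) (isT : 0 < 8 :> rat) X.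
  exists a; split=> //; split; last by exists J.
  exists (scl (ratr (1 / 2)) J); have := fid_sclr (isT : 0 < 1 / 2 :> rat) fJ.
  by congr (fid dd _); field; rewrite gt_eqF.
have dK' : \det K = (m * 2)%N%:Z * D by rewrite dK nz2.
rewrite (split2_total sK m20 a0 hd D3 dK' _ f1); last by rewrite nz2 dvdz_mulr.
rewrite (glue2n3_total sK m20 a0 hd rH nm2 om D3 dK (ex_intro _ J2 f2)).
by rewrite -mulrDl -mulrDl -natrD; case: ifP.
Qed.

End Totals.

(** * The class number formula *)

Lemma quad_field_sq (dd : sqf) (k : int) : k != 0 -> quad_field (- (k ^+ 2 * sqf_val dd)) = quad_field (- sqf_val dd).
Proof.
move=> k0; have kn : ratr k%:~R != 0 :> algC by rewrite ratr_int intr_eq0.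
have [e ee Es] : exists2 e : rat, e != 0 & sqrtC (- (k ^+ 2 * sqf_val dd))%:~R = ratr e * qs dd.
  have : sqrtC (- (k ^+ 2 * sqf_val dd))%:~R ^+ 2 = (k%:~R * qs dd) ^+ 2.
    by rewrite sqrtCK exprMn qs_sq rmorphN rmorphM rmorphXn /= mulrN.
  move=> /eqP; rewrite eqf_sqr => /orP[] /eqP ->; [exists k%:~R|exists (- k%:~R)]; rewrite ?oppr_eq0 ?intr_eq0 //.
    by rewrite ratr_int.
  by rewrite rmorphN /= ratr_int mulNr.
rewrite /quad_field Es -/(qs dd); apply/seteqP; split=> _ [a [b ->]].
  by exists a, (b * e); rewrite (rmorphM (@ratr algC) b) /= mulrA.
by exists a, (b / e); rewrite mulrA -(rmorphM (@ratr algC) (b / e)) /= divfK.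
Qed.

Lemma sqfreez_coprime (a b : nat) : (0 < a)%N -> sqfreez (a * b)%N%:Z -> coprime a b.
Proof.
move=> a0 sq; rewrite /coprime eqn_leq gcdn_gt0 a0 andbT leqNgt; apply/negP => h.
have := sq _ (pdiv_prime h); rewrite dvdzE /= expnS expn1.
by rewrite dvdn_mul // (dvdn_trans (pdiv_dvd _)) ?dvdn_gcdl ?dvdn_gcdr.
Qed.

Lemma sqfreez_double (n : nat) : odd n -> sqfreez n%:Z -> sqfreez (2 * n)%N%:Z.
Proof.
move=> on sn q pq; apply/negP; rewrite dvdzE /=.
have [->|q2] := eqVneq q 2%N; first by move: on; clear; lia.
rewrite Gauss_dvdr; first by move=> h; have := sn q pq; rewrite dvdzE /= h.
by rewrite coprimeXl // coprime_sym prime_coprime // dvdn_prime2 // eq_sym.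
Qed.

Section Term.
Variables (K : 'M[int]_3) (m : nat) (Hs : seq 'M[int]_3).
Hypotheses (sK : stable K) (mP : (m %| PQ K)%N) (rH : reps (genus K) (@isometric 3 int) Hs).
Local Notation L := (lambda m K).
Local Notation total F := (\sum_(H <- Hs) ((ncard (F H))%:R / (ncard (Defs.ortho H))%:R : rat)).
Local Notation e := (PQ K %/ m)%N.

Definition term dl : rat := let E := quad_field (- (dl%:Z * \det L)) in
  tcoef L dl * 2 ^ ((nu m)%:Z - (nu (PQ K))%:Z) * ((field_class_number E)%:R / (mu E)%:R).

Let PQE : PQ K = (m * e)%N. Proof. by rewrite mulnC divnK. Qed.
Let om : odd m. Proof. exact: dvdn_odd mP (PQ_odd K). Qed.
Let oe : odd e. Proof. by move: (PQ_odd K); rewrite {1}PQE oddM om. Qed.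
Let m0 : (0 < m)%N. Proof. by case: (m) om. Qed.
Let e0 : (0 < e)%N. Proof. by case: (e) oe. Qed.
Let detE : \det K = (m * e * (if `[< even_lattice K >] then 2 else 1))%N%:Z.
Proof. by rewrite -PQE -PQ_det // gez0_abs // ltW // lattice_det_gt0; case: sK. Qed.
Let sPQ : sqfreez (m * e)%N%:Z.
Proof. by apply: sqfreez_dvd (stable_sqfree sK) _; rewrite detE PoszM dvdz_mulr. Qed.
Let se : sqfreez e%:Z.
Proof. by apply: sqfreez_dvd sPQ _; rewrite PoszM dvdz_mull. Qed.
Let nuE : nu (PQ K) = (nu m + nu e)%N.
Proof. by rewrite {1}PQE nuM // sqfreez_coprime. Qed.
Let m8 D : (8 %| m%:Z ^+ 2 * D - D)%Z.
Proof.
have /sq_mod8[t ->] : ~~ (2 %| m%:Z)%Z by rewrite dvdzE /= dvdn2 om.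
by apply/dvdzP; exists (t * D); ring.
Qed.

(** With e = PQ / m the power of 2 in the formula is 1 / 2^nu(e), while the count has 1 / 2^nu(ram).
    The defect [j] is 1 when 2 ramifies in E, e being odd, and 0 otherwise; it accounts for the
    halves in [tcoef]. *)
Lemma term_value (dl : nat) (dd : sqf) (k : int) (j kk : nat) : k != 0 -> dl%:Z * \det L = k ^+ 2 * sqf_val dd ->
  nu (ram dd) = (j + nu e)%N -> tcoef L dl = kk%:R / 2 ^+ j ->
  term dl = kk%:R * (field_class_number (quad_field (- sqf_val dd)))%:R
     / (2 ^+ nu (ram dd) * (mu (quad_field (- sqf_val dd)))%:R).
Proof.
move=> k0 Ed En Et; rewrite /term Ed quad_field_sq // Et En nuE PoszD opprD addrA subrr add0r.
rewrite exprD invfM invfM -exprnN; ring.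
Qed.

Lemma nu_double : nu (2 * e) = (1 + nu e)%N.
Proof. by rewrite nuM // coprime2n. Qed.

Let eD : 0 < e%:Z. Proof. by rewrite ltz_nat. Qed.
Let s2e : sqfreez (2 * e)%N%:Z. Proof. exact: sqfreez_double. Qed.
Let e2D : 0 < (2 * e)%N%:Z. Proof. by rewrite ltz_nat muln_gt0. Qed.
Let mn : m%:Z != 0. Proof. by rewrite eqz_nat -lt0n. Qed.
Let lK : lattice K. Proof. by case: sK. Qed.
Let sL := lambda_sym sK mP.

Lemma term1 : (exists H v, genus K H /\ rvec m 1 H v) -> total (rvec m 1) = term 1.
Proof.
move=> ex; have [H [v [gH [Qv _]]]] := ex.
have oK : ~ even_lattice K.
  by move=> /(genus_even lK gH) /(_ v); rewrite Qv muln1 dvdzE /= dvdn2 om.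
have oL : ~ even_lattice L by rewrite lambda_even.
have dK : \det K = m%:Z * e%:Z by rewrite detE asboolF // muln1 PoszM.
have dL : \det L = m%:Z ^+ 2 * e%:Z by rewrite lambda_det // dK; ring.
have d8 : (8 %| \det L - e%:Z)%Z by rewrite dL.
pose dd := SqF eD se.
have dl1 : 1%N%:Z * \det L = m%:Z ^+ 2 * sqf_val dd by rewrite mul1r dL.
have cases : ((e%:Z %% 4)%Z = 1) \/ ((e%:Z %% 4)%Z = 3) by move: oe; clear; lia.
case: cases => e4.
  rewrite (@total_1_1 K m dd Hs) // (term_value (j := 1) (kk := 1) mn dl1) //.
    by rewrite /ram e4 /= nu_double.
  by rewrite (tcoef1_1 d8 e4).
have ramE : nu (ram dd) = (0 + nu e)%N by rewrite /ram e4.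
rewrite (@total_1_3 K m dd Hs) // (term_value mn dl1 ramE (kk := if (sqf_val dd %% 8)%Z == 7 then 2%N else
  if `[< isoZ (ext (padic_int 2) K) >] then 3%N else 1%N)) //= expr0 divr1.
case: ifP => [/eqP e8|e8].
  by rewrite (tcoef1_7 sL oL d8 e8) // lambda_isoZ //; apply: (@iso_mod8 K m dd).
have e83 : (e%:Z %% 8)%Z = 3 by move: e4 e8; clear; lia.
case: asboolP => iK.
  by rewrite (tcoef1_3i sL oL d8 e83) // lambda_isoZ.
by rewrite (tcoef1_3a sL oL d8 e83) // lambda_isoZ.
Qed.

Lemma term2 : (exists H v, genus K H /\ rvec m 2 H v) -> total (rvec m 2) = term 2.
Proof.
move=> ex; case: (pselect (even_lattice K)) => evK; last first.
  have oL : ~ even_lattice L by rewrite lambda_even.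
  have dK : \det K = m%:Z * e%:Z by rewrite detE asboolF // muln1 PoszM.
  pose dd := SqF e2D s2e.
  have e4 : ((2 * e)%N%:Z %% 4)%Z = 2 by move: oe; clear; lia.
  have dl2 : 2%N%:Z * \det L = m%:Z ^+ 2 * sqf_val dd by rewrite lambda_det // dK /= PoszM; ring.
  rewrite (@total_2_odd K m dd Hs) //; last by rewrite dK /= PoszM; ring.
  rewrite (term_value (j := 1) (kk := 1) mn dl2) ?tcoef2_odd //.
  by rewrite /ram e4 /= nu_double.
have eL : even_lattice L by rewrite lambda_even.
have dK : \det K = 2 * m%:Z * e%:Z by rewrite detE asboolT // !PoszM; ring.
have dL : \det L = 2 * (m%:Z ^+ 2 * e%:Z) by rewrite lambda_det // dK; ring.
pose dd := SqF eD se.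
have m2n : 2 * m%:Z != 0 by rewrite mulf_neq0.
have dl2 : 2%N%:Z * \det L = (2 * m%:Z) ^+ 2 * sqf_val dd by rewrite dL /=; ring.
have tc := tcoef2_even sL eL dL (m8 e%:Z) _; rewrite dvdzE /= dvdn2 oe in tc.
have cases : ((e%:Z %% 4)%Z = 1) \/ ((e%:Z %% 4)%Z = 3) by move: oe; clear; lia.
case: cases => e4.
  rewrite (@total_2_1 K m dd Hs) // (term_value (j := 1) (kk := 2) m2n dl2) //.
    by rewrite /ram e4 /= nu_double.
  rewrite tc // !ifF ?divff //; apply/eqP; move: e4; clear; lia.
have ramE : nu (ram dd) = (0 + nu e)%N by rewrite /ram e4.
rewrite (@total_2_3 K m dd Hs) // (term_value m2n dl2 ramE (kk := if (sqf_val dd %% 8)%Z == 7 then 2%N else 4%N)) //=.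
rewrite tc // expr0 divr1; have [e8|e8] : (e%:Z %% 8)%Z = 7 \/ (e%:Z %% 8)%Z = 3 by move: e4; clear; lia.
  by rewrite e8.
by rewrite e8.
Qed.

Lemma total_term dl : dl \in [:: 1; 2]%N -> total (rvec m dl) =
  if `[< represented_by_genus L dl%:Z >] then term dl else 0.
Proof.
move=> dlP; case: asboolP => [/(represented_rvec sK mP) ex|nr].
  by move: dlP ex; rewrite !inE => /orP[] /eqP ->; [apply: term1|apply: term2].
rewrite big_seq big1 // => H hH; rewrite ncard0 ?mul0r // => v.
by case: rH => -[_ hs _] _ /(rvec_represented sK mP (hs _ hH)).
Qed.

End Term.

(** Extends the exclusion of <1, 1, 1> from K to its whole genus: determinant 1 leaves a single
    class, since the reduction inequalities force a = 1 and then b = c = 1. *)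
Lemma unimodular_cubic (G : 'M[int]_3) : lattice G -> \det G = 1 -> isometric G (diag3 1 1 1).
Proof.
move=> lG dG; have [a [b [c [d [e [f [iG [d2 e2] ab g23 hg]]]]]]] := reduced_shape lG.
have lM := isometric_lattice iG lG; have [a0 g0 _] := lattice_minors lM.
have D1 : \det (smx3 a b c d e f) = 1 by rewrite -(isometric_det_int iG).
have DE : (a * b - d ^+ 2) * (a * c - e ^+ 2) - (a * f - d * e) ^+ 2 = a.
  by rewrite -[RHS]mulr1 -D1 det_mx3; ring.
move: hg g23 g0 DE; set g2 := a * b - d ^+ 2; set g3 := a * c - e ^+ 2; set h := a * f - d * e.
move=> hg g23 g0 DE.
have sqr_abs (x y : int) : `|2 * x| <= y -> 4 * x ^+ 2 <= y ^+ 2.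
  move=> h'; rewrite (_ : 4 * x ^+ 2 = (2 * x) ^+ 2); last by ring.
  rewrite -[(2 * x) ^+ 2]real_normK ?num_real //.
  by rewrite lerXn2r ?nnegrE ?normr_ge0 ?(le_trans _ h').
have h4 := sqr_abs _ _ hg; have d4 := sqr_abs _ _ d2.
have g2a : 3 * g2 ^+ 2 <= 4 * a.
  have : g2 ^+ 2 <= g2 * g3 by rewrite expr2 ler_pM2l.
  by move: h4 DE; clear; lia.
have ag : 3 * a ^+ 2 <= 4 * g2.
  have : a ^+ 2 <= a * b by rewrite expr2 ler_pM2l.
  by move: d4; rewrite /g2; clear; lia.
have a1 : a = 1.
  have : (3 * a ^+ 2) ^+ 2 <= (4 * g2) ^+ 2 by rewrite lerXn2r ?nnegrE ?mulr_ge0 ?exprn_ge0 ?(ltW g0) ?(ltW a0).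
  rewrite (_ : (3 * a ^+ 2) ^+ 2 = 9 * a ^+ 4); last by ring.
  rewrite (_ : (4 * g2) ^+ 2 = 16 * g2 ^+ 2) => [a4|]; last by ring.
  have a3 : 27 * a ^+ 3 <= 64.
    by rewrite -(ler_pM2l a0) (_ : a * (27 * a ^+ 3) = 27 * a ^+ 4); [lia|ring].
  have [//|a2] := leP a 1; first by move: a0; clear; lia.
  have : 2 ^+ 3 <= a ^+ 3 by rewrite lerXn2r ?nnegrE ?(ltW a0).
  by move: a3; clear; lia.
have d0 : d = 0 by move: d2; rewrite a1; clear; lia.
have e0 : e = 0 by move: e2; rewrite a1; clear; lia.
move: hg g23 g0 DE; rewrite /g2 /g3 /h a1 d0 e0 !mul1r mul0r !expr0n !subr0 => hg g23 g0 DE.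
have b1 : b = 1.
  have : b * 1 <= b * c by rewrite ler_pM2l //; apply: le_trans g23; move: g0; clear; lia.
  have := g2a; rewrite /g2 a1 d0; move: g0; clear; nia.
have f0 : f = 0 by move: hg; rewrite b1; clear; lia.
have c1 : c = 1 by move: DE; rewrite b1 f0; clear; lia.
by rewrite diag3E; move: iG; rewrite a1 b1 c1 d0 e0 f0.
Qed.

(** * Class number, mass and b_t as sums over representatives *)

Section GenusSums.
Variables (K : 'M[int]_3) (Hs : seq 'M[int]_3).
Hypothesis rH : reps (genus K) (@isometric 3 int) Hs.

Let gxx (H : 'M[int]_3) : genus K H -> isometric H H. Proof. by move=> _; exact: isometric_refl. Qed.
Let gsym (H H' : 'M[int]_3) : genus K H -> genus K H' -> isometric H H' -> isometric H' H.
Proof. by move=> _ _; exact: isometric_sym. Qed.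
Let gtrans (H H' H'' : 'M[int]_3) : genus K H -> genus K H' -> genus K H'' ->
  isometric H H' -> isometric H' H'' -> isometric H H''.
Proof. by move=> _ _ _; exact: isometric_trans. Qed.

Lemma class_number_reps : class_number K = size Hs.
Proof. exact: (ncard_eq_classes gxx gsym gtrans rH). Qed.

Lemma ortho_order_rclass H : H \in Hs ->
  ortho_order (rclass (genus K) (@isometric 3 int) H) = ncard (Defs.ortho H).
Proof.
case: rH => -[_ hs _] _ /hs gH; rewrite /ortho_order; case: xgetP => [H' -> [gH' i]|/(_ H) []].
  by have [-> _] := ncard_ortho_isometric (genus_lattice gH) i.
by split=> //; exact: isometric_refl.
Qed.

Lemma mass_reps : mass K = \sum_(H <- Hs) (ncard (Defs.ortho H))%:R^-1.
Proof.
rewrite /mass (fsbig_eq_classes gxx gsym gtrans _ rH).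
by apply: eq_big_seq => H hH; rewrite ortho_order_rclass.
Qed.

Lemma b_reps t : b_ t K = count (fun H => ncard (Defs.ortho H) == t) Hs.
Proof.
have [[us _ _] _] := rH; rewrite -size_filter -(size_map (rclass (genus K) (@isometric 3 int))).
apply: ncard_seq.
  rewrite map_inj_in_uniq ?filter_uniq // => x y; rewrite !mem_filter => /andP[_ hx] /andP[_ hy].
  exact: (rclass_inj gxx rH.1).
move=> C; split=> [[/(eq_classesE gsym gtrans rH)/mapP[H hH ->]]|/mapP[H]].
  by rewrite ortho_order_rclass // => oH; apply/mapP; exists H; rewrite // mem_filter oH eqxx.
rewrite mem_filter => /andP[/eqP oH hH] ->; split; last by rewrite ortho_order_rclass.
by apply/(eq_classesE gsym gtrans rH)/mapP; exists H.
Qed.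

End GenusSums.

Theorem theorem8p10 (K : 'M[int]_3) (hK : stable K)
    (hK1 : ~ isometric K (diag3 1 1 1)) :
  let PQ := (frakP K * frakQ K)%N in
  (class_number K)%:R =
    2 * mass K
    + (\sum_(m <- divisors PQ)
        \sum_(delta <- [:: 1%N; 2%N] |
              `[< represented_by_genus (lambda m K) delta%:Z >])
          (let E := quad_field (- (delta%:Z * \det (lambda m K))) in
           tcoef (lambda m K) delta
           * 2 ^ ((nu m)%:Z - (nu PQ)%:Z)
           * ((field_class_number E)%:R / (mu E)%:R)))
    + 1 / 3 * ((b_ 12 K)%:R + (b_ 24 K)%:R)
    + 1 / 4 * (b_ 16 K)%:R
    :> rat.
Proof.
move=> PQ0; rewrite {}/PQ0 -/(PQ K).
have lK : lattice K by case: hK.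
have [Hs rH] := genus_reps lK; have [[us gHs _] _] := rH.
pose o (H : 'M[int]_3) := ncard (Defs.ortho H).
have -> : \sum_(m <- divisors (PQ K)) \sum_(delta <- [:: 1%N; 2%N] | `[< represented_by_genus (lambda m K) delta%:Z >])
    term K m delta = \sum_(H <- Hs) (ncard (symv H))%:R / (o H)%:R.
  transitivity (\sum_(m <- divisors (PQ K)) \sum_(dl <- [:: 1%N; 2%N]) \sum_(H <- Hs) ((ncard (rvec m dl H))%:R / (o H)%:R : rat)).
    apply: eq_big_seq => m; rewrite -dvdn_divisors; last by case: (PQ K) (PQ_odd K).
    move=> mP; rewrite big_mkcond; apply: eq_big_seq => dl dlP.
    by rewrite (total_term hK mP rH dlP).
  under eq_bigr => m _ do rewrite exchange_big.
  rewrite exchange_big /=.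
  apply: eq_big_seq => H /gHs gH; rewrite (ncard_symv hK gH) natr_sum mulr_suml.
  by apply: eq_bigr => m _; rewrite natr_sum mulr_suml.
have cnt t : (b_ t K)%:R = \sum_(H <- Hs) (o H == t)%:R :> rat.
  by rewrite (b_reps rH) -sum1_count natr_sum big_mkcond; apply: eq_bigr => H _; case: ifP.
rewrite (class_number_reps rH) (mass_reps rH) !cnt -big_split /= !mulr_sumr -!big_split /=.
rewrite -sum1_size natr_sum; apply: eq_big_seq => H hH; have gH := gHs _ hH.
have lH := genus_lattice gH.
have nH : ~ isometric H (diag3 1 1 1).
  move=> /isometric_det_int; rewrite (genus_det lK gH) diag3_det => d1.
  exact/hK1/unimodular_cubic.
have sH : sqfreez (\det H) by rewrite (genus_det lK gH); exact: stable_sqfree.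
have := ortho_cases lH sH nH; rewrite ncard_invols // -/(o H).
move: (o H) (ncard (symv H)) => k r [[-> le8]|[-> [->]]|[-> [->]]|[-> [->]]] //=.
(* Only the involutive case is left: the order is 2 plus the number of vectors and at most 8, so no
   correction term counts this class. The three exceptional orders are settled by evaluation. *)
by rewrite !ltn_eqF ?(leq_ltn_trans le8) //= addr0 !mulr0 !addr0 -mulrDl -natrD add2n divff // pnatr_eq0.
Qed.
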